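(* Let $N\ge2$ and let $f$ satisfy assumptions $(A1)$ or $(A2)$ (with $\gamma_*=\infty$ in case $(A2)$). Let $\bar\beta,\bar F,\bar C,A,\bar I$ be the constants defined in the context. If $$(\bar C+A)\,\bar I<\frac{2^{1/2}(N-1)}{(\bar I+\bar F)^{1/2}}\int_0^{\beta_1}|F(s)|\,ds,$$ then for every $k\in\mathbb N\cup\{0\}$ there exist at least two solutions $u$ of $$u''+\frac{N-1}{r}u'+f(u)=0,\quad r>0,\qquad u'(0)=0,\quad \lim_{r\to\infty}u(r)=0,$$ with initial value $u(0)\in(\beta_*,\gamma_* )$, having exactly $k$ sign changes in $(0,\infty)$.
   Context: Throughout, $N\ge 2$ is an integer, $'$ denotes $d/dr$, $F(s)=\int_0^s f(t)\,dt$, $Q(s):=2NF(s)-(N-2)sf(s)$, and a solution is a $C^1$ function $u$ of $r\ge 0$ such that $u'$ is also $C^1$. Assumptions $(A1)$ (finite case, $\gamma_*<\infty$): $(f_1)$ $f$ is a continuous function defined in $(\gamma_*^-,\gamma_*]$, $-\infty\le\gamma_*^-<0<\gamma_*$, $f(0)=0$, $f(\gamma_* )=0$, and $f$ is locally Lipschitz in $(\gamma_*^-,\gamma_*]\setminus\{0\}$. $(f_2)$ There exists $\delta>0$ such that $F(s)<0$ for all $0<|s|<\delta$; moreover $\lim_{s\to\gamma_*^-}F(s)=F(\gamma_* )$ and $F(s)<F(\gamma_* )$ for all $s\in(\gamma_*^-,\gamma_* )$. $(f_3)$ $F$ has a local maximum at some $\gamma\in(\delta,\gamma_* )$ with $F(\gamma)>0$.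 $(f_4)$ $f$ has a finite number of zeros in $(\gamma_*^-,-\delta)\cup(\delta,\gamma_* )$ and $f$ changes sign at these points. Assumptions $(A2)$ (infinite case, $\gamma_*=\infty$): $(f_1)$ $f$ is a continuous function defined in $(\gamma_*^-,\infty)$, $-\infty\le\gamma_*^-<0$, $f(0)=0$, and $f$ is locally Lipschitz in $(\gamma_*^-,\infty)\setminus\{0\}$. $(f_2)$ There exists $\delta>0$ such that $F(s)<0$ for all $0<|s|<\delta$, and $F(s)<\lim_{s\to\infty}F(s)=\lim_{s\to\gamma_*^-}F(s)$ for all $s$. $(f_3)$ $F$ has a local maximum at some $\gamma\in(\delta,\infty)$ with $F(\gamma)>0$. $(f_4)$ $f$ has a finite number of zeros in $(\gamma_*^-,-\delta)\cup(\delta,\infty)$ and $f$ changes sign at these points. $(f_5)$ There exists $s_0\in(\gamma_*^-,0)$ such that $Q(s)>0$ for all $s\in(\gamma_*^-,s_0)$, and there exists $\theta\in(0,1)$ such that $$\lim_{s\to\infty}\Bigl(\inf_{s_1,s_2\in[\theta s,s]}Q(s_2)\Bigl(\frac{s}{f(s_1)}\Bigr)^{N/2}\Bigr)=\infty.$$ Constants: $\gamma_0=0$; $\gamma_1$ is the first positive local maximum point of $F$ with $F(\gamma_1)>0$; for $i\in\mathbb N$, $\gamma_{i+1}$ is the first local maximum point of $F$ in $(\gamma_i,\gamma_* )$ with $F(\gamma_i)<F(\gamma_{i+1})$; the last one is $\gamma_M$. Similarly $\gamma_{-1}$ is the first (closest to $0$) negative local maximum point of $F$ (if any) with $F(\gamma_{-1})>0$;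 for $i\le -1$, $\gamma_{i-1}$ is the first local maximum point of $F$ to the left of $\gamma_i$ with $F(\gamma_i)<F(\gamma_{i-1})$; the last one is $\gamma_{\bar M}$; if there is no negative local maximum point with $F>0$, $\bar M=0$. $\beta_1$ is the largest point in $(0,\gamma_1)$ with $F(\beta_1)=0$; $\beta_*$ is the largest point in $(\gamma_M,\gamma_* )$ with $F(\beta_* )=F(\gamma_M)$; $\beta_*^-$ is the smallest point in $(\gamma_*^-,\gamma_{\bar M})$ with $F(\beta_*^-)=F(\gamma_{\bar M})$. $\bar\beta\in(\beta_*,\gamma_* )$ is a fixed point chosen as follows: under $(A1)$, $F(\bar\beta)>F(\beta_*^-)$; under $(A2)$, $F(\bar\beta)>F(\beta_*^-)$ and $Q(s)>0$ for all $s$ satisfying $F(s)>F(\bar\beta)$. $$\bar F:=-\min_{s\in[0,\beta_1]}F(s)>0,\qquad \bar C:=2(N-1)\frac{\bar\beta-\beta_1}{F(\bar\beta)-F(\gamma_M)}\Bigl(2\bigl(F(\bar\beta)-\min_{s\in[\beta_1,\beta_*]}F(s)\bigr)\Bigr)^{1/2}.$$ If $f$ satisfies $(A1)$: $$A=\frac{\beta_*-\beta_1}{(F(\bar\beta)-F(\gamma_M))^{1/2}}+\Bigl(\frac{2N(\bar\beta-\beta_* )}{\min_{t\in[\beta_*,\bar\beta]}f(t)}\Bigr)^{1/2},\qquad \bar I=F(\gamma_* ).$$ If $f$ satisfies $(A2)$: $$A=\max\Bigl\{1,\ \frac{\beta_*-\beta_1}{(F(\bar\beta)-F(\gamma_M))^{1/2}}+\Bigl(\frac{2N(\bar\beta-\beta_*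 )}{\min_{t\in[\beta_*,\bar\beta]}f(t)}\Bigr)^{1/2}\Bigr\},$$ $$\bar I:=\Bigl(\frac{\bar C+1}{\bar C}\Bigr)^N\Bigl(2F(\bar\beta)+(\bar\beta-\beta_1)^2+\frac1N\Bigl(\sup_{s\in[\beta_1,\bar\beta]}Q(s)-\min_{s\in[s_0,\bar\beta]}Q(s)\Bigr)\Bigr)+\frac{(N-2)^2\bar\beta^2}{2\bar C^2},$$ where $s_0$ is the point in $(f_5)$ of $(A2)$. *)

(* Defs.v *)
From Stdlib Require Import Reals List.
From Coquelicot Require Import Coquelicot.
Open Scope R_scope.

(* The nonlinearity is a total function f : R -> R of which only the values on
   the interval [dom gm gs] are ever used; gm < 0 < gs are its end points in
   Rbar.  A finite gs belongs to the interval, gm never does, so this is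
   (gm, gs] for finite gs and (gm, +oo) for gs = p_infty. *)
Definition dom (gm gs : Rbar) (s : R) : Prop := Rbar_lt gm s /\ Rbar_le s gs.

Definition Fint (f : R -> R) (s : R) : R := RInt f 0 s.

Definition Qfun (N : nat) (f : R -> R) (s : R) : R :=
  2 * INR N * Fint f s - (INR N - 2) * s * f s.

(* On a compact interval where g is continuous these are the minimum and the
   maximum of g. *)
Definition inf_on (g : R -> R) (a b : R) : R :=
  Glb_Rbar (fun y => exists s, a <= s <= b /\ y = g s).
Definition sup_on (g : R -> R) (a b : R) : R :=
  Lub_Rbar (fun y => exists s, a <= s <= b /\ y = g s).

Definition locally_lipschitz_on (D : R -> Prop) (f : R -> R) : Prop :=
  forall x, D x -> exists eps L, 0 < eps /\
    forall y z, D y -> D z -> Rabs (y - x) < eps -> Rabs (z - x) < eps ->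
      Rabs (f y - f z) <= L * Rabs (y - z).

(* Only used at interior points of [dom gm gs]. *)
Definition local_max (g : R -> R) (x : R) : Prop :=
  exists eps, 0 < eps /\ forall y, Rabs (y - x) < eps -> g y <= g x.

Definition changes_sign_at (f : R -> R) (z : R) : Prop :=
  exists eps, 0 < eps /\
    forall x y, z - eps < x < z -> z < y < z + eps -> f x * f y < 0.

(* Neighbourhoods of gm inside (gm, +oo): right neighbourhoods of a finite gm,
   neighbourhoods of -oo for gm = m_infty. *)
Definition from_above (gm : Rbar) : (R -> Prop) -> Prop :=
  within (fun s : R => Rbar_lt gm s) (Rbar_locally gm).

Record common_assumptions (f : R -> R) (gm gs : Rbar) (delta : R) : Prop := {
  gm_neg : Rbar_lt gm 0;
  gs_pos : Rbar_lt 0 gs;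
  f_cont : continuous_on (dom gm gs) f;
  f_0 : f 0 = 0;
  f_lip : locally_lipschitz_on (fun s => dom gm gs s /\ s <> 0) f;
  delta_pos : 0 < delta;
  F_neg : forall s : R, dom gm gs s -> 0 < Rabs s < delta -> Fint f s < 0;
  F_local_max : exists g, delta < g /\ Rbar_lt g gs /\
    local_max (Fint f) g /\ 0 < Fint f g;
  f_zeros_finite : exists l : list R, forall s : R,
    Rbar_lt gm s -> Rbar_lt s gs -> (s < - delta \/ delta < s) -> f s = 0 -> In s l;
  f_zeros_sign : forall s : R,
    Rbar_lt gm s -> Rbar_lt s gs -> (s < - delta \/ delta < s) -> f s = 0 ->
    changes_sign_at f s
}.

Record assumptions_A1 (f : R -> R) (gm : Rbar) (gs : R) (delta : R) : Prop := {
  A1_common : common_assumptions f gm gs delta;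
  A1_f_gs : f gs = 0;
  A1_F_gm : filterlim (Fint f) (from_above gm) (locally (Fint f gs));
  A1_F_lt : forall s : R, Rbar_lt gm s -> s < gs -> Fint f s < Fint f gs
}.

(* The common limit of F at the two ends may be finite or +oo.
   In the last condition f > 0 near +oo, by the other ones, so [Rpower] is the
   actual power for s large; an infimum equal to -oo is sent to 0 by the
   coercion from Rbar to R, which is harmless since the limit is +oo. *)
Record assumptions_A2 (N : nat) (f : R -> R) (gm : Rbar) (delta s0 : R) : Prop := {
  A2_common : common_assumptions f gm p_infty delta;
  A2_F_lim : exists L : Rbar,
    filterlim (Fint f) (Rbar_locally p_infty) (Rbar_locally L) /\
    filterlim (Fint f) (from_above gm) (Rbar_locally L) /\
    forall s : R, dom gm p_infty s -> Rbar_lt (Fint f s) L;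
  A2_s0 : Rbar_lt gm s0 /\ s0 < 0;
  A2_Q_pos : forall s : R, Rbar_lt gm s -> s < s0 -> 0 < Qfun N f s;
  A2_Q_lim : exists theta, 0 < theta < 1 /\
    is_lim (fun s : R => real (Glb_Rbar (fun y => exists s1 s2,
        theta * s <= s1 <= s /\ theta * s <= s2 <= s /\
        y = Qfun N f s2 * Rpower (s / f s1) (INR N / 2))))
      p_infty p_infty
}.

(* g' is the first local maximum point of F in (g, gs) with F g < F g'. *)
Definition next_right (F : R -> R) (gs : Rbar) (g g' : R) : Prop :=
  g < g' /\ Rbar_lt g' gs /\ local_max F g' /\ F g < F g' /\
  forall t, g < t < g' -> local_max F t -> F t <= F g.

Definition next_left (F : R -> R) (gm : Rbar) (g g' : R) : Prop :=
  g' < g /\ Rbar_lt gm g' /\ local_max F g' /\ F g < F g' /\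
  forall t, g' < t < g -> local_max F t -> F t <= F g.

(* g = gamma_i for i >= 0.  As gamma_0 = 0 and F 0 = 0, the step from 0 to 1
   gives the first positive local maximum point with F > 0. *)
Fixpoint is_gamma (F : R -> R) (gs : Rbar) (i : nat) (g : R) : Prop :=
  match i with
  | O => g = 0
  | S j => exists g0, is_gamma F gs j g0 /\ next_right F gs g0 g
  end.

(* g = gamma_{-i}. *)
Fixpoint is_gamma_neg (F : R -> R) (gm : Rbar) (i : nat) (g : R) : Prop :=
  match i with
  | O => g = 0
  | S j => exists g0, is_gamma_neg F gm j g0 /\ next_left F gm g0 g
  end.

Definition is_last_gamma (F : R -> R) (gs : Rbar) (g : R) : Prop :=
  exists M : nat, is_gamma F gs M g /\ forall g', ~ next_right F gs g g'.

Definition is_last_gamma_neg (F : R -> R) (gm : Rbar) (g : R) : Prop :=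
  exists M : nat, is_gamma_neg F gm M g /\ forall g', ~ next_left F gm g g'.

(* b is the largest, resp. smallest, point of the open interval (a, c) at which
   F takes the value v. *)
Definition is_largest_level (F : R -> R) (v : R) (a c : Rbar) (b : R) : Prop :=
  Rbar_lt a b /\ Rbar_lt b c /\ F b = v /\
  forall t : R, b < t -> Rbar_lt t c -> F t <> v.

Definition is_smallest_level (F : R -> R) (v : R) (a c : Rbar) (b : R) : Prop :=
  Rbar_lt a b /\ Rbar_lt b c /\ F b = v /\
  forall t : R, Rbar_lt a t -> t < b -> F t <> v.

Definition Fbar (f : R -> R) (beta1 : R) : R := - inf_on (Fint f) 0 beta1.

Definition Cbar (N : nat) (f : R -> R) (gammaM beta1 betas bbar : R) : R :=
  2 * (INR N - 1) * ((bbar - beta1) / (Fint f bbar - Fint f gammaM)) *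
  sqrt (2 * (Fint f bbar - inf_on (Fint f) beta1 betas)).

(* The constant A of the finite case; it is max {1, A_fin} in the infinite one. *)
Definition A_fin (N : nat) (f : R -> R) (gammaM beta1 betas bbar : R) : R :=
  (betas - beta1) / sqrt (Fint f bbar - Fint f gammaM) +
  sqrt (2 * INR N * (bbar - betas) / inf_on f betas bbar).

Definition Ibar_inf (N : nat) (f : R -> R) (beta1 bbar C s0 : R) : R :=
  ((C + 1) / C) ^ N *
    (2 * Fint f bbar + (bbar - beta1) ^ 2 +
     1 / INR N * (sup_on (Qfun N f) beta1 bbar - inf_on (Qfun N f) s0 bbar)) +
  (INR N - 2) ^ 2 * bbar ^ 2 / (2 * C ^ 2).

(* u is of class C^1 on [0, +oo), one-sidedly at 0, with derivative du there. *)
Definition C1_halfline (u du : R -> R) : Prop :=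
  (forall r, 0 <= r -> D_in u du (fun t => 0 <= t) r) /\
  continuous_on (fun t => 0 <= t) du.

Definition is_solution (N : nat) (f : R -> R) (gm gs : Rbar) (u : R -> R) : Prop :=
  exists du ddu : R -> R,
    C1_halfline u du /\ C1_halfline du ddu /\
    (forall r, 0 <= r -> dom gm gs (u r)) /\
    (forall r, 0 < r -> ddu r + (INR N - 1) / r * du r + f (u r) = 0) /\
    du 0 = 0 /\ is_lim u p_infty 0.

(* u takes alternating signs at k + 1 successive points of (0, +oo). *)
Definition alternates (u : R -> R) (k : nat) : Prop :=
  exists t : nat -> R, 0 < t O /\
    forall i, (i < k)%nat -> t i < t (S i) /\ u (t i) * u (t (S i)) < 0.

Definition exactly_sign_changes (u : R -> R) (k : nat) : Prop :=
  alternates u k /\ ~ alternates u (S k).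

(* Main.v *)
Require Import Defs.
From Stdlib Require Import Reals List.
From Stdlib Require Import Lra Lia Classical ClassicalEpsilon Cantor.
From Coquelicot Require Import Coquelicot.
Open Scope R_scope.

(** The proof is a shooting argument in the initial value [a = u 0], on both sides of a value
    [y] whose solution ends up in the well of [F] between [0] and [beta1] without ever
    changing sign.

    Energy.  Along a solution [u'^2 / 2 + F u] does not increase, and [r] times the energy has
    the derivative [F u - (n - 1/2) u'^2] in dimension [n + 1], so that crossing a region where
    [F] is negative costs a fixed amount of this product, however late it happens.  Two
    consequences are used throughout: a solution with negative energy never vanishes again, and
    late in time one swing of [u] loses little energy ([late_energy]).

    Shooting ([shooting]).  Fix [k] and a small interval [[cm, cp]] around [0] in which [F] has
    its central well.  An initial value escapes when its solution changes sign more than [k]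
    times or leaves [[cm, cp]] after some late time.  The escaping values form an open set.  Let
    [a] be an end point of an interval of escaping values that does not escape itself.  Its
    solution stays in [[cm, cp]] from some time on, and either acquires negative energy, or tends
    to a zero of [F] in the well ([trapped_or_settles]).  If the energy becomes negative or the limit is an
    interior point of the well other than [0], all nearby values do not escape either
    ([stay_of_one_sign]), which is absurd.  If the limit is [0] but there are fewer than [k] sign
    changes, a nearby solution can change sign only once more ([barrier_one_change]), which is
    absurd again.  The remaining limit, an edge of the well at which the force vanishes, is
    excluded by [no_settling_at_edge]: the nearby solutions would fall from the edge after
    arbitrarily long times, and the slowness of these falls would force [f <= K F] on a whole
    interval beyond the edge, where [F] vanishes at the edge and is positive after it.  Hence
    [u] tends to [0] with exactly [k] sign changes.

    The three initial values ([two_solutions]).  The value [betas] escapes, because its energy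
    does not suffice to come below [gammaM].  A value close to [gs], or very large when [gs] is
    infinite, escapes because late in time its solution is still far away or fast.  Between them the
    hypothesis on the constants provides the value [y]: by continuity one can prescribe the time
    [C] at which [u] comes down to [bbar] ([crossing_at]); at that time the friction is so small
    that [u] reaches [beta1] within the further time [A] ([descent]).  So [beta1] is reached at
    a time [T <= C + A] with energy at most [I], and [T I] is less than the cost of crossing the
    well, which is what the inequality of the theorem says ([well_cost]).  So [u] stays positive
    and does not tend to [0] ([bottom]).  Shooting between [betas] and [y] and between the third
    value and [y] gives the two solutions.

    In the infinite case the energy bound is not automatic, since [F] may tend to infinity.  A
    solution needing at least a unit of time from [bbar] to [beta1] has a moderate speed on the
    way ([slow_passage]), and if the descent is faster than that, the initial value can be
    lowered until it is not ([reaches_later]).  That large initial values keep a high energy for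
    a long time comes from a Pohozaev identity and the growth condition on [Q]
    ([high_energy]).

    Since [f] is only continuous at [0], solutions may not be unique after [u = u' = 0]; they are
    then continued by [0].  Existence follows from a compactness argument for equations with a
    delay ([sol_exists]); continuous dependence holds up to such a point because at a
    transversal zero [u] and the energy can serve as coordinates ([continuous_dependence]). *)

(** * Calculus on the real line *)

(** Signs of products, quotients, powers and square roots. *)
Ltac pos := first [lra | assumption |
  match goal with
  | |- 0 < _ * _ => apply Rmult_lt_0_compat; pos
  | |- 0 <= _ * _ => apply Rmult_le_pos; pos
  | |- 0 < _ / _ => apply Rmult_lt_0_compat; [pos|apply Rinv_0_lt_compat; pos]
  | |- 0 <= _ / _ => apply Rmult_le_pos; [pos|left; apply Rinv_0_lt_compat; pos]
  | |- 0 < / _ => apply Rinv_0_lt_compat; pos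
  | |- 0 < sqrt _ => apply sqrt_lt_R0; pos
  | |- 0 <= sqrt _ => apply sqrt_pos
  | |- 0 < _ ^ _ => apply pow_lt; pos
  | |- 0 <= _ ^ 2 => apply pow2_ge_0
  | |- 0 <= _ ^ _ => apply pow_le; pos
  | |- 0 < INR _ => apply lt_0_INR; lia
  | |- 0 <= INR _ => apply pos_INR
  | |- 0 < exp _ => apply exp_pos
  | |- 0 < Rmin _ _ => apply Rmin_pos; pos
  | |- 0 <= Rabs _ => apply Rabs_pos
  | |- 0 < ?x => is_var x; unfold x; pos
  | |- 0 <= _ => left; pos
  end].

Tactic Notation "max_of" ident(x) constr(a) constr(b) "as" ident(H1) ident(H2) :=
  set (x := Rmax a b); assert (H1 : a <= x) by apply Rmax_l; assert (H2 : b <= x) by apply Rmax_r.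
Tactic Notation "min_of" ident(x) constr(a) constr(b) "as" ident(H1) ident(H2) :=
  set (x := Rmin a b); assert (H1 : x <= a) by apply Rmin_l; assert (H2 : x <= b) by apply Rmin_r.

Lemma below2 (a b : R) : 0 < a -> 0 < b -> exists e, 0 < e /\ e <= a /\ e <= b.
Proof. intros Ha Hb. exists (Rmin a b). split; [pos|]. split; [apply Rmin_l|apply Rmin_r]. Qed.

Lemma below3 (a b c : R) : 0 < a -> 0 < b -> 0 < c -> exists e, 0 < e /\ e <= a /\ e <= b /\ e <= c.
Proof.
intros Ha Hb Hc. destruct (below2 a b Ha Hb) as (e & He & A & B).
destruct (below2 e c He Hc) as (d & Hd & D1 & D2). exists d. lra.
Qed.

Lemma below4 (a b c d : R) : 0 < a -> 0 < b -> 0 < c -> 0 < d ->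
  exists e, 0 < e /\ e <= a /\ e <= b /\ e <= c /\ e <= d.
Proof.
intros Ha Hb Hc Hd. destruct (below3 a b c Ha Hb Hc) as (x & Hx & A & B & C).
destruct (below2 x d Hx Hd) as (e & He & E1 & E2). exists e. lra.
Qed.

Lemma continuous_eps (f : R -> R) (x : R) :
  continuous f x ->
  forall eps, 0 < eps -> exists d, 0 < d /\
    forall y, Rabs (y - x) < d -> Rabs (f y - f x) < eps.
Proof.
intros H eps Heps.
destruct (proj1 (filterlim_locally _ _) H (mkposreal eps Heps)) as [d Hd].
exists d; split; [apply cond_pos|]. intros y Hy. exact (Hd y Hy).
Qed.

Lemma eps_continuous (f : R -> R) (x : R) :
  (forall eps, 0 < eps -> exists d, 0 < d /\
    forall y, Rabs (y - x) < d -> Rabs (f y - f x) < eps) ->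
  continuous f x.
Proof.
intros H. apply filterlim_locally. intros [eps Heps].
destruct (H eps Heps) as (d & Hd & Hy).
exists (mkposreal d Hd). intros y; apply Hy.
Qed.

Lemma continuous_ptR (f : R -> R) (x : R) : continuous f x -> continuity_pt f x.
Proof. intros H; apply continuity_pt_filterlim; exact H. Qed.

Lemma continuous_gt (f : R -> R) (x c : R) :
  continuous f x -> c < f x -> exists d, 0 < d /\
    forall y, Rabs (y - x) < d -> c < f y.
Proof.
intros H Hc. destruct (continuous_eps f x H (f x - c)) as (d & Hd & Hy); [lra|].
exists d; split; [exact Hd|]. intros y Hy'.
specialize (Hy y Hy'). apply Rabs_def2 in Hy. lra.
Qed.

Lemma continuous_lt (f : R -> R) (x c : R) :
  continuous f x -> f x < c -> exists d, 0 < d /\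
    forall y, Rabs (y - x) < d -> f y < c.
Proof.
intros H Hc. destruct (continuous_eps f x H (c - f x)) as (d & Hd & Hy); [lra|].
exists d; split; [exact Hd|]. intros y Hy'.
specialize (Hy y Hy'). apply Rabs_def2 in Hy. lra.
Qed.

Lemma is_derive_cont (f : R -> R) (x l : R) : is_derive f x l -> continuous f x.
Proof. intros H. apply @ex_derive_continuous. exists l; exact H. Qed.

Lemma first_time (P : R -> Prop) (a b : R) :
  a <= b -> P b ->
  (forall x, a <= x <= b -> ~ P x ->
     exists d, 0 < d /\ forall y, a <= y <= b -> Rabs (y - x) < d -> ~ P y) ->
  exists t, a <= t <= b /\ P t /\ forall s, a <= s < t -> ~ P s.
Proof.
intros Hab Pb Hop.
destruct (completeness (fun x => a <= x <= b /\ forall s, a <= s < x -> ~ P s))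
  as [m [Hub Hlub]].
- exists b. intros x [Hx _]; lra.
- exists a. split; [lra|]. intros s Hs; lra.
- assert (Ham : a <= m) by (apply Hub; split; [lra|intros s Hs; lra]).
  assert (Hmb : m <= b) by (apply Hlub; intros x [Hx _]; lra).
  assert (Hlow : forall s, a <= s < m -> ~ P s).
  { intros s Hs Ps. enough (m <= s) by lra.
    apply Hlub. intros x [Hx Hx2]. apply Rnot_lt_le. intros Hlt.
    exact (Hx2 s (conj (proj1 Hs) Hlt) Ps). }
  exists m. split; [lra|]. split; [|exact Hlow].
  apply NNPP. intros nP.
  destruct (Hop m (conj Ham Hmb) nP) as (d & Hd & Hy).
  destruct (Req_dec m b) as [->|Hne]; [exact (nP Pb)|].
  assert (Hz : Rmin b (m + d / 2) <= m).
  { apply Hub. split.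
    - split; [apply Rmin_glb; lra|apply Rmin_l].
    - intros s [Hs1 Hs2].
      assert (Hb := Rmin_l b (m + d / 2)). assert (Hb2 := Rmin_r b (m + d / 2)).
      destruct (Rlt_le_dec s m) as [Hsm|Hsm]; [apply Hlow; lra|].
      apply Hy; [lra|]. rewrite Rabs_right; lra. }
  revert Hz. unfold Rmin. destruct (Rle_dec b (m + d / 2)); lra.
Qed.

Lemma last_time (P : R -> Prop) (a b : R) :
  a <= b -> P a ->
  (forall x, a <= x <= b -> ~ P x ->
     exists d, 0 < d /\ forall y, a <= y <= b -> Rabs (y - x) < d -> ~ P y) ->
  exists t, a <= t <= b /\ P t /\ forall s, t < s <= b -> ~ P s.
Proof.
intros Hab Pa Hop.
destruct (first_time (fun x => P (- x)) (- b) (- a)) as (t & Ht & Pt & Hs).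
- lra.
- rewrite Ropp_involutive; exact Pa.
- intros x Hx nP. destruct (Hop (- x)) as (d & Hd & Hy); [lra|exact nP|].
  exists d; split; [exact Hd|]. intros y Hy1 Hy2. apply Hy; [lra|].
  replace (- y - - x) with (- (y - x)) by ring. rewrite Rabs_Ropp; exact Hy2.
- exists (- t). split; [lra|]. split; [exact Pt|].
  intros s Hs1. specialize (Hs (- s)). rewrite Ropp_involutive in Hs. apply Hs; lra.
Qed.

Lemma first_ge (f : R -> R) (a b c : R) :
  a <= b -> (forall x, a <= x <= b -> continuous f x) -> f a < c -> c <= f b ->
  exists t, a < t <= b /\ f t = c /\ forall s, a <= s < t -> f s < c.
Proof.
intros Hab Hf Ha Hb.
destruct (first_time (fun x => c <= f x) a b) as (t & Ht & Pt & Hs); [exact Hab|exact Hb| |].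
- intros x Hx nP. destruct (continuous_lt f x c) as (d & Hd & Hy); [auto|lra|].
  exists d; split; [exact Hd|]. intros y _ Hy2. specialize (Hy y Hy2). lra.
- assert (Hat : a < t).
  { destruct (proj1 Ht) as [H|H]; [exact H|subst t; lra]. }
  exists t. split; [lra|]. split; [|intros s Hs1; specialize (Hs s Hs1); lra].
  apply Rle_antisym; [|exact Pt]. apply Rnot_lt_le. intros Hlt.
  destruct (continuous_gt f t c) as (d & Hd & Hy); [apply Hf; lra|exact Hlt|].
  set (s := Rmax a (t - d / 2)).
  assert (Hs1 : a <= s < t) by (unfold s, Rmax; destruct (Rle_dec a (t - d / 2)); lra).
  apply (Hs s Hs1). left. apply Hy.
  unfold s, Rmax; destruct (Rle_dec a (t - d / 2)); apply Rabs_def1; lra.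
Qed.

Lemma last_ge (f : R -> R) (a b c : R) :
  a <= b -> (forall x, a <= x <= b -> continuous f x) -> c <= f a -> f b < c ->
  exists t, a <= t < b /\ f t = c /\ forall s, t < s <= b -> f s < c.
Proof.
intros Hab Hf Ha Hb.
destruct (first_ge (fun x => f (- x)) (- b) (- a) c) as (t & Ht & Pt & Hs); try lra.
- intros x Hx. apply (continuous_comp Ropp f).
  + apply (continuous_opp (fun y : R => y) x), continuous_id.
  + apply Hf; lra.
- rewrite Ropp_involutive; lra.
- rewrite Ropp_involutive; lra.
- exists (- t). split; [lra|]. split; [exact Pt|].
  intros s Hs1. specialize (Hs (- s)). rewrite Ropp_involutive in Hs. apply Hs; lra.
Qed.

Lemma continuous_Ropp (f : R -> R) x : continuous f x -> continuous (fun y => - f y) x.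
Proof. intros H. apply (continuous_opp f x H). Qed.

Lemma first_le (f : R -> R) (a b c : R) :
  a <= b -> (forall x, a <= x <= b -> continuous f x) -> c < f a -> f b <= c ->
  exists t, a < t <= b /\ f t = c /\ forall s, a <= s < t -> c < f s.
Proof.
intros Hab Hf Ha Hb.
destruct (first_ge (fun x => - f x) a b (- c)) as (t & Ht & Pt & Hs); try lra.
- intros x Hx. apply continuous_Ropp; auto.
- exists t. split; [lra|]. split; [lra|]. intros s Hs1. specialize (Hs s Hs1); lra.
Qed.

Lemma last_le (f : R -> R) (a b c : R) :
  a <= b -> (forall x, a <= x <= b -> continuous f x) -> f a <= c -> c < f b ->
  exists t, a <= t < b /\ f t = c /\ forall s, t < s <= b -> c < f s.
Proof.
intros Hab Hf Ha Hb.
destruct (last_ge (fun x => - f x) a b (- c)) as (t & Ht & Pt & Hs); try lra.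
- intros x Hx. apply continuous_Ropp; auto.
- exists t. split; [lra|]. split; [lra|]. intros s Hs1. specialize (Hs s Hs1); lra.
Qed.

Lemma ivt (f : R -> R) (a b c : R) :
  a <= b -> (forall x, a <= x <= b -> continuous f x) ->
  (f a <= c <= f b \/ f b <= c <= f a) ->
  exists t, a <= t <= b /\ f t = c.
Proof.
intros Hab Hf H.
destruct (Req_dec (f a) c) as [E|E]; [exists a; split; [lra|exact E]|].
destruct H as [H|H].
- destruct (first_ge f a b c) as (t & Ht & E' & _); try lra; auto.
  exists t; split; [lra|exact E'].
- destruct (first_le f a b c) as (t & Ht & E' & _); try lra; auto.
  exists t; split; [lra|exact E'].
Qed.

(** Induction along an interval, for properties that pass to smaller arguments: the
    supremum of the points reached cannot be an obstacle. *)
Lemma real_induction (P : R -> Prop) (a b : R) :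
  a <= b -> P a ->
  (forall x y, a <= x <= y -> y <= b -> P y -> P x) ->
  (forall x, a <= x <= b -> exists h, 0 < h /\
     (P (Rmax a (x - h)) -> P (Rmin b (x + h)))) ->
  P b.
Proof.
intros Hab Pa Hmon Hstep.
destruct (completeness (fun x => a <= x <= b /\ P x)) as [m [Hub Hlub]].
- exists b. intros x [Hx _]; lra.
- exists a. split; [lra|exact Pa].
- assert (Ham : a <= m) by (apply Hub; split; [lra|exact Pa]).
  assert (Hmb : m <= b) by (apply Hlub; intros x [Hx _]; lra).
  destruct (Hstep m (conj Ham Hmb)) as (h & Hh & Himp).
  assert (HP : P (Rmax a (m - h))).
  { apply NNPP. intros nP. enough (m <= m - h) by lra.
    apply Hlub. intros x [Hx Px]. apply Rnot_lt_le. intros Hlt. apply nP.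
    apply (Hmon _ x); [|lra|exact Px].
    split; [apply Rmax_l|apply Rmax_lub; lra]. }
  specialize (Himp HP).
  destruct (Rle_dec b (m + h)) as [Hb|Hb].
  + rewrite Rmin_left in Himp; auto.
  + rewrite Rmin_right in Himp; [|lra].
    enough (m + h <= m) by lra. apply Hub. split; [lra|exact Himp].
Qed.

Lemma derive_nonpos (f df : R -> R) (a b : R) :
  a <= b -> (forall x, a <= x <= b -> continuous f x) ->
  (forall x, a < x < b -> is_derive f x (df x)) ->
  (forall x, a < x < b -> df x <= 0) -> f b <= f a.
Proof.
intros Hab Hc Hd Hle.
set (df' := fun x => if Rlt_dec a x then if Rlt_dec x b then df x else 0 else 0).
destruct (MVT_gen f a b df') as (c & Hc1 & Hc2).
- rewrite Rmin_left, Rmax_right by lra. intros x Hx. unfold df'.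
  destruct (Rlt_dec a x); [|lra]. destruct (Rlt_dec x b); [|lra]. apply Hd; lra.
- rewrite Rmin_left, Rmax_right by lra. intros x Hx. apply continuous_ptR; auto.
- assert (df' c <= 0).
  { unfold df'. destruct (Rlt_dec a c); [|lra]. destruct (Rlt_dec c b); [|lra].
    apply Hle; lra. }
  nra.
Qed.

Lemma derive_nonneg (f df : R -> R) (a b : R) :
  a <= b -> (forall x, a <= x <= b -> continuous f x) ->
  (forall x, a < x < b -> is_derive f x (df x)) ->
  (forall x, a < x < b -> 0 <= df x) -> f a <= f b.
Proof.
intros Hab Hc Hd Hle.
enough (- f b <= - f a) by lra.
apply (derive_nonpos (fun x => - f x) (fun x => - df x)); auto.
- intros x Hx. apply continuous_Ropp; auto.
- intros x Hx. apply (is_derive_opp f x (df x)), Hd; auto.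
- intros x Hx. specialize (Hle x Hx); lra.
Qed.

Lemma mean_value (f df : R -> R) (a b : R) :
  a < b -> (forall x, a <= x <= b -> is_derive f x (df x)) ->
  exists c, a <= c <= b /\ f b - f a = df c * (b - a).
Proof.
intros Hab Hd.
destruct (MVT_gen f a b df) as (c & Hc1 & Hc2).
- rewrite Rmin_left, Rmax_right by lra. intros x Hx. apply Hd; lra.
- rewrite Rmin_left, Rmax_right by lra. intros x Hx.
  apply continuous_ptR, (is_derive_cont _ _ (df x)); auto.
- rewrite Rmin_left, Rmax_right in Hc1 by lra. exists c; split; [lra|exact Hc2].
Qed.

Lemma gronwall (D dD : R -> R) (K a b : R) :
  a <= b -> (forall x, a <= x <= b -> continuous D x) ->
  (forall x, a < x < b -> is_derive D x (dD x)) ->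
  (forall x, a < x < b -> dD x <= K * D x) ->
  D b <= D a * exp (K * (b - a)).
Proof.
intros Hab Hc Hd Hle.
assert (He : forall x, is_derive (fun y => exp (- K * (y - a))) x (- K * exp (- K * (x - a)))).
{ intros x. auto_derive; [easy|]. unfold Rminus; ring. }
assert (H : D b * exp (- K * (b - a)) <= D a * exp (- K * (a - a))).
{ apply (derive_nonpos (fun x => D x * exp (- K * (x - a)))
    (fun x => dD x * exp (- K * (x - a)) + D x * (- K * exp (- K * (x - a))))); auto.
  - intros x Hx. apply (continuous_mult D (fun y => exp (- K * (y - a)))); auto.
    apply (is_derive_cont _ _ _ (He x)).
  - intros x Hx. apply (is_derive_mult D (fun y => exp (- K * (y - a))) x _ _ (Hd x Hx) (He x)).
    intros; apply Rmult_comm.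
  - intros x Hx. specialize (Hle x Hx).
    assert (P := exp_pos (- K * (x - a))). nra. }
replace (- K * (a - a)) with 0 in H by ring. rewrite exp_0 in H.
replace (- K * (b - a)) with (- (K * (b - a))) in H by ring. rewrite exp_Ropp in H.
assert (P := exp_pos (K * (b - a))).
apply Rmult_le_reg_r with (/ exp (K * (b - a))); [apply Rinv_0_lt_compat; exact P|].
rewrite Rmult_assoc, Rinv_r, Rmult_1_r by lra. lra.
Qed.

Lemma derive_neg_local (w : R -> R) (t l : R) :
  is_derive w t l -> l < 0 -> exists d, 0 < d /\
    (forall y, t < y < t + d -> w y < w t) /\ (forall y, t - d < y < t -> w t < w y).
Proof.
intros Hw Hl. apply is_derive_Reals in Hw.
destruct (Hw (- l)) as [d Hd]; [lra|].
exists d; split; [apply cond_pos|].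
assert (H : forall h, h <> 0 -> Rabs h < d -> (w (t + h) - w t) / h < 0).
{ intros h Hh1 Hh2. specialize (Hd h Hh1 Hh2). apply Rabs_def2 in Hd. lra. }
split; intros y Hy.
- specialize (H (y - t)). replace (t + (y - t)) with y in H by ring.
  assert (H1 : (w y - w t) / (y - t) < 0) by (apply H; [lra|apply Rabs_def1; lra]).
  assert (w y - w t = (w y - w t) / (y - t) * (y - t)) by (field; lra). nra.
- specialize (H (y - t)). replace (t + (y - t)) with y in H by ring.
  assert (H1 : (w y - w t) / (y - t) < 0) by (apply H; [lra|apply Rabs_def1; lra]).
  assert (w y - w t = (w y - w t) / (y - t) * (y - t)) by (field; lra). nra.
Qed.

Lemma neg_stays (w dw : R -> R) (a b : R) :
  (forall x, a <= x <= b -> is_derive w x (dw x)) -> w a <= 0 ->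
  (forall x, a <= x <= b -> w x = 0 -> dw x < 0) ->
  forall x, a < x <= b -> w x < 0.
Proof.
intros Hd Ha H0 x Hx. apply Rnot_le_lt. intros Hx0.
assert (Hs : exists a', a <= a' < x /\ w a' < 0).
{ destruct (Req_dec (w a) 0) as [E|E].
  - destruct (derive_neg_local w a (dw a)) as (d & Hd1 & Hd2 & _).
    + apply Hd; lra.
    + apply H0; [lra|exact E].
    + exists (a + Rmin (d / 2) ((x - a) / 2)).
      assert (M1 := Rmin_l (d / 2) ((x - a) / 2)). assert (M2 := Rmin_r (d / 2) ((x - a) / 2)).
      assert (0 < Rmin (d / 2) ((x - a) / 2)) by pos.
      split; [lra|]. rewrite <- E. apply Hd2. lra.
  - exists a; split; lra. }
destruct Hs as (a' & Ha' & Hw).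
destruct (first_ge w a' x 0) as (t & Ht & E & Hb); [lra| |exact Hw|exact Hx0|].
- intros y Hy. apply (is_derive_cont _ _ (dw y)), Hd; lra.
- destruct (derive_neg_local w t (dw t)) as (d & Hd1 & _ & Hd2).
  + apply Hd; lra.
  + apply H0; [lra|exact E].
  + set (s := Rmax a' (t - d / 2)).
    assert (Hs1 : a' <= s < t) by (unfold s, Rmax; destruct (Rle_dec a' (t - d / 2)); lra).
    assert (Hs2 : t - d < s) by (unfold s, Rmax; destruct (Rle_dec a' (t - d / 2)); lra).
    specialize (Hb s Hs1). specialize (Hd2 s). lra.
Qed.

Lemma derive_zero_const (f : R -> R) (a b : R) :
  a <= b -> (forall x, a <= x <= b -> continuous f x) ->
  (forall x, a < x < b -> is_derive f x 0) -> f b = f a.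
Proof.
intros Hab Hc Hd. apply Rle_antisym.
- apply (derive_nonpos f (fun _ => 0)); auto; intros; lra.
- apply (derive_nonneg f (fun _ => 0)); auto; intros; lra.
Qed.

Lemma cont_max (f : R -> R) (a b : R) :
  a <= b -> (forall x, a <= x <= b -> continuous f x) ->
  exists m, a <= m <= b /\ forall x, a <= x <= b -> f x <= f m.
Proof.
intros Hab Hc. destruct (continuity_ab_maj f a b Hab) as (m & H1 & H2).
- intros; apply continuous_ptR; auto.
- exists m; auto.
Qed.

Lemma cont_min (f : R -> R) (a b : R) :
  a <= b -> (forall x, a <= x <= b -> continuous f x) ->
  exists m, a <= m <= b /\ forall x, a <= x <= b -> f m <= f x.
Proof.
intros Hab Hc. destruct (continuity_ab_min f a b Hab) as (m & H1 & H2).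
- intros; apply continuous_ptR; auto.
- exists m; auto.
Qed.

Lemma is_derive_eq (f : R -> R) (x l l' : R) : is_derive f x l -> l = l' -> is_derive f x l'.
Proof. intros H <-; exact H. Qed.

Lemma dR_const (c x : R) : is_derive (fun _ : R => c) x 0.
Proof. apply (is_derive_const (K := R_AbsRing) (V := R_NormedModule)). Qed.

Lemma dR_id (x : R) : is_derive (fun y : R => y) x 1.
Proof. apply (is_derive_id (K := R_AbsRing)). Qed.

Lemma dR_plus (f g : R -> R) (x a b : R) :
  is_derive f x a -> is_derive g x b -> is_derive (fun y => f y + g y) x (a + b).
Proof. apply (is_derive_plus (K := R_AbsRing) (V := R_NormedModule) f g). Qed.

Lemma dR_minus (f g : R -> R) (x a b : R) :
  is_derive f x a -> is_derive g x b -> is_derive (fun y => f y - g y) x (a - b).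
Proof. apply (is_derive_minus (K := R_AbsRing) (V := R_NormedModule) f g). Qed.

Lemma dR_mult (f g : R -> R) (x a b : R) :
  is_derive f x a -> is_derive g x b ->
  is_derive (fun y => f y * g y) x (a * g x + f x * b).
Proof.
intros Hf Hg'. apply (is_derive_mult f g x a b Hf Hg').
intros; apply Rmult_comm.
Qed.

Lemma dR_scal (c : R) (f : R -> R) (x a : R) :
  is_derive f x a -> is_derive (fun y => c * f y) x (c * a).
Proof. intros Hf. apply (is_derive_scal f x c a Hf). Qed.

Lemma dR_comp (f g : R -> R) (x a b : R) :
  is_derive f (g x) a -> is_derive g x b -> is_derive (fun y => f (g y)) x (b * a).
Proof. apply (is_derive_comp (K := R_AbsRing) (V := R_NormedModule) f g). Qed.

Lemma dR_opp (f : R -> R) (x a : R) :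
  is_derive f x a -> is_derive (fun y => - f y) x (- a).
Proof. apply (is_derive_opp (K := R_AbsRing) (V := R_NormedModule) f). Qed.

Lemma dR_pow (k : nat) (x : R) : is_derive (fun y => y ^ k) x (INR k * x ^ pred k).
Proof.
eapply is_derive_eq; [apply (is_derive_pow (fun y => y) k x 1), dR_id|ring].
Qed.

Lemma dR_sqr (f : R -> R) (x a : R) :
  is_derive f x a -> is_derive (fun y => f y ^ 2) x (2 * f x * a).
Proof.
intros Hf. eapply is_derive_eq; [apply (is_derive_pow f 2 x a Hf)|simpl; ring].
Qed.

Lemma cR_plus (f g : R -> R) (x : R) :
  continuous f x -> continuous g x -> continuous (fun y => f y + g y) x.
Proof. apply (continuous_plus (K := R_AbsRing) (V := R_NormedModule) f g). Qed.

Lemma cR_minus (f g : R -> R) (x : R) :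
  continuous f x -> continuous g x -> continuous (fun y => f y - g y) x.
Proof. apply (continuous_minus (K := R_AbsRing) (V := R_NormedModule) f g). Qed.

Lemma cR_mult (f g : R -> R) (x : R) :
  continuous f x -> continuous g x -> continuous (fun y => f y * g y) x.
Proof. apply (continuous_mult (K := R_AbsRing) f g). Qed.

Lemma cR_scal (c : R) (f : R -> R) (x : R) :
  continuous f x -> continuous (fun y => c * f y) x.
Proof. intros Hf. apply cR_mult; [apply continuous_const|exact Hf]. Qed.

Lemma cR_pow (k : nat) (x : R) : continuous (fun y => y ^ k) x.
Proof. apply (is_derive_cont _ _ _ (dR_pow k x)). Qed.

Lemma cR_sqr (f : R -> R) (x : R) : continuous f x -> continuous (fun y => f y ^ 2) x.
Proof. intros Hf. apply (continuous_comp f (fun y => y ^ 2)); [exact Hf|apply cR_pow]. Qed.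

Lemma sqr_lt (x e : R) : - e < x < e -> 0 <= x ^ 2 < e * e.
Proof. intros [H1 H2]. split; [apply pow2_ge_0|nra]. Qed.

Lemma sqr_le (x e : R) : - e <= x <= e -> 0 <= x ^ 2 <= e * e.
Proof. intros [H1 H2]. split; [apply pow2_ge_0|nra]. Qed.

Lemma abs_lt_sqr (x e : R) : 0 <= e -> x ^ 2 < e * e -> Rabs x < e.
Proof. intros He H. apply Rabs_def1; nra. Qed.

Lemma abs_le_sqr (x e : R) : 0 <= e -> x ^ 2 <= e * e -> Rabs x <= e.
Proof. intros He H. apply Rabs_le; split; nra. Qed.

(** * Radial solutions and their energy *)

(** A radial solution in dimension [n + 1] with initial value [a], as the pair of [u] and
    [w = u'].  It is continued by constants to [r <= 0], so that [u] is differentiable on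
    the whole line and no one-sided derivatives occur. *)
Record sol (n : nat) (g : R -> R) (a : R) (u w : R -> R) : Prop := {
  sol_init : forall r, r <= 0 -> u r = a /\ w r = 0;
  sol_du : forall r, is_derive u r (w r);
  sol_cw : forall r, continuous w r;
  sol_dw : forall r, 0 < r -> is_derive w r (- (INR n / r) * w r - g (u r))
}.
Arguments sol_init {n g a u w} _ r.
Arguments sol_du {n g a u w} _ r.
Arguments sol_cw {n g a u w} _ r.
Arguments sol_dw {n g a u w} _ r.

Definition energy (g u w : R -> R) (r : R) : R := w r ^ 2 / 2 + Fint g (u r).

Lemma Fint_derive (g : R -> R) (s : R) :
  (forall x, continuous g x) -> is_derive (Fint g) s (g s).
Proof.
intros Hg. apply (is_derive_RInt g (Fint g) 0 s); [|apply Hg].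
exists (mkposreal 1 Rlt_0_1). intros y _. apply (RInt_correct g).
apply (ex_RInt_continuous g). intros; apply Hg.
Qed.

Lemma Fint_cont (g : R -> R) (s : R) :
  (forall x, continuous g x) -> continuous (Fint g) s.
Proof. intros Hg. apply (is_derive_cont _ _ (g s)), Fint_derive, Hg. Qed.

Lemma Fint_lipschitz (g : R -> R) (M x y : R) :
  (forall x, continuous g x) -> (forall x, Rabs (g x) <= M) ->
  Rabs (Fint g x - Fint g y) <= M * Rabs (x - y).
Proof.
intros Hg HM.
assert (H : forall a b, a < b -> Rabs (Fint g b - Fint g a) <= M * Rabs (b - a)).
{ intros a b Hab. destruct (mean_value (Fint g) g a b Hab) as (c & _ & ->).
  - intros; apply Fint_derive, Hg.
  - rewrite Rabs_mult. apply Rmult_le_compat_r; [apply Rabs_pos|apply HM]. }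
destruct (Rtotal_order x y) as [Hlt|[->|Hlt]].
- rewrite Rabs_minus_sym, (Rabs_minus_sym x). apply H, Hlt.
- rewrite !Rminus_diag, Rabs_R0. lra.
- apply H, Hlt.
Qed.

Lemma abs_sqr (x : R) : Rabs x * Rabs x = x * x.
Proof. rewrite <- Rabs_mult. apply Rabs_pos_eq. nra. Qed.

Section solutions.

Variables (n : nat) (g : R -> R) (a : R) (u w : R -> R).
Hypothesis Hg : forall x, continuous g x.
Hypothesis Hs : sol n g a u w.

Lemma sol_cu r : continuous u r.
Proof. apply (is_derive_cont _ _ (w r)), (sol_du Hs). Qed.

Lemma sol_flux r : 0 < r -> is_derive (fun r => r ^ n * w r) r (- (r ^ n * g (u r))).
Proof.
intros Hr. eapply is_derive_eq.
{ apply (dR_mult (fun r => r ^ n) w r _ _ (dR_pow n r) (sol_dw Hs r Hr)). }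
destruct n as [|m]; [simpl; lra|].
simpl pred. rewrite <- tech_pow_Rmult. field. lra.
Qed.

Lemma energy_derive r : 0 < r ->
  is_derive (energy g u w) r (- (INR n / r) * w r ^ 2).
Proof.
intros Hr. eapply is_derive_eq.
{ apply (dR_plus (fun r => w r ^ 2 * / 2) (fun r => Fint g (u r))).
  - apply dR_mult; [apply dR_sqr, (sol_dw Hs r Hr)|apply dR_const].
  - apply (dR_comp (Fint g) u); [apply Fint_derive, Hg|apply (sol_du Hs)]. }
simpl. field. lra.
Qed.

Lemma energy_cont r : continuous (energy g u w) r.
Proof.
apply cR_plus.
- apply cR_mult; [apply cR_sqr, (sol_cw Hs)|apply continuous_const].
- apply (continuous_comp u (Fint g)); [apply sol_cu|apply Fint_cont, Hg].
Qed.

Lemma energy_0 r : r <= 0 -> energy g u w r = Fint g a.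
Proof.
intros Hr. destruct (sol_init Hs r Hr) as [H1 H2].
unfold energy. rewrite H1, H2. lra.
Qed.

Lemma fric_nonpos r x : 0 < r -> - (INR n / r) * x ^ 2 <= 0.
Proof.
intros Hr. assert (0 <= INR n / r) by pos.
nra.
Qed.

Lemma energy_noninc r1 r2 : r1 <= r2 -> energy g u w r2 <= energy g u w r1.
Proof.
intros H.
assert (P : forall r1 r2, 0 <= r1 <= r2 -> energy g u w r2 <= energy g u w r1).
{ intros x y Hxy. apply (derive_nonpos _ (fun r => - (INR n / r) * w r ^ 2)); try lra.
  - intros; apply energy_cont.
  - intros; apply energy_derive; lra.
  - intros; apply fric_nonpos; lra. }
destruct (Rle_dec 0 r1); [apply P; lra|].
rewrite (energy_0 r1) by lra.
destruct (Rle_dec 0 r2).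
- rewrite <- (energy_0 0) by lra. apply P; lra.
- rewrite energy_0; lra.
Qed.

Lemma energy_le_init r : energy g u w r <= Fint g a.
Proof.
destruct (Rle_dec r 0).
- rewrite energy_0; lra.
- rewrite <- (energy_0 0) by lra. apply energy_noninc. lra.
Qed.

Lemma F_le_energy r : Fint g (u r) <= energy g u w r.
Proof. unfold energy. nra. Qed.

(** Without loss of energy there is no motion, as the friction dissipates. *)
Lemma energy_const_rest r1 r2 : (1 <= n)%nat -> 0 <= r1 < r2 ->
  energy g u w r1 <= energy g u w r2 ->
  (forall r, r1 <= r <= r2 -> u r = u r1) /\ (forall r, r1 < r <= r2 -> w r = 0).
Proof.
intros Hn Hr HE.
assert (Hw : forall r, r1 < r < r2 -> w r = 0).
{ intros r Hr'.
  assert (D1 := energy_derive r ltac:(lra)).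
  assert (D2 : is_derive (energy g u w) r 0).
  { apply (is_derive_ext_loc (fun _ => energy g u w r1)); [|apply dR_const].
    assert (Hd : 0 < Rmin (r - r1) (r2 - r)) by pos.
    exists (mkposreal _ Hd). intros y Hy.
    assert (Hy' : Rabs (y - r) < Rmin (r - r1) (r2 - r)) by exact Hy.
    assert (M1 := Rmin_l (r - r1) (r2 - r)). assert (M2 := Rmin_r (r - r1) (r2 - r)).
    apply Rabs_def2 in Hy'.
    assert (Hy1 : r1 <= y) by lra. assert (Hy2 : y <= r2) by lra.
    assert (A1 := energy_noninc r1 y Hy1). assert (A2 := energy_noninc y r2 Hy2). lra. }
  assert (E0 : - (INR n / r) * w r ^ 2 = 0).
  { rewrite <- (is_derive_unique _ _ _ D1). apply is_derive_unique, D2. }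
  assert (0 < INR n / r) by pos.
  assert (w r ^ 2 = 0) by nra. nra. }
assert (Hu : forall r, r1 <= r <= r2 -> u r = u r1).
{ intros r Hr'. apply (derive_zero_const u r1 r); [lra|intros; apply sol_cu|].
  intros x Hx. rewrite <- (Hw x) by lra. apply (sol_du Hs). }
split; [exact Hu|].
intros r Hr'. destruct (Req_dec r r2) as [->|]; [|apply Hw; lra].
apply NNPP. intros Hne.
destruct (continuous_eps w r2 (sol_cw Hs r2) (Rabs (w r2))) as (d & Hd & Hy).
{ apply Rabs_pos_lt, Hne. }
set (s := Rmax ((r1 + r2) / 2) (r2 - d / 2)).
assert (M1 := Rmax_l ((r1 + r2) / 2) (r2 - d / 2)).
assert (M2 := Rmax_r ((r1 + r2) / 2) (r2 - d / 2)).
assert (s < r2) by (apply Rmax_lub_lt; lra).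
specialize (Hy s). rewrite (Hw s), Rminus_0_l, Rabs_Ropp in Hy by (fold s in M1, M2; lra).
enough (Rabs (s - r2) < d) by (specialize (Hy ltac:(assumption)); lra).
apply Rabs_def1; fold s in M1, M2; lra.
Qed.

Lemma speed_bound M r : (forall x, Rabs (g x) <= M) -> 0 <= r -> Rabs (w r) <= M * r.
Proof.
intros HM Hr.
assert (M0 : 0 <= M) by (apply Rle_trans with (2 := HM 0), Rabs_pos).
destruct (Req_dec r 0) as [->|Hr0].
{ rewrite (proj2 (sol_init Hs 0 (Rle_refl 0))), Rabs_R0. lra. }
assert (Hr1 : 0 < r) by lra.
assert (Hpr : 0 < r ^ n) by pos.
assert (Hc : forall x, continuous (fun r => r ^ n * w r) x).
{ intros x. apply cR_mult; [apply cR_pow|apply (sol_cw Hs)]. }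
assert (Hw0 := proj2 (sol_init Hs 0 (Rle_refl 0))).
assert (Hlin : forall c x, is_derive (fun y => y * (c * r ^ n)) x (c * r ^ n)).
{ intros c x. auto_derive; [easy|ring]. }
assert (Hb : forall x, 0 < x < r -> Rabs (x ^ n * g (u x)) <= M * r ^ n).
{ intros x Hx. rewrite Rabs_mult, Rmult_comm.
  assert (0 <= x ^ n <= r ^ n) by (split; [pos|apply pow_incr; lra]).
  rewrite (Rabs_pos_eq (x ^ n)) by lra.
  apply Rmult_le_compat; try lra; [apply Rabs_pos|apply HM]. }
assert (U : r ^ n * w r + r * (- M * r ^ n) <= 0 ^ n * w 0 + 0 * (- M * r ^ n)).
{ apply (derive_nonpos (fun x => x ^ n * w x + x * (- M * r ^ n))
    (fun x => - (x ^ n * g (u x)) + - M * r ^ n)); try lra.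
  - intros x _. apply cR_plus; [apply Hc|].
    apply (is_derive_cont _ _ _ (Hlin (- M) x)).
  - intros x Hx. apply dR_plus; [apply sol_flux; lra|apply Hlin].
  - intros x Hx. specialize (Hb x Hx). apply Rabs_le_between in Hb. lra. }
assert (L : 0 ^ n * w 0 + 0 * (M * r ^ n) <= r ^ n * w r + r * (M * r ^ n)).
{ apply (derive_nonneg (fun x => x ^ n * w x + x * (M * r ^ n))
    (fun x => - (x ^ n * g (u x)) + M * r ^ n)); try lra.
  - intros x _. apply cR_plus; [apply Hc|].
    apply (is_derive_cont _ _ _ (Hlin M x)).
  - intros x Hx. apply dR_plus; [apply sol_flux; lra|apply Hlin].
  - intros x Hx. specialize (Hb x Hx). apply Rabs_le_between in Hb. lra. }
rewrite Hw0 in U, L. apply Rabs_le. split; nra.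
Qed.

Lemma pos_lipschitz M T r s : (forall x, Rabs (g x) <= M) ->
  0 <= r <= T -> 0 <= s <= T -> Rabs (u r - u s) <= M * T * Rabs (r - s).
Proof.
intros HM.
assert (M0 : 0 <= M) by (apply Rle_trans with (2 := HM 0), Rabs_pos).
assert (H : forall x y, 0 <= x -> x < y -> y <= T -> Rabs (u y - u x) <= M * T * Rabs (y - x)).
{ intros x y H0 H1 H2. destruct (mean_value u w x y H1) as (c & Hc & ->).
  - intros; apply (sol_du Hs).
  - rewrite Rabs_mult. apply Rmult_le_compat_r; [apply Rabs_pos|].
    apply Rle_trans with (M * c); [apply speed_bound; [exact HM|lra]|].
    apply Rmult_le_compat_l; lra. }
intros Hr Hs'. destruct (Rtotal_order r s) as [Hlt|[->|Hlt]].
- rewrite Rabs_minus_sym, (Rabs_minus_sym r). apply H; lra.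
- rewrite !Rminus_diag, Rabs_R0. lra.
- apply H; lra.
Qed.

End solutions.
Arguments sol_cu {n g a u w}.
Arguments sol_flux {n g a u w}.
Arguments energy_derive {n g a u w}.
Arguments energy_cont {n g a u w}.
Arguments energy_0 {n g a u w}.
Arguments energy_noninc {n g a u w}.
Arguments energy_le_init {n g a u w}.
Arguments energy_const_rest {n g a u w}.
Arguments speed_bound {n g a u w}.
Arguments pos_lipschitz {n g a u w}.

(** * Continuous dependence on the initial value *)

Definition lip_off_0 (g : R -> R) : Prop :=
  forall x, x <> 0 -> exists eps L, 0 < eps /\ 0 <= L /\
    forall y z, Rabs (y - x) < eps -> Rabs (z - x) < eps ->
      Rabs (g y - g z) <= L * Rabs (y - z).

Section dependence.

Variables (n : nat) (g : R -> R) (M : R).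
Hypothesis Hg : forall x, continuous g x.
Hypothesis HM : forall x, Rabs (g x) <= M.

Lemma bound_nonneg : 0 <= M.
Proof. apply Rle_trans with (2 := HM 0), Rabs_pos. Qed.

(** Where [g] is Lipschitz the friction term only helps: it has the good sign in the
    derivative of the squared distance, also near the singular point [r = 0]. *)
Lemma gronwall_phase a u w a' u' w' L r1 r2 :
  sol n g a u w -> sol n g a' u' w' -> 0 <= L -> 0 <= r1 <= r2 ->
  (forall r, r1 < r < r2 -> Rabs (g (u' r) - g (u r)) <= L * Rabs (u' r - u r)) ->
  (u' r2 - u r2) ^ 2 + (w' r2 - w r2) ^ 2 <=
  ((u' r1 - u r1) ^ 2 + (w' r1 - w r1) ^ 2) * exp ((1 + L) * (r2 - r1)).
Proof.
intros S S' HL Hr HLip.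
apply (gronwall (fun r => (u' r - u r) ^ 2 + (w' r - w r) ^ 2)
  (fun r => 2 * (u' r - u r) * (w' r - w r) + 2 * (w' r - w r) *
     ((- (INR n / r) * w' r - g (u' r)) - (- (INR n / r) * w r - g (u r))))).
- lra.
- intros r _. apply cR_plus; apply cR_sqr, cR_minus;
    first [apply (sol_cw S')|apply (sol_cw S)|apply (sol_cu S')|apply (sol_cu S)].
- intros r Hr'. apply dR_plus;
    [apply (dR_sqr (fun r => u' r - u r))|apply (dR_sqr (fun r => w' r - w r))]; apply dR_minus;
    first [apply (sol_du S')|apply (sol_du S)|apply (sol_dw S'); lra|apply (sol_dw S); lra].
- intros r Hr'. specialize (HLip r Hr').
  assert (Hn : 0 <= INR n / r) by pos.
  set (x := u' r - u r) in *. set (y := w' r - w r).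
  replace (- (INR n / r) * w' r - g (u' r) - (- (INR n / r) * w r - g (u r)))
    with (- (INR n / r) * y - (g (u' r) - g (u r))) by (unfold y; ring).
  set (d := g (u' r) - g (u r)) in *.
  assert (Hyd : - y * d <= Rabs y * (L * Rabs x)).
  { apply Rle_trans with (Rabs (- y * d)); [apply Rle_abs|].
    rewrite Rabs_mult, Rabs_Ropp. apply Rmult_le_compat_l; [apply Rabs_pos|exact HLip]. }
  assert (Sx := abs_sqr x). assert (Sy := abs_sqr y).
  assert (0 <= INR n / r * y ^ 2) by pos.
  assert (2 * (Rabs y * (L * Rabs x)) <= L * (x ^ 2 + y ^ 2)).
  { assert (0 <= L * ((Rabs x - Rabs y) * (Rabs x - Rabs y)))
      by (apply Rmult_le_pos; [lra|apply Rle_0_sqr]).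
    replace (x ^ 2) with (Rabs x * Rabs x) by (rewrite Sx; ring).
    replace (y ^ 2) with (Rabs y * Rabs y) by (rewrite Sy; ring). lra. }
  assert (0 <= (x - y) * (x - y)) by apply Rle_0_sqr.
  lra.
Qed.

(** Where [w] does not vanish, [u] and the energy solve a system in which [g] enters only
    through its primitive, so that no Lipschitz condition on [g] is used. *)
Lemma gronwall_energy a u w a' u' w' p c r1 r2 :
  sol n g a u w -> sol n g a' u' w' -> 0 < p -> 0 < c -> c <= r1 <= r2 ->
  (forall r, r1 < r < r2 -> p <= Rabs (w' r + w r)) ->
  (u' r2 - u r2) ^ 2 + (energy g u' w' r2 - energy g u w r2) ^ 2 <=
  ((u' r1 - u r1) ^ 2 + (energy g u' w' r1 - energy g u w r1) ^ 2) *
    exp (4 * (2 / p + 2 * INR n / c) * (1 + M) * (r2 - r1)).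
Proof.
intros S S' Hp Hc Hr Hpw. assert (M0 := bound_nonneg).
apply (gronwall (fun r => (u' r - u r) ^ 2 + (energy g u' w' r - energy g u w r) ^ 2)
  (fun r => 2 * (u' r - u r) * (w' r - w r) + 2 * (energy g u' w' r - energy g u w r) *
     ((- (INR n / r) * w' r ^ 2) - (- (INR n / r) * w r ^ 2)))).
- lra.
- intros r _. apply cR_plus; apply cR_sqr, cR_minus;
    first [apply (sol_cu S')|apply (sol_cu S)|
           apply (energy_cont Hg S')|apply (energy_cont Hg S)].
- intros r Hr'. apply dR_plus;
    [apply (dR_sqr (fun r => u' r - u r))
    |apply (dR_sqr (fun r => energy g u' w' r - energy g u w r))]; apply dR_minus;
    first [apply (sol_du S')|apply (sol_du S)|
           apply (energy_derive Hg S'); lra|apply (energy_derive Hg S); lra].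
- intros r Hr'. specialize (Hpw r Hr').
  assert (HF := Fint_lipschitz g M (u' r) (u r) Hg HM).
  assert (Hid : (w' r - w r) * (w' r + w r) =
    2 * ((energy g u' w' r - energy g u w r) - (Fint g (u' r) - Fint g (u r)))).
  { unfold energy. field. }
  set (x := u' r - u r) in *. set (e := energy g u' w' r - energy g u w r) in *.
  set (d := Fint g (u' r) - Fint g (u r)) in *.
  set (y := w' r - w r) in *. set (z := w' r + w r) in *.
  set (t := Rabs e + M * Rabs x).
  assert (Ht : Rabs (e - d) <= t).
  { unfold t. apply Rle_trans with (Rabs e + Rabs (- d)); [apply Rabs_triang|].
    rewrite Rabs_Ropp. lra. }
  assert (Hyz : Rabs y * Rabs z <= 2 * t).
  { rewrite <- Rabs_mult, Hid, Rabs_mult, (Rabs_pos_eq 2) by lra. lra. }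
  assert (Ay := Rabs_pos y). assert (Ax := Rabs_pos x). assert (Ae := Rabs_pos e).
  assert (Hy : Rabs y <= 2 / p * t).
  { apply Rmult_le_reg_r with p; [exact Hp|].
    replace (2 / p * t * p) with (2 * t) by (field; lra). nra. }
  assert (Hn : 0 <= INR n / r <= INR n / c).
  { assert (P := pos_INR n). assert (0 < / r) by pos.
    assert (/ r <= / c) by (apply Rinv_le_contravar; lra).
    unfold Rdiv; split; nra. }
  assert (H1 : 2 * x * y <= 2 * (Rabs x * (2 / p * t))).
  { assert (x * y <= Rabs x * Rabs y) by (rewrite <- Rabs_mult; apply Rle_abs). nra. }
  assert (H2 : 2 * e * (- (INR n / r) * w' r ^ 2 - - (INR n / r) * w r ^ 2) <=
               2 * (Rabs e * (2 * INR n / c * t))).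
  { replace (2 * e * (- (INR n / r) * w' r ^ 2 - - (INR n / r) * w r ^ 2))
      with (2 * (INR n / r * (- e * (y * z)))) by (unfold y, z; ring).
    assert (- e * (y * z) <= Rabs e * (2 * t)).
    { apply Rle_trans with (Rabs (- e * (y * z))); [apply Rle_abs|].
      rewrite Rabs_mult, Rabs_Ropp, Rabs_mult. apply Rmult_le_compat_l; [exact Ae|exact Hyz]. }
    assert (0 <= Rabs e * (2 * t)) by (assert (0 <= t) by (unfold t; nra); nra).
    replace (2 * INR n / c) with (2 * (INR n / c)) by (field; lra). nra. }
  assert (C1 : 0 < 2 / p) by pos.
  assert (C2 : 0 <= 2 * INR n / c) by (replace (2 * INR n / c) with (2 * (INR n / c)) by (field; lra); lra).
  assert (t0 : 0 <= t <= (1 + M) * (Rabs x + Rabs e)) by (unfold t; split; nra).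
  set (A := 2 / p) in *. set (B := 2 * INR n / c) in *.
  assert (H3 : Rabs x * (A * t) + Rabs e * (B * t) <= (A + B) * (1 + M) * ((Rabs x + Rabs e) * (Rabs x + Rabs e))).
  { apply Rle_trans with ((A + B) * ((Rabs x + Rabs e) * t)); [|].
    - assert (0 <= Rabs x * t) by nra. assert (0 <= Rabs e * t) by nra. nra.
    - replace ((A + B) * (1 + M) * ((Rabs x + Rabs e) * (Rabs x + Rabs e)))
        with ((A + B) * ((Rabs x + Rabs e) * ((1 + M) * (Rabs x + Rabs e)))) by ring.
      apply Rmult_le_compat_l; [lra|]. apply Rmult_le_compat_l; lra. }
  assert (H4 : (Rabs x + Rabs e) * (Rabs x + Rabs e) <= 2 * (x ^ 2 + e ^ 2)).
  { replace (x ^ 2) with (Rabs x * Rabs x) by (rewrite abs_sqr; ring).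
    replace (e ^ 2) with (Rabs e * Rabs e) by (rewrite abs_sqr; ring).
    assert (0 <= (Rabs x - Rabs e) * (Rabs x - Rabs e)) by apply Rle_0_sqr. lra. }
  assert (0 <= (A + B) * (1 + M)) by nra.
  assert (H5 : (A + B) * (1 + M) * ((Rabs x + Rabs e) * (Rabs x + Rabs e)) <=
               (A + B) * (1 + M) * (2 * (x ^ 2 + e ^ 2))) by (apply Rmult_le_compat_l; lra).
  replace (4 * (A + B) * (1 + M) * (x ^ 2 + e ^ 2)) with
     (2 * ((A + B) * (1 + M) * (2 * (x ^ 2 + e ^ 2)))) by ring. lra.
Qed.

Definition close_on (T eps : R) (u w u' w' : R -> R) : Prop :=
  forall r, 0 <= r <= T -> Rabs (u' r - u r) < eps /\ Rabs (w' r - w r) < eps.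

Definition stable_upto (u w : R -> R) (a T : R) : Prop :=
  forall eps, 0 < eps -> exists d, 0 < d /\ forall a' u' w',
    sol n g a' u' w' -> Rabs (a' - a) < d -> close_on T eps u w u' w'.

Lemma velocity_lipschitz a u w T c r s :
  sol n g a u w -> 0 < c -> c <= r <= T -> c <= s <= T ->
  Rabs (w r - w s) <= (INR n / c * (M * T) + M) * Rabs (r - s).
Proof.
intros S Hc. assert (M0 := bound_nonneg).
assert (P := pos_INR n).
assert (H : forall x y, c <= x -> x < y -> y <= T ->
  Rabs (w y - w x) <= (INR n / c * (M * T) + M) * Rabs (y - x)).
{ intros x y H0 H1 H2.
  destruct (mean_value w (fun r => - (INR n / r) * w r - g (u r)) x y H1) as (t & Ht & ->).
  - intros; apply (sol_dw S); lra.
  - rewrite Rabs_mult. apply Rmult_le_compat_r; [apply Rabs_pos|].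
    unfold Rminus. apply Rle_trans with (1 := Rabs_triang _ _).
    rewrite Rabs_Ropp. apply Rplus_le_compat; [|apply HM].
    rewrite Rabs_mult, Rabs_Ropp.
    assert (0 <= INR n / t) by pos.
    rewrite (Rabs_pos_eq (INR n / t)) by lra.
    apply Rmult_le_compat; [lra|apply Rabs_pos| |].
    + apply Rmult_le_compat_l; [exact P|]. apply Rinv_le_contravar; lra.
    + apply Rle_trans with (M * t); [apply (speed_bound S); [exact HM|lra]|].
      apply Rmult_le_compat_l; lra. }
intros Hr Hs'. destruct (Rtotal_order r s) as [Hlt|[->|Hlt]].
- rewrite Rabs_minus_sym, (Rabs_minus_sym r). apply H; lra.
- rewrite !Rminus_diag, Rabs_R0. lra.
- apply H; lra.
Qed.

Lemma stable_step_lipschitz a u w T x :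
  lip_off_0 g -> sol n g a u w -> 0 <= x <= T -> u x <> 0 ->
  exists h, 0 < h /\ (stable_upto u w a (Rmax 0 (x - h)) -> stable_upto u w a (Rmin T (x + h))).
Proof.
intros Hlip S Hx Hux. assert (M0 := bound_nonneg).
destruct (Hlip (u x) Hux) as (eta & L & Heta & HL & Hl).
set (V := M * T + 1).
assert (HV : 0 < V) by (unfold V; nra).
set (h := Rmin (1 / 2) (eta / (8 * V))).
assert (Hh : 0 < h) by pos.
assert (Hh2 : h <= 1 / 2) by apply Rmin_l.
assert (HhV : V * h <= eta / 8).
{ apply Rle_trans with (V * (eta / (8 * V))).
  - apply Rmult_le_compat_l; [lra|apply Rmin_r].
  - right; field; lra. }
exists h; split; [exact Hh|]. intros Hst eps Heps.
set (rho := Rmax 0 (x - h)) in *.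
assert (Hrho : 0 <= rho <= x) by (unfold rho; split; [apply Rmax_l|apply Rmax_lub; lra]).
assert (Hrho2 : x - h <= rho) by apply Rmax_r.
set (K := exp (1 + L)).
assert (HK : 1 < K) by (assert (X := exp_increasing 0 (1 + L)); rewrite exp_0 in X; unfold K; lra).
destruct (below3 (eta / 4) eps (eps / (2 * K))) as (e1 & He1 & He1a & He1b & He1c'); [lra|lra|pos|].
assert (He1c : e1 * (2 * K) <= eps).
{ apply Rle_trans with (eps / (2 * K) * (2 * K)).
  - apply Rmult_le_compat_r; lra.
  - right; field; lra. }
destruct (Hst e1 He1) as (d & Hd & Hcl).
exists d; split; [exact Hd|]. intros a' u' w' S' Ha'.
specialize (Hcl a' u' w' S' Ha').
intros r [Hr0 Hr1].
assert (HrT : r <= T) by (apply Rle_trans with (1 := Hr1), Rmin_l).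
assert (Hrx : r <= x + h) by (apply Rle_trans with (1 := Hr1), Rmin_r).
destruct (Rle_dec r rho) as [Hle|Hnle].
{ destruct (Hcl r (conj Hr0 Hle)). split; lra. }
destruct (Hcl rho (conj (proj1 Hrho) (Rle_refl _))) as [Hu1 Hw1].
assert (Hnear : forall y, rho <= y <= r -> Rabs (u y - u x) < eta /\ Rabs (u' y - u x) < eta).
{ intros y Hy.
  assert (D1 : Rabs (u y - u x) <= eta / 8).
  { eapply Rle_trans; [apply (pos_lipschitz S M T); [exact HM|lra|lra]|].
    assert (Rabs (y - x) <= h) by (apply Rabs_le; lra).
    assert (0 <= Rabs (y - x)) by apply Rabs_pos. unfold V in HhV. nra. }
  assert (D2 : Rabs (u rho - u x) <= eta / 8).
  { eapply Rle_trans; [apply (pos_lipschitz S M T); [exact HM|lra|lra]|].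
    assert (Rabs (rho - x) <= h) by (apply Rabs_le; lra).
    assert (0 <= Rabs (rho - x)) by apply Rabs_pos. unfold V in HhV. nra. }
  assert (D3 : Rabs (u' y - u' rho) <= eta / 4).
  { eapply Rle_trans; [apply (pos_lipschitz S' M T); [exact HM|lra|lra]|].
    assert (Rabs (y - rho) <= 2 * h) by (apply Rabs_le; lra).
    assert (0 <= Rabs (y - rho)) by apply Rabs_pos. unfold V in HhV. nra. }
  apply Rabs_le_between in D1, D2, D3. apply Rabs_def2 in Hu1.
  split; apply Rabs_def1; lra. }
assert (HD := gronwall_phase a u w a' u' w' L rho r S S' HL ltac:(lra)
  ltac:(intros y Hy; destruct (Hnear y); [lra|]; apply Hl; assumption)).
assert (Hexp : exp ((1 + L) * (r - rho)) <= K).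
{ unfold K. destruct (Rle_lt_or_eq_dec ((1 + L) * (r - rho)) (1 + L)) as [H|H].
  - nra.
  - left; apply exp_increasing, H.
  - rewrite H; lra. }
assert (Hsm : (u' r - u r) ^ 2 + (w' r - w r) ^ 2 < eps * eps).
{ eapply Rle_lt_trans; [exact HD|].
  apply Rabs_def2 in Hu1. apply Rabs_def2 in Hw1.
  assert (S1 := sqr_lt (u' rho - u rho) e1 ltac:(lra)).
  assert (S2 := sqr_lt (w' rho - w rho) e1 ltac:(lra)).
  assert (0 <= (u' rho - u rho) ^ 2 + (w' rho - w rho) ^ 2 < 2 * (e1 * e1)) by lra.
  assert (0 < exp ((1 + L) * (r - rho))) by pos.
  apply Rle_lt_trans with (((u' rho - u rho) ^ 2 + (w' rho - w rho) ^ 2) * K); [nra|].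
  apply Rlt_le_trans with (2 * (e1 * e1) * K); [nra|].
  assert (e1 * (e1 * (2 * K)) <= eps * eps) by (apply Rmult_le_compat; [lra|pos|lra|lra]). lra. }
assert (Q1 := pow2_ge_0 (u' r - u r)). assert (Q2 := pow2_ge_0 (w' r - w r)).
split; apply abs_lt_sqr; lra.
Qed.

(** Closeness of [u] and of the energy gives back closeness of [w], because the sign of [w] is
    constant on the interval considered. *)
Lemma stable_step_transversal a u w T x :
  sol n g a u w -> 0 < x <= T -> w x <> 0 ->
  exists h, 0 < h /\ (stable_upto u w a (Rmax 0 (x - h)) -> stable_upto u w a (Rmin T (x + h))).
Proof.
intros S Hx Hwx. assert (M0 := bound_nonneg). assert (Pn := pos_INR n).
set (p := Rabs (w x)). assert (Hp : 0 < p) by (apply Rabs_pos_lt, Hwx).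
set (c := x / 2). assert (Hc : 0 < c) by (unfold c; lra).
set (A := INR n / c * (M * T) + M).
assert (HA : 0 <= A).
{ unfold A. assert (0 <= INR n / c) by pos.
  assert (0 <= M * T) by nra. nra. }
destruct (below3 (1 / 2) (x / 2) (p / (8 * (A + 1)))) as (h & Hh & Hh2 & Hh3 & Hh4); [lra|lra|pos|].
assert (HhA : (A + 1) * h <= p / 8).
{ apply Rle_trans with ((A + 1) * (p / (8 * (A + 1)))).
  - apply Rmult_le_compat_l; lra.
  - right; field; lra. }
exists h; split; [exact Hh|]. intros Hst eps Heps.
rewrite Rmax_right in Hst by lra.
set (rho := x - h) in *.
assert (Hrho : c <= rho < x) by (unfold rho, c; lra).
set (Kc := 4 * (2 / p + 2 * INR n / c) * (1 + M)).
assert (HKc : 0 <= Kc).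
{ unfold Kc. assert (0 < 2 / p) by pos.
  assert (0 <= INR n / c) by pos.
  replace (2 * INR n / c) with (2 * (INR n / c)) by (field; lra). nra. }
set (V := M * T).
assert (HV : 0 <= V) by (unfold V; nra).
set (B := (1 + (V + M) * (V + M)) * exp Kc).
assert (HB : 1 <= B).
{ unfold B. assert (1 <= exp Kc).
  { destruct HKc as [H|H]; [|rewrite <- H, exp_0; lra].
    apply exp_increasing in H. rewrite exp_0 in H. lra. }
  assert (0 <= (V + M) * (V + M)) by apply Rle_0_sqr.
  assert (0 <= (V + M) * (V + M) * exp Kc) by pos. lra. }
set (q := 2 / p * (1 + M)).
assert (Hq : 0 < q) by (unfold q; apply Rmult_lt_0_compat; [apply Rdiv_lt_0_compat|]; lra).
set (e2 := eps / (2 * (1 + q))).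
assert (He2 : 0 < e2) by (unfold e2; pos).
assert (He2a : e2 + q * e2 < eps).
{ replace (e2 + q * e2) with (eps / 2) by (unfold e2; field; lra). lra. }
destruct (below3 (p / 8) eps (e2 / (1 + B))) as (e1 & He1 & He1a & He1b & He1c'); [lra|lra|pos|].
assert (He1c : e1 * (1 + B) <= e2).
{ apply Rle_trans with (e2 / (1 + B) * (1 + B)).
  - apply Rmult_le_compat_r; lra.
  - right; field; lra. }
destruct (Hst e1 He1) as (d & Hd & Hcl).
exists d; split; [exact Hd|]. intros a' u' w' S' Ha'.
specialize (Hcl a' u' w' S' Ha').
intros r [Hr0 Hr1].
assert (HrT : r <= T) by (apply Rle_trans with (1 := Hr1), Rmin_l).
assert (Hrx : r <= x + h) by (apply Rle_trans with (1 := Hr1), Rmin_r).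
destruct (Rle_dec r rho) as [Hle|Hnle].
{ destruct (Hcl r (conj Hr0 Hle)). split; lra. }
destruct (Hcl rho ltac:(lra)) as [Hu1 Hw1].
assert (Hsum : forall y, rho <= y <= r -> p <= Rabs (w' y + w y)).
{ intros y Hy.
  assert (D1 : Rabs (w y - w x) <= p / 8).
  { eapply Rle_trans; [apply (velocity_lipschitz a u w T c); [exact S|lra|lra|lra]|]. fold A.
    assert (Rabs (y - x) <= h) by (apply Rabs_le; unfold rho in Hy; lra).
    assert (0 <= Rabs (y - x)) by apply Rabs_pos. nra. }
  assert (D2 : Rabs (w rho - w x) <= p / 8).
  { eapply Rle_trans; [apply (velocity_lipschitz a u w T c); [exact S|lra|lra|lra]|]. fold A.
    assert (Rabs (rho - x) <= h) by (apply Rabs_le; unfold rho; lra).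
    assert (0 <= Rabs (rho - x)) by apply Rabs_pos. nra. }
  assert (D3 : Rabs (w' y - w' rho) <= p / 4).
  { eapply Rle_trans; [apply (velocity_lipschitz a' u' w' T c); [exact S'|lra|lra|lra]|]. fold A.
    assert (Rabs (y - rho) <= 2 * h) by (apply Rabs_le; unfold rho in *; lra).
    assert (0 <= Rabs (y - rho)) by apply Rabs_pos. nra. }
  apply Rabs_le_between in D1, D2, D3. apply Rabs_def2 in Hw1.
  unfold p in *. destruct (Rle_dec 0 (w x)) as [H|H].
  - rewrite (Rabs_pos_eq (w x)) in * by lra. rewrite Rabs_pos_eq; lra.
  - rewrite (Rabs_left (w x)) in * by lra. rewrite Rabs_left; lra. }
assert (HD := gronwall_energy a u w a' u' w' p c rho r S S' Hp Hc ltac:(lra)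
  ltac:(intros y Hy; apply Hsum; lra)).
fold Kc in HD.
assert (Hexp : exp (Kc * (r - rho)) <= exp Kc).
{ destruct (Rle_lt_or_eq_dec (Kc * (r - rho)) Kc) as [H|H].
  - unfold rho in *. nra.
  - left; apply exp_increasing, H.
  - rewrite H; lra. }
set (E := energy g u w) in *. set (E' := energy g u' w') in *.
assert (HE1 : Rabs (E' rho - E rho) <= (V + M) * e1).
{ assert (HF := Fint_lipschitz g M (u' rho) (u rho) Hg HM).
  replace (E' rho - E rho) with
    ((w' rho - w rho) * ((w' rho + w rho) / 2) + (Fint g (u' rho) - Fint g (u rho)))
    by (unfold E, E', energy; field).
  eapply Rle_trans; [apply Rabs_triang|]. rewrite Rabs_mult.
  assert (Rabs ((w' rho + w rho) / 2) <= V).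
  { assert (B1 := speed_bound S M rho HM ltac:(lra)).
    assert (B2 := speed_bound S' M rho HM ltac:(lra)).
    apply Rabs_le_between in B1, B2. apply Rabs_le. unfold V.
    assert (M * rho <= M * T) by nra. lra. }
  assert (P1 := Rabs_pos (w' rho - w rho)). assert (P2 := Rabs_pos (u' rho - u rho)).
  assert (P3 := Rabs_pos ((w' rho + w rho) / 2)). nra. }
assert (Hsm : (u' r - u r) ^ 2 + (E' r - E r) ^ 2 <= e2 * e2).
{ eapply Rle_trans; [exact HD|].
  apply Rabs_def2 in Hu1. apply Rabs_le_between in HE1.
  set (vm := (V + M) * e1) in *.
  assert (Hvm : 0 <= vm) by (unfold vm; nra).
  assert (Q1 : 0 <= (u' rho - u rho) ^ 2 + (E' rho - E rho) ^ 2 <= e1 * e1 + vm * vm).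
  { assert (S1 := sqr_le (u' rho - u rho) e1 ltac:(lra)).
    assert (S2 := sqr_le (E' rho - E rho) vm ltac:(lra)). lra. }
  assert (Q0 : 0 < exp (Kc * (r - rho))) by pos.
  apply Rle_trans with ((e1 * e1 + vm * vm) * exp Kc); [apply Rmult_le_compat; lra|].
  replace ((e1 * e1 + vm * vm) * exp Kc) with (e1 * e1 * B) by (unfold B, vm; ring).
  apply Rle_trans with ((e1 * (1 + B)) * (e1 * (1 + B))); [nra|].
  apply Rmult_le_compat; nra. }
assert (R1 := pow2_ge_0 (u' r - u r)). assert (R2 := pow2_ge_0 (E' r - E r)).
assert (HU : Rabs (u' r - u r) <= e2) by (apply abs_le_sqr; lra).
assert (HE : Rabs (E' r - E r) <= e2) by (apply abs_le_sqr; lra).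
assert (0 < q * e2) by pos.
split; [lra|].
assert (HF := Fint_lipschitz g M (u' r) (u r) Hg HM).
assert (Hid : (w' r - w r) * (w' r + w r) =
    2 * ((E' r - E r) - (Fint g (u' r) - Fint g (u r)))).
{ unfold E, E', energy. field. }
assert (Hab : Rabs (w' r - w r) * Rabs (w' r + w r) <= 2 * ((1 + M) * e2)).
{ rewrite <- Rabs_mult, Hid, Rabs_mult, (Rabs_pos_eq 2) by lra.
  assert (Rabs (E' r - E r - (Fint g (u' r) - Fint g (u r))) <= e2 + M * e2).
  { eapply Rle_trans; [apply Rabs_triang|]. rewrite Rabs_Ropp.
    assert (M * Rabs (u' r - u r) <= M * e2) by (apply Rmult_le_compat_l; lra). lra. }
  lra. }
assert (Hpr := Hsum r ltac:(lra)).
assert (Hfin : Rabs (w' r - w r) <= q * e2).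
{ apply Rmult_le_reg_r with p; [exact Hp|].
  replace (q * e2 * p) with (2 * ((1 + M) * e2)) by (unfold q; field; lra).
  assert (P1 := Rabs_pos (w' r - w r)). nra. }
lra.
Qed.

(** Continuous dependence on the initial value holds as long as the solution does not
    reach [u = w = 0]: elsewhere either [g] is Lipschitz or [u] is a coordinate. *)
Theorem continuous_dependence a u w T :
  lip_off_0 g -> sol n g a u w -> 0 <= T ->
  (forall r, 0 <= r <= T -> ~ (u r = 0 /\ w r = 0)) ->
  stable_upto u w a T.
Proof.
intros Hlip S HT Hnd.
apply (real_induction (stable_upto u w a) 0 T HT).
- intros eps Heps. exists eps; split; [exact Heps|]. intros a' u' w' S' Ha' r Hr.
  destruct (sol_init S r) as [-> ->]; [lra|]. destruct (sol_init S' r) as [-> ->]; [lra|].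
  split; [exact Ha'|]. rewrite Rminus_diag, Rabs_R0; exact Heps.
- intros x y Hxy _ Hy eps Heps. destruct (Hy eps Heps) as (d & Hd & Hcl).
  exists d; split; [exact Hd|]. intros a' u' w' S' Ha' r Hr. apply (Hcl a' u' w' S' Ha'). lra.
- intros x Hx. destruct (Req_dec (u x) 0) as [E|E].
  + apply (stable_step_transversal a u w T x S).
    * split; [|lra]. destruct (proj1 Hx) as [H|H]; [exact H|].
      exfalso. apply (Hnd 0); [lra|]. split; [congruence|].
      apply (proj2 (sol_init S 0 (Rle_refl 0))).
    * intros E'. exact (Hnd x Hx (conj E E')).
  + exact (stable_step_lipschitz a u w T x Hlip S Hx E).
Qed.

End dependence.

(** * Extracting a convergent subsequence *)

Lemma dense_nonneg (r eps : R) : 0 <= r -> 0 < eps ->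
  exists a b : nat, Rabs (INR a / INR (S b) - r) < eps.
Proof.
intros Hr He.
destruct (nfloor_ex (/ eps)) as (b & Hb1 & Hb2); [left; apply Rinv_0_lt_compat, He|].
assert (HS : INR (S b) = INR b + 1) by apply S_INR.
assert (Hpos : 0 < INR (S b)) by pos.
destruct (nfloor_ex (r * INR (S b))) as (a & Ha1 & Ha2); [pos|].
exists a, b.
assert (Hi : / INR (S b) < eps).
{ rewrite <- (Rinv_inv eps). apply Rinv_lt_contravar; [|lra].
  apply Rmult_lt_0_compat; [apply Rinv_0_lt_compat, He|exact Hpos]. }
replace (INR a / INR (S b) - r) with (- ((r * INR (S b) - INR a) * / INR (S b))) by (field; lra).
rewrite Rabs_Ropp, Rabs_pos_eq.
- apply Rle_lt_trans with (2 := Hi). rewrite <- (Rmult_1_l (/ INR (S b))) at 2.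
  apply Rmult_le_compat_r; [left; apply Rinv_0_lt_compat, Hpos|lra].
- apply Rmult_le_pos; [lra|left; apply Rinv_0_lt_compat, Hpos].
Qed.

(** Pairs of a nonnegative rational point and a rational level, enumerated by a pairing
    function. *)
Definition dense_fst (j : nat) : R :=
  let (p, _) := of_nat j in let (a, b) := of_nat p in INR a / INR (S b).
Definition dense_snd (j : nat) : R :=
  let (_, p) := of_nat j in let (q, e) := of_nat p in
  let (a, b) := of_nat q in INR a / INR (S b) - INR e.

Lemma dense_pairs (r y eps : R) : 0 <= r -> 0 < eps ->
  exists j, 0 <= dense_fst j /\ Rabs (dense_fst j - r) < eps /\ Rabs (dense_snd j - y) < eps.
Proof.
intros Hr He.
destruct (dense_nonneg r eps Hr He) as (a & b & Hab).
destruct (nfloor_ex (Rabs y)) as (e & He1 & He2); [apply Rabs_pos|].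
destruct (dense_nonneg (y + INR (S e)) eps) as (c & d & Hcd); [|exact He|].
{ rewrite S_INR. assert (- y <= Rabs y) by (rewrite <- Rabs_Ropp; apply Rle_abs). lra. }
exists (to_nat (to_nat (a, b), to_nat (to_nat (c, d), S e))).
unfold dense_fst, dense_snd. rewrite !cancel_of_to. split; [|split; [exact Hab|]].
- apply Rmult_le_pos; [apply pos_INR|left; apply Rinv_0_lt_compat, lt_0_INR; lia].
- replace (INR c / INR (S d) - INR (S e) - y) with (INR c / INR (S d) - (y + INR (S e))) by ring.
  exact Hcd.
Qed.

Definition often (P : nat -> Prop) : Prop := forall m, exists k, (m <= k)%nat /\ P k.

Lemma often_split (P A : nat -> Prop) : often P -> ~ often (fun k => P k /\ A k) ->
  often (fun k => P k /\ ~ A k).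
Proof.
intros HP HA m. apply not_all_ex_not in HA. destruct HA as [m0 HA].
destruct (HP (max m m0)) as (k & Hk & Pk). exists k. split; [lia|]. split; [exact Pk|].
intros Ak. apply HA. exists k. split; [lia|auto].
Qed.

Lemma often_ext (P Q : nat -> Prop) : (forall k, P k -> Q k) -> often P -> often Q.
Proof. intros H HP m. destruct (HP m) as (k & Hk & Pk). eauto. Qed.

(** A decreasing chain of infinite sets of indices, each deciding one more property. *)
Fixpoint refine (A : nat -> nat -> Prop) (j : nat) : nat -> Prop :=
  match j with
  | O => fun _ => True
  | S j => fun k => refine A j k /\
      (if excluded_middle_informative (often (fun k => refine A j k /\ A j k))
       then A j k else ~ A j k)
  end.

Lemma refine_often A j : often (refine A j).
Proof.
induction j as [|j IH]; simpl.
- intros m. exists m. auto.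
- destruct (excluded_middle_informative _) as [H|H]; [exact H|].
  apply often_split; assumption.
Qed.

Lemma refine_decr A i j k : (i <= j)%nat -> refine A j k -> refine A i k.
Proof. induction 1 as [|j Hj IH]; [auto|]. intros [H _]; auto. Qed.

Lemma diagonal (A : nat -> nat -> Prop) : exists phi : nat -> nat,
  (forall i, (i <= phi i)%nat) /\
  forall j, (forall i, (j < i)%nat -> A j (phi i)) \/ (forall i, (j < i)%nat -> ~ A j (phi i)).
Proof.
assert (H : forall i, exists k, (i <= k)%nat /\ refine A i k) by (intros i; apply refine_often).
destruct (choice _ H) as [phi Hphi]. exists phi. split; [intros i; apply Hphi|].
intros j.
assert (R : forall i, (j < i)%nat -> refine A (S j) (phi i)).
{ intros i Hi. apply (refine_decr A (S j) i); [lia|apply Hphi]. }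
simpl in R. destruct (excluded_middle_informative _) as [Hd|Hd];
  [left|right]; intros i Hi; apply R, Hi.
Qed.

Lemma not_often (P : nat -> Prop) : ~ often P -> exists m, forall k, (m <= k)%nat -> ~ P k.
Proof.
intros H. apply not_all_ex_not in H. destruct H as [m H]. exists m.
intros k Hk Pk. apply H. eauto.
Qed.

Lemma limit_of_no_oscillation (x : nat -> R) (B : R) :
  (forall i, Rabs (x i) <= B) ->
  (forall y z, y < z -> ~ (often (fun i => x i < y) /\ often (fun i => z < x i))) ->
  exists l : R, forall eps, 0 < eps -> exists m, forall i, (m <= i)%nat -> Rabs (x i - l) < eps.
Proof.
intros HB Hno.
destruct (completeness (fun y => often (fun i => y < x i))) as [l [Hub Hlub]].
- exists B. intros y Hy. destruct (Hy 0%nat) as (i & _ & Hi).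
  specialize (HB i). apply Rabs_le_between in HB. lra.
- exists (- B - 1). intros m. exists m. split; [lia|].
  specialize (HB m). apply Rabs_le_between in HB. lra.
- exists l. intros eps He.
  assert (H1 : ~ often (fun i => l + eps / 2 < x i)).
  { intros H. specialize (Hub _ H). lra. }
  assert (H2 : often (fun i => l - eps / 2 < x i)).
  { apply NNPP. intros H. enough (l <= l - eps / 2) by lra. apply Hlub. intros y Hy.
    apply Rnot_lt_le. intros Hlt. apply H. revert Hy. apply often_ext. intros; lra. }
  assert (H3 : ~ often (fun i => x i < l - eps * 3 / 4)).
  { intros H. apply (Hno (l - eps * 3 / 4) (l - eps / 2)); [lra|auto]. }
  destruct (not_often _ H1) as [m1 M1]. destruct (not_often _ H3) as [m3 M3].
  exists (max m1 m3). intros i Hi.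
  specialize (M1 i ltac:(lia)). specialize (M3 i ltac:(lia)). apply Rabs_def1; lra.
Qed.

Definition seq_lim (x : nat -> R) (l : R) : Prop :=
  forall eps, 0 < eps -> exists m, forall i, (m <= i)%nat -> Rabs (x i - l) < eps.

(** A diagonal argument decides, along one subsequence, all comparisons of values at
    rational points with rational numbers; equicontinuity then excludes oscillation at
    every point. *)
Lemma equilipschitz_extraction (v : nat -> R -> R) :
  (forall T, 0 <= T -> exists B L, forall k r s, 0 <= r <= T -> 0 <= s <= T ->
     Rabs (v k r) <= B /\ Rabs (v k r - v k s) <= L * Rabs (r - s)) ->
  exists phi : nat -> nat, (forall i, (i <= phi i)%nat) /\
    forall r, 0 <= r -> exists l, seq_lim (fun i => v (phi i) r) l.
Proof.
intros H.
destruct (diagonal (fun j k => v k (dense_fst j) <= dense_snd j)) as (phi & Hphi & Hdec).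
exists phi. split; [exact Hphi|]. intros r Hr.
destruct (H (r + 1)) as (B & L & HBL); [lra|].
apply (limit_of_no_oscillation _ B).
- intros i. destruct (HBL (phi i) r r); lra.
- intros y z Hyz [O1 O2].
  assert (HL : 0 <= L).
  { destruct (HBL 0%nat (r + 1) r) as [_ HL]; [lra|lra|].
    replace (r + 1 - r) with 1 in HL by ring. rewrite Rabs_R1 in HL.
    assert (P := Rabs_pos (v 0%nat (r + 1) - v 0%nat r)). lra. }
  set (eta := (z - y) / (4 * (L + 1))).
  assert (Heta : 0 < eta) by (unfold eta; pos).
  destruct (below3 1 eta ((z - y) / 4)) as (e & He & He1 & He2 & He3); [lra|lra|lra|].
  destruct (dense_pairs r ((y + z) / 2) e Hr He) as (j & Hj0 & Hj1 & Hj2).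
  assert (Hclose : forall k, Rabs (v k (dense_fst j) - v k r) < (z - y) / 4).
  { intros k. destruct (HBL k (dense_fst j) r) as [_ HL2].
    - apply Rabs_def2 in Hj1. lra.
    - lra.
    - apply Rle_lt_trans with (1 := HL2).
      apply Rle_lt_trans with (L * eta).
      + apply Rmult_le_compat_l; lra.
      + apply Rlt_le_trans with ((L + 1) * eta); [lra|].
        unfold eta; right; field; lra. }
  apply Rabs_def2 in Hj2.
  destruct (Hdec j) as [D|D].
  + destruct (O2 (S j)) as (i & Hi & Hz). specialize (D i Hi).
    specialize (Hclose (phi i)). apply Rabs_def2 in Hclose. lra.
  + destruct (O1 (S j)) as (i & Hi & Hz). specialize (D i Hi).
    specialize (Hclose (phi i)). apply Rabs_def2 in Hclose. lra.
Qed.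

Lemma equilipschitz_uniform (v : nat -> R -> R) (u : R -> R) (L T : R) :
  0 <= L -> 0 <= T ->
  (forall k r s, 0 <= r <= T -> 0 <= s <= T -> Rabs (v k r - v k s) <= L * Rabs (r - s)) ->
  (forall r s, 0 <= r <= T -> 0 <= s <= T -> Rabs (u r - u s) <= L * Rabs (r - s)) ->
  (forall r, 0 <= r <= T -> seq_lim (fun i => v i r) (u r)) ->
  forall eps, 0 < eps -> exists m, forall i, (m <= i)%nat ->
    forall r, 0 <= r <= T -> Rabs (v i r - u r) < eps.
Proof.
intros HL HT Hv Hu Hlim eps He.
set (h := eps / (4 * (L + 1))).
assert (Hh : 0 < h) by (unfold h; pos).
assert (HLh : L * h <= eps / 4).
{ apply Rle_trans with ((L + 1) * h); [nra|]. unfold h; right; field; lra. }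
assert (Hgrid : forall N : nat, exists m, forall i, (m <= i)%nat ->
  forall j, (j <= N)%nat -> INR j * h <= T -> Rabs (v i (INR j * h) - u (INR j * h)) < eps / 4).
{ induction N as [|N [m IH]].
  - destruct (Hlim 0 ltac:(lra) (eps / 4)) as [m Hm]; [lra|]. exists m. intros i Hi j Hj _.
    replace j with 0%nat by lia. simpl. rewrite Rmult_0_l. apply Hm, Hi.
  - destruct (Rle_dec (INR (S N) * h) T) as [Hle|Hle].
    + destruct (Hlim (INR (S N) * h)) with (eps := eps / 4) as [m' Hm'].
      * split; [pos|exact Hle].
      * lra.
      * exists (max m m'). intros i Hi j Hj HjT. destruct (Nat.eq_dec j (S N)) as [->|Hne].
        -- apply Hm'; lia.
        -- apply IH; [lia|lia|exact HjT].
    + exists m. intros i Hi j Hj HjT. destruct (Nat.eq_dec j (S N)) as [->|Hne]; [lra|].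
      apply IH; [lia|lia|exact HjT]. }
destruct (nfloor_ex (T / h)) as (N & HN1 & HN2).
{ pos. }
destruct (Hgrid N) as [m Hm]. exists m. intros i Hi r Hr.
destruct (nfloor_ex (r / h)) as (j & Hj1 & Hj2).
{ pos. }
assert (Hr' : r = r / h * h) by (field; lra).
assert (HjN : (j <= N)%nat).
{ apply INR_le. assert (r / h <= T / h) by (apply Rmult_le_compat_r; [left; apply Rinv_0_lt_compat, Hh|lra]).
  assert (INR j < INR N + 1) by lra. rewrite <- S_INR in H0. apply INR_lt in H0.
  apply le_INR. lia. }
assert (Hjr : 0 <= INR j * h <= r).
{ split; [pos|]. rewrite Hr'. apply Rmult_le_compat_r; lra. }
assert (Hrj : Rabs (r - INR j * h) <= h).
{ rewrite Rabs_pos_eq by lra. rewrite Hr'. nra. }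
assert (A := Hm i Hi j HjN ltac:(lra)).
assert (B := Hv i r (INR j * h) ltac:(lra) ltac:(lra)).
assert (C := Hu r (INR j * h) ltac:(lra) ltac:(lra)).
assert (L * Rabs (r - INR j * h) <= eps / 4) by (apply Rle_trans with (2 := HLh); apply Rmult_le_compat_l; lra).
apply Rabs_def2 in A.
assert (B' := Rle_trans _ _ _ B H). assert (C' := Rle_trans _ _ _ C H).
apply Rabs_le_between in B', C'. apply Rabs_def1; lra.
Qed.

(** * Existence of radial solutions *)

Lemma RInt_derive0 (f : R -> R) (r : R) :
  (forall x, continuous f x) -> is_derive (fun r => RInt f 0 r) r (f r).
Proof. intros Hf. exact (Fint_derive f r Hf). Qed.

Section existence.

Variables (n : nat) (g : R -> R) (M a : R).
Hypothesis Hg : forall x, continuous g x.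
Hypothesis HM : forall x, Rabs (g x) <= M.

(** Integrating [(r^n w)' = - r^n g(u)] twice turns the equation into [u = place u]. *)
Definition flux (v : R -> R) (r : R) : R := RInt (fun s => s ^ n * g (v s)) 0 r.
Definition vel (v : R -> R) (r : R) : R := if Rle_dec r 0 then 0 else - flux v r / r ^ n.
Definition place (v : R -> R) (r : R) : R := a + RInt (vel v) 0 r.

Lemma M_nonneg : 0 <= M.
Proof. apply Rle_trans with (2 := HM 0), Rabs_pos. Qed.

Section one_step.

Variable v : R -> R.
Hypothesis Hv : forall x, continuous v x.

Lemma integrand_cont x : continuous (fun s => s ^ n * g (v s)) x.
Proof. apply cR_mult; [apply cR_pow|apply (continuous_comp v g); auto]. Qed.

Lemma flux_derive r : is_derive (flux v) r (r ^ n * g (v r)).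
Proof. apply (RInt_derive0 (fun s => s ^ n * g (v s))), integrand_cont. Qed.

Lemma vel_pos r : 0 < r -> vel v r = - flux v r / r ^ n.
Proof. intros Hr. unfold vel. destruct (Rle_dec r 0); [lra|reflexivity]. Qed.

Lemma vel_nonpos r : r <= 0 -> vel v r = 0.
Proof. intros Hr. unfold vel. destruct (Rle_dec r 0); [reflexivity|lra]. Qed.

Lemma vel_bound r : 0 <= r -> Rabs (vel v r) <= M * r.
Proof.
intros Hr. destruct (Req_dec r 0) as [->|Hr0].
{ rewrite vel_nonpos, Rabs_R0; lra. }
rewrite vel_pos by lra.
assert (Hp : 0 < r ^ n) by (apply pow_lt; lra).
unfold Rdiv. rewrite Rabs_mult, Rabs_Ropp, (Rabs_pos_eq (/ r ^ n))
  by (left; apply Rinv_0_lt_compat, Hp).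
apply Rmult_le_reg_r with (r ^ n); [exact Hp|].
rewrite Rmult_assoc, Rinv_l, Rmult_1_r by lra.
apply Rle_trans with ((r - 0) * (r ^ n * M)); [|right; ring].
apply abs_RInt_le_const; [lra| |].
- apply (ex_RInt_continuous (fun s => s ^ n * g (v s))). intros; apply integrand_cont.
- intros t Ht. rewrite Rabs_mult.
  assert (0 <= t ^ n <= r ^ n) by (split; [apply pow_le; lra|apply pow_incr; lra]).
  rewrite (Rabs_pos_eq (t ^ n)) by lra.
  apply Rmult_le_compat; [lra|apply Rabs_pos|lra|apply HM].
Qed.

Lemma vel_derive r : 0 < r -> is_derive (vel v) r (- (INR n / r) * vel v r - g (v r)).
Proof.
intros Hr. rewrite vel_pos by exact Hr.
apply (is_derive_ext_loc (fun r => - flux v r / r ^ n)).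
{ exists (mkposreal r Hr). intros y Hy. assert (Hy' : Rabs (y - r) < r) by exact Hy.
  apply Rabs_def2 in Hy'. symmetry. apply vel_pos. lra. }
assert (Hp : 0 < r ^ n) by (apply pow_lt; lra).
eapply is_derive_eq.
{ apply (is_derive_div (fun r => - flux v r) (fun r => r ^ n)).
  - apply dR_opp, flux_derive.
  - apply dR_pow.
  - lra. }
destruct n as [|m].
- simpl. field. lra.
- cbn [pred]. rewrite <- !tech_pow_Rmult in *.
  assert (0 < r ^ m) by (apply pow_lt; lra). field. lra.
Qed.

Lemma vel_cont r : continuous (vel v) r.
Proof.
destruct (Rtotal_order r 0) as [Hr|[->|Hr]].
- apply (continuous_ext_loc _ (fun _ => 0)); [|apply continuous_const].
  assert (Hr' : 0 < - r) by lra. exists (mkposreal _ Hr'). intros y Hy.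
  assert (Hy' : Rabs (y - r) < - r) by exact Hy. apply Rabs_def2 in Hy'.
  symmetry. apply vel_nonpos. lra.
- apply eps_continuous. intros eps He. assert (M0 := M_nonneg).
  exists (eps / (M + 1)). split; [apply Rdiv_lt_0_compat; lra|]. intros y Hy.
  rewrite (vel_nonpos 0), Rminus_0_r by lra.
  destruct (Rle_dec y 0) as [Hy0|Hy0]; [rewrite vel_nonpos, Rabs_R0 by lra; exact He|].
  apply Rle_lt_trans with (M * y); [apply vel_bound; lra|].
  rewrite Rminus_0_r, Rabs_pos_eq in Hy by lra.
  apply Rle_lt_trans with ((M + 1) * y); [nra|].
  apply Rlt_le_trans with ((M + 1) * (eps / (M + 1))); [|right; field; lra].
  apply Rmult_lt_compat_l; lra.
- apply (is_derive_cont _ _ _ (vel_derive r Hr)).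
Qed.

Lemma place_derive r : is_derive (place v) r (vel v r).
Proof.
eapply is_derive_eq.
{ apply (dR_plus (fun _ => a)); [apply dR_const|apply RInt_derive0, vel_cont]. }
ring.
Qed.

Lemma place_cont r : continuous (place v) r.
Proof. apply (is_derive_cont _ _ _ (place_derive r)). Qed.

Lemma place_nonpos r : r <= 0 -> place v r = a.
Proof.
intros Hr. unfold place. rewrite (RInt_ext _ (fun _ => 0)).
- rewrite RInt_const. unfold scal; simpl; unfold mult; simpl. ring.
- intros x. rewrite Rmin_right, Rmax_left by lra. intros Hx. apply vel_nonpos. lra.
Qed.

Lemma place_lip T r s : 0 <= r <= T -> 0 <= s <= T ->
  Rabs (place v r - place v s) <= M * T * Rabs (r - s).
Proof.
assert (H : forall x y, 0 <= x -> x < y -> y <= T ->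
  Rabs (place v y - place v x) <= M * T * Rabs (y - x)).
{ intros x y H0 H1 H2. destruct (mean_value (place v) (vel v) x y H1) as (c & Hc & ->).
  - intros; apply place_derive.
  - rewrite Rabs_mult. apply Rmult_le_compat_r; [apply Rabs_pos|].
    apply Rle_trans with (M * c); [apply vel_bound; lra|].
    apply Rmult_le_compat_l; [apply M_nonneg|lra]. }
intros Hr Hs. destruct (Rtotal_order r s) as [Hlt|[->|Hlt]].
- rewrite Rabs_minus_sym, (Rabs_minus_sym r). apply H; lra.
- rewrite !Rminus_diag, Rabs_R0. lra.
- apply H; lra.
Qed.

End one_step.

Lemma place_ext v1 v2 r : (forall s, s <= r -> v1 s = v2 s) -> place v1 r = place v2 r.
Proof.
intros H. destruct (Rle_dec r 0) as [Hr|Hr].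
- unfold place. f_equal. apply RInt_ext. intros x.
  rewrite Rmin_right, Rmax_left by lra. intros Hx. unfold vel.
  destruct (Rle_dec x 0); [reflexivity|lra].
- unfold place. f_equal. apply RInt_ext. intros x. rewrite Rmin_left, Rmax_right by lra.
  intros Hx. unfold vel. destruct (Rle_dec x 0); [reflexivity|].
  f_equal. f_equal. unfold flux. apply RInt_ext. intros y.
  rewrite Rmin_left, Rmax_right by lra. intros Hy. rewrite H; [reflexivity|lra].
Qed.

(** Stability of the integral operator: the integrands are compared through [g], hence
    uniform closeness of [g o v1] and [g o v2] suffices. *)
Lemma place_stable v1 v2 T e : (forall x, continuous v1 x) -> (forall x, continuous v2 x) ->
  0 <= e -> (forall s, 0 <= s <= T -> Rabs (g (v1 s) - g (v2 s)) <= e) ->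
  forall r, 0 <= r <= T -> Rabs (place v1 r - place v2 r) <= e * T * T.
Proof.
intros H1 H2 He Hclose r Hr.
assert (Hfl : forall s, 0 <= s <= T -> Rabs (flux v1 s - flux v2 s) <= s * (s ^ n * e)).
{ intros s Hs. unfold flux.
  rewrite <- (RInt_minus (V := R_CompleteNormedModule));
    try (apply (ex_RInt_continuous (V := R_CompleteNormedModule)); intros; apply integrand_cont; assumption).
  apply Rle_trans with ((s - 0) * (s ^ n * e)); [|right; ring].
  apply abs_RInt_le_const; [lra| |].
  - apply (ex_RInt_continuous (V := R_CompleteNormedModule)). intros.
    apply cR_minus; apply integrand_cont; assumption.
  - intros t Ht. unfold minus, plus, opp; simpl.
    replace (t ^ n * g (v1 t) + - (t ^ n * g (v2 t))) with (t ^ n * (g (v1 t) - g (v2 t))) by ring.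
    rewrite Rabs_mult.
    assert (0 <= t ^ n <= s ^ n) by (split; [apply pow_le; lra|apply pow_incr; lra]).
    rewrite (Rabs_pos_eq (t ^ n)) by lra.
    apply Rmult_le_compat; [lra|apply Rabs_pos|lra|apply Hclose; lra]. }
assert (Hvel : forall s, 0 <= s <= T -> Rabs (vel v1 s - vel v2 s) <= e * T).
{ intros s Hs. destruct (Req_dec s 0) as [->|Hs0].
  - rewrite !vel_nonpos, Rminus_diag, Rabs_R0 by lra. nra.
  - rewrite !vel_pos by lra. assert (Hp : 0 < s ^ n) by (apply pow_lt; lra).
    replace (- flux v1 s / s ^ n - - flux v2 s / s ^ n)
      with (- (flux v1 s - flux v2 s) / s ^ n) by (field; lra).
    unfold Rdiv. rewrite Rabs_mult, Rabs_Ropp, (Rabs_pos_eq (/ s ^ n))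
      by (left; apply Rinv_0_lt_compat, Hp).
    apply Rmult_le_reg_r with (s ^ n); [exact Hp|].
    rewrite Rmult_assoc, Rinv_l, Rmult_1_r by lra.
    apply Rle_trans with (1 := Hfl s Hs).
    replace (s * (s ^ n * e)) with (e * s * s ^ n) by ring.
    apply Rmult_le_compat_r; [lra|]. apply Rmult_le_compat_l; lra. }
unfold place.
replace (a + RInt (vel v1) 0 r - (a + RInt (vel v2) 0 r))
  with (RInt (vel v1) 0 r - RInt (vel v2) 0 r) by ring.
assert (Hex : forall v, (forall x, continuous v x) -> ex_RInt (vel v) 0 r).
{ intros v Hv. apply (ex_RInt_continuous (V := R_CompleteNormedModule)).
  intros; apply vel_cont, Hv. }
rewrite <- (RInt_minus (V := R_CompleteNormedModule)) by (apply Hex; assumption).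
apply Rle_trans with ((r - 0) * (e * T)).
- apply abs_RInt_le_const; [lra| |].
  + apply (ex_RInt_minus (V := R_NormedModule)); apply Hex; assumption.
  + intros t Ht. apply Hvel. lra.
- replace (e * T * T) with (T * (e * T)) by ring. apply Rmult_le_compat_r; nra.
Qed.

(** Approximate solutions: with a delay [d] in the nonlinearity each iteration extends the
    interval on which the next one changes nothing. *)
Fixpoint delayed (d : R) (m : nat) : R -> R :=
  match m with
  | O => fun _ => a
  | S m => place (fun s => delayed d m (s - d))
  end.

Lemma shift_cont (v : R -> R) (d x : R) :
  (forall x, continuous v x) -> continuous (fun s => v (s - d)) x.
Proof.
intros Hv. apply (continuous_comp (fun s => s - d) v); [|apply Hv].
apply cR_minus; [apply continuous_id|apply continuous_const].
Qed.

Lemma delayed_cont d m x : continuous (delayed d m) x.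
Proof.
revert x. induction m as [|m IH]; intros x; simpl.
- apply continuous_const.
- apply place_cont. intros y. apply shift_cont, IH.
Qed.

Lemma delayed_stationary d m r : r <= INR m * d -> delayed d (S m) r = delayed d m r.
Proof.
revert r. induction m as [|m IH]; intros r Hr.
- simpl. apply place_nonpos. simpl in Hr. lra.
- change (delayed d (S (S m)) r) with (place (fun s => delayed d (S m) (s - d)) r).
  change (delayed d (S m) r) with (place (fun s => delayed d m (s - d)) r).
  apply place_ext. intros s Hs. apply IH. rewrite S_INR in Hr. lra.
Qed.

Definition approx (k : nat) : R -> R := delayed (/ INR (S k)) (S (S k * S k)).

Lemma approx_cont k x : continuous (approx k) x.
Proof. apply delayed_cont. Qed.

Lemma approx_lip T k r s : 0 <= r <= T -> 0 <= s <= T ->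
  Rabs (approx k r - approx k s) <= M * T * Rabs (r - s).
Proof. intros Hr Hs. apply place_lip; auto. intros x. apply shift_cont, delayed_cont. Qed.

Lemma approx_nonpos k r : r <= 0 -> approx k r = a.
Proof. intros Hr. apply place_nonpos. exact Hr. Qed.

Lemma approx_eq k r : r <= INR (S k) ->
  approx k r = place (fun s => approx k (s - / INR (S k))) r.
Proof.
intros Hr. unfold approx at 1. 
change (delayed (/ INR (S k)) (S (S k * S k)) r)
  with (place (fun s => delayed (/ INR (S k)) (S k * S k) (s - / INR (S k))) r).
apply place_ext. intros s Hs. symmetry. apply delayed_stationary.
assert (P : 0 < INR (S k)) by (apply lt_0_INR; lia).
assert (0 < / INR (S k)) by (apply Rinv_0_lt_compat, P).
rewrite mult_INR, Rmult_assoc, Rinv_r, Rmult_1_r; lra.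
Qed.

Lemma seq_lim_abs (x : nat -> R) (l c B : R) :
  seq_lim x l -> (forall i, Rabs (x i - c) <= B) -> Rabs (l - c) <= B.
Proof.
intros Hx HB. apply Rnot_lt_le. intros Hlt.
destruct (Hx (Rabs (l - c) - B)) as [m Hm]; [lra|].
specialize (Hm m (le_n m)). specialize (HB m).
assert (Rabs (l - c) <= Rabs (x m - l) + Rabs (x m - c)).
{ replace (l - c) with ((x m - c) - (x m - l)) by ring.
  eapply Rle_trans; [apply Rabs_triang|]. rewrite Rabs_Ropp. lra. }
lra.
Qed.

Lemma seq_lim_unique (x : nat -> R) (l1 l2 : R) : seq_lim x l1 -> seq_lim x l2 -> l1 = l2.
Proof.
intros H1 H2. apply NNPP. intros Hne.
assert (P : 0 < Rabs (l1 - l2)) by (apply Rabs_pos_lt; lra).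
destruct (H1 (Rabs (l1 - l2) / 2)) as [m1 M1]; [lra|].
destruct (H2 (Rabs (l1 - l2) / 2)) as [m2 M2]; [lra|].
specialize (M1 (max m1 m2) ltac:(lia)). specialize (M2 (max m1 m2) ltac:(lia)).
assert (Rabs (l1 - l2) <= Rabs (x (max m1 m2) - l2) + Rabs (x (max m1 m2) - l1)).
{ replace (l1 - l2) with ((x (max m1 m2) - l2) - (x (max m1 m2) - l1)) by ring.
  eapply Rle_trans; [apply Rabs_triang|]. rewrite Rabs_Ropp. lra. }
lra.
Qed.

Lemma seq_lim_lip (x y : nat -> R) (l m B : R) :
  seq_lim x l -> seq_lim y m -> (forall i, Rabs (x i - y i) <= B) -> Rabs (l - m) <= B.
Proof.
intros Hx Hy HB.
assert (Hd : seq_lim (fun i => x i - y i) (l - m)).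
{ intros eps He. destruct (Hx (eps / 2)) as [m1 M1]; [lra|].
  destruct (Hy (eps / 2)) as [m2 M2]; [lra|]. exists (max m1 m2). intros i Hi.
  specialize (M1 i ltac:(lia)). specialize (M2 i ltac:(lia)).
  apply Rabs_def2 in M1, M2. apply Rabs_def1; lra. }
rewrite <- (Rminus_0_r (l - m)). apply (seq_lim_abs _ _ 0 B Hd).
intros i. rewrite Rminus_0_r. apply HB.
Qed.

(** The approximations are equilipschitz because [g] is bounded, so a subsequence converges
    locally uniformly, and the delay disappears in the limit. *)
Theorem sol_exists : exists u w, sol n g a u w.
Proof.
assert (M0 := M_nonneg).
destruct (equilipschitz_extraction approx) as (phi & Hphi & Hlim).
{ intros T HT. exists (Rabs a + M * T * T), (M * T). intros k r s Hr Hs. split.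
  - replace (approx k r) with (a + (approx k r - approx k 0)).
    + eapply Rle_trans; [apply Rabs_triang|]. apply Rplus_le_compat_l.
      eapply Rle_trans; [apply (approx_lip T); lra|].
      apply Rmult_le_compat_l; [nra|]. rewrite Rminus_0_r, Rabs_pos_eq; lra.
    + rewrite (approx_nonpos k 0) by lra. ring.
  - apply approx_lip; assumption. }
assert (Hl : forall r, exists l, seq_lim (fun i => approx (phi i) r) l).
{ intros r. destruct (Rle_dec 0 r) as [Hr|Hr]; [apply Hlim, Hr|].
  exists a. intros eps He. exists 0%nat. intros i _.
  rewrite approx_nonpos, Rminus_diag, Rabs_R0; lra. }
destruct (choice _ Hl) as [u0 Hu0].
assert (Hneg : forall r, r <= 0 -> u0 r = a).
{ intros r Hr. apply (seq_lim_unique _ _ _ (Hu0 r)). intros eps He. exists 0%nat.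
  intros i _. rewrite approx_nonpos, Rminus_diag, Rabs_R0; lra. }
assert (Hlip : forall T r s, 0 <= r <= T -> 0 <= s <= T ->
  Rabs (u0 r - u0 s) <= M * T * Rabs (r - s)).
{ intros T r s Hr Hs. apply (seq_lim_lip _ _ _ _ _ (Hu0 r) (Hu0 s)).
  intros i. apply approx_lip; assumption. }
assert (Hc : forall r, continuous u0 r).
{ intros r. destruct (Rlt_dec r 0) as [Hr|Hr].
  - apply (continuous_ext_loc _ (fun _ => a)); [|apply continuous_const].
    assert (Hr' : 0 < - r) by lra. exists (mkposreal _ Hr'). intros y Hy.
    assert (Hy' : Rabs (y - r) < - r) by exact Hy. apply Rabs_def2 in Hy'.
    symmetry. apply Hneg. lra.
  - apply eps_continuous. intros eps He.
    set (L := M * (r + 1) + 1). assert (HL : 0 < L) by (unfold L; nra).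
    exists (Rmin 1 (eps / L)). split; [apply Rmin_pos; [lra|apply Rdiv_lt_0_compat; lra]|].
    intros y Hy.
    assert (Hy1 : Rabs (y - r) < 1) by (apply Rlt_le_trans with (1 := Hy), Rmin_l).
    assert (Hy2 : Rabs (y - r) < eps / L) by (apply Rlt_le_trans with (1 := Hy), Rmin_r).
    assert (Hy3 : L * Rabs (y - r) < eps).
    { apply Rlt_le_trans with (L * (eps / L)); [apply Rmult_lt_compat_l; lra|right; field; lra]. }
    apply Rabs_def2 in Hy1. assert (P := Rabs_pos (y - r)).
    destruct (Rle_dec 0 y) as [Hy0|Hy0].
    + apply Rle_lt_trans with (M * (r + 1) * Rabs (y - r)); [apply Hlip; lra|].
      unfold L in Hy3. lra.
    + rewrite (Hneg y), <- (Hneg 0) by lra.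
      apply Rle_lt_trans with (M * (r + 1) * Rabs (0 - r)); [apply Hlip; lra|].
      assert (Rabs (0 - r) <= Rabs (y - r)) by (rewrite !Rabs_left1; lra).
      apply Rle_lt_trans with (M * (r + 1) * Rabs (y - r)); [apply Rmult_le_compat_l; nra|].
      unfold L in Hy3. lra. }
assert (Hfix : forall r, u0 r = place u0 r).
{ intros r. destruct (Rle_dec r 0) as [Hr|Hr]; [rewrite Hneg, place_nonpos; lra|].
  apply (seq_lim_unique _ _ _ (Hu0 r)). intros eps He.
  set (T := r + 1). assert (HT : 1 < T) by (unfold T; lra). assert (HrT : r <= T) by (unfold T; lra).
  set (B := Rabs a + M * T * T + 1).
  set (e := eps / (2 * T * T)). assert (He0 : 0 < e) by (unfold e; apply Rdiv_lt_0_compat; nra).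
  destruct (Heine_cor2 (f := g) (a := - B) (b := B)) with (eps := mkposreal e He0) as [[dl Hdl0] Hdl].
  { intros x _. apply continuous_ptR, Hg. }
  simpl in Hdl.
  destruct (equilipschitz_uniform (fun i => approx (phi i)) u0 (M * T) T) with (eps := dl / 2) as [m1 Hm1].
  { nra. } { lra. } { intros; apply approx_lip; assumption. } { intros; apply Hlip; assumption. }
  { intros x _. apply Hu0. } { lra. }
  destruct (nfloor_ex (T + 2 * (M * T + 1) / dl)) as (m2 & _ & Hm2).
  { assert (0 < 2 * (M * T + 1) / dl) by (apply Rdiv_lt_0_compat; nra). lra. }
  assert (Hq : 0 < 2 * (M * T + 1) / dl) by (apply Rdiv_lt_0_compat; nra).
  exists (max m1 m2). intros i Hi.
  assert (Hphi2 : INR m2 <= INR (phi i)) by (apply le_INR; specialize (Hphi i); lia).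
  assert (HSk : INR (S (phi i)) = INR (phi i) + 1) by apply S_INR.
  set (d := / INR (S (phi i))).
  assert (HSp : 0 < INR (S (phi i))) by lra.
  assert (Hd : 0 < d) by pos.
  assert (HdM : M * T * d <= dl / 2).
  { apply Rle_trans with ((M * T + 1) * d); [nra|].
    apply Rmult_le_reg_r with (INR (S (phi i))); [lra|].
    unfold d. rewrite Rmult_assoc, Rinv_l, Rmult_1_r by lra.
    apply Rmult_le_reg_l with (2 / dl); [pos|].
    replace (2 / dl * (dl / 2 * INR (S (phi i)))) with (INR (S (phi i))) by (field; lra).
    replace (2 / dl * (M * T + 1)) with (2 * (M * T + 1) / dl) by (field; lra). lra. }
  rewrite approx_eq by lra. fold d.
  apply Rle_lt_trans with (e * T * T).
  - apply (place_stable _ _ T); [intros x; apply shift_cont, approx_cont|exact Hc|lra| |unfold T; lra].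
    intros s Hs.
    assert (Bu : forall y, 0 <= y <= T -> Rabs (u0 y - a) <= M * T * T).
    { intros y Hy. rewrite <- (Hneg 0) at 1 by lra.
      eapply Rle_trans; [apply (Hlip T); lra|]. apply Rmult_le_compat_l; [nra|].
      rewrite Rminus_0_r, Rabs_pos_eq; lra. }
    assert (Ba : forall k y, y <= T -> Rabs (approx k y - a) <= M * T * T).
    { intros k y Hy. destruct (Rle_dec y 0).
      - rewrite approx_nonpos, Rminus_diag, Rabs_R0; [nra|lra].
      - rewrite <- (approx_nonpos k 0) at 1 by lra.
        eapply Rle_trans; [apply (approx_lip T); lra|]. apply Rmult_le_compat_l; [nra|].
        rewrite Rminus_0_r, Rabs_pos_eq; lra. }
    assert (Hin : forall x, Rabs (x - a) <= M * T * T -> - B <= x <= B).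
    { intros x Hx. apply Rabs_le_between in Hx. unfold B.
      assert (Q := Rle_abs a).
      assert (Q2 := Rle_abs (- a)). rewrite Rabs_Ropp in Q2. lra. }
    left. apply Hdl.
    + apply Hin, Ba. lra.
    + apply Hin, Bu, Hs.
    + assert (E1 : Rabs (approx (phi i) (s - d) - approx (phi i) s) <= dl / 2).
      { destruct (Rle_dec 0 (s - d)) as [Hsd|Hsd].
        - eapply Rle_trans; [apply (approx_lip T); lra|].
          replace (s - d - s) with (- d) by ring. rewrite Rabs_Ropp, Rabs_pos_eq by lra. lra.
        - rewrite (approx_nonpos _ (s - d)), <- (approx_nonpos (phi i) 0) by lra.
          eapply Rle_trans; [apply (approx_lip T); lra|].
          rewrite Rminus_0_l, Rabs_Ropp, Rabs_pos_eq by lra. nra. }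
      assert (E2 := Hm1 i ltac:(lia) s Hs).
      apply Rabs_le_between in E1. apply Rabs_def2 in E2. apply Rabs_def1; lra.
  - unfold e. replace (eps / (2 * T * T) * T * T) with (eps / 2) by (field; lra). lra. }
exists (place u0), (vel u0). split.
- intros r Hr. split; [apply place_nonpos, Hr|apply vel_nonpos, Hr].
- intros r. apply place_derive, Hc.
- intros r. apply vel_cont, Hc.
- intros r Hr. rewrite <- Hfix. apply vel_derive; [exact Hc|exact Hr].
Qed.

End existence.

(** * Counting sign changes *)

(** The solution that stays at rest once it has reached [u = w = 0]; this selects one
    continuation where uniqueness may fail. *)
Definition rests (u w : R -> R) : Prop :=
  forall r1, u r1 = 0 -> w r1 = 0 -> forall r, r1 <= r -> u r = 0.

Lemma glue_derive (f h : R -> R) (x l : R) :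
  is_derive f x l -> is_derive h x l -> f x = h x ->
  is_derive (fun r => if Rle_dec r x then f r else h r) x l.
Proof.
intros Hf Hh E. apply is_derive_Reals. apply is_derive_Reals in Hf, Hh.
intros eps He. destruct (Hf eps He) as [d1 D1]. destruct (Hh eps He) as [d2 D2].
assert (Hd : 0 < Rmin d1 d2) by (apply Rmin_pos; apply cond_pos).
exists (mkposreal _ Hd). intros k Hk Hk'. simpl in Hk'.
destruct (Rle_dec x x) as [_|]; [|lra].
destruct (Rle_dec (x + k) x) as [H|H].
- apply D1; [exact Hk|]. apply Rlt_le_trans with (1 := Hk'), Rmin_l.
- rewrite E. apply D2; [exact Hk|]. apply Rlt_le_trans with (1 := Hk'), Rmin_r.
Qed.

Lemma first_double_zero (u w : R -> R) (T : R) :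
  (forall r, continuous u r) -> (forall r, continuous w r) -> 0 <= T ->
  u T = 0 -> w T = 0 ->
  exists t, 0 <= t <= T /\ (u t = 0 /\ w t = 0) /\
    forall s, 0 <= s < t -> ~ (u s = 0 /\ w s = 0).
Proof.
intros Hu Hw HT Eu Ew. apply (first_time (fun r => u r = 0 /\ w r = 0)); [exact HT|auto|].
intros x Hx Hn. destruct (Req_dec (u x) 0) as [E|E].
- assert (E' : w x <> 0) by tauto.
  destruct (continuous_eps w x (Hw x) (Rabs (w x))) as (d & Hd & Hy); [apply Rabs_pos_lt, E'|].
  exists d; split; [exact Hd|]. intros y _ Hy1 [_ Hy2]. specialize (Hy y Hy1).
  rewrite Hy2, Rminus_0_l, Rabs_Ropp in Hy. lra.
- destruct (continuous_eps u x (Hu x) (Rabs (u x))) as (d & Hd & Hy); [apply Rabs_pos_lt, E|].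
  exists d; split; [exact Hd|]. intros y _ Hy1 [Hy2 _]. specialize (Hy y Hy1).
  rewrite Hy2, Rminus_0_l, Rabs_Ropp in Hy. lra.
Qed.

(** The solution may be replaced by [0] after its first double zero, as [g 0 = 0]. *)
Lemma sol_rests n g a u w : a <> 0 -> g 0 = 0 -> sol n g a u w ->
  exists u' w', sol n g a u' w' /\ rests u' w'.
Proof.
intros Ha Hg0 S.
destruct (classic (exists r, u r = 0 /\ w r = 0)) as [(r0 & E1 & E2)|Hno].
2: { exists u, w. split; [exact S|]. intros r1 H1 H2. exfalso; eauto. }
assert (Hr0 : 0 <= r0).
{ apply Rnot_lt_le. intros H. apply Ha. rewrite <- E1. symmetry.
  apply (sol_init S r0). lra. }
destruct (first_double_zero u w r0) as (t & Ht & [Et1 Et2] & Hfirst); auto.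
{ intros; apply (sol_cu S). } { apply (sol_cw S). }
assert (Ht0 : 0 < t).
{ destruct (proj1 Ht) as [H|H]; [exact H|]. exfalso. apply Ha. rewrite <- Et1. symmetry.
  apply (sol_init S t). lra. }
set (u' := fun r => if Rle_dec r t then u r else 0).
set (w' := fun r => if Rle_dec r t then w r else 0).
assert (Lu : forall r, r <= t -> u' r = u r) by (intros r Hr; unfold u'; destruct (Rle_dec r t); lra).
assert (Lw : forall r, r <= t -> w' r = w r) by (intros r Hr; unfold w'; destruct (Rle_dec r t); lra).
assert (Ru : forall r, t < r -> u' r = 0) by (intros r Hr; unfold u'; destruct (Rle_dec r t); lra).
assert (Rw : forall r, t < r -> w' r = 0) by (intros r Hr; unfold w'; destruct (Rle_dec r t); lra).
assert (Nl : forall (f f' : R -> R) r, r < t -> (forall s, s <= t -> f' s = f s) -> locally r (fun s => f s = f' s)).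
{ intros f f' r Hr Hf. assert (Hd : 0 < t - r) by lra. exists (mkposreal _ Hd). intros y Hy.
  assert (Hy' : Rabs (y - r) < t - r) by exact Hy. apply Rabs_def2 in Hy'. symmetry. apply Hf. lra. }
assert (Nr : forall (f' : R -> R) r, t < r -> (forall s, t < s -> f' s = 0) -> locally r (fun s => 0 = f' s)).
{ intros f' r Hr Hf. assert (Hd : 0 < r - t) by lra. exists (mkposreal _ Hd). intros y Hy.
  assert (Hy' : Rabs (y - r) < r - t) by exact Hy. apply Rabs_def2 in Hy'. symmetry. apply Hf. lra. }
assert (DW : forall r, 0 < r -> is_derive w' r (- (INR n / r) * w' r - g (u' r))).
{ intros r Hr. destruct (Rtotal_order r t) as [H|[->|H]].
  - rewrite Lu, Lw by lra. apply (is_derive_ext_loc w); [apply Nl; auto|apply (sol_dw S), Hr].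
  - rewrite Lu, Lw, Et1, Et2, Hg0 by lra. apply glue_derive; [|apply (is_derive_eq _ _ 0); [apply dR_const|ring]|lra].
    eapply is_derive_eq; [apply (sol_dw S t Ht0)|]. rewrite Et1, Et2, Hg0. ring.
  - rewrite Ru, Rw, Hg0 by lra. apply (is_derive_ext_loc (fun _ => 0)); [apply Nr; auto|].
    eapply is_derive_eq; [apply dR_const|ring]. }
exists u', w'. split.
- split.
  + intros r Hr. rewrite Lu, Lw by lra. apply (sol_init S r Hr).
  + intros r. destruct (Rtotal_order r t) as [H|[->|H]].
    * rewrite Lw by lra. apply (is_derive_ext_loc u); [apply Nl; auto|apply (sol_du S)].
    * rewrite Lw, Et2 by lra. apply glue_derive; [|apply dR_const|exact Et1].
      rewrite <- Et2. apply (sol_du S).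
    * rewrite Rw by lra. apply (is_derive_ext_loc (fun _ => 0)); [apply Nr; auto|apply dR_const].
  + intros r. destruct (Rlt_dec r t) as [H|H].
    * apply (continuous_ext_loc _ w); [|apply (sol_cw S)]. apply Nl; auto.
    * apply (is_derive_cont _ _ _ (DW r ltac:(lra))).
  + exact DW.
- intros r1 H1 H2 r Hr. destruct (Rlt_dec t r) as [H|H]; [apply Ru, H|].
  destruct (Req_dec r t) as [->|Hne]; [rewrite Lu; lra|].
  exfalso. rewrite Lu in H1 by lra. rewrite Lw in H2 by lra.
  destruct (Rle_dec 0 r1) as [H0|H0].
  + apply (Hfirst r1); [lra|auto].
  + apply Ha. rewrite <- H1. symmetry. apply (sol_init S r1). lra.
Qed.

(** [k] sign changes, the last one completed at [r]. *)
Inductive alt_end (v : R -> R) : nat -> R -> Prop :=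
| alt_end_O r : 0 < r -> alt_end v 0 r
| alt_end_S j r r' : alt_end v j r -> r < r' -> v r * v r' < 0 -> alt_end v (S j) r'.

Lemma alt_end_pos v j r : alt_end v j r -> 0 < r.
Proof. induction 1; lra. Qed.

Lemma alternates_alt_end v k : alternates v k <-> exists r, alt_end v k r.
Proof.
split.
- intros (t & Ht0 & Ht). exists (t k).
  assert (H : forall j, (j <= k)%nat -> alt_end v j (t j)).
  { induction j as [|j IH]; intros Hj; [constructor; exact Ht0|].
    destruct (Ht j ltac:(lia)) as [H1 H2].
    apply (alt_end_S v j (t j)); [apply IH; lia|exact H1|exact H2]. }
  apply H. lia.
- intros [r H].
  enough (H' : exists t : nat -> R, 0 < t O /\ t k = r /\
    forall i, (i < k)%nat -> t i < t (S i) /\ v (t i) * v (t (S i)) < 0)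
    by (destruct H' as (t & H1 & _ & H2); exists t; auto).
  induction H as [r Hr|j r r' Hj IH Hlt Hs].
  + exists (fun _ => r). split; [exact Hr|]. split; [reflexivity|]. intros i Hi; lia.
  + destruct IH as (t & H1 & H2 & H3).
    exists (fun i => if Nat.leb i j then t i else r'). split; [exact H1|]. split.
    * replace (Nat.leb (S j) j) with false by (symmetry; apply Nat.leb_gt; lia). reflexivity.
    * intros i Hi. replace (Nat.leb i j) with true by (symmetry; apply Nat.leb_le; lia).
      destruct (Nat.leb (S i) j) eqn:E.
      -- apply H3. apply Nat.leb_le in E. lia.
      -- apply Nat.leb_gt in E. replace i with j by lia. rewrite H2. auto.
Qed.

Lemma alternates_pred v k : alternates v (S k) -> alternates v k.
Proof. rewrite !alternates_alt_end. intros [r H]. inversion H; subst. eauto. Qed.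

Lemma alternates_le v i k : (i <= k)%nat -> alternates v k -> alternates v i.
Proof. induction 1 as [|k Hk IH]; [auto|]. intros H. apply IH, alternates_pred, H. Qed.

Lemma same_sign_trans x y z : 0 < x * y -> y * z < 0 -> x * z < 0.
Proof. intros H1 H2. destruct (Rlt_dec 0 y); nra. Qed.

Lemma same_sign_trans2 x y z : 0 < x * y -> 0 < y * z -> 0 < x * z.
Proof. intros H1 H2. destruct (Rlt_dec 0 y); nra. Qed.

Lemma alt_end_later v j r r' : alt_end v j r -> r <= r' -> 0 < v r * v r' -> alt_end v j r'.
Proof.
intros H Hr Hs. inversion H; subst.
- constructor. lra.
- apply (alt_end_S v _ r0); [assumption|lra|].
  rewrite Rmult_comm. apply (same_sign_trans _ (v r)); [lra|]. rewrite Rmult_comm. assumption.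
Qed.

Lemma alt_end_sooner v j r r' : alt_end v j r -> 0 < r' <= r ->
  (forall s, r' <= s <= r -> 0 < v s * v r) -> alt_end v j r'.
Proof.
intros H Hr Hs. inversion H; subst.
- constructor. lra.
- apply (alt_end_S v _ r0); [assumption| |].
  + apply Rnot_le_lt. intros Hle. specialize (Hs r0). lra.
  + rewrite Rmult_comm. apply (same_sign_trans _ (v r)); [apply Hs; lra|].
    rewrite Rmult_comm. assumption.
Qed.

Lemma alt_end_truncate v k r0 : 0 < r0 ->
  (forall s, r0 <= s -> 0 < v s * v r0) -> alternates v k ->
  exists j, (k <= j)%nat /\ alt_end v j r0.
Proof.
intros Hr0 Hs Hk. apply alternates_alt_end in Hk. destruct Hk as [r Hk].
assert (H00 : v r0 <> 0) by (specialize (Hs r0 (Rle_refl _)); nra).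
destruct (Rle_dec r0 r) as [Hle|Hlt].
- exists k. split; [lia|]. apply (alt_end_sooner v k r); [exact Hk|lra|].
  intros s Hs'. apply (same_sign_trans2 _ (v r0)); [apply Hs; lra|].
  rewrite Rmult_comm. apply Hs; lra.
- destruct (Rtotal_order (v r * v r0) 0) as [H|[H|H]].
  + exists (S k). split; [lia|]. apply (alt_end_S v k r); [exact Hk|lra|exact H].
  + assert (E : v r = 0) by nra.
    inversion Hk; subst.
    * exists 0%nat. split; [lia|constructor; lra].
    * rewrite E in H2. lra.
  + exists k. split; [lia|]. apply (alt_end_later v k r); [exact Hk|lra|exact H].
Qed.

Lemma const_sign (v : R -> R) (a b : R) : a <= b ->
  (forall s, a <= s <= b -> continuous v s) -> (forall s, a <= s <= b -> v s <> 0) ->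
  0 < v a * v b.
Proof.
intros Hab Hc Hn. assert (Ha := Hn a ltac:(lra)). assert (Hb := Hn b ltac:(lra)).
destruct (Rlt_dec 0 (v a * v b)) as [H|H]; [exact H|exfalso].
destruct (ivt v a b 0 Hab Hc) as (t & Ht & E).
- destruct (Rle_dec (v a) 0); [left|right]; nra.
- exact (Hn t Ht E).
Qed.

Section semicontinuity.

Variables (u w : R -> R) (T : R).
Hypothesis Hu : forall r, is_derive u r (w r).
Hypothesis Hw : forall r, continuous w r.

Definition count_stable (s : R) : Prop :=
  exists d, 0 < d /\ forall v z, (forall r, is_derive v r (z r)) ->
    close_on T d u w v z -> forall j, alt_end v j s -> alt_end u j s.

Lemma close_same_sign (x y d : R) : Rabs (y - x) < d -> d <= Rabs x -> 0 < x * y.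
Proof.
intros H1 H2. apply Rabs_def2 in H1. unfold Rabs in H2. destruct (Rcase_abs x); nra.
Qed.

Lemma abs_lower_bound (f : R -> R) (a b : R) : a <= b ->
  (forall s, a <= s <= b -> continuous f s) -> (forall s, a <= s <= b -> f s <> 0) ->
  exists m, 0 < m /\ forall s, a <= s <= b -> m <= Rabs (f s).
Proof.
intros Hab Hc Hn.
destruct (cont_min (fun s => Rabs (f s)) a b Hab) as (m & Hm & Hmin).
- intros s Hs. apply (continuous_comp f Rabs); [auto|apply continuous_Rabs].
- exists (Rabs (f m)). split; [apply Rabs_pos_lt, Hn, Hm|exact Hmin].
Qed.

Lemma count_stable_nonzero r s : 0 <= r <= s -> s <= T -> 0 < s ->
  (forall x, r <= x <= s -> u x <> 0) -> (0 < r -> count_stable r) -> count_stable s.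
Proof.
intros Hrs HsT Hs0 Hn Hr.
assert (Hcu : forall x, continuous u x) by (intros x; apply (is_derive_cont _ _ _ (Hu x))).
destruct (abs_lower_bound u r s) as (m & Hm & Hmin); [lra|intros; apply Hcu|exact Hn|].
assert (Hsgn : forall d v z, d <= m -> close_on T d u w v z ->
  forall x, r <= x <= s -> 0 < u x * v x).
{ intros d v z Hd Hcl x Hx. destruct (Hcl x ltac:(lra)) as [H1 _].
  apply (close_same_sign _ _ d H1). specialize (Hmin x Hx). lra. }
assert (Hus : forall x, r <= x <= s -> 0 < u x * u s).
{ intros x Hx. apply const_sign; [lra|intros; apply Hcu|intros; apply Hn; lra]. }
assert (Hvs : forall d v z, d <= m -> close_on T d u w v z ->
  forall x, r <= x <= s -> 0 < v x * v s).
{ intros d v z Hd Hcl x Hx.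
  assert (A := Hsgn d v z Hd Hcl x Hx). assert (B := Hsgn d v z Hd Hcl s ltac:(lra)).
  apply (same_sign_trans2 _ (u x)); [lra|]. apply (same_sign_trans2 _ (u s)); [apply Hus, Hx|exact B]. }
destruct (Req_dec r 0) as [E|E].
- exists m. split; [exact Hm|]. intros v z _ Hcl j Hj. inversion Hj; subst; [constructor; lra|].
  exfalso. assert (Q := alt_end_pos _ _ _ H).
  specialize (Hvs m v z (Rle_refl _) Hcl r0 ltac:(lra)). lra.
- destruct (Hr ltac:(lra)) as (d & Hd & Hst).
  exists (Rmin d m). split; [pos|]. intros v z Hv Hcl j Hj.
  apply (alt_end_later u j r); [|lra|apply Hus; lra].
  apply (Hst v z Hv).
  + intros x Hx. destruct (Hcl x Hx). assert (Q := Rmin_l d m). split; lra.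
  + apply (alt_end_sooner v j s); [exact Hj|lra|]. apply (Hvs (Rmin d m) v z); [apply Rmin_r|exact Hcl].
Qed.

Lemma monotone_same_sign (v z : R -> R) p q : p <= q -> (forall r, is_derive v r (z r)) ->
  ((forall r, p <= r <= q -> 0 < z r) \/ (forall r, p <= r <= q -> z r < 0)) ->
  0 < v p * v q -> forall s, p <= s <= q -> 0 < v s * v q.
Proof.
intros Hpq Hv Hz Hs s Hsp.
assert (Hc : forall r, continuous v r) by (intros r; apply (is_derive_cont _ _ _ (Hv r))).
destruct Hz as [Hz|Hz].
- assert (A : v p <= v s) by (apply (derive_nonneg v z); [lra|auto|auto|intros x Hx; left; apply Hz; lra]).
  assert (B : v s <= v q) by (apply (derive_nonneg v z); [lra|auto|auto|intros x Hx; left; apply Hz; lra]).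
  destruct (Rlt_dec 0 (v q)).
  + assert (0 < v p) by nra. apply Rmult_lt_0_compat; lra.
  + assert (v q < 0) by nra. assert (v s < 0) by lra. nra.
- assert (A : v s <= v p) by (apply (derive_nonpos v z); [lra|auto|auto|intros x Hx; left; apply Hz; lra]).
  assert (B : v q <= v s) by (apply (derive_nonpos v z); [lra|auto|auto|intros x Hx; left; apply Hz; lra]).
  destruct (Rlt_dec 0 (v q)).
  + apply Rmult_lt_0_compat; lra.
  + assert (v q < 0) by nra. assert (v p < 0) by nra. assert (v s < 0) by lra. nra.
Qed.

Lemma count_stable_crossing r s : 0 < r < s -> s <= T -> u r * u s < 0 ->
  ((forall x, r <= x <= s -> 0 < w x) \/ (forall x, r <= x <= s -> w x < 0)) ->
  count_stable r -> count_stable s.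
Proof.
intros Hrs HsT Hopp Hmono (d & Hd & Hst).
assert (Hcu : forall x, continuous u x) by (intros x; apply (is_derive_cont _ _ _ (Hu x))).
destruct (abs_lower_bound w r s) as (m & Hm & Hmin); [lra|intros; apply Hw| |].
{ intros x Hx. destruct Hmono as [H|H]; specialize (H x Hx); lra. }
assert (Hur : u r <> 0) by nra. assert (Hus : u s <> 0) by nra.
destruct (below4 d m (Rabs (u r)) (Rabs (u s))) as (d' & D0 & D1 & D2 & D3 & D4);
  [lra|lra|apply Rabs_pos_lt, Hur|apply Rabs_pos_lt, Hus|].
exists d'. split; [exact D0|].
intros v z Hv Hcl j Hj.
assert (Sr : 0 < u r * v r) by (apply (close_same_sign _ _ d'); [apply (Hcl r); lra|exact D3]).
assert (Ss : 0 < u s * v s) by (apply (close_same_sign _ _ d'); [apply (Hcl s); lra|exact D4]).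
assert (Hz : (forall x, r <= x <= s -> 0 < z x) \/ (forall x, r <= x <= s -> z x < 0)).
{ assert (Q : forall x, r <= x <= s -> 0 < w x * z x).
  { intros x Hx. apply (close_same_sign _ _ d'); [apply (Hcl x); lra|]. specialize (Hmin x Hx). lra. }
  destruct Hmono as [H|H]; [left|right]; intros x Hx; specialize (H x Hx); specialize (Q x Hx); nra. }
assert (Hrs' : v r * v s < 0).
{ apply (same_sign_trans _ (u r)); [lra|]. rewrite Rmult_comm. apply (same_sign_trans _ (u s)); [lra|].
  rewrite Rmult_comm. exact Hopp. }
inversion Hj; subst; [constructor; lra|].
apply (alt_end_S u j0 r); [|lra|exact Hopp].
apply (Hst v z Hv); [intros x Hx; destruct (Hcl x Hx); split; lra|].
assert (Hr0 : 0 < v r * v r0).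
{ assert (v r0 <> 0) by nra. assert (v s <> 0) by nra. destruct (Rlt_dec 0 (v s)); nra. }
destruct (Rle_dec r0 r) as [Hle|Hle].
- apply (alt_end_later v j0 r0); [assumption|exact Hle|lra].
- apply (alt_end_sooner v j0 r0); [assumption|lra|].
  apply (monotone_same_sign v z r r0); [lra|exact Hv| |exact Hr0].
  destruct Hz as [Hz|Hz]; [left|right]; intros x Hx; apply Hz; lra.
Qed.

(** Between zeros the sign is stable, and near a simple zero a perturbed function is monotone;
    so the count can be carried along the interval. *)
Theorem count_semicontinuous : 0 < T -> u 0 <> 0 -> u T <> 0 ->
  (forall r, 0 <= r <= T -> ~ (u r = 0 /\ w r = 0)) -> count_stable T.
Proof.
intros HT H0 HuT Hnd.
assert (Hcu : forall x, continuous u x) by (intros x; apply (is_derive_cont _ _ _ (Hu x))).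
enough (P : forall s, 0 < s <= T -> u s <> 0 -> count_stable s) by (apply P; [lra|exact HuT]).
apply (real_induction (fun t => forall s, 0 < s <= t -> u s <> 0 -> count_stable s) 0 T).
- lra.
- intros s Hs; lra.
- intros x y Hxy _ Hy s Hs. apply Hy. lra.
- intros x Hx. destruct (Req_dec (u x) 0) as [E|E].
  + assert (Ew : w x <> 0) by (intros E'; exact (Hnd x Hx (conj E E'))).
    assert (Hx0 : 0 < x) by (destruct (proj1 Hx) as [H|H]; [exact H|subst x; contradiction]).
    destruct (continuous_eps w x (Hw x) (Rabs (w x))) as (d & Hd & Hy); [apply Rabs_pos_lt, Ew|].
    destruct (below2 (d / 2) (x / 2)) as (h & Hh & Hh1 & Hh2); [lra|lra|].
    exists h. split; [exact Hh|]. rewrite Rmax_right by lra. intros IH s Hs Hus.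
    assert (HsT : s <= T) by (apply Rle_trans with (1 := proj2 Hs), Rmin_l).
    assert (Hsx : s <= x + h) by (apply Rle_trans with (1 := proj2 Hs), Rmin_r).
    assert (Hmono : (forall y, x - h <= y <= x + h -> 0 < w y) \/ (forall y, x - h <= y <= x + h -> w y < 0)).
    { assert (Q : forall y, x - h <= y <= x + h -> 0 < w x * w y).
      { intros y Hy'. apply (close_same_sign _ _ (Rabs (w x))); [|lra]. apply Hy. apply Rabs_def1; lra. }
      destruct (Rlt_dec 0 (w x)); [left|right]; intros y Hy'; specialize (Q y Hy'); nra. }
    assert (Hbef : forall y, x - h <= y < x -> u y <> 0 /\ u y * w x < 0).
    { intros y Hy'. destruct (mean_value u w y x) as (c & Hc & Ec); [lra|intros; apply Hu|].
      rewrite E in Ec. destruct Hmono as [H|H]; assert (A := H c ltac:(lra)); assert (B := H x ltac:(lra)).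
      - assert (0 < w c * (x - y)) by pos. split; [lra|].
        assert (u y < 0) by lra. nra.
      - assert (0 < - w c * (x - y)) by pos. split; [lra|].
        assert (0 < u y) by lra. nra. }
    assert (Haft : forall y, x < y <= x + h -> u y <> 0 /\ 0 < u y * w x).
    { intros y Hy'. destruct (mean_value u w x y) as (c & Hc & Ec); [lra|intros; apply Hu|].
      rewrite E in Ec. destruct Hmono as [H|H]; assert (A := H c ltac:(lra)); assert (B := H x ltac:(lra)).
      - assert (0 < w c * (y - x)) by pos. split; [lra|].
        assert (0 < u y) by lra. nra.
      - assert (0 < - w c * (y - x)) by pos. split; [lra|].
        assert (u y < 0) by lra. nra. }
    destruct (Rle_dec s (x - h)) as [Hle|Hle]; [apply IH; [lra|exact Hus]|].
    assert (Hr : count_stable (x - h)) by (apply IH; [lra|apply Hbef; lra]).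
    destruct (Rtotal_order s x) as [Hlt|[->|Hgt]].
    * apply (count_stable_nonzero (x - h) s); try lra; [|auto].
      intros y Hy'. apply Hbef. lra.
    * contradiction.
    * apply (count_stable_crossing (x - h) s); try lra.
      -- destruct (Hbef (x - h) ltac:(lra)) as [_ A]. destruct (Haft s ltac:(lra)) as [_ B].
         destruct (Rlt_dec 0 (w x)); nra.
      -- destruct Hmono as [H|H]; [left|right]; intros y Hy'; apply H; lra.
      -- exact Hr.
  + destruct (continuous_eps u x (Hcu x) (Rabs (u x))) as (d & Hd & Hy); [apply Rabs_pos_lt, E|].
    exists (d / 2). split; [lra|]. intros IH s Hs Hus.
    assert (HsT : s <= T) by (apply Rle_trans with (1 := proj2 Hs), Rmin_l).
    assert (Hsx : s <= x + d / 2) by (apply Rle_trans with (1 := proj2 Hs), Rmin_r).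
    set (r := Rmax 0 (x - d / 2)) in *.
    assert (Hr0 : 0 <= r) by apply Rmax_l. assert (Hr1 : x - d / 2 <= r) by apply Rmax_r.
    assert (Hnz : forall y, x - d / 2 <= y <= x + d / 2 -> u y <> 0).
    { intros y Hy' E'. specialize (Hy y ltac:(apply Rabs_def1; lra)).
      rewrite E', Rminus_0_l, Rabs_Ropp in Hy. lra. }
    destruct (Rle_dec s r) as [Hle|Hle]; [apply IH; [lra|exact Hus]|].
    apply (count_stable_nonzero r s); try lra.
    * intros y Hy'. apply Hnz. lra.
    * intros Hrp. apply IH; [lra|]. apply Hnz.
      assert (r <= x) by (unfold r; apply Rmax_lub; lra). lra.
Qed.

End semicontinuity.

(** * The central well and the cost of late swings *)

(** The shape of [F] near [0]: a well over [[bm, bp]] between two monotone flanks that reach the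
    common height [h].  The force may vanish at the edges of the well, and [F] may touch [0]
    inside, but not on an interval. *)
Record central (g : R -> R) (cm bm bp cp h : R) : Prop := {
  ct_cont : forall x, continuous g x;
  ct_lip : lip_off_0 g;
  ct_g0 : g 0 = 0;
  ct_cm : cm < bm; ct_bm : bm < 0; ct_bp : 0 < bp; ct_cp : bp < cp; ct_h : 0 < h;
  ct_F_le : forall s, bm <= s <= bp -> Fint g s <= 0;
  ct_F_dense : forall p q, bm <= p -> p < q -> q <= bp -> exists s, p < s < q /\ Fint g s < 0;
  ct_F_near0 : exists d, 0 < d /\ forall s, 0 < Rabs s < d -> Fint g s < 0;
  ct_gp : forall s, bp < s <= cp -> 0 < g s;
  ct_gm : forall s, cm <= s < bm -> g s < 0;
  ct_Fbp : Fint g bp = 0; ct_Fbm : Fint g bm = 0;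
  ct_Fcp : Fint g cp = h; ct_Fcm : Fint g cm = h
}.
Arguments ct_cont {g cm bm bp cp h} _ x.
Arguments ct_lip {g cm bm bp cp h} _.
Arguments ct_g0 {g cm bm bp cp h} _.
Arguments ct_cm {g cm bm bp cp h} _.
Arguments ct_bm {g cm bm bp cp h} _.
Arguments ct_bp {g cm bm bp cp h} _.
Arguments ct_cp {g cm bm bp cp h} _.
Arguments ct_h {g cm bm bp cp h} _.
Arguments ct_F_le {g cm bm bp cp h} _ s _.
Arguments ct_F_dense {g cm bm bp cp h} _ p q _ _ _.
Arguments ct_F_near0 {g cm bm bp cp h} _.
Arguments ct_gp {g cm bm bp cp h} _ s _.
Arguments ct_gm {g cm bm bp cp h} _ s _.
Arguments ct_Fbp {g cm bm bp cp h} _.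
Arguments ct_Fbm {g cm bm bp cp h} _.
Arguments ct_Fcp {g cm bm bp cp h} _.
Arguments ct_Fcm {g cm bm bp cp h} _.

Definition mirror (g : R -> R) (s : R) : R := - g (- s).

Lemma continuous_mirror g : (forall x, continuous g x) -> forall x, continuous (mirror g) x.
Proof.
intros Hg x. apply continuous_Ropp. apply (continuous_comp Ropp g); [|apply Hg].
apply continuous_Ropp, continuous_id.
Qed.

Lemma Fint_0 g : Fint g 0 = 0.
Proof. unfold Fint. rewrite RInt_point. reflexivity. Qed.

Lemma Fint_mirror g s : (forall x, continuous g x) -> Fint (mirror g) s = Fint g (- s).
Proof.
intros Hg.
set (D := fun x => Fint (mirror g) x - Fint g (- x)).
assert (HD : forall x, is_derive D x 0).
{ intros x. eapply is_derive_eq.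
  - apply dR_minus; [apply Fint_derive, continuous_mirror, Hg|].
    apply (dR_comp (Fint g) Ropp); [apply Fint_derive, Hg|apply (dR_opp (fun y => y)), dR_id].
  - unfold mirror. ring. }
assert (D0 : D 0 = 0) by (unfold D; rewrite Ropp_0, !Fint_0; ring).
assert (Hc : forall x, continuous D x) by (intros x; apply (is_derive_cont _ _ _ (HD x))).
enough (D s = 0) by (unfold D in H; lra).
destruct (Rle_dec 0 s).
- rewrite (derive_zero_const D 0 s); auto.
- rewrite <- D0. symmetry. apply (derive_zero_const D s 0); auto; lra.
Qed.

Lemma sol_mirror n g a u w : sol n g a u w ->
  sol n (mirror g) (- a) (fun r => - u r) (fun r => - w r).
Proof.
intros S. split.
- intros r Hr. destruct (sol_init S r Hr) as [-> ->]. split; ring.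
- intros r. apply dR_opp, (sol_du S).
- intros r. apply continuous_Ropp, (sol_cw S).
- intros r Hr. eapply is_derive_eq; [apply dR_opp, (sol_dw S r Hr)|].
  unfold mirror. rewrite Ropp_involutive. ring.
Qed.

Lemma energy_mirror g u w r : (forall x, continuous g x) ->
  energy (mirror g) (fun r => - u r) (fun r => - w r) r = energy g u w r.
Proof. intros Hg. unfold energy. rewrite Fint_mirror, Ropp_involutive by exact Hg. field. Qed.

Lemma alternates_opp u k : alternates (fun r => - u r) k <-> alternates u k.
Proof.
split; intros (t & H0 & H); exists t; (split; [exact H0|]);
  intros i Hi; destruct (H i Hi); split; lra.
Qed.

Lemma central_mirror g cm bm bp cp h : central g cm bm bp cp h ->
  central (mirror g) (- cp) (- bp) (- bm) (- cm) h.
Proof.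
intros C. assert (Hg := ct_cont C). split.
- apply continuous_mirror, Hg.
- intros x Hx. destruct (ct_lip C (- x)) as (e & L & He & HL & H); [lra|].
  exists e, L. split; [exact He|]. split; [exact HL|]. intros y z Hy Hz.
  unfold mirror. replace (- g (- y) - - g (- z)) with (- (g (- y) - g (- z))) by ring.
  replace (y - z) with (- (- y - - z)) by ring. rewrite !Rabs_Ropp. apply H.
  + replace (- y - - x) with (- (y - x)) by ring. rewrite Rabs_Ropp. exact Hy.
  + replace (- z - - x) with (- (z - x)) by ring. rewrite Rabs_Ropp. exact Hz.
- unfold mirror. rewrite Ropp_0, (ct_g0 C). ring.
- assert (H := ct_cp C); lra.
- assert (H := ct_bp C); lra.
- assert (H := ct_bm C); lra.
- assert (H := ct_cm C); lra.
- exact (ct_h C).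
- intros s Hs. rewrite Fint_mirror by exact Hg. apply (ct_F_le C); lra.
- intros p q Hp Hpq Hq. destruct (ct_F_dense C (- q) (- p)) as (s & Hs & HF); try lra.
  exists (- s). split; [lra|]. rewrite Fint_mirror, Ropp_involutive by exact Hg. exact HF.
- destruct (ct_F_near0 C) as (d & Hd & H). exists d. split; [exact Hd|]. intros s Hs.
  rewrite Fint_mirror by exact Hg. apply H. rewrite Rabs_Ropp. exact Hs.
- intros s Hs. unfold mirror. assert (H := ct_gm C (- s) ltac:(lra)). lra.
- intros s Hs. unfold mirror. assert (H := ct_gp C (- s) ltac:(lra)). lra.
- rewrite Fint_mirror, Ropp_involutive by exact Hg. apply (ct_Fbm C).
- rewrite Fint_mirror, Ropp_involutive by exact Hg. apply (ct_Fbp C).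
- rewrite Fint_mirror, Ropp_involutive by exact Hg. apply (ct_Fcm C).
- rewrite Fint_mirror, Ropp_involutive by exact Hg. apply (ct_Fcp C).
Qed.

Lemma turning_split (w dw : R -> R) (a b : R) : a <= b ->
  (forall r, a <= r <= b -> is_derive w r (dw r)) ->
  (forall r, a <= r <= b -> w r = 0 -> dw r < 0) ->
  exists t, a <= t <= b /\ (forall r, a <= r < t -> 0 <= w r) /\ (forall r, t < r <= b -> w r <= 0).
Proof.
intros Hab Hd H0.
destruct (classic (exists r, a <= r <= b /\ w r <= 0)) as [(r0 & Hr0 & Hw0)|Hno].
- destruct (first_time (fun r => w r <= 0) a r0) as (t & Ht & Hwt & Hbef); [lra|exact Hw0| |].
  + intros x Hx Hn. destruct (continuous_gt w x 0) as (d & Hd1 & Hd2).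
    * apply (is_derive_cont _ _ (dw x)), Hd; lra.
    * lra.
    * exists d. split; [exact Hd1|]. intros y _ Hy. specialize (Hd2 y Hy). lra.
  + exists t. split; [lra|]. split.
    * intros r Hr. specialize (Hbef r Hr). lra.
    * intros r Hr. left. apply (neg_stays w dw t b); [|exact Hwt| |exact Hr].
      -- intros; apply Hd; lra.
      -- intros; apply H0; [lra|assumption].
- exists b. split; [lra|]. split; [|intros r Hr; lra].
  intros r Hr. apply Rnot_lt_le. intros Hlt. apply Hno. exists r. split; lra.
Qed.

(** The loss is the integral of [(n / r) w^2], and the integral of [|w|] is the variation of [u]
    as long as [u] is monotone. *)
Lemma energy_loss n g a u w r r' S : (forall x, continuous g x) -> sol n g a u w ->
  0 < r <= r' ->
  (forall s, r < s < r' -> 0 <= w s) \/ (forall s, r < s < r' -> w s <= 0) ->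
  (forall s, r < s < r' -> Rabs (w s) <= S) ->
  energy g u w r - energy g u w r' <= INR n / r * S * Rabs (u r' - u r).
Proof.
intros Hg HS Hr Hsgn Hb.
set (k := INR n / r * S).
assert (Hn : forall s, r < s < r' -> 0 <= INR n / s <= INR n / r).
{ intros s Hs. assert (P := pos_INR n). assert (0 < / s) by pos.
  assert (/ s <= / r) by (apply Rinv_le_contravar; lra). unfold Rdiv; split; nra. }
assert (Hmain : forall sg, (sg = 1 \/ sg = - 1) -> (forall s, r < s < r' -> 0 <= sg * w s) ->
  energy g u w r - energy g u w r' <= k * (sg * (u r' - u r))).
{ intros sg Hsg Hw.
  enough (energy g u w r + k * (sg * u r) <= energy g u w r' + k * (sg * u r')) by lra.
  apply (derive_nonneg (fun s => energy g u w s + k * (sg * u s))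
    (fun s => - (INR n / s) * w s ^ 2 + k * (sg * w s))).
  - lra.
  - intros s _. apply cR_plus; [apply (energy_cont Hg HS)|].
    apply cR_scal, cR_scal, (sol_cu HS).
  - intros s Hs. apply dR_plus; [apply (energy_derive Hg HS); lra|].
    apply dR_scal, dR_scal, (sol_du HS).
  - intros s Hs. specialize (Hn s Hs). specialize (Hw s Hs). specialize (Hb s Hs).
    assert (Ew : Rabs (w s) = sg * w s).
    { destruct Hsg as [->| ->]; [rewrite Rabs_pos_eq; lra|rewrite Rabs_left1; lra]. }
    rewrite Ew in Hb.
    replace (w s ^ 2) with (sg * w s * (sg * w s)) by (destruct Hsg as [->| ->]; ring).
    set (y := sg * w s) in *. unfold k.
    assert (INR n / s * (y * y) <= INR n / r * (S * y)).
    { apply Rmult_le_compat; [lra|pos|lra|apply Rmult_le_compat_r; lra]. }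
    lra. }
assert (Hk : 0 <= k \/ r = r').
{ destruct (Req_dec r r') as [E|E]; [right; exact E|left]. unfold k.
  assert (A := Hb ((r + r') / 2) ltac:(lra)). assert (B := Hn ((r + r') / 2) ltac:(lra)).
  assert (P := Rabs_pos (w ((r + r') / 2))). apply Rmult_le_pos; lra. }
destruct Hk as [Hk|E].
2: { subst r'. rewrite !Rminus_diag, Rabs_R0. lra. }
destruct Hsgn as [H|H].
- apply Rle_trans with (k * (1 * (u r' - u r))).
  + apply Hmain; [auto|]. intros s Hs. specialize (H s Hs). lra.
  + apply Rmult_le_compat_l; [exact Hk|]. rewrite Rmult_1_l. apply Rle_abs.
- apply Rle_trans with (k * (-1 * (u r' - u r))).
  + apply Hmain; [auto|]. intros s Hs. specialize (H s Hs). lra.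
  + apply Rmult_le_compat_l; [exact Hk|]. rewrite <- Rabs_Ropp.
    replace (-1 * (u r' - u r)) with (- (u r' - u r)) by ring. apply Rle_abs.
Qed.

Section shape.

Variables (g : R -> R) (cm bm bp cp h : R).
Hypothesis C : central g cm bm bp cp h.

Lemma F_increasing_right s t : bp <= s -> s < t -> t <= cp -> Fint g s < Fint g t.
Proof.
intros Hs Hst Ht.
set (m := (s + t) / 2).
assert (A : Fint g s <= Fint g m).
{ apply (derive_nonneg (Fint g) g); [unfold m; lra| | |].
  - intros; apply Fint_cont, (ct_cont C).
  - intros; apply Fint_derive, (ct_cont C).
  - intros x Hx. left. apply (ct_gp C). unfold m in Hx. lra. }
destruct (mean_value (Fint g) g m t) as (c & Hc & E); [unfold m; lra|intros; apply Fint_derive, (ct_cont C)|].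
assert (0 < g c) by (apply (ct_gp C); unfold m in Hc; lra).
assert (0 < g c * (t - m)) by (apply Rmult_lt_0_compat; [lra|unfold m; lra]). lra.
Qed.

Lemma F_pos_right s : bp < s <= cp -> 0 < Fint g s.
Proof. intros Hs. rewrite <- (ct_Fbp C). apply F_increasing_right; lra. Qed.

Lemma F_lt_h_right s : 0 <= s < cp -> Fint g s < h.
Proof.
intros Hs. destruct (Rle_dec s bp) as [H|H].
- assert (A := ct_F_le C s). assert (B := ct_bm C). assert (D := ct_h C). lra.
- rewrite <- (ct_Fcp C). apply F_increasing_right; lra.
Qed.

Lemma turn_right s : 0 <= s <= cp -> 0 < Fint g s -> 0 < g s.
Proof.
intros Hs HF. apply (ct_gp C). split; [|lra]. apply Rnot_le_lt. intros Hle.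
assert (A := ct_F_le C s). assert (B := ct_bm C). lra.
Qed.

End shape.

Lemma F_lt_h g cm bm bp cp h s : central g cm bm bp cp h -> cm < s < cp -> Fint g s < h.
Proof.
intros C Hs. destruct (Rle_dec 0 s) as [H|H].
- apply (F_lt_h_right g cm bm bp cp h C). lra.
- rewrite <- (Ropp_involutive s), <- Fint_mirror by apply (ct_cont C).
  apply (F_lt_h_right _ _ _ _ _ _ (central_mirror _ _ _ _ _ _ C)). lra.
Qed.

Section dynamics.

Variables (n : nat) (g : R -> R) (cm bm bp cp h : R).
Hypothesis Hn : (1 <= n)%nat.
Hypothesis C : central g cm bm bp cp h.

Lemma stays_inside a u w r0 : sol n g a u w ->
  cm <= u r0 <= cp -> energy g u w r0 < h -> forall r, r0 <= r -> cm < u r < cp.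
Proof.
intros S Hu HE r Hr.
assert (Hg := ct_cont C).
assert (Hne : forall s, r0 <= s -> Fint g (u s) < h).
{ intros s Hs. assert (A := F_le_energy g u w s).
  assert (B := energy_noninc Hg S r0 s Hs). lra. }
assert (Hcu : forall s, continuous u s) by (intros; apply (sol_cu S)).
split; apply Rnot_le_lt; intros Hc.
- destruct (ivt u r0 r cm Hr) as (t & Ht & E); [auto|lra|].
  assert (A := Hne t ltac:(lra)). rewrite E, (ct_Fcm C) in A. lra.
- destruct (ivt u r0 r cp Hr) as (t & Ht & E); [auto|lra|].
  assert (A := Hne t ltac:(lra)). rewrite E, (ct_Fcp C) in A. lra.
Qed.

Lemma no_zero_negative_energy a u w r0 : sol n g a u w ->
  energy g u w r0 < 0 -> forall r, r0 <= r -> u r <> 0.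
Proof.
intros S HE r Hr E. assert (A := F_le_energy g u w r). rewrite E, Fint_0 in A.
assert (B := energy_noninc (ct_cont C) S r0 r Hr). lra.
Qed.

Lemma speed_inside u w S r : 0 <= S ->
  (forall s, cm <= s <= cp -> 2 * (h - Fint g s) <= S * S) ->
  cm <= u r <= cp -> energy g u w r <= h -> Rabs (w r) <= S.
Proof.
intros HS Hb Hu HE. specialize (Hb (u r) Hu). unfold energy in HE.
apply abs_le_sqr; [exact HS|]. lra.
Qed.

End dynamics.

(** During one swing on the positive side the solution turns at most once, because turning
    with positive energy is only possible where [g > 0]; so its variation, and with it
    the energy lost at large [r], is controlled. *)
Lemma swing_right n g cm bm bp cp h a u w S R r0 r' :
  (1 <= n)%nat -> central g cm bm bp cp h -> sol n g a u w ->
  0 < S -> (forall s, cm <= s <= cp -> 2 * (h - Fint g s) <= S * S) ->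
  0 < R <= r0 -> (forall r, r0 <= r -> cm <= u r <= cp) ->
  energy g u w r0 <= h -> 0 < u r0 -> r0 <= r' ->
  let loss := 2 * (INR n / R * S * (cp - cm)) in
  0 < energy g u w r0 - loss -> energy g u w r' < energy g u w r0 - loss ->
  exists r1, r0 < r1 /\ u r1 < 0 /\ energy g u w r0 - loss <= energy g u w r1.
Proof.
intros Hn C HS S0 Hb HR HK HE Hu Hr' loss Hpos Hlow.
assert (Hg := ct_cont C). assert (B1 := ct_cm C). assert (B2 := ct_bm C).
assert (B3 := ct_bp C). assert (B4 := ct_cp C).
assert (Hn0 : 0 < INR n) by pos.
set (kap := INR n / R * S).
assert (Hkap : 0 < kap).
{ unfold kap. apply Rmult_lt_0_compat; [pos|exact S0]. }
assert (Hloss : loss = 2 * (kap * (cp - cm))) by reflexivity.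
assert (Hl : 0 < kap * (cp - cm)) by pos.
destruct (first_le (energy g u w) r0 r' (energy g u w r0 - loss)) as (r2 & Hr2 & E2 & Hbef);
  [exact Hr'|intros; apply (energy_cont Hg HS)|lra|lra|].
apply NNPP. intros Hno.
assert (Hnn : forall r, r0 <= r <= r2 -> 0 <= u r).
{ intros r Hr. apply Rnot_lt_le. intros Hlt. apply Hno. exists r.
  destruct (Req_dec r r0) as [->|Hne]; [lra|]. split; [lra|]. split; [exact Hlt|].
  rewrite <- E2. apply (energy_noninc Hg HS). lra. }
assert (HEp : forall r, r0 <= r <= r2 -> 0 < energy g u w r).
{ intros r Hr. assert (A := energy_noninc Hg HS r r2 ltac:(lra)). lra. }
destruct (turning_split w (fun r => - (INR n / r) * w r - g (u r)) r0 r2) as (t & Ht & Hup & Hdn).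
- lra.
- intros r Hr. apply (sol_dw HS). lra.
- intros r Hr Ew. rewrite Ew.
  enough (0 < g (u r)) by lra. apply (turn_right g cm bm bp cp h C).
  + specialize (HK r ltac:(lra)). specialize (Hnn r Hr). lra.
  + specialize (HEp r Hr). unfold energy in HEp. rewrite Ew in HEp. lra.
- assert (Hsp : forall s, r0 <= s -> Rabs (w s) <= S).
  { intros s Hs. apply (speed_inside g cm cp h u w); [lra|exact Hb|apply HK, Hs|].
    apply Rle_trans with (2 := HE). apply (energy_noninc Hg HS), Hs. }
  assert (Hkr : forall r, r0 <= r -> INR n / r * S <= kap).
  { intros r Hr. unfold kap. apply Rmult_le_compat_r; [lra|].
    apply Rmult_le_compat_l; [lra|]. apply Rinv_le_contravar; lra. }
  assert (L1 : energy g u w r0 - energy g u w t <= kap * Rabs (u t - u r0)).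
  { eapply Rle_trans; [apply (energy_loss n g a u w r0 t S Hg HS)|].
    - lra.
    - left. intros s Hs. apply Hup. lra.
    - intros s Hs. apply Hsp. lra.
    - apply Rmult_le_compat_r; [apply Rabs_pos|apply Hkr; lra]. }
  assert (L2 : energy g u w t - energy g u w r2 <= kap * Rabs (u r2 - u t)).
  { eapply Rle_trans; [apply (energy_loss n g a u w t r2 S Hg HS)|].
    - lra.
    - right. intros s Hs. apply Hdn. lra.
    - intros s Hs. apply Hsp. lra.
    - apply Rmult_le_compat_r; [apply Rabs_pos|apply Hkr; lra]. }
  assert (V : forall r s, r0 <= r <= r2 -> r0 <= s <= r2 -> Rabs (u r - u s) <= cp).
  { intros r s Hr Hs. assert (A := HK r ltac:(lra)). assert (A' := HK s ltac:(lra)).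
    assert (A2 := Hnn r Hr). assert (A3 := Hnn s Hs). apply Rabs_le; lra. }
  assert (V1 := V t r0 ltac:(lra) ltac:(lra)). assert (V2 := V r2 t ltac:(lra) ltac:(lra)).
  assert (K1 : kap * Rabs (u t - u r0) <= kap * cp) by (apply Rmult_le_compat_l; lra).
  assert (K2 : kap * Rabs (u r2 - u t) <= kap * cp) by (apply Rmult_le_compat_l; lra).
  assert (kap * cp < kap * (cp - cm)) by (apply Rmult_lt_compat_l; lra). lra.
Qed.

Lemma swing n g cm bm bp cp h a u w S R r0 r' :
  (1 <= n)%nat -> central g cm bm bp cp h -> sol n g a u w ->
  0 < S -> (forall s, cm <= s <= cp -> 2 * (h - Fint g s) <= S * S) ->
  0 < R <= r0 -> (forall r, r0 <= r -> cm <= u r <= cp) ->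
  energy g u w r0 <= h -> u r0 <> 0 -> r0 <= r' ->
  let loss := 2 * (INR n / R * S * (cp - cm)) in
  0 < energy g u w r0 - loss -> energy g u w r' < energy g u w r0 - loss ->
  exists r1, r0 < r1 /\ u r0 * u r1 < 0 /\ energy g u w r0 - loss <= energy g u w r1.
Proof.
intros Hn C HS S0 Hb HR HK HE Hu Hr' loss Hpos Hlow.
assert (Hg := ct_cont C).
destruct (Rlt_dec 0 (u r0)) as [H|H].
- destruct (swing_right n g cm bm bp cp h a u w S R r0 r') as (r1 & H1 & H2 & H3); auto.
  exists r1. split; [exact H1|]. split; [nra|exact H3].
- destruct (swing_right n (mirror g) (- cp) (- bp) (- bm) (- cm) h (- a)
    (fun r => - u r) (fun r => - w r) S R r0 r') as (r1 & H1 & H2 & H3);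
    rewrite ?energy_mirror by exact Hg; auto.
  + apply central_mirror, C.
  + apply sol_mirror, HS.
  + intros s Hs. rewrite Fint_mirror by exact Hg. apply Hb. lra.
  + intros r Hr. specialize (HK r Hr). lra.
  + lra.
  + replace (- cm - - cp) with (cp - cm) by ring. exact Hpos.
  + replace (- cm - - cp) with (cp - cm) by ring. exact Hlow.
  + exists r1. split; [exact H1|]. split; [nra|].
    rewrite !energy_mirror in H3 by exact Hg.
    replace (- cm - - cp) with (cp - cm) in H3 by ring. exact H3.
Qed.

Lemma many_swings n g cm bm bp cp h a u w S R j :
  (1 <= n)%nat -> central g cm bm bp cp h -> sol n g a u w ->
  0 < S -> (forall s, cm <= s <= cp -> 2 * (h - Fint g s) <= S * S) -> 0 < R ->
  let loss := 2 * (INR n / R * S * (cp - cm)) in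
  forall r0 r' e i, R <= r0 -> (forall r, r0 <= r -> cm <= u r <= cp) ->
  energy g u w r0 <= h -> u r0 <> 0 -> 0 < e -> energy g u w r' < e ->
  e + INR j * loss <= energy g u w r0 ->
  alt_end u i r0 -> exists r, alt_end u (i + j) r.
Proof.
intros Hn C HS S0 Hb HR loss.
assert (Hg := ct_cont C).
assert (Hloss : 0 < loss).
{ unfold loss. assert (B1 := ct_cm C). assert (B2 := ct_bm C).
  assert (B3 := ct_bp C). assert (B4 := ct_cp C).
  assert (0 < INR n / R) by pos.
  assert (0 < INR n / R * S * (cp - cm)) by pos.
  lra. }
induction j as [|j IH]; intros r0 r' e i Hr0 HK HE Hu He Hlow Hhigh Halt.
- exists r0. rewrite Nat.add_0_r. exact Halt.
- rewrite S_INR in Hhigh.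
  assert (Hj : 0 <= INR j * loss) by pos.
  assert (Hrr : r0 <= r').
  { apply Rnot_lt_le. intros Hlt. assert (A := energy_noninc Hg HS r' r0 ltac:(lra)). lra. }
  destruct (swing n g cm bm bp cp h a u w S R r0 r') as (r1 & H1 & H2 & H3); auto.
  + fold loss. lra.
  + fold loss. lra.
  + fold loss in H3. replace (i + Datatypes.S j)%nat with (Datatypes.S i + j)%nat by lia.
    apply (IH r1 r' e).
    * lra.
    * intros r Hr. apply HK. lra.
    * apply Rle_trans with (2 := HE). apply (energy_noninc Hg HS). lra.
    * intros E. rewrite E, Rmult_0_r in H2. lra.
    * exact He.
    * exact Hlow.
    * lra.
    * apply (alt_end_S u i r0); assumption.
Qed.

(** A solution that is outside the central interval at a late time and is later caught
    inside with little energy must have changed sign many times on the way: at late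
    times each swing costs little energy. *)
Lemma late_energy n g cm bm bp cp h a u w S R k r r0 :
  (1 <= n)%nat -> central g cm bm bp cp h -> sol n g a u w ->
  0 < S -> (forall s, cm <= s <= cp -> 2 * (h - Fint g s) <= S * S) -> 0 < R ->
  INR (Datatypes.S k) * (2 * (INR n / R * S * (cp - cm))) <= h / 4 ->
  R <= r -> ~ cm <= u r <= cp -> cm <= u r0 <= cp -> energy g u w r0 < h / 2 ->
  alternates u (Datatypes.S k).
Proof.
intros Hn C HS S0 Hb HR Hk Hr Hout Hin HE.
assert (Hg := ct_cont C). assert (Hh := ct_h C).
assert (Hcu : forall s, continuous u s) by (intros; apply (sol_cu HS)).
assert (Hrr : r < r0).
{ apply Rnot_le_lt. intros Hle. apply Hout.
  assert (A := stays_inside n g cm bm bp cp h C a u w r0 HS Hin ltac:(lra) r Hle). lra. }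
destruct (last_time (fun s => u s <= cm \/ cp <= u s) r r0) as (ra & Hra & Ha & Haft).
{ lra. } { lra. }
{ intros x Hx Hno. destruct (continuous_gt u x cm) as (d1 & D1 & D1'); [auto|lra|].
  destruct (continuous_lt u x cp) as (d2 & D2 & D2'); [auto|lra|].
  exists (Rmin d1 d2). split; [pos|]. intros y _ Hy.
  specialize (D1' y ltac:(apply Rlt_le_trans with (1 := Hy), Rmin_l)).
  specialize (D2' y ltac:(apply Rlt_le_trans with (1 := Hy), Rmin_r)). lra. }
assert (Hra0 : ra < r0 \/ ra = r0) by lra.
assert (HEra : h <= energy g u w ra).
{ assert (A := F_le_energy g u w ra).
  assert (HF : Fint g (u ra) = h).
  { destruct Hra0 as [Hlt|Heq].
    - assert (Eq : u ra = cm \/ u ra = cp).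
      { apply NNPP. intros Hne. destruct Ha as [Ha|Ha].
        - destruct (continuous_lt u ra cm) as (d & Hd & Hd'); [auto|lra|].
          min_of y r0 (ra + d / 2) as Y1 Y2.
          assert (Y3 : ra < y) by (unfold y; apply Rmin_glb_lt; lra).
          specialize (Hd' y ltac:(apply Rabs_def1; lra)). apply (Haft y); [lra|left; lra].
        - destruct (continuous_gt u ra cp) as (d & Hd & Hd'); [auto|lra|].
          min_of y r0 (ra + d / 2) as Y1 Y2.
          assert (Y3 : ra < y) by (unfold y; apply Rmin_glb_lt; lra).
          specialize (Hd' y ltac:(apply Rabs_def1; lra)). apply (Haft y); [lra|right; lra]. }
      destruct Eq as [-> | ->]; [apply (ct_Fcm C)|apply (ct_Fcp C)].
    - subst ra. destruct Ha as [Ha|Ha];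
        [replace (u r0) with cm by lra; apply (ct_Fcm C)|replace (u r0) with cp by lra; apply (ct_Fcp C)]. }
  lra. }
assert (HK : forall s, ra < s -> cm <= u s <= cp).
{ intros s Hs. destruct (Rle_dec s r0) as [H|H].
  - specialize (Haft s ltac:(lra)). lra.
  - assert (A := stays_inside n g cm bm bp cp h C a u w r0 HS Hin ltac:(lra) s ltac:(lra)). lra. }
assert (HcE : forall s, continuous (energy g u w) s) by (intros; apply (energy_cont Hg HS)).
destruct (first_le (energy g u w) ra r0 (7 / 8 * h)) as (r1 & Hr1 & E1 & _); [lra|auto|lra|lra|].
destruct (first_le (energy g u w) r1 r0 (3 / 4 * h)) as (r2 & Hr2 & E2 & _); [lra|auto|lra|lra|].
assert (Hb0 : exists rb, r1 <= rb <= r2 /\ u rb <> 0).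
{ apply NNPP. intros Hno.
  assert (Hz : forall s, r1 <= s <= r2 -> u s = 0).
  { intros s Hs. apply NNPP. intros Hne. apply Hno. exists s; auto. }
  destruct (mean_value u w r1 r2) as (c & Hc & Ec); [lra|intros; apply (sol_du HS)|].
  rewrite (Hz r1), (Hz r2) in Ec by lra.
  assert (Wc : w c = 0) by nra.
  assert (A := energy_noninc Hg HS c r2 ltac:(lra)).
  unfold energy at 2 in A. rewrite Wc, (Hz c Hc), Fint_0 in A. lra. }
destruct Hb0 as (rb & Hrb & Hub).
apply alternates_alt_end.
destruct (many_swings n g cm bm bp cp h a u w S R (Datatypes.S k) Hn C HS S0 Hb HR
  rb r0 (h / 2) 0%nat) as [r3 H3].
- lra.
- intros s Hs. apply HK. lra.
- apply Rle_trans with (energy g u w r1); [apply (energy_noninc Hg HS); lra|lra].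
- exact Hub.
- lra.
- exact HE.
- assert (A := energy_noninc Hg HS rb r2 ltac:(lra)). lra.
- constructor. lra.
- exists r3. exact H3.
Qed.

(** * Where trapped solutions settle *)

Lemma growth_unbounded (f df : R -> R) (T c B : R) : 0 < c ->
  (forall r, T <= r -> is_derive f r (df r)) -> (forall r, T <= r -> c <= df r) ->
  (forall r, T <= r -> f r <= B) -> False.
Proof.
intros Hc Hd Hdf HB.
set (t := (B - f T) / c + 1).
assert (Ht : 0 < t).
{ assert (0 <= (B - f T) / c); [|unfold t; lra].
  apply Rmult_le_pos; [specialize (HB T (Rle_refl _)); lra|left; apply Rinv_0_lt_compat, Hc]. }
destruct (mean_value f df T (T + t)) as (x & Hx & E); [lra|intros; apply Hd; lra|].
assert (A := HB (T + t) ltac:(lra)). assert (A2 := Hdf x ltac:(lra)).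
replace (T + t - T) with t in E by ring.
assert (c * t <= df x * t) by (apply Rmult_le_compat_r; lra).
assert (c * t = B - f T + c) by (unfold t; field; lra). lra.
Qed.

Lemma monotone_limit (f : R -> R) (T B : R) :
  (forall r s, T <= r -> r <= s -> f r <= f s) -> (forall r, T <= r -> f r <= B) ->
  exists l, (forall r, T <= r -> f r <= l) /\ l <= B /\
    forall eps, 0 < eps -> exists r0, T <= r0 /\ forall r, r0 <= r -> l - eps < f r.
Proof.
intros Hm HB.
destruct (completeness (fun y => exists r, T <= r /\ y = f r)) as [l [Hub Hlub]].
- exists B. intros y (r & Hr & ->). apply HB, Hr.
- exists (f T), T. split; [lra|reflexivity].
- exists l. split; [intros r Hr; apply Hub; eauto|]. split.
  + apply Hlub. intros y (r & Hr & ->). apply HB, Hr.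
  + intros eps He. apply NNPP. intros Hno. enough (l <= l - eps) by lra.
    apply Hlub. intros y (r & Hr & ->). apply Rnot_lt_le. intros Hlt. apply Hno.
    exists r. split; [exact Hr|]. intros s Hs. specialize (Hm r s Hr Hs). lra.
Qed.

Definition no_double_zero (u w : R -> R) (T : R) : Prop :=
  forall r, 0 <= r <= T -> ~ (u r = 0 /\ w r = 0).

(** Convergence to a rest point at zero energy.  The quantity [r * energy] is the one
    that has to be small for a perturbed solution to stay near [l]. *)
Record settles (g u w : R -> R) (l : R) : Prop := {
  st_lim : forall eps, 0 < eps -> exists r0, forall r, r0 <= r -> Rabs (u r - l) < eps;
  st_near : forall eps rho, 0 < eps -> exists r0, 0 < r0 /\ (l <> 0 -> rho <= r0) /\ u r0 <> 0 /\ no_double_zero u w r0 /\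
    Rabs (u r0 - l) < eps /\ energy g u w r0 < eps /\ r0 * energy g u w r0 < eps
}.

(** Once the energy vanishes the solution rests.  With positive energy it can only turn where
    the force is positive, so it is eventually monotone and has a limit; a bounded solution cannot have a limit speed or a limit force other than [0]. *)
Lemma settle_right n g cm bm bp cp h a u w T :
  (1 <= n)%nat -> central g cm bm bp cp h -> sol n g a u w -> 0 < T ->
  (forall r, ~ (u r = 0 /\ w r = 0)) -> (forall r, T <= r -> 0 < u r <= cp) ->
  (forall r, 0 <= energy g u w r) ->
  exists l, 0 <= l <= bp /\ Fint g l = 0 /\ g l = 0 /\ settles g u w l.
Proof.
intros Hn C HS HT Hnd Hu HE.
assert (Hg := ct_cont C). assert (Hn0 : 0 < INR n) by pos.
assert (Bm := ct_bm C).
destruct (classic (exists r1, T <= r1 /\ energy g u w r1 = 0)) as [(r1 & Hr1 & E1)|Hpos].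
- assert (Hrest : forall r, r1 < r -> u r = u r1 /\ w r = 0 /\ energy g u w r = 0).
  { intros r Hr. assert (A := energy_noninc Hg HS r1 r ltac:(lra)).
    assert (B := HE r).
    destruct (energy_const_rest Hg HS r1 r Hn ltac:(lra) ltac:(lra)) as [H1 H2].
    split; [apply H1; lra|]. split; [apply H2; lra|lra]. }
  set (l := u r1) in *.
  assert (Hl : 0 < l <= cp) by (apply Hu, Hr1).
  destruct (Hrest (r1 + 1) ltac:(lra)) as (U1 & W1 & F1).
  assert (HF : Fint g l = 0) by (unfold energy in F1; rewrite U1, W1 in F1; lra).
  assert (Hlb : l <= bp).
  { apply Rnot_lt_le. intros Hlt. assert (A := F_pos_right g cm bm bp cp h C l). lra. }
  assert (Hgl : g l = 0).
  { assert (D1 := sol_dw HS (r1 + 1) ltac:(lra)). rewrite U1, W1 in D1.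
    assert (D2 : is_derive w (r1 + 1) 0).
    { apply (is_derive_ext_loc (fun _ => 0)); [|apply dR_const].
      exists (mkposreal 1 Rlt_0_1). intros y Hy. assert (Hy' : Rabs (y - (r1 + 1)) < 1) by exact Hy.
      apply Rabs_def2 in Hy'. symmetry. apply (Hrest y). lra. }
    assert (Q := is_derive_unique _ _ _ D1). rewrite (is_derive_unique _ _ _ D2) in Q. lra. }
  exists l. split; [lra|]. split; [exact HF|]. split; [exact Hgl|]. split.
  + intros eps He. exists (r1 + 1). intros r Hr.
    destruct (Hrest r ltac:(lra)) as [-> _]. rewrite Rminus_diag, Rabs_R0. exact He.
  + intros eps rho He. exists (Rmax rho (r1 + 1)).
    assert (M1 := Rmax_l rho (r1 + 1)). assert (M2 := Rmax_r rho (r1 + 1)).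
    destruct (Hrest (Rmax rho (r1 + 1)) ltac:(lra)) as (U2 & W2 & F2).
    split; [lra|]. split; [auto|]. split; [rewrite U2; lra|].
    split; [intros r _; apply Hnd|]. rewrite U2, F2, Rminus_diag, Rabs_R0. lra.
- assert (HEp : forall r, T <= r -> 0 < energy g u w r).
  { intros r Hr. destruct (HE r) as [H|H]; [exact H|]. exfalso. apply Hpos. eauto. }
  assert (Hturn : forall r, T <= r -> w r = 0 -> - (INR n / r) * w r - g (u r) < 0).
  { intros r Hr Ew. rewrite Ew. enough (0 < g (u r)) by lra.
    apply (turn_right g cm bm bp cp h C); [specialize (Hu r Hr); lra|].
    specialize (HEp r Hr). unfold energy in HEp. rewrite Ew in HEp. lra. }
  assert (Hmono : exists T1 sg, T <= T1 /\ (sg = 1 \/ sg = -1) /\ forall r, T1 <= r -> 0 <= sg * w r).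
  { destruct (classic (exists r, T <= r /\ w r <= 0)) as [(r & Hr & Hw)|Hno].
    - exists r, (-1). split; [exact Hr|]. split; [auto|]. intros s Hs.
      destruct (Req_dec s r) as [->|Hne]; [lra|].
      enough (w s < 0) by lra.
      apply (neg_stays w (fun r => - (INR n / r) * w r - g (u r)) r s).
      + intros x Hx. apply (sol_dw HS). lra.
      + exact Hw.
      + intros x Hx. apply Hturn. lra.
      + lra.
    - exists T, 1. split; [lra|]. split; [auto|]. intros r Hr.
      apply Rnot_lt_le. intros Hlt. apply Hno. exists r. split; lra. }
  destruct Hmono as (T1 & sg & HT1 & Hsg & Hw).
  assert (Sg2 : sg * sg = 1) by (destruct Hsg as [->| ->]; ring).
  assert (Dv : forall r, is_derive (fun r => sg * u r) r (sg * w r)) by (intros r; apply dR_scal, (sol_du HS)).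
  destruct (monotone_limit (fun r => sg * u r) T1 cp) as (lv & Hlv1 & Hlv2 & Hlv3).
  { intros r s Hr Hrs. apply (derive_nonneg (fun r => sg * u r) (fun r => sg * w r)); auto.
    - intros x _. apply (is_derive_cont _ _ _ (Dv x)).
    - intros x Hx. apply Hw. lra. }
  { intros r Hr. assert (A := Hu r ltac:(lra)). destruct Hsg as [->| ->]; lra. }
  set (l := sg * lv).
  assert (Hd : forall r, T1 <= r -> Rabs (u r - l) = lv - sg * u r).
  { intros r Hr. specialize (Hlv1 r Hr). unfold l.
    replace (u r - sg * lv) with (- sg * (lv - sg * u r)) by (replace (u r) with (sg * sg * u r) at 2 by (rewrite Sg2; ring); ring).
    rewrite Rabs_mult, (Rabs_pos_eq (lv - sg * u r)) by lra.
    destruct Hsg as [->| ->]; [rewrite Rabs_left|rewrite Rabs_pos_eq]; lra. }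
  assert (Hlim : forall eps, 0 < eps -> exists r0, T1 <= r0 /\ forall r, r0 <= r -> Rabs (u r - l) < eps).
  { intros eps He. destruct (Hlv3 eps He) as (r0 & Hr0 & H). exists r0. split; [exact Hr0|].
    intros r Hr. rewrite Hd by lra. specialize (H r Hr). lra. }
  assert (Hl : 0 <= l <= cp).
  { split; apply Rnot_lt_le; intros Hlt.
    - destruct (Hlim (- l)) as (r0 & Hr0 & H); [lra|]. specialize (H r0 (Rle_refl _)).
      apply Rabs_def2 in H. assert (A := Hu r0 ltac:(lra)). lra.
    - destruct (Hlim (l - cp)) as (r0 & Hr0 & H); [lra|]. specialize (H r0 (Rle_refl _)).
      apply Rabs_def2 in H. assert (A := Hu r0 ltac:(lra)). lra. }
  destruct (monotone_limit (fun r => - energy g u w r) T1 0) as (le & Hle1 & Hle2 & Hle3).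
  { intros r s Hr Hrs. assert (A := energy_noninc Hg HS r s Hrs). lra. }
  { intros r Hr. specialize (HE r). lra. }
  assert (HFl : forall eps, 0 < eps -> exists r0, T1 <= r0 /\ forall r, r0 <= r -> Rabs (Fint g (u r) - Fint g l) < eps).
  { intros eps He. destruct (continuous_eps (Fint g) l (Fint_cont g l Hg) eps He) as (d & Hd0 & Hd').
    destruct (Hlim d Hd0) as (r0 & Hr0 & H). exists r0. split; [exact Hr0|].
    intros r Hr. apply Hd', H, Hr. }
  assert (Hw2 : forall eps, 0 < eps -> exists r0, T1 <= r0 /\ forall r, r0 <= r ->
    Rabs (w r ^ 2 / 2 - (- le - Fint g l)) < eps).
  { intros eps He. destruct (HFl (eps / 2)) as (r1 & Hr1 & H1); [lra|].
    destruct (Hle3 (eps / 2)) as (r2 & Hr2 & H2); [lra|].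
    exists (Rmax r1 r2). split; [apply Rle_trans with (1 := Hr1), Rmax_l|]. intros r Hr.
    assert (A1 := Rmax_l r1 r2). assert (A2 := Rmax_r r1 r2).
    specialize (H1 r ltac:(lra)). specialize (H2 r ltac:(lra)). specialize (Hle1 r ltac:(lra)).
    unfold energy in H2, Hle1. apply Rabs_def2 in H1. apply Rabs_def1; lra. }
  assert (Hq : - le - Fint g l = 0).
  { set (q := - le - Fint g l) in *.
    destruct (Rtotal_order q 0) as [H|[H|H]]; [exfalso|exact H|exfalso].
    - destruct (Hw2 (- q)) as (r0 & _ & H'); [lra|]. specialize (H' r0 (Rle_refl _)).
      apply Rabs_def2 in H'. assert (A := pow2_ge_0 (w r0)). lra.
    - destruct (Hw2 (q / 2)) as (r0 & Hr0 & H'); [lra|].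
      destruct (below2 1 q) as (c & Hc & Hc1 & Hc2); [lra|lra|].
      apply (growth_unbounded (fun r => sg * u r) (fun r => sg * w r) r0 c cp Hc).
      + intros r _. apply Dv.
      + intros r Hr. specialize (H' r Hr). apply Rabs_def2 in H'.
        specialize (Hw r ltac:(lra)). apply Rnot_lt_le. intros Hlt.
        replace (w r ^ 2) with (sg * sg * w r ^ 2) in H' by (rewrite Sg2; ring).
        assert ((sg * w r) * (sg * w r) <= c * 1) by (apply Rmult_le_compat; lra).
        replace (sg * sg * w r ^ 2) with ((sg * w r) * (sg * w r)) in H' by ring. lra.
      + intros r Hr. specialize (Hlv1 r ltac:(lra)). lra. }
  assert (Hw0 : forall eps, 0 < eps -> exists r0, T1 <= r0 /\ forall r, r0 <= r -> Rabs (w r) < eps).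
  { intros eps He. destruct (Hw2 (eps * eps / 2)) as (r0 & Hr0 & H'); [nra|].
    exists r0. split; [exact Hr0|]. intros r Hr. specialize (H' r Hr). rewrite Hq, Rminus_0_r in H'.
    apply Rabs_def2 in H'. apply abs_lt_sqr; lra. }
  assert (Hgl : g l = 0).
  { apply NNPP. intros Hne.
    set (c := Rabs (g l)). assert (Hc : 0 < c) by (apply Rabs_pos_lt, Hne).
    assert (Hs : exists s, (s = 1 \/ s = -1) /\ s * g l = c).
    { unfold c. destruct (Rle_dec 0 (g l)); [exists 1|exists (-1)];
        [rewrite Rabs_pos_eq|rewrite Rabs_left]; lra. }
    destruct Hs as (s & Hs1 & Hs2).
    destruct (continuous_eps g l (Hg l) (c / 4)) as (d & Hd0 & Hd'); [lra|].
    destruct (Hlim d Hd0) as (r1 & Hr1 & H1).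
    destruct (Hw0 (Rmin 1 (c / (4 * INR n)))) as (r2 & Hr2 & H2).
    { pos. }
    set (r0 := Rmax 1 (Rmax r1 r2)).
    assert (A0 : 1 <= r0) by apply Rmax_l.
    assert (A1 : r1 <= r0) by (eapply Rle_trans; [apply Rmax_l|apply Rmax_r]).
    assert (A2 : r2 <= r0) by (eapply Rle_trans; [apply Rmax_r|apply Rmax_r]).
    apply (growth_unbounded (fun r => - s * w r) (fun r => - s * (- (INR n / r) * w r - g (u r))) r0 (c / 2) 1).
    - lra.
    - intros r Hr. apply dR_scal, (sol_dw HS). lra.
    - intros r Hr. specialize (H1 r ltac:(lra)). specialize (H2 r ltac:(lra)).
      specialize (Hd' _ H1).
      assert (W : Rabs (INR n / r * w r) <= c / 4).
      { rewrite Rabs_mult.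
        assert (0 <= INR n / r <= INR n).
        { split; [pos|].
          apply Rmult_le_reg_r with r; [lra|]. unfold Rdiv. rewrite Rmult_assoc, Rinv_l by lra. nra. }
        rewrite (Rabs_pos_eq (INR n / r)) by lra.
        apply Rle_trans with (INR n * (c / (4 * INR n))); [|right; field; lra].
        apply Rmult_le_compat; [lra|apply Rabs_pos|lra|].
        left. apply Rlt_le_trans with (1 := H2), Rmin_r. }
      apply Rabs_def2 in Hd'. apply Rabs_le_between in W.
      destruct Hs1 as [->| ->]; lra.
    - intros r Hr. specialize (H2 r ltac:(lra)).
      assert (Rabs (w r) < 1) by (apply Rlt_le_trans with (1 := H2), Rmin_l).
      apply Rabs_def2 in H. destruct Hs1 as [->| ->]; lra. }
  assert (Hlb : l <= bp).
  { apply Rnot_lt_le. intros Hlt. assert (A := ct_gp C l). lra. }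
  assert (HF0 : Fint g l = 0).
  { assert (A := ct_F_le C l). lra. }
  exists l. split; [lra|]. split; [exact HF0|]. split; [exact Hgl|]. split.
  + intros eps He. destruct (Hlim eps He) as (r0 & _ & H). eauto.
  + intros eps rho He.
    destruct (Hw0 1 Rlt_0_1) as (r1 & Hr1 & H1).
    destruct (Hlim (Rmin eps (eps / INR n))) as (r2 & Hr2 & H2).
    { pos. }
    destruct (Hle3 eps He) as (r3 & Hr3 & H3).
    set (r4 := Rmax r1 (Rmax r2 r3)). max_of r0 rho r4 as A0 A4.
    assert (A1 : r1 <= r0) by (apply Rle_trans with (2 := A4), Rmax_l).
    assert (A2 : r2 <= r0).
    { apply Rle_trans with (2 := A4). eapply Rle_trans; [apply Rmax_l|apply Rmax_r]. }
    assert (A3 : r3 <= r0).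
    { apply Rle_trans with (2 := A4). eapply Rle_trans; [apply Rmax_r|apply Rmax_r]. }
    exists r0. split; [lra|]. split; [auto|]. split; [assert (A := Hu r0 ltac:(lra)); lra|].
    split; [intros r _; apply Hnd|].
    specialize (H2 r0 A2). specialize (H3 r0 A3).
    assert (D1 : Rabs (u r0 - l) < eps) by (apply Rlt_le_trans with (1 := H2), Rmin_l).
    assert (D2 : Rabs (u r0 - l) < eps / INR n) by (apply Rlt_le_trans with (1 := H2), Rmin_r).
    split; [exact D1|]. split; [lra|].
    assert (Hb : energy g u w r0 <= INR n / r0 * Rabs (u r0 - l)).
    { apply Rnot_lt_le. intros Hlt.
      destruct (Hle3 (energy g u w r0 - INR n / r0 * Rabs (u r0 - l))) as (r5 & Hr5 & H4); [lra|].
      max_of r' r0 r5 as Q1 Q2.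
      specialize (H4 r' Q2).
      assert (L := energy_loss n g a u w r0 r' 1 Hg HS ltac:(lra)
        ltac:(destruct Hsg as [E| E]; rewrite E in Hw; [left|right]; intros s Hs; specialize (Hw s ltac:(lra)); lra)
        ltac:(intros s Hs; left; apply H1; lra)).
      assert (V : Rabs (u r' - u r0) <= Rabs (u r0 - l)).
      { rewrite (Hd r0) by lra.
        assert (B1 := Hlv1 r' ltac:(lra)).
        assert (B2 : sg * u r0 <= sg * u r').
        { apply (derive_nonneg (fun r => sg * u r) (fun r => sg * w r)); auto.
          - intros x _. apply (is_derive_cont _ _ _ (Dv x)).
          - intros x Hx. apply Hw. lra. }
        apply Rabs_le. destruct Hsg as [E| E]; rewrite E in *; lra. }
      assert (INR n / r0 * 1 * Rabs (u r' - u r0) <= INR n / r0 * Rabs (u r0 - l)).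
      { rewrite Rmult_1_r. apply Rmult_le_compat_l; [|exact V].
        apply Rmult_le_pos; [lra|left; pos]. }
      lra. }
    apply Rle_lt_trans with (INR n * Rabs (u r0 - l)).
    * replace (INR n * Rabs (u r0 - l)) with (r0 * (INR n / r0 * Rabs (u r0 - l))) by (field; lra).
      apply Rmult_le_compat_l; lra.
    * apply Rlt_le_trans with (INR n * (eps / INR n)); [apply Rmult_lt_compat_l; lra|right; field; lra].
Qed.

Lemma settles_mirror g u w l : (forall x, continuous g x) ->
  settles (mirror g) (fun r => - u r) (fun r => - w r) l -> settles g u w (- l).
Proof.
intros Hg [H1 H2]. split.
- intros eps He. destruct (H1 eps He) as (r0 & H). exists r0. intros r Hr.
  specialize (H r Hr). replace (u r - - l) with (- (- u r - l)) by ring. rewrite Rabs_Ropp. exact H.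
- intros eps rho He. destruct (H2 eps rho He) as (r0 & A1 & A0 & A2 & A3 & A4 & A5 & A6).
  rewrite energy_mirror in A5, A6 by exact Hg. exists r0.
  split; [exact A1|]. split; [intros Hl; apply A0; lra|]. split; [lra|]. split.
  + intros r Hr [E1 E2]. apply (A3 r Hr). rewrite E1, E2. split; ring.
  + split; [|split; assumption].
    replace (u r0 - - l) with (- (- u r0 - l)) by ring. rewrite Rabs_Ropp. exact A4.
Qed.

(** Infinitely many simple zeros would produce infinitely many sign changes. *)
Lemma eventual_sign (u w : R -> R) k :
  (forall r, is_derive u r (w r)) -> (forall r, ~ (u r = 0 /\ w r = 0)) ->
  ~ alternates u (S k) ->
  exists T, 0 < T /\ ((forall r, T <= r -> 0 < u r) \/ (forall r, T <= r -> u r < 0)).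
Proof.
intros Hu Hnd Hk.
assert (Hcu : forall x, continuous u x) by (intros x; apply (is_derive_cont _ _ _ (Hu x))).
assert (Hj : exists j, alternates u j /\ ~ alternates u (S j)).
{ induction k as [|k IH].
  - exists 0%nat. split; [|exact Hk]. apply alternates_alt_end. exists 1. constructor. lra.
  - destruct (classic (alternates u (S k))) as [H|H]; [exists (S k); auto|auto]. }
destruct Hj as (j & Hj1 & Hj2). apply alternates_alt_end in Hj1. destruct Hj1 as [r Hr].
assert (Hr0 := alt_end_pos _ _ _ Hr).
assert (Hno : forall s t, r < s -> s < t -> ~ u s * u t < 0).
{ intros s t Hs Ht Hneg. apply Hj2. apply alternates_alt_end.
  destruct (Rtotal_order (u r * u s) 0) as [H|[H|H]].
  - exists s. apply (alt_end_S u j r); assumption.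
  - inversion Hr; subst.
    + exists t. apply (alt_end_S u 0 s); [constructor; lra|exact Ht|exact Hneg].
    + assert (u r <> 0) by nra. assert (u s <> 0) by nra. exfalso. apply Rmult_integral in H. tauto.
  - exists t. apply (alt_end_S u j s); [apply (alt_end_later u j r); [exact Hr|lra|exact H]|exact Ht|exact Hneg]. }
assert (Hnz : forall s, r < s -> u s <> 0).
{ intros s Hs E. assert (Hw : w s <> 0) by (intros E'; exact (Hnd s (conj E E'))).
  assert (Hsg : exists sg, (sg = 1 \/ sg = -1) /\ sg * w s < 0).
  { destruct (Rlt_dec 0 (w s)); [exists (-1)|exists 1]; split; auto; lra. }
  destruct Hsg as (sg & Hsg & Hneg).
  destruct (derive_neg_local (fun x => sg * u x) s (sg * w s)) as (d & Hd & H1 & H2);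
    [apply dR_scal, Hu|exact Hneg|].
  destruct (below2 (d / 2) ((s - r) / 2)) as (e & He & He1 & He2); [lra|lra|].
  apply (Hno (s - e) (s + e)); [lra|lra|].
  specialize (H1 (s + e) ltac:(lra)). specialize (H2 (s - e) ltac:(lra)).
  cbv beta in H1, H2. rewrite E in H1, H2. destruct Hsg as [->| ->]; nra. }
exists (r + 1). split; [lra|].
assert (Hs : forall s, r + 1 <= s -> 0 < u (r + 1) * u s).
{ intros s Hs. apply const_sign; [exact Hs|intros; apply Hcu|intros; apply Hnz; lra]. }
assert (H0 := Hnz (r + 1) ltac:(lra)).
destruct (Rlt_dec 0 (u (r + 1))); [left|right]; intros s Hs'; specialize (Hs s Hs'); nra.
Qed.

(** Finitely many sign changes mean a constant sign from some time on; negative signs are treated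
    by reflection. *)
Theorem trapped_or_settles n g cm bm bp cp h a u w R k :
  (1 <= n)%nat -> central g cm bm bp cp h -> a <> 0 -> sol n g a u w -> rests u w -> 0 < R ->
  ~ alternates u (S k) -> (forall r, R <= r -> cm <= u r <= cp) ->
  (exists r, R < r /\ energy g u w r < 0) \/
  exists l, bm <= l <= bp /\ Fint g l = 0 /\ g l = 0 /\ settles g u w l.
Proof.
intros Hn C Ha HS Hrest HR Hk HK.
assert (Hg := ct_cont C). assert (Bm := ct_bm C). assert (Bp := ct_bp C).
destruct (classic (exists r, R < r /\ energy g u w r < 0)) as [H|Hno]; [left; exact H|right].
assert (HE : forall r, 0 <= energy g u w r).
{ intros r. apply Rnot_lt_le. intros Hlt. apply Hno. exists (Rmax (R + 1) r).
  assert (A := Rmax_l (R + 1) r). assert (B := Rmax_r (R + 1) r). split; [lra|].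
  assert (D := energy_noninc Hg HS r (Rmax (R + 1) r) B). lra. }
destruct (classic (exists r, u r = 0 /\ w r = 0)) as [(rz & Ez1 & Ez2)|Hnd].
- assert (Hrz : 0 <= rz).
  { apply Rnot_lt_le. intros H. apply Ha. rewrite <- Ez1. symmetry. apply (sol_init HS rz). lra. }
  destruct (first_double_zero u w rz) as (t & Ht & [Et1 Et2] & Hfirst); auto.
  { intros; apply (sol_cu HS). } { apply (sol_cw HS). }
  assert (Ht0 : 0 < t).
  { destruct (proj1 Ht) as [H|H]; [exact H|]. exfalso. apply Ha. rewrite <- Et1. symmetry.
    apply (sol_init HS t). lra. }
  assert (E0 : energy g u w t = 0) by (unfold energy; rewrite Et1, Et2, Fint_0; lra).
  exists 0. split; [lra|]. split; [apply Fint_0|]. split; [apply (ct_g0 C)|]. split.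
  + intros eps He. exists t. intros r Hr. rewrite (Hrest t Et1 Et2 r Hr), Rminus_diag, Rabs_R0. exact He.
  + intros eps rho He.
    destruct (continuous_eps u t (sol_cu HS t) eps He) as (d1 & D1 & D1').
    set (eps' := Rmin eps (eps / (t + 1))).
    assert (He' : 0 < eps') by pos.
    assert (He1 : eps' <= eps) by apply Rmin_l.
    assert (He2 : t * eps' < eps).
    { apply Rlt_le_trans with ((t + 1) * eps'); [nra|].
      apply Rle_trans with ((t + 1) * (eps / (t + 1))); [apply Rmult_le_compat_l; [lra|apply Rmin_r]|right; field; lra]. }
    destruct (continuous_eps (energy g u w) t (energy_cont Hg HS t) eps' He') as (d2 & D2 & D2').
    destruct (below3 (t / 2) d1 d2) as (d & Hd & Hd0 & Hd1 & Hd2); [lra|lra|lra|].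
    assert (Hr0 : exists r0, t - d < r0 < t /\ u r0 <> 0).
    { apply NNPP. intros Hz.
      assert (Hz' : forall s, t - d < s < t -> u s = 0).
      { intros s Hs. apply NNPP. intros Hne. apply Hz. exists s; auto. }
      destruct (mean_value u w (t - d * 2 / 3) (t - d / 3)) as (c & Hc & Ec);
        [lra|intros; apply (sol_du HS)|].
      rewrite (Hz' (t - d / 3)), (Hz' (t - d * 2 / 3)) in Ec by lra.
      apply (Hfirst c); [lra|]. split; [apply Hz'; lra|nra]. }
    destruct Hr0 as (r0 & Hr0 & Hu0). exists r0.
    split; [lra|]. split; [intros Hl; contradiction|]. split; [exact Hu0|].
    split; [intros r Hr; apply Hfirst; lra|].
    assert (A1 := D1' r0 ltac:(apply Rabs_def1; lra)). rewrite Et1 in A1.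
    assert (A2 := D2' r0 ltac:(apply Rabs_def1; lra)). rewrite E0, Rminus_0_r in A2.
    apply Rabs_def2 in A2. split; [exact A1|]. split; [lra|].
    assert (0 <= energy g u w r0) by apply HE.
    apply Rle_lt_trans with (t * eps'); [apply Rmult_le_compat; lra|exact He2].
- assert (Hnd' : forall r, ~ (u r = 0 /\ w r = 0)) by (intros r H; apply Hnd; eauto).
  destruct (eventual_sign u w k (sol_du HS) Hnd' Hk) as (T0 & HT0 & Hsg).
  max_of T T0 R as A1 A2.
  destruct Hsg as [Hs|Hs].
  + destruct (settle_right n g cm bm bp cp h a u w T Hn C HS) as (l & L1 & L2 & L3 & L4); auto.
    * lra.
    * intros r Hr. assert (Q := Hs r ltac:(lra)). assert (Q' := HK r ltac:(lra)). lra.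
    * exists l. split; [lra|auto].
  + destruct (settle_right n (mirror g) (- cp) (- bp) (- bm) (- cm) h (- a)
      (fun r => - u r) (fun r => - w r) T Hn) as (l & L1 & L2 & L3 & L4); auto.
    * apply central_mirror, C.
    * apply sol_mirror, HS.
    * lra.
    * intros r [E1 E2]. apply (Hnd' r). split; lra.
    * intros r Hr. assert (Q := Hs r ltac:(lra)). assert (Q' := HK r ltac:(lra)). lra.
    * intros r. rewrite energy_mirror by exact Hg. apply HE.
    * rewrite Fint_mirror in L2 by exact Hg. unfold mirror in L3.
      exists (- l). split; [lra|]. split; [exact L2|]. split; [lra|].
      apply settles_mirror; assumption.
Qed.

(** * Energy barriers *)

Section barrier.

Variables (n : nat) (g : R -> R) (a : R) (u w : R -> R).
Hypothesis Hn : (1 <= n)%nat.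
Hypothesis Hg : forall x, continuous g x.
Hypothesis HS : sol n g a u w.

Let H (r : R) : R := r * energy g u w r.

(** Both terms are nonpositive where [F <= 0]. *)
Lemma rE_derive r : 0 < r ->
  is_derive (fun r => r * energy g u w r) r (Fint g (u r) - (INR n - / 2) * w r ^ 2).
Proof.
intros Hr. eapply is_derive_eq.
- apply dR_mult; [apply dR_id|apply (energy_derive Hg HS r Hr)].
- unfold energy. field. lra.
Qed.

Lemma rE_cont r : continuous (fun r => r * energy g u w r) r.
Proof. apply cR_mult; [apply continuous_id|apply (energy_cont Hg HS)]. Qed.

Lemma n_half : / 2 <= INR n - / 2.
Proof. assert (1 <= INR n) by (apply (le_INR 1); lia). lra. Qed.

Lemma rE_noninc s0 s1 : 0 < s0 <= s1 ->
  (forall s, s0 < s < s1 -> Fint g (u s) <= 0) ->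
  s1 * energy g u w s1 <= s0 * energy g u w s0.
Proof.
intros Hs HF. assert (P := n_half).
apply (derive_nonpos (fun r => r * energy g u w r)
  (fun r => Fint g (u r) - (INR n - / 2) * w r ^ 2)).
- lra.
- intros; apply rE_cont.
- intros; apply rE_derive; lra.
- intros r Hr. specialize (HF r Hr). assert (Q := pow2_ge_0 (w r)). nra.
Qed.

(** Crossing a range where [F <= - t^2 / 2] costs an amount of [r * energy] that does not
    depend on the time of the crossing. *)
Lemma rE_crossing s0 s1 t : 0 < s0 <= s1 -> 0 <= t ->
  (forall s, s0 < s < s1 -> Fint g (u s) <= - (t * t) / 2) ->
  s1 * energy g u w s1 + t * Rabs (u s1 - u s0) <= s0 * energy g u w s0.
Proof.
intros Hs Ht HF. assert (P := n_half).
assert (Hmain : forall sg, (sg = 1 \/ sg = -1) ->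
  s1 * energy g u w s1 + t * (sg * u s1) <= s0 * energy g u w s0 + t * (sg * u s0)).
{ intros sg Hsg.
  apply (derive_nonpos (fun r => r * energy g u w r + t * (sg * u r))
    (fun r => Fint g (u r) - (INR n - / 2) * w r ^ 2 + t * (sg * w r))).
  - lra.
  - intros r _. apply cR_plus; [apply rE_cont|]. apply cR_scal, cR_scal, (sol_cu HS).
  - intros r Hr. apply dR_plus; [apply rE_derive; lra|]. apply dR_scal, dR_scal, (sol_du HS).
  - intros r Hr. specialize (HF r Hr). assert (Q := pow2_ge_0 (w r)).
    assert (Q2 := pow2_ge_0 (t - sg * w r)).
    assert (/ 2 * w r ^ 2 <= (INR n - / 2) * w r ^ 2) by (apply Rmult_le_compat_r; lra).
    assert (Esg : sg * sg = 1) by (destruct Hsg as [->| ->]; ring).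
    replace ((t - sg * w r) ^ 2) with (t * t - 2 * (t * (sg * w r)) + (sg * sg) * w r ^ 2) in Q2 by ring.
    rewrite Esg in Q2. lra. }
unfold Rabs. destruct (Rcase_abs (u s1 - u s0)).
- assert (A := Hmain (-1) (or_intror eq_refl)). lra.
- assert (A := Hmain 1 (or_introl eq_refl)). lra.
Qed.

End barrier.

(** An interval inside the well with a moat of positive depth at each end. *)
Record barrier (g : R -> R) (p p' q' q t : R) : Prop := {
  br_t : 0 < t; br_p : p < p'; br_m : p' < q'; br_q : q' < q;
  br_F : forall s, p <= s <= q -> Fint g s <= 0;
  br_left : forall s, p <= s <= p' -> Fint g s <= - (t * t) / 2;
  br_right : forall s, q' <= s <= q -> Fint g s <= - (t * t) / 2
}.

Lemma deep_interval g cm bm bp cp h lo hi : central g cm bm bp cp h ->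
  bm <= lo -> lo < hi -> hi <= bp ->
  exists x y t, lo < x /\ x < y /\ y < hi /\ 0 < t /\
    forall s, x <= s <= y -> Fint g s <= - (t * t) / 2.
Proof.
intros C H1 H2 H3. destruct (ct_F_dense C lo hi H1 H2 H3) as (s & Hs & HF).
destruct (continuous_lt (Fint g) s (Fint g s / 2)) as (d & Hd & Hd').
- apply Fint_cont, (ct_cont C).
- lra.
- destruct (below2 1 (- Fint g s)) as (t & Ht & Ht1 & Ht2); [lra|lra|].
  destruct (below2 (d / 2) ((hi - s) / 2)) as (e & He & He1 & He2); [lra|lra|].
  exists s, (s + e), t. split; [lra|]. split; [lra|]. split; [lra|]. split; [exact Ht|].
  intros x Hx. specialize (Hd' x ltac:(apply Rabs_def1; lra)).
  assert (t * t <= t * 1) by (apply Rmult_le_compat_l; lra). lra.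
Qed.

Lemma barrier_exists g cm bm bp cp h l eta : central g cm bm bp cp h ->
  bm < l < bp -> 0 < eta ->
  exists p p' q' q t, barrier g p p' q' q t /\ p' < l < q' /\
    l - eta < p /\ q < l + eta /\ bm < p /\ q < bp.
Proof.
intros C Hl He.
destruct (deep_interval g cm bm bp cp h l (Rmin bp (l + eta)) C) as (x1 & y1 & t1 & A1 & A2 & A3 & A4 & A5).
{ lra. } { apply Rmin_glb_lt; lra. } { apply Rmin_l. }
destruct (deep_interval g cm bm bp cp h (Rmax bm (l - eta)) l C) as (x2 & y2 & t2 & B1 & B2 & B3 & B4 & B5).
{ apply Rmax_l. } { apply Rmax_lub_lt; lra. } { lra. }
assert (M1 := Rmin_l bp (l + eta)). assert (M2 := Rmin_r bp (l + eta)).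
assert (M3 := Rmax_l bm (l - eta)). assert (M4 := Rmax_r bm (l - eta)).
set (t := Rmin t1 t2).
assert (T1 : t <= t1) by apply Rmin_l. assert (T2 : t <= t2) by apply Rmin_r.
assert (T0 : 0 < t) by (apply Rmin_pos; lra).
exists x2, y2, x1, y1, t. split; [|lra]. split; try lra.
- intros s Hs. apply (ct_F_le C). lra.
- intros s Hs. specialize (B5 s Hs). assert (t * t <= t2 * t2) by (apply Rmult_le_compat; lra). lra.
- intros s Hs. specialize (A5 s Hs). assert (t * t <= t1 * t1) by (apply Rmult_le_compat; lra). lra.
Qed.

(** Crossing one of the two moats would cost more than the available [r * energy]. *)
Lemma barrier_stays n g a u w p p' q' q t r0 r1 :
  (1 <= n)%nat -> (forall x, continuous g x) -> sol n g a u w -> barrier g p p' q' q t ->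
  0 < r0 <= r1 -> p' <= u r0 <= q' ->
  r0 * energy g u w r0 < t * (p' - p) -> r0 * energy g u w r0 < t * (q - q') ->
  0 <= energy g u w r1 -> p < u r1 < q.
Proof.
intros Hn Hg HS [T0 P1 P2 P3 HF HL HR] Hr Hu Hc1 Hc2 HE.
apply NNPP. intros Hout.
assert (Hcu : forall s, continuous u s) by (intros; apply (sol_cu HS)).
destruct (first_time (fun s => u s <= p \/ q <= u s) r0 r1) as (s1 & Hs1 & Hex & Hbef).
{ lra. } { lra. }
{ intros x Hx Hno. destruct (continuous_gt u x p) as (d1 & D1 & D1'); [auto|lra|].
  destruct (continuous_lt u x q) as (d2 & D2 & D2'); [auto|lra|].
  exists (Rmin d1 d2). split; [apply Rmin_pos; lra|]. intros y _ Hy.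
  specialize (D1' y ltac:(apply Rlt_le_trans with (1 := Hy), Rmin_l)).
  specialize (D2' y ltac:(apply Rlt_le_trans with (1 := Hy), Rmin_r)). lra. }
assert (Hin : forall s, r0 <= s < s1 -> p < u s < q) by (intros s Hs; specialize (Hbef s Hs); lra).
assert (HE1 : 0 <= s1 * energy g u w s1).
{ apply Rmult_le_pos; [lra|]. apply Rle_trans with (1 := HE).
  apply (energy_noninc Hg HS). lra. }
assert (Hdec : forall s, r0 <= s <= s1 -> s * energy g u w s <= r0 * energy g u w r0).
{ intros s Hs. apply (rE_noninc n g a u w Hn Hg HS); [lra|].
  intros x Hx. apply HF. specialize (Hin x ltac:(lra)). lra. }
destruct Hex as [Hex|Hex].
- destruct (last_ge u r0 s1 p') as (s0 & Hs0 & E0 & Haft); [lra|auto|lra|lra|].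
  assert (Hcr := rE_crossing n g a u w Hn Hg HS s0 s1 t ltac:(lra) ltac:(lra)
    ltac:(intros x Hx; apply HL; assert (A := Hin x ltac:(lra)); assert (B := Haft x ltac:(lra)); lra)).
  specialize (Hdec s0 ltac:(lra)).
  assert (p' - p <= Rabs (u s1 - u s0)) by (rewrite E0, Rabs_left1; lra).
  assert (t * (p' - p) <= t * Rabs (u s1 - u s0)) by (apply Rmult_le_compat_l; lra). lra.
- destruct (last_le u r0 s1 q') as (s0 & Hs0 & E0 & Haft); [lra|auto|lra|lra|].
  assert (Hcr := rE_crossing n g a u w Hn Hg HS s0 s1 t ltac:(lra) ltac:(lra)
    ltac:(intros x Hx; apply HR; assert (A := Hin x ltac:(lra)); assert (B := Haft x ltac:(lra)); lra)).
  specialize (Hdec s0 ltac:(lra)).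
  assert (q - q' <= Rabs (u s1 - u s0)) by (rewrite E0, Rabs_pos_eq; lra).
  assert (t * (q - q') <= t * Rabs (u s1 - u s0)) by (apply Rmult_le_compat_l; lra). lra.
Qed.

Lemma interior_min (f df : R -> R) (a b m : R) : a < m < b -> is_derive f m (df m) ->
  (forall s, a <= s <= b -> f m <= f s) -> df m = 0.
Proof.
intros Hm Hd Hmin. destruct (Rtotal_order (df m) 0) as [Hlt|[E|Hgt]]; [exfalso|exact E|exfalso].
- destruct (derive_neg_local f m (df m) Hd Hlt) as (d & Hd0 & H1 & _).
  destruct (below2 (d / 2) ((b - m) / 2)) as (e & He & He1 & He2); [lra|lra|].
  specialize (H1 (m + e) ltac:(lra)). specialize (Hmin (m + e) ltac:(lra)). lra.
- destruct (derive_neg_local (fun x => - f x) m (- df m)) as (d & Hd0 & _ & H1);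
    [apply dR_opp, Hd|lra|].
  destruct (below2 (d / 2) ((m - a) / 2)) as (e & He & He1 & He2); [lra|lra|].
  specialize (H1 (m - e) ltac:(lra)). specialize (Hmin (m - e) ltac:(lra)). lra.
Qed.

(** Between two further changes of sign the solution would turn at a point of the barrier where
    [F < 0], hence with negative energy, and could not vanish any more. *)
Lemma barrier_one_change n g a u w p p' q' q t r0 s1 s2 :
  (1 <= n)%nat -> (forall x, continuous g x) -> sol n g a u w -> barrier g p p' q' q t ->
  (forall s, p < s < q -> s <> 0 -> Fint g s < 0) ->
  0 < r0 -> p' <= u r0 <= q' ->
  r0 * energy g u w r0 < t * (p' - p) -> r0 * energy g u w r0 < t * (q - q') ->
  r0 < s1 < s2 -> u r0 * u s1 < 0 -> ~ u s1 * u s2 < 0.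
Proof.
intros Hn Hg HS Br Hneg Hr0 Hu Hc1 Hc2 Hs O1 O2.
assert (Hcu : forall s, continuous u s) by (intros; apply (sol_cu HS)).
assert (Hz : forall x y, x < y -> u x * u y < 0 -> exists z, x < z < y /\ u z = 0).
{ intros x y Hxy Ho. destruct (ivt u x y 0) as (z & Hz & E); [lra|auto| |].
  - destruct (Rle_dec (u x) 0); [left|right]; nra.
  - exists z. split; [|exact E]. assert (z <> x) by (intros ->; rewrite E in Ho; lra).
    assert (z <> y) by (intros ->; rewrite E in Ho; lra). lra. }
destruct (Hz r0 s1) as (z1 & Z1 & E1); [lra|exact O1|].
destruct (Hz s1 s2) as (z2 & Z2 & E2); [lra|exact O2|].
assert (HEz : 0 <= energy g u w z2).
{ assert (A := F_le_energy g u w z2). rewrite E2, Fint_0 in A. exact A. }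
assert (HE : forall s, s <= z2 -> 0 <= energy g u w s).
{ intros s Hs'. apply Rle_trans with (1 := HEz). apply (energy_noninc Hg HS), Hs'. }
assert (Hsg : exists sg, (sg = 1 \/ sg = -1) /\ sg * u s1 < 0).
{ assert (u s1 <> 0) by (intros E; rewrite E in O1; lra).
  destruct (Rlt_dec 0 (u s1)); [exists (-1)|exists 1]; split; auto; lra. }
destruct Hsg as (sg & Hsg & Hneg1).
destruct (cont_min (fun s => sg * u s) z1 z2) as (m & Hm & Hmin); [lra|intros; apply cR_scal, Hcu|].
assert (Hm1 : sg * u m < 0) by (specialize (Hmin s1 ltac:(lra)); lra).
assert (Hmi : z1 < m < z2).
{ assert (m <> z1) by (intros ->; rewrite E1 in Hm1; lra).
  assert (m <> z2) by (intros ->; rewrite E2 in Hm1; lra). lra. }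
assert (Wm : sg * w m = 0).
{ apply (interior_min (fun s => sg * u s) (fun s => sg * w s) z1 z2 m Hmi); [apply dR_scal, (sol_du HS)|exact Hmin]. }
assert (Wm' : w m = 0) by (destruct Hsg as [->| ->]; lra).
assert (Hin := barrier_stays n g a u w p p' q' q t r0 m Hn Hg HS Br ltac:(lra) Hu Hc1 Hc2 (HE m ltac:(lra))).
assert (A := Hneg (u m) Hin ltac:(intros E; rewrite E in Hm1; lra)).
assert (B := HE m ltac:(lra)). unfold energy in B. rewrite Wm' in B. lra.
Qed.

Lemma alt_end_upto v j r r0 : v r0 <> 0 -> alt_end v j r -> r <= r0 ->
  exists i, (j <= i)%nat /\ alt_end v i r0.
Proof.
intros H0 Hj Hr. assert (Q := alt_end_pos _ _ _ Hj).
destruct (Req_dec r r0) as [->|Hne]; [exists j; auto|].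
destruct (Rtotal_order (v r * v r0) 0) as [Hlt|[E|Hgt]].
- exists (S j). split; [lia|]. apply (alt_end_S v j r); [exact Hj|lra|exact Hlt].
- inversion Hj; subst.
  + exists 0%nat. split; [lia|constructor; lra].
  + apply Rmult_integral in E. destruct E as [E|E]; [rewrite E in H2; lra|contradiction].
- exists j. split; [lia|]. apply (alt_end_later v j r); assumption.
Qed.

Lemma alt_end_one_more v k r0 : 0 < r0 -> v r0 <> 0 ->
  (forall s1 s2, r0 < s1 < s2 -> v r0 * v s1 < 0 -> ~ v s1 * v s2 < 0) ->
  alternates v (S k) -> exists j, (k <= j)%nat /\ alt_end v j r0.
Proof.
intros Hr0 H0 Hone Hk. apply alternates_alt_end in Hk. destruct Hk as [r Hk].
destruct (Rle_dec r r0) as [Hr|Hr].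
{ destruct (alt_end_upto v (S k) r r0 H0 Hk Hr) as (i & Hi & A). exists i. split; [lia|exact A]. }
inversion Hk as [|j r1 r' Hj Hlt Hopp]; subst.
destruct (Rle_dec r1 r0) as [Hr1|Hr1].
{ apply (alt_end_upto v k r1 r0 H0 Hj Hr1). }
assert (Hsame : 0 < v r0 * v r1).
{ assert (v r1 <> 0) by (intros E; rewrite E in Hopp; lra).
  assert (N := Hone r1 r ltac:(lra)).
  destruct (Rtotal_order (v r0 * v r1) 0) as [Hl|[E|Hg]]; [exfalso; apply N; assumption| |exact Hg].
  apply Rmult_integral in E. tauto. }
inversion Hj as [|j0 r2 r1' Hj0 Hlt0 Hopp0]; subst.
{ exists 0%nat. split; [lia|constructor; exact Hr0]. }
assert (Hr2 : v r2 * v r0 < 0).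
{ rewrite Rmult_comm. apply (same_sign_trans _ (v r1)); [exact Hsame|lra]. }
assert (r2 < r0).
{ apply Rnot_le_lt. intros Hle. destruct Hle as [Hle|Hle].
  - apply (Hone r2 r1); [lra|lra|exact Hopp0].
  - subst r2. nra. }
exists (S j0). split; [lia|]. apply (alt_end_S v j0 r2); assumption.
Qed.

Lemma energy_close g u w r eps : (forall x, continuous g x) -> 0 < eps ->
  exists d, 0 < d /\ forall u' w' : R -> R, Rabs (u' r - u r) < d -> Rabs (w' r - w r) < d ->
    Rabs (energy g u' w' r - energy g u w r) < eps.
Proof.
intros Hg He.
destruct (continuous_eps (Fint g) (u r) (Fint_cont g _ Hg) (eps / 2)) as (d1 & D1 & H1); [lra|].
destruct (continuous_eps (fun x => x ^ 2 / 2) (w r)) with (eps := eps / 2) as (d2 & D2 & H2).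
{ apply cR_mult; [apply cR_pow|apply continuous_const]. } { lra. }
exists (Rmin d1 d2). split; [pos|]. intros u' w' Hu Hw.
specialize (H1 (u' r) ltac:(apply Rlt_le_trans with (1 := Hu), Rmin_l)).
specialize (H2 (w' r) ltac:(apply Rlt_le_trans with (1 := Hw), Rmin_r)).
unfold energy. apply Rabs_def2 in H1, H2. apply Rabs_def1; lra.
Qed.

Lemma alt_end_open u j r : alt_end u j r ->
  exists eps, 0 < eps /\ forall v : R -> R, (forall s, 0 <= s <= r -> Rabs (v s - u s) < eps) -> alt_end v j r.
Proof.
induction 1 as [r Hr|j r r' Hj (e & He & IH) Hlt Hopp].
- exists 1. split; [lra|]. intros v _. constructor. exact Hr.
- assert (Hr := alt_end_pos _ _ _ Hj).
  assert (A1 : u r <> 0) by nra. assert (A2 : u r' <> 0) by nra.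
  destruct (below3 e (Rabs (u r)) (Rabs (u r'))) as (e' & He' & M1 & M2 & M3);
    [exact He|apply Rabs_pos_lt, A1|apply Rabs_pos_lt, A2|].
  exists e'. split; [exact He'|]. intros v Hv.
  apply (alt_end_S v j r); [|exact Hlt|].
  + apply IH. intros s Hs. specialize (Hv s ltac:(lra)). lra.
  + assert (S1 := close_same_sign _ _ _ (Hv r ltac:(lra)) ltac:(lra)).
    assert (S2 := close_same_sign _ _ _ (Hv r' ltac:(lra)) ltac:(lra)).
    apply (same_sign_trans _ (u r)); [lra|]. rewrite Rmult_comm.
    apply (same_sign_trans _ (u r')); [lra|]. lra.
Qed.

Lemma rests_no_double_zero u w r : rests u w -> u r <> 0 -> no_double_zero u w r.
Proof. intros Hr Hu s Hs [E1 E2]. apply Hu. apply (Hr s E1 E2). lra. Qed.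

(** * Falling from the edge of the well *)

Section edge.

Variables (n : nat) (g : R -> R) (cm bm bp cp h q' q t : R).
Hypothesis Hn : (1 <= n)%nat.
Hypothesis C : central g cm bm bp cp h.
Hypothesis Hq : 0 < q' < q /\ q < bp.
Hypothesis Ht : 0 < t.
Hypothesis Hdeep : forall s, q' <= s <= q -> Fint g s <= - (t * t) / 2.

Let c := t * (q - q').

(** At time [r0] the product [r * energy] is too small for crossing the moat [[q', q]], so a fall
    to [0], which happens first at [z], has to wait. *)
Record falls (r0 : R) (u w : R -> R) (z : R) : Prop := {
  fl_sol : exists a, sol n g a u w;
  fl_r0 : 0 < r0 < z;
  fl_u : q < u r0 < cp;
  fl_E : energy g u w r0 < h;
  fl_H : r0 * energy g u w r0 < c / 32;
  fl_z : u z = 0;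
  fl_pos : forall r, r0 <= r < z -> 0 < u r
}.

Definition last_at_edge (u : R -> R) (z T : R) : Prop :=
  T < z /\ u T = bp /\ forall r, T < r <= z -> u r < bp.

Section one_fall.

Variables (r0 : R) (u w : R -> R) (z : R).
Hypothesis Fl : falls r0 u w z.

Lemma c_pos : 0 < c.
Proof. unfold c. apply Rmult_lt_0_compat; lra. Qed.

Lemma fl_cont r : continuous u r.
Proof. destruct (fl_sol _ _ _ _ Fl) as [a S]. apply (sol_cu S). Qed.

Lemma fl_mono r s : r <= s -> energy g u w s <= energy g u w r.
Proof. destruct (fl_sol _ _ _ _ Fl) as [a S]. apply (energy_noninc (ct_cont C) S). Qed.

Lemma fall_energy_nonneg r : r <= z -> 0 <= energy g u w r.
Proof.
intros Hr. apply Rle_trans with (energy g u w z); [|apply fl_mono, Hr].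
assert (A := F_le_energy g u w z). rewrite (fl_z _ _ _ _ Fl), Fint_0 in A. exact A.
Qed.

Lemma fall_energy_pos r : r0 <= r < z -> 0 < energy g u w r.
Proof.
intros Hr. destruct (fall_energy_nonneg r ltac:(lra)) as [H|H]; [exact H|exfalso].
destruct (fl_sol _ _ _ _ Fl) as [a S]. assert (H0 := fl_r0 _ _ _ _ Fl).
assert (A := fall_energy_nonneg z (Rle_refl _)).
destruct (energy_const_rest (ct_cont C) S r z Hn) as [B _]; [lra|lra|].
specialize (B z ltac:(lra)). rewrite (fl_z _ _ _ _ Fl) in B.
assert (D := fl_pos _ _ _ _ Fl r Hr). lra.
Qed.

Lemma fall_below_cp r : r0 <= r -> u r < cp.
Proof.
intros Hr. destruct (fl_sol _ _ _ _ Fl) as [a S]. assert (H1 := fl_u _ _ _ _ Fl).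
assert (B1 := ct_cm C). assert (B2 := ct_bm C).
apply (stays_inside n g cm bm bp cp h C a u w r0 S); [lra|apply (fl_E _ _ _ _ Fl)|exact Hr].
Qed.

Lemma fall_no_turn r : r0 <= r < z -> u r <= bp -> w r <> 0.
Proof.
intros Hr Hu E. assert (A := fall_energy_pos r Hr). unfold energy in A. rewrite E in A.
assert (B := fl_pos _ _ _ _ Fl r Hr). assert (D := ct_F_le C (u r)). assert (D' := ct_bm C). lra.
Qed.

(** A dip below the edge would contain a turning point, impossible with positive energy. *)
Lemma fall_no_dip r1 r2 r3 : r0 <= r1 -> r1 < r2 -> r2 < r3 -> r3 <= z ->
  u r2 <= bp -> u r2 < u r1 -> u r2 <= u r3 -> False.
Proof.
intros H0 H1 H2 H3 Hb Hu1 Hu3.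
destruct (fl_sol _ _ _ _ Fl) as [a S].
destruct (cont_min u r1 r3) as (m & Hm & Hmin); [lra|intros; apply fl_cont|].
assert (Hm2 := Hmin r2 ltac:(lra)).
assert (Hex : exists x, r1 < x < r3 /\ u x <= u r2 /\ forall s, r1 <= s <= r3 -> u x <= u s).
{ destruct (Req_dec m r3) as [E|E].
  - subst m. exists r2. split; [lra|]. split; [lra|]. intros s Hs. specialize (Hmin s Hs). lra.
  - exists m. split; [|split; [exact Hm2|exact Hmin]].
    assert (m <> r1) by (intros ->; lra). lra. }
destruct Hex as (x & Hx & Hx2 & Hxm).
assert (W := interior_min u w r1 r3 x Hx (sol_du S x) Hxm).
apply (fall_no_turn x); [lra|lra|exact W].
Qed.

(** The fall crosses the moat [[q', q]] after [s]. *)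
Lemma fall_cost s : r0 <= s <= z -> q <= u s -> (forall r, s < r < z -> u r <= bp) ->
  c <= s * energy g u w s.
Proof.
intros Hs Hu Hb. destruct (fl_sol _ _ _ _ Fl) as [a S]. assert (Hg := ct_cont C).
assert (H0 := fl_r0 _ _ _ _ Fl). assert (Hz := fl_z _ _ _ _ Fl).
assert (Bm := ct_bm C).
assert (HF : forall r, s < r < z -> Fint g (u r) <= 0).
{ intros r Hr. apply (ct_F_le C). specialize (Hb r Hr).
  assert (A := fl_pos _ _ _ _ Fl r ltac:(lra)). lra. }
destruct (first_le u s z q') as (s1 & Hs1 & E1 & Bef1); [lra|intros; apply fl_cont|lra|lra|].
destruct (last_ge u s s1 q) as (s0 & Hs0 & E0 & Aft0); [lra|intros; apply fl_cont|exact Hu|lra|].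
assert (A1 := rE_noninc n g a u w Hn Hg S s s0 ltac:(lra) ltac:(intros x Hx; apply HF; lra)).
assert (A2 := rE_crossing n g a u w Hn Hg S s0 s1 t ltac:(lra) ltac:(lra)
  ltac:(intros x Hx; apply Hdeep; assert (Q1 := Aft0 x ltac:(lra)); assert (Q2 := Bef1 x ltac:(lra)); lra)).
rewrite E0, E1, Rabs_left in A2 by lra.
assert (0 <= s1 * energy g u w s1) by (apply Rmult_le_pos; [lra|apply fall_energy_nonneg; lra]).
unfold c. lra.
Qed.

Lemma last_at_edge_exists : exists T, r0 <= T /\ last_at_edge u z T.
Proof.
assert (H0 := fl_r0 _ _ _ _ Fl). assert (H1 := fl_u _ _ _ _ Fl). assert (Hc := c_pos).
assert (Hex : exists s, r0 <= s <= z /\ bp <= u s).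
{ apply NNPP. intros Hno.
  assert (A := fall_cost r0 ltac:(lra) ltac:(lra)
    ltac:(intros r Hr; left; apply Rnot_le_lt; intros Hle; apply Hno; exists r; split; lra)).
  assert (B := fl_H _ _ _ _ Fl). lra. }
destruct Hex as (s & Hs & Hus). assert (Bp := ct_bp C).
destruct (last_ge u s z bp) as (T & HT & ET & Aft); [lra|intros; apply fl_cont|exact Hus|rewrite (fl_z _ _ _ _ Fl); exact Bp|].
exists T. split; [lra|]. split; [lra|]. split; assumption.
Qed.

Variable T : R.
Hypothesis HT0 : r0 <= T.
Hypothesis HT : last_at_edge u z T.

Lemma edge_cost : c <= T * energy g u w T.
Proof.
destruct HT as (H1 & H2 & H3). apply fall_cost; [lra|lra|]. intros r Hr. left. apply H3. lra.
Qed.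

(** At time [r0] the product [r * energy] is far below the cost of the fall, and the energy does
    not increase; so the fall takes place much later. *)
Lemma edge_late : 16 * r0 < T.
Proof.
apply Rnot_le_lt. intros Hle. assert (A := edge_cost). assert (B := fl_H _ _ _ _ Fl).
assert (Hc := c_pos). assert (H0 := fl_r0 _ _ _ _ Fl).
assert (M := fl_mono r0 T HT0). assert (P := fall_energy_nonneg r0 ltac:(lra)).
destruct HT as (HTz & _).
assert (P2 := fall_energy_nonneg T ltac:(lra)).
assert (T * energy g u w T <= 16 * r0 * energy g u w r0) by (apply Rmult_le_compat; lra).
lra.
Qed.

Lemma edge_velocity : w T < 0.
Proof.
destruct HT as (H1 & H2 & H3). assert (Q := fall_no_turn T ltac:(lra) ltac:(lra)).
destruct (fl_sol _ _ _ _ Fl) as [a S].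
apply Rnot_le_lt. intros Hle. assert (Hpos : 0 < w T) by lra.
destruct (derive_neg_local (fun x => - u x) T (- w T)) as (d & Hd & A & _);
  [apply dR_opp, (sol_du S)|lra|].
destruct (below2 (d / 2) (z - T)) as (e & He & He1 & He2); [lra|lra|].
specialize (A (T + e) ltac:(lra)). specialize (H3 (T + e) ltac:(lra)). lra.
Qed.

Lemma above_edge r : T / 16 <= r < T -> bp < u r.
Proof.
intros Hr. apply Rnot_le_lt. intros Hle.
assert (L := edge_late). assert (H0 := fl_r0 _ _ _ _ Fl). assert (Hc := c_pos).
destruct HT as (HTz & HuT & _). destruct (fl_sol _ _ _ _ Fl) as [a S].
assert (Hb : forall s, r0 <= s <= r -> u s <= bp).
{ intros s Hs. apply Rnot_lt_le. intros Hlt.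
  assert (s <> r) by (intros ->; lra).
  apply (fall_no_dip s r T); lra. }
assert (A := rE_noninc n g a u w Hn (ct_cont C) S r0 r ltac:(lra)
  ltac:(intros x Hx; apply (ct_F_le C); assert (B1 := Hb x ltac:(lra));
        assert (B2 := fl_pos _ _ _ _ Fl x ltac:(lra)); assert (B3 := ct_bm C); lra)).
assert (B := fl_H _ _ _ _ Fl). assert (D := edge_cost).
assert (M := fl_mono r T ltac:(lra)). assert (P := fall_energy_nonneg T ltac:(lra)).
assert (P' := fall_energy_nonneg r ltac:(lra)).
assert (T * energy g u w T <= 16 * r * energy g u w r) by (apply Rmult_le_compat; lra).
lra.
Qed.

Lemma above_edge_flux r s : T / 16 <= r <= s -> s <= T -> s ^ n * w s <= r ^ n * w r.
Proof.
intros Hr Hs. destruct (fl_sol _ _ _ _ Fl) as [a S].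
assert (L := edge_late). assert (H0 := fl_r0 _ _ _ _ Fl).
apply (derive_nonpos (fun x => x ^ n * w x) (fun x => - (x ^ n * g (u x)))).
- lra.
- intros x _. apply cR_mult; [apply cR_pow|apply (sol_cw S)].
- intros x Hx. apply (sol_flux S). lra.
- intros x Hx. enough (0 <= x ^ n * g (u x)) by lra.
  apply Rmult_le_pos; [pos|]. left. apply (ct_gp C).
  assert (A := above_edge x ltac:(lra)). assert (B := fall_below_cp x ltac:(lra)). lra.
Qed.

(** The solution has been above the edge for the whole of [T / 16, T], a long time compared
    to its height, so it moves slowly in the middle of this interval. *)
Lemma slow_above_edge s : T / 8 <= s <= T / 2 ->
  Rabs (w s) <= 16 * 2 ^ n * ((u s - bp) / T).
Proof.
intros Hs. destruct (fl_sol _ _ _ _ Fl) as [a S].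
assert (L := edge_late). assert (H0 := fl_r0 _ _ _ _ Fl).
assert (T0 : 0 < T) by lra.
assert (P2 : 1 <= 2 ^ n) by (apply pow_R1_Rle; lra).
assert (Y0 := above_edge s ltac:(lra)).
assert (Hsn : 0 < s ^ n) by pos.
destruct (Rle_dec 0 (w s)) as [Hw|Hw].
- rewrite Rabs_pos_eq by exact Hw.
  assert (Hge : forall r, T / 16 <= r <= s -> w s <= w r).
  { intros r Hr. assert (F := above_edge_flux r s ltac:(lra) ltac:(lra)).
    assert (Hrn : 0 < r ^ n) by pos.
    assert (r ^ n <= s ^ n) by (apply pow_incr; lra).
    assert (r ^ n * w s <= s ^ n * w s) by (apply Rmult_le_compat_r; lra).
    apply Rmult_le_reg_l with (r ^ n); lra. }
  destruct (mean_value u w (T / 16) s) as (x & Hx & E); [lra|intros; apply (sol_du S)|].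
  specialize (Hge x Hx). assert (Y1 := above_edge (T / 16) ltac:(lra)).
  assert (A : w s * (T / 16) <= u s - bp).
  { apply Rle_trans with (w x * (s - T / 16)); [apply Rmult_le_compat; lra|lra]. }
  apply Rle_trans with (16 * ((u s - bp) / T)).
  + apply Rmult_le_reg_r with (T / 16); [lra|].
    replace (16 * ((u s - bp) / T) * (T / 16)) with (u s - bp) by (field; lra). exact A.
  + assert (0 < (u s - bp) / T) by pos. nra.
- rewrite Rabs_left by lra. set (v := - w s). assert (Hv : 0 < v) by (unfold v; lra).
  assert (Hge : forall r, s <= r <= 2 * s -> v <= 2 ^ n * (- w r)).
  { intros r Hr. assert (F := above_edge_flux s r ltac:(lra) ltac:(lra)).
    assert (Hrn : 0 < r ^ n) by pos.
    assert (r ^ n <= 2 ^ n * s ^ n) by (rewrite <- Rpow_mult_distr; apply pow_incr; lra).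
    assert (s ^ n * v <= r ^ n * (- w r)) by (unfold v; lra).
    assert (0 < - w r).
    { apply Rmult_lt_reg_l with (r ^ n); [exact Hrn|]. rewrite Rmult_0_r.
      apply Rlt_le_trans with (s ^ n * v); [pos|lra]. }
    assert (r ^ n * (- w r) <= 2 ^ n * s ^ n * (- w r)) by (apply Rmult_le_compat_r; lra).
    apply Rmult_le_reg_l with (s ^ n); [exact Hsn|]. lra. }
  destruct (mean_value u w s (2 * s)) as (x & Hx & E); [lra|intros; apply (sol_du S)|].
  specialize (Hge x Hx).
  assert (Y1 : bp <= u (2 * s)).
  { destruct (Req_dec (2 * s) T) as [E2|E2].
    - rewrite E2. destruct HT as (_ & -> & _). lra.
    - left. apply above_edge. lra. }
  replace (2 * s - s) with s in E by ring.
  assert (A : v * s <= 2 ^ n * (u s - bp)).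
  { apply Rle_trans with (2 ^ n * (- w x) * s); [apply Rmult_le_compat_r; lra|].
    replace (2 ^ n * - w x * s) with (2 ^ n * (- (w x * s))) by ring.
    apply Rmult_le_compat_l; lra. }
  apply Rmult_le_reg_r with (T / 8); [lra|].
  replace (16 * 2 ^ n * ((u s - bp) / T) * (T / 8)) with (2 * (2 ^ n * (u s - bp))) by (field; lra).
  assert (v * (T / 8) <= v * s) by (apply Rmult_le_compat_l; lra).
  assert (0 < 2 ^ n * (u s - bp)) by pos. lra.
Qed.

(** Between the times [T / 2 - 1] and [T / 2] the flux changes little, because the speed is small
    compared to the height; the change of flux is the integral of the force.  This bounds the
    force by a multiple of height over [T], while the energy still needed for the fall bounds
    [F] below by a multiple of [1 / T]. *)
Lemma slow_force eps L e0 K :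
  K = 16 * 2 ^ n -> 0 <= L -> 0 < eps <= 1 -> eps <= cp - bp ->
  (forall y x, Rabs (y - bp) < eps -> Rabs (x - bp) < eps -> Rabs (g y - g x) <= L * Rabs (y - x)) ->
  0 < e0 -> e0 <= Fint g (bp + eps) -> 16 * e0 <= c -> 2 * K * e0 <= c -> K * K * e0 <= c * c ->
  energy g u w r0 < e0 ->
  g (u (T / 2)) <= 2 * (K * (4 * 2 ^ n + 2 * L)) / c * Fint g (u (T / 2)).
Proof.
intros HK HL Heps Heps2 Hlip He0 HFe E16 EK EK2 HE0.
destruct (fl_sol _ _ _ _ Fl) as [a S].
assert (Lt := edge_late). assert (H0 := fl_r0 _ _ _ _ Fl). assert (Hc := c_pos).
assert (Hcost := edge_cost). destruct HT as (HTz & HuT & _).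
assert (T0 : 0 < T) by lra.
assert (P2 : 1 <= 2 ^ n) by (apply pow_R1_Rle; lra).
assert (ET := fl_mono r0 T HT0).
assert (HcT : c <= T * e0).
{ apply Rle_trans with (1 := Hcost). apply Rmult_le_compat_l; lra. }
assert (T16 : 16 <= T) by (apply Rmult_le_reg_r with e0; lra).
assert (TK : 2 * K <= T) by (apply Rmult_le_reg_r with e0; lra).
assert (TKK : K * K <= c * T).
{ apply Rmult_le_reg_r with e0; [exact He0|]. apply Rle_trans with (1 := EK2).
  replace (c * T * e0) with (c * (T * e0)) by ring. apply Rmult_le_compat_l; lra. }
assert (Hy : forall r, T / 16 <= r <= T / 2 -> bp < u r < bp + eps).
{ intros r Hr. assert (A := above_edge r ltac:(lra)). assert (B := fall_below_cp r ltac:(lra)).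
  split; [exact A|]. apply Rnot_le_lt. intros Hle.
  assert (D : Fint g (bp + eps) <= Fint g (u r)).
  { destruct Hle as [Hle|Hle]; [|rewrite Hle; lra].
    left. apply (F_increasing_right g cm bm bp cp h C); lra. }
  assert (M := fl_mono r0 r ltac:(lra)). assert (D2 := F_le_energy g u w r). lra. }
set (s := T / 2). set (Y := u s - bp).
assert (HY := Hy s ltac:(unfold s; lra)).
assert (Hs : 2 <= s) by (unfold s; lra).
assert (K0 : 0 < K) by lra.
assert (Hsl : forall r, T / 8 <= r <= T / 2 -> Rabs (w r) <= K * ((u r - bp) / T)).
{ intros r Hr. rewrite HK. apply slow_above_edge, Hr. }
(* The height at most doubles when one goes back by one unit of time. *)
assert (Hdouble : forall r, s - 1 <= r <= s -> u r - bp <= 2 * Y).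
{ destruct (cont_max u (s - 1) s) as (m & Hm & Hmax); [lra|intros; apply fl_cont|].
  assert (Hm2 : u m - bp <= 2 * Y).
  { destruct (Req_dec m s) as [->|Hne]; [unfold Y; lra|].
    destruct (mean_value u w m s) as (x & Hx & E); [lra|intros; apply (sol_du S)|].
    assert (A := Hsl x ltac:(unfold s in *; lra)).
    assert (B := Hmax x ltac:(lra)).
    assert (D : K * ((u x - bp) / T) <= (u m - bp) / 2).
    { assert (Dx := Hy x ltac:(unfold s in *; lra)).
      apply Rmult_le_reg_r with (2 * T); [lra|].
      replace (K * ((u x - bp) / T) * (2 * T)) with (2 * K * (u x - bp)) by (field; lra).
      replace ((u m - bp) / 2 * (2 * T)) with (T * (u m - bp)) by field.
      apply Rmult_le_compat; lra. }
    apply Rle_trans with (1 := A) in D. apply Rabs_le_between in D.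
    assert (Dm := Hy m ltac:(unfold s in *; lra)).
    assert (- ((u m - bp) / 2) * 1 <= w x * (s - m)) by nra.
    unfold Y. lra. }
  intros r Hr. specialize (Hmax r Hr). lra. }
set (V := K * (2 * Y / T)).
assert (HV : forall r, s - 1 <= r <= s -> Rabs (w r) <= V).
{ intros r Hr. apply Rle_trans with (1 := Hsl r ltac:(unfold s in *; lra)). unfold V.
  apply Rmult_le_compat_l; [lra|]. apply Rmult_le_compat_r; [left; apply Rinv_0_lt_compat, T0|].
  apply Hdouble, Hr. }
assert (V0 : 0 <= V) by (apply Rle_trans with (2 := HV s ltac:(lra)), Rabs_pos).
destruct (mean_value (fun r => r ^ n * w r) (fun r => - (r ^ n * g (u r))) (s - 1) s) as (x & Hx & E).
{ lra. } { intros r Hr. apply (sol_flux S). lra. }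
replace (s - (s - 1)) with 1 in E by ring.
assert (Hsn : 0 < s ^ n) by pos.
assert (Hgx : g (u x) <= 2 ^ n * (2 * V)).
{ assert (Hxn : 0 < x ^ n) by pos.
  assert (HH : s ^ n <= 2 ^ n * x ^ n) by (rewrite <- Rpow_mult_distr; apply pow_incr; lra).
  assert (A1 := HV s ltac:(lra)). assert (A2 := HV (s - 1) ltac:(lra)).
  apply Rabs_le_between in A1, A2.
  assert (B1 : (s - 1) ^ n * w (s - 1) <= s ^ n * V).
  { apply Rle_trans with ((s - 1) ^ n * V); [apply Rmult_le_compat_l; [pos|lra]|].
    apply Rmult_le_compat_r; [exact V0|apply pow_incr; lra]. }
  assert (B2 : - (s ^ n * w s) <= s ^ n * V).
  { replace (- (s ^ n * w s)) with (s ^ n * (- w s)) by ring. apply Rmult_le_compat_l; lra. }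
  assert (B3 : x ^ n * g (u x) <= x ^ n * (2 ^ n * (2 * V))).
  { apply Rle_trans with (s ^ n * (2 * V)); [lra|].
    replace (x ^ n * (2 ^ n * (2 * V))) with (2 ^ n * x ^ n * (2 * V)) by ring.
    apply Rmult_le_compat_r; lra. }
  apply Rmult_le_reg_l with (x ^ n); assumption. }
assert (Hgs : g (u s) <= 2 ^ n * (2 * V) + L * V).
{ assert (Dx := Hy x ltac:(unfold s in *; lra)).
  assert (A := Hlip (u s) (u x) ltac:(apply Rabs_def1; lra) ltac:(apply Rabs_def1; lra)).
  assert (B : Rabs (u s - u x) <= V).
  { destruct (Req_dec x s) as [->|Hne]; [rewrite Rminus_diag, Rabs_R0; exact V0|].
    destruct (mean_value u w x s) as (y & Hy1 & Ey); [lra|intros; apply (sol_du S)|].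
    rewrite Ey, Rabs_mult, (Rabs_pos_eq (s - x)) by lra.
    rewrite <- (Rmult_1_r V). apply Rmult_le_compat; [apply Rabs_pos|lra|apply HV; lra|lra]. }
  assert (L * Rabs (u s - u x) <= L * V) by (apply Rmult_le_compat_l; lra).
  assert (D := Rle_abs (g (u s) - g (u x))). lra. }
assert (HFs : c / (2 * T) <= Fint g (u s)).
{ assert (A := fl_mono s T ltac:(unfold s; lra)).
  assert (B : c / T <= energy g u w T).
  { apply Rmult_le_reg_l with T; [exact T0|]. replace (T * (c / T)) with c by (field; lra). exact Hcost. }
  assert (D := Hsl s ltac:(unfold s; lra)). fold Y in D.
  assert (D2 : Rabs (w s) <= K / T).
  { apply Rle_trans with (1 := D). unfold Rdiv. rewrite <- Rmult_assoc.
    apply Rmult_le_compat_r; [left; apply Rinv_0_lt_compat, T0|].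
    rewrite <- (Rmult_1_r K) at 2. apply Rmult_le_compat_l; [lra|unfold Y; lra]. }
  assert (D3 : w s ^ 2 <= K / T * (K / T)).
  { apply Rabs_le_between in D2. apply sqr_le. lra. }
  assert (D4 : K / T * (K / T) <= c / T).
  { apply Rmult_le_reg_r with (T * T); [apply Rmult_lt_0_compat; exact T0|].
    replace (K / T * (K / T) * (T * T)) with (K * K) by (field; lra).
    replace (c / T * (T * T)) with (c * T) by (field; lra). exact TKK. }
  unfold energy at 2 in A. replace (c / (2 * T)) with (c / T / 2) by (field; lra). lra. }
apply Rle_trans with (1 := Hgs).
assert (HVT : V <= 2 * K / T).
{ unfold V. replace (2 * K / T) with (K * (2 * 1 / T)) by (field; lra).
  apply Rmult_le_compat_l; [lra|]. apply Rmult_le_compat_r; [left; apply Rinv_0_lt_compat, T0|unfold Y; lra]. }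
apply Rle_trans with ((2 ^ n * 2 + L) * (2 * K / T)).
{ replace (2 ^ n * (2 * V) + L * V) with ((2 ^ n * 2 + L) * V) by ring. apply Rmult_le_compat_l; lra. }
apply Rle_trans with (2 * (K * (4 * 2 ^ n + 2 * L)) / c * (c / (2 * T))).
{ right. field. lra. }
apply Rmult_le_compat_l; [|exact HFs].
apply Rmult_le_pos; [|left; apply Rinv_0_lt_compat, Hc].
apply Rmult_le_pos; [lra|]. apply Rmult_le_pos; lra.
Qed.

End one_fall.

End edge.

(** * No settling at the edge *)

Section edge_family.

Variables (n : nat) (g : R -> R) (M cm bm bp cp h : R) (k : nat).
Variables (x0 dx : R) (U W : R -> R -> R).
Hypothesis Hn : (1 <= n)%nat.
Hypothesis C : central g cm bm bp cp h.
Hypothesis HM : forall x, Rabs (g x) <= M.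
Hypothesis HU : forall t, 0 <= t <= 1 ->
  x0 + t * dx <> 0 /\ sol n g (x0 + t * dx) (U t) (W t) /\ rests (U t) (W t).
Hypothesis Hset : settles g (U 0) (W 0) bp.
Hypothesis Hk0 : ~ alternates (U 0) (S k).
Hypothesis Hk : forall t, 0 < t <= 1 -> alternates (U t) (S k).

Lemma family_stable t T eps : 0 <= t <= 1 -> 0 <= T -> no_double_zero (U t) (W t) T -> 0 < eps ->
  exists d, 0 < d /\ forall t', 0 <= t' <= 1 -> Rabs (t' - t) < d ->
    close_on T eps (U t) (W t) (U t') (W t').
Proof.
intros Ht HT Hnd He. destruct (HU t Ht) as (_ & S & _).
destruct (continuous_dependence n g M (ct_cont C) HM _ _ _ T (ct_lip C) S HT Hnd eps He) as (d & Hd & Hcl).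
assert (Hx : 0 < Rabs dx + 1) by (assert (A := Rabs_pos dx); lra).
exists (d / (Rabs dx + 1)). split; [pos|]. intros t' Ht' Hc.
destruct (HU t' Ht') as (_ & S' & _). apply (Hcl _ _ _ S').
replace (x0 + t' * dx - (x0 + t * dx)) with ((t' - t) * dx) by ring. rewrite Rabs_mult.
apply Rle_lt_trans with (Rabs (t' - t) * (Rabs dx + 1)).
- apply Rmult_le_compat_l; [apply Rabs_pos|lra].
- apply Rlt_le_trans with (d / (Rabs dx + 1) * (Rabs dx + 1)); [apply Rmult_lt_compat_r; lra|right; field; lra].
Qed.

Variables (q' q tq rho0 : R).
Hypothesis Hq : 0 < q' < q /\ q < bp.
Hypothesis Htq : 0 < tq.
Hypothesis Hdeep : forall s, q' <= s <= q -> Fint g s <= - (tq * tq) / 2.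
Hypothesis Hrho0 : 0 < rho0.
Hypothesis Htail : forall r, rho0 <= r -> q < U 0 r < cp.

Notation Falls := (falls n g cp h q' q tq).

(** The solution at the parameter [0] has fewer sign changes, none of them after [r0], so the
    additional one of its neighbours requires a fall. *)
Lemma nearby_falls e rho : 0 < e -> rho0 <= rho ->
  exists r0 t0, rho <= r0 /\ 0 < t0 <= 1 /\ forall t, 0 < t <= t0 ->
    (exists z, Falls r0 (U t) (W t) z) /\ energy g (U t) (W t) r0 < e /\
    (forall s, rho0 <= s <= r0 -> q < U t s).
Proof.
intros He Hrho. assert (Bp := ct_bp C). assert (Hh := ct_h C).
assert (Hc : 0 < tq * (q - q')) by pos.
set (c := tq * (q - q')) in *.
destruct (below3 e h (c / 32)) as (e1 & He1 & E1 & E2 & E3); [lra|lra|lra|].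
destruct (st_near _ _ _ _ Hset e1 rho He1) as (r0 & R0 & R1 & R2 & R3 & _ & R5 & R6).
assert (Rr : rho <= r0) by (apply R1; lra).
destruct (HU 0 ltac:(lra)) as (A0 & S0 & _).
assert (Hcu : forall r, continuous (U 0) r) by (intros; apply (sol_cu S0)).
destruct (count_semicontinuous (U 0) (W 0) r0 (sol_du S0) (sol_cw S0) R0) as (d1 & D1 & Hcount); auto.
{ destruct (sol_init S0 0 (Rle_refl 0)) as [-> _]. exact A0. }
destruct (cont_min (U 0) rho0 r0) as (m & Hm & Hmin); [lra|intros; apply Hcu|].
assert (Htm := Htail m ltac:(lra)). assert (Htr := Htail r0 ltac:(lra)).
destruct (below2 (e1 - energy g (U 0) (W 0) r0) ((e1 - r0 * energy g (U 0) (W 0) r0) / r0)) as (e2 & He2 & M1 & M2); [pos|pos|].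
destruct (energy_close g (U 0) (W 0) r0 e2 (ct_cont C) He2) as (d2 & D2 & HEc).
destruct (below4 d1 d2 (U 0 m - q) (cp - U 0 r0)) as (eps & Heps & P1 & P2 & P3 & P4); [lra|lra|lra|lra|].
destruct (family_stable 0 r0 eps) as (d & Hd & Hcl); [lra|lra|exact R3|exact Heps|].
exists r0, (Rmin 1 (d / 2)). split; [exact Rr|].
split; [split; [pos|apply Rmin_l]|]. intros t Ht.
assert (T1 : t <= 1) by (apply Rle_trans with (1 := proj2 Ht), Rmin_l).
assert (T2 : t <= d / 2) by (apply Rle_trans with (1 := proj2 Ht), Rmin_r).
assert (Hct := Hcl t ltac:(lra) ltac:(rewrite Rminus_0_r, Rabs_pos_eq; lra)).
destruct (HU t ltac:(lra)) as (At & St & Rt).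
destruct (Hct r0 ltac:(lra)) as [Cu Cw].
assert (HEt := HEc (U t) (W t) ltac:(lra) ltac:(lra)). apply Rabs_def2 in HEt.
assert (HE1 : energy g (U t) (W t) r0 < e1) by lra.
assert (HE2 : r0 * energy g (U t) (W t) r0 < e1).
{ assert (r0 * energy g (U t) (W t) r0 < r0 * (energy g (U 0) (W 0) r0 + e2)) by (apply Rmult_lt_compat_l; lra).
  assert (r0 * e2 <= r0 * ((e1 - r0 * energy g (U 0) (W 0) r0) / r0)) by (apply Rmult_le_compat_l; lra).
  replace (r0 * ((e1 - r0 * energy g (U 0) (W 0) r0) / r0)) with (e1 - r0 * energy g (U 0) (W 0) r0) in H0 by (field; lra).
  lra. }
assert (Hqs : forall s, rho0 <= s <= r0 -> q < U t s).
{ intros s Hs. destruct (Hct s ltac:(lra)) as [Cs _]. specialize (Hmin s Hs).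
  apply Rabs_def2 in Cs. lra. }
split; [|split; [lra|exact Hqs]].
assert (Hcut : forall r, continuous (U t) r) by (intros; apply (sol_cu St)).
assert (Hut : q < U t r0) by (apply Hqs; lra).
assert (Hz : exists s, r0 <= s /\ U t s = 0).
{ apply NNPP. intros Hno.
  destruct (alt_end_truncate (U t) (S k) r0 R0) as (j & Hj & Hend).
  - intros s Hs. rewrite Rmult_comm. apply const_sign; [exact Hs|intros; apply Hcut|].
    intros y Hy E. apply Hno. exists y. split; [lra|exact E].
  - apply Hk. lra.
  - apply Hk0. apply (alternates_le _ _ j Hj). apply alternates_alt_end. exists r0.
    apply (Hcount (U t) (W t) (sol_du St)); [|exact Hend].
    intros s Hs. destruct (Hct s Hs). split; lra. }
destruct Hz as (s & Hs & Es).
destruct (first_le (U t) r0 s 0) as (z & Hz & Ez & Hbef); [exact Hs|intros; apply Hcut|lra|lra|].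
exists z. split.
- eexists; exact St.
- lra.
- apply Rabs_def2 in Cu. lra.
- lra.
- fold c. lra.
- exact Ez.
- exact Hbef.
Qed.

Section continuity_of_fall.

Variables (r0 t0 : R).
Hypothesis Ht0 : 0 < t0 <= 1.
Hypothesis Hfam : forall t, 0 < t <= t0 -> exists z, Falls r0 (U t) (W t) z.

Definition crosses (t T : R) : Prop :=
  exists z, Falls r0 (U t) (W t) z /\ r0 <= T /\ last_at_edge bp (U t) z T.

Lemma crosses_exists t : 0 < t <= t0 -> exists T, crosses t T.
Proof.
intros Ht. destruct (Hfam t Ht) as (z & Hz).
destruct (last_at_edge_exists n g cm bm bp cp h q' q tq Hn C Hq Htq Hdeep r0 _ _ z Hz) as (T & HT1 & HT2).
exists T, z. auto.
Qed.

Lemma crosses_unique t T T' : crosses t T -> crosses t T' -> T = T'.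
Proof.
intros (z & F & HT & L) (z' & F' & HT' & L').
assert (Ez : z = z').
{ assert (A := fl_r0 _ _ _ _ _ _ _ _ _ _ _ F). assert (A' := fl_r0 _ _ _ _ _ _ _ _ _ _ _ F').
  assert (B := fl_z _ _ _ _ _ _ _ _ _ _ _ F). assert (B' := fl_z _ _ _ _ _ _ _ _ _ _ _ F').
  destruct (Rtotal_order z z') as [H|[H|H]]; [exfalso|exact H|exfalso].
  - assert (P := fl_pos _ _ _ _ _ _ _ _ _ _ _ F' z ltac:(lra)). lra.
  - assert (P := fl_pos _ _ _ _ _ _ _ _ _ _ _ F z' ltac:(lra)). lra. }
subst z'. destruct L as (L1 & L2 & L3). destruct L' as (L1' & L2' & L3').
destruct (Rtotal_order T T') as [H|[H|H]]; [exfalso|exact H|exfalso].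
- assert (P := L3 T' ltac:(lra)). lra.
- assert (P := L3' T ltac:(lra)). lra.
Qed.

(** The crossing of the edge is transversal, hence its time depends continuously on the
    parameter. *)
Lemma crosses_stable t T eta : 0 < t <= t0 -> crosses t T -> 0 < eta ->
  exists d, 0 < d /\ forall t', 0 < t' <= t0 -> Rabs (t' - t) < d ->
    exists T', crosses t' T' /\ Rabs (U t' (T' / 2) - U t (T / 2)) < eta.
Proof.
intros Ht (z & F & HT & L) Heta.
destruct (HU t ltac:(lra)) as (At & St & Rt).
assert (Hcu : forall r, continuous (U t) r) by (intros; apply (sol_cu St)).
assert (Hv := edge_velocity n g cm bm bp cp h q' q tq Hn C r0 _ _ z F T HT L).
assert (Hlate := edge_late n g cm bm bp cp h q' q tq Hn C Hq Htq Hdeep r0 _ _ z F T HT L).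
assert (Hr0 := fl_r0 _ _ _ _ _ _ _ _ _ _ _ F). assert (Bp := ct_bp C).
destruct L as (L1 & L2 & L3).
destruct (derive_neg_local (U t) T (W t T) (sol_du St T) Hv) as (d1 & D1 & _ & D1').
destruct (continuous_eps (U t) (T / 2) (Hcu _) (eta / 2)) as (d2 & D2 & D2'); [lra|].
destruct (below4 ((z - T) / 2) (T - r0) (d1 / 2) d2) as (e & He & E1 & E2 & E3 & E4); [lra|lra|lra|lra|].
assert (A1 : bp < U t (T - e)) by (rewrite <- L2; apply D1'; lra).
assert (A2 : U t (T + e) < bp) by (apply L3; lra).
destruct (cont_min (U t) r0 (T + e)) as (m & Hm & Hmin); [lra|intros; apply Hcu|].
assert (Hmpos := fl_pos _ _ _ _ _ _ _ _ _ _ _ F m ltac:(lra)).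
destruct (below4 (eta / 2) (U t m) (U t (T - e) - bp) (bp - U t (T + e))) as (eps & Heps & P1 & P2 & P3 & P4); [lra|lra|lra|lra|].
assert (Hnd : no_double_zero (U t) (W t) (T + e)).
{ apply (rests_no_double_zero _ _ _ Rt).
  assert (Q := fl_pos _ _ _ _ _ _ _ _ _ _ _ F (T + e) ltac:(lra)). lra. }
destruct (family_stable t (T + e) eps) as (d & Hd & Hcl); [lra|lra|exact Hnd|exact Heps|].
exists d. split; [exact Hd|]. intros t' Ht' Hc.
specialize (Hcl t' ltac:(lra) Hc).
destruct (crosses_exists t' Ht') as (T' & z' & F' & HT' & L').
destruct L' as (L1' & L2' & L3').
assert (Hr0' := fl_r0 _ _ _ _ _ _ _ _ _ _ _ F').
assert (Hz' : T + e < z').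
{ apply Rnot_le_lt. intros Hle. destruct (Hcl z' ltac:(lra)) as [B _].
  rewrite (fl_z _ _ _ _ _ _ _ _ _ _ _ F') in B. apply Rabs_def2 in B.
  assert (Q := Hmin z' ltac:(lra)). lra. }
destruct (Hcl (T - e) ltac:(lra)) as [B1 _]. destruct (Hcl (T + e) ltac:(lra)) as [B2 _].
apply Rabs_def2 in B1, B2.
assert (Hlo : T - e <= T').
{ apply Rnot_lt_le. intros Hlt. assert (Q := L3' (T - e) ltac:(lra)). lra. }
assert (Hhi : T' <= T + e).
{ apply Rnot_lt_le. intros Hlt.
  apply (fall_no_dip n g cm bm bp cp h q' q tq Hn C r0 _ _ z' F' (T - e) (T + e) T'); lra. }
exists T'. split; [exists z'; split; [exact F'|]; split; [exact HT'|]; split; [exact L1'|auto]|].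
destruct (Hcl (T' / 2) ltac:(lra)) as [B3 _].
assert (B4 := D2' (T' / 2) ltac:(apply Rabs_def1; lra)).
apply Rabs_def2 in B3, B4. apply Rabs_def1; lra.
Qed.

End continuity_of_fall.

(** The fall times grow without bound as [t] tends to [0], so the heights above the edge at
    half of the fall time sweep out a whole interval.  On this interval [g <= K * F], which
    is incompatible with [F bp = 0] and [F > 0] beyond. *)
Lemma edge_contradiction : False.
Proof.
assert (Bp := ct_bp C). assert (Bc := ct_cp C). assert (Hg := ct_cont C).
assert (Hc : 0 < tq * (q - q')) by pos.
set (c := tq * (q - q')) in *.
destruct (ct_lip C bp) as (el & L & Hel & HL & Hlip); [lra|].
destruct (below3 el 1 (cp - bp)) as (eps & Heps & P1 & P2 & P3); [lra|lra|lra|].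
set (K := 16 * 2 ^ n).
assert (HK : 0 < K) by (unfold K; assert (0 < 2 ^ n) by pos; lra).
assert (HFe : 0 < Fint g (bp + eps)) by (apply (F_pos_right g cm bm bp cp h C); lra).
destruct (below4 (Fint g (bp + eps)) (c / 16) (c / (2 * K)) (c * c / (K * K))) as (e0 & He0 & E1 & E2 & E3 & E4).
{ exact HFe. } { lra. } { pos. } { pos. }
assert (E2' : 16 * e0 <= c) by lra.
assert (E3' : 2 * K * e0 <= c).
{ apply Rle_trans with (2 * K * (c / (2 * K))); [apply Rmult_le_compat_l; lra|right; field; lra]. }
assert (E4' : K * K * e0 <= c * c).
{ apply Rle_trans with (K * K * (c * c / (K * K))); [apply Rmult_le_compat_l; [pos|exact E4]|right; field; lra]. }
destruct (nearby_falls e0 rho0 He0 (Rle_refl _)) as (r0 & t0 & Hr0 & Ht0 & Hfam).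
assert (Hfam' : forall t, 0 < t <= t0 -> exists z, Falls r0 (U t) (W t) z) by (intros t Ht; apply Hfam, Ht).
destruct (crosses_exists r0 t0 Hfam' t0 ltac:(lra)) as (T0 & X0).
set (y0 := U t0 (T0 / 2) - bp).
assert (Hab : forall t T, 0 < t <= t0 -> crosses r0 t T -> bp < U t (T / 2) < cp /\ 16 * r0 < T).
{ intros t T Ht (z & F & HT & HL0).
  assert (Late := edge_late n g cm bm bp cp h q' q tq Hn C Hq Htq Hdeep r0 _ _ z F T HT HL0).
  assert (Q := fl_r0 _ _ _ _ _ _ _ _ _ _ _ F).
  split; [|exact Late]. split.
  - apply (above_edge n g cm bm bp cp h q' q tq Hn C Hq Htq Hdeep r0 _ _ z F T HT HL0). lra.
  - apply (fall_below_cp n g cm bm bp cp h q' q tq C Hq r0 _ _ z F). lra. }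
assert (Hy0 : 0 < y0 < cp - bp) by (destruct (Hab t0 T0 ltac:(lra) X0); unfold y0; lra).
set (K3 := 2 * (K * (4 * 2 ^ n + 2 * L)) / c).
assert (Hforce : forall y, 0 < y < y0 -> g (bp + y) <= K3 * Fint g (bp + y)).
{ intros y Hy.
  assert (HFy : 0 < Fint g (bp + y)) by (apply (F_pos_right g cm bm bp cp h C); lra).
  destruct (nearby_falls (Fint g (bp + y)) r0 HFy Hr0) as (r1 & t1 & Hr1 & Ht1 & Hfam1).
  destruct (below2 t0 t1) as (ta & Hta & Hta0 & Hta1); [lra|lra|].
  destruct (last_time (fun t => exists T, crosses r0 t T /\ U t (T / 2) <= bp + y) ta t0) as (t & Ht & (T & X & HX) & Haft).
  - exact Hta0.
  - destruct (crosses_exists r0 t0 Hfam' ta ltac:(lra)) as (T & X). exists T. split; [exact X|].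
    destruct (Hab ta T ltac:(lra) X) as [HTb _].
    destruct X as (z & F & HT & HL0).
    destruct (Hfam1 ta ltac:(lra)) as ((z1 & F1) & HE1 & Hq1).
    assert (Q := fl_r0 _ _ _ _ _ _ _ _ _ _ _ F). assert (Q1 := fl_r0 _ _ _ _ _ _ _ _ _ _ _ F1).
    assert (Ez : z1 = z).
    { assert (B := fl_z _ _ _ _ _ _ _ _ _ _ _ F). assert (B1 := fl_z _ _ _ _ _ _ _ _ _ _ _ F1).
      destruct (Rtotal_order z1 z) as [H|[H|H]]; [exfalso|exact H|exfalso].
      - assert (A := fl_pos _ _ _ _ _ _ _ _ _ _ _ F z1 ltac:(lra)). lra.
      - destruct (Rle_dec r1 z) as [H1|H1].
        + assert (A := fl_pos _ _ _ _ _ _ _ _ _ _ _ F1 z ltac:(lra)). lra.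
        + assert (A := Hq1 z ltac:(lra)). lra. }
    subst z1.
    assert (HT1 : r1 <= T).
    { destruct HL0 as (L1 & L2 & L3).
      destruct (last_at_edge_exists n g cm bm bp cp h q' q tq Hn C Hq Htq Hdeep r1 _ _ z F1) as (T' & HT' & L1' & L2' & L3').
      apply Rnot_lt_le. intros Hlt. assert (A := L3 T' ltac:(lra)). lra. }
    assert (Late := edge_late n g cm bm bp cp h q' q tq Hn C Hq Htq Hdeep r1 _ _ z F1 T HT1 HL0).
    assert (A := fl_mono n g cm bm bp cp h q' q tq C r1 _ _ z F1 r1 (T / 2) ltac:(lra)).
    assert (B := F_le_energy g (U ta) (W ta) (T / 2)).
    apply Rnot_lt_le. intros Hlt.
    assert (D := F_increasing_right g cm bm bp cp h C (bp + y) (U ta (T / 2)) ltac:(lra) Hlt ltac:(lra)). lra.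
  - intros x Hx Hno. destruct (crosses_exists r0 t0 Hfam' x ltac:(lra)) as (T & X).
    assert (Hgt : bp + y < U x (T / 2)).
    { apply Rnot_le_lt. intros Hle. apply Hno. eauto. }
    destruct (crosses_stable r0 t0 Ht0 Hfam' x T (U x (T / 2) - (bp + y))) as (d & Hd & Hst); [lra|exact X|lra|].
    exists d. split; [exact Hd|]. intros t' Ht' Hdist (T' & X' & HX').
    destruct (Hst t' ltac:(lra) Hdist) as (T'' & X'' & Hcl).
    rewrite (crosses_unique r0 t' T'' T' X'' X') in Hcl. apply Rabs_def2 in Hcl. lra.
  - assert (Hlt : t < t0).
    { destruct (proj2 Ht) as [H|H]; [exact H|exfalso]. subst t.
      rewrite (crosses_unique r0 t0 T T0 X X0) in HX. unfold y0 in Hy. lra. }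
    assert (HE : U t (T / 2) = bp + y).
    { apply Rle_antisym; [exact HX|]. apply Rnot_lt_le. intros Hl.
      destruct (crosses_stable r0 t0 Ht0 Hfam' t T (bp + y - U t (T / 2))) as (d & Hd & Hst); [lra|exact X|lra|].
      min_of t' t0 (t + d / 2) as M1 M2.
      assert (M3 : t < t') by (apply Rmin_glb_lt; lra).
      destruct (Hst t' ltac:(lra) ltac:(apply Rabs_def1; lra)) as (T' & X' & Hcl).
      apply (Haft t'); [lra|]. exists T'. split; [exact X'|]. apply Rabs_def2 in Hcl. lra. }
    rewrite <- HE. destruct X as (z & F & HT & HL0).
    unfold K3, c.
    apply (slow_force n g cm bm bp cp h q' q tq Hn C Hq Htq Hdeep r0 _ _ z F T HT HL0 eps L e0 K); auto.
    + intros y1 x1 Hy1 Hx1. apply Hlip; lra.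
    + apply Hfam. lra. }
assert (G := gronwall (Fint g) g K3 bp (bp + y0) ltac:(lra)
  ltac:(intros; apply Fint_cont, Hg) ltac:(intros; apply Fint_derive, Hg)
  ltac:(intros x Hx; replace x with (bp + (x - bp)) by ring; apply Hforce; lra)).
rewrite (ct_Fbp C), Rmult_0_l in G.
assert (A := F_pos_right g cm bm bp cp h C (bp + y0) ltac:(lra)). lra.
Qed.

End edge_family.

(** [edge_contradiction] applies with a moat just inside the edge, which exists because [F] is
    negative on a dense set. *)
Theorem no_settling_at_edge n g M cm bm bp cp h k x0 dx (U W : R -> R -> R) :
  (1 <= n)%nat -> central g cm bm bp cp h -> (forall x, Rabs (g x) <= M) ->
  (forall t, 0 <= t <= 1 ->
    x0 + t * dx <> 0 /\ sol n g (x0 + t * dx) (U t) (W t) /\ rests (U t) (W t)) ->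
  settles g (U 0) (W 0) bp -> ~ alternates (U 0) (S k) ->
  ~ (forall t, 0 < t <= 1 -> alternates (U t) (S k)).
Proof.
intros Hn C HM HU Hset Hk0 Hk. assert (Bp := ct_bp C). assert (Bc := ct_cp C). assert (Bm := ct_bm C).
destruct (deep_interval g cm bm bp cp h 0 bp C) as (q' & q & tq & A1 & A2 & A3 & A4 & A5); try lra.
destruct (below2 (bp - q) (cp - bp)) as (eta & Heta & M1 & M2); [lra|lra|].
destruct (st_lim _ _ _ _ Hset eta Heta) as (r1 & Hr1).
apply (edge_contradiction n g M cm bm bp cp h k x0 dx U W Hn C HM HU Hset Hk0 Hk q' q tq (Rmax 1 r1)); auto.
- apply Rlt_le_trans with 1; [lra|apply Rmax_l].
- intros r Hr. assert (r1 <= r) by (apply Rle_trans with (2 := Hr), Rmax_r).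
  specialize (Hr1 r H).
  apply Rabs_def2 in Hr1. lra.
Qed.

(** * The shooting argument *)

Lemma settles_to_mirror g u w l : (forall x, continuous g x) ->
  settles g u w l -> settles (mirror g) (fun r => - u r) (fun r => - w r) (- l).
Proof.
intros Hg [H1 H2]. split.
- intros eps He. destruct (H1 eps He) as (r0 & H). exists r0. intros r Hr.
  specialize (H r Hr). replace (- u r - - l) with (- (u r - l)) by ring. rewrite Rabs_Ropp. exact H.
- intros eps rho He. destruct (H2 eps rho He) as (r0 & A1 & A0 & A2 & A3 & A4 & A5 & A6).
  exists r0. rewrite energy_mirror by exact Hg.
  split; [exact A1|]. split; [intros Hl; apply A0; lra|]. split; [lra|]. split.
  + intros r Hr [E1 E2]. apply (A3 r Hr). split; lra.
  + split; [|split; assumption].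
    replace (- u r0 - - l) with (- (u r0 - l)) by ring. rewrite Rabs_Ropp. exact A4.
Qed.

(** [rk] is late enough for [k + 1] swings to cost less than a quarter of the height of the
    flanks; see [late_energy]. *)
Definition escapes (cm cp rk : R) (k : nat) (u : R -> R) : Prop :=
  alternates u (S k) \/ exists r, rk <= r /\ ~ cm <= u r <= cp.

Definition tends_to_0 (u : R -> R) : Prop :=
  forall eps, 0 < eps -> exists r0, forall r, r0 <= r -> Rabs (u r) < eps.

Section shooting.

Variables (n : nat) (g : R -> R) (M cm bm bp cp h : R).
Variables (sp rk : R) (k : nat) (x0 dx : R) (U W : R -> R -> R).
Hypothesis Hn : (1 <= n)%nat.
Hypothesis C : central g cm bm bp cp h.
Hypothesis HM : forall x, Rabs (g x) <= M.
Hypothesis HU : forall t, 0 <= t <= 1 ->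
  x0 + t * dx <> 0 /\ sol n g (x0 + t * dx) (U t) (W t) /\ rests (U t) (W t).
Hypothesis HS0 : 0 < sp.
Hypothesis HSb : forall s, cm <= s <= cp -> 2 * (h - Fint g s) <= sp * sp.
Hypothesis HR : 0 < rk.
Hypothesis HRk : INR (S k) * (2 * (INR n / rk * sp * (cp - cm))) <= h / 4.

Notation stable := (family_stable n g M cm bm bp cp h x0 dx U W C HM HU).

Lemma escapes_alternates t r0 : 0 <= t <= 1 -> cm <= U t r0 <= cp ->
  energy g (U t) (W t) r0 < h / 2 -> escapes cm cp rk k (U t) -> alternates (U t) (S k).
Proof.
intros Ht Hu HE [Ha|(r & Hr & Hout)]; [exact Ha|].
destruct (HU t Ht) as (_ & St & _).
apply (late_energy n g cm bm bp cp h _ _ _ sp rk k r r0 Hn C St HS0 HSb HR HRk Hr Hout Hu HE).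
Qed.

Lemma escapes_open t : 0 <= t <= 1 -> escapes cm cp rk k (U t) ->
  exists d, 0 < d /\ forall s, 0 <= s <= 1 -> Rabs (s - t) < d -> escapes cm cp rk k (U s).
Proof.
intros Ht Hesc. destruct (HU t Ht) as (_ & St & Rt).
assert (B1 := ct_cm C). assert (B2 := ct_bm C). assert (B3 := ct_bp C). assert (B4 := ct_cp C).
destruct Hesc as [Ha|(r & Hr & Hout)].
- apply alternates_alt_end in Ha. destruct Ha as [r Ha].
  assert (Hr := alt_end_pos _ _ _ Ha).
  assert (Hur : U t r <> 0) by (inversion Ha as [|j r1 r2 Hj Hlt Hopp]; subst; intros E; rewrite E in Hopp; lra).
  destruct (alt_end_open _ _ _ Ha) as (eps & He & Hop).
  destruct (stable t r eps Ht ltac:(lra) (rests_no_double_zero _ _ _ Rt Hur) He) as (d & Hd & Hcl).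
  exists d. split; [exact Hd|]. intros s Hs Hc. left. apply alternates_alt_end. exists r.
  apply Hop. intros x Hx. apply (Hcl s Hs Hc x Hx).
- assert (Hur : U t r <> 0) by (intros E; apply Hout; lra).
  assert (He : exists eps, 0 < eps /\ forall y, Rabs (y - U t r) < eps -> ~ cm <= y <= cp).
  { destruct (Rlt_dec (U t r) cm).
    - exists (cm - U t r). split; [lra|]. intros y Hy. apply Rabs_def2 in Hy. lra.
    - exists (U t r - cp). split; [lra|]. intros y Hy. apply Rabs_def2 in Hy. lra. }
  destruct He as (eps & He & Hy).
  destruct (stable t r eps Ht ltac:(lra) (rests_no_double_zero _ _ _ Rt Hur) He) as (d & Hd & Hcl).
  exists d. split; [exact Hd|]. intros s Hs Hc. right. exists r. split; [exact Hr|].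
  apply Hy. apply (Hcl s Hs Hc). lra.
Qed.

Lemma nearby_state t r0 eps : 0 <= t <= 1 -> 0 < r0 -> U t r0 <> 0 -> no_double_zero (U t) (W t) r0 ->
  0 < eps -> exists d, 0 < d /\ forall s, 0 <= s <= 1 -> Rabs (s - t) < d ->
    Rabs (U s r0 - U t r0) < eps /\ Rabs (energy g (U s) (W s) r0 - energy g (U t) (W t) r0) < eps /\
    forall j, alt_end (U s) j r0 -> alt_end (U t) j r0.
Proof.
intros Ht Hr0 Hu Hnd He. destruct (HU t Ht) as (At & St & _).
destruct (count_semicontinuous (U t) (W t) r0 (sol_du St) (sol_cw St) Hr0) as (d1 & D1 & Hcount); auto.
{ destruct (sol_init St 0 (Rle_refl 0)) as [-> _]. exact At. }
destruct (energy_close g (U t) (W t) r0 eps (ct_cont C) He) as (d2 & D2 & HEc).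
destruct (below3 eps d1 d2) as (e & He0 & P1 & P2 & P3); [lra|lra|lra|].
destruct (stable t r0 e Ht ltac:(lra) Hnd He0) as (d & Hd & Hcl).
exists d. split; [exact Hd|]. intros s Hs Hc. specialize (Hcl s Hs Hc).
destruct (Hcl r0 ltac:(lra)) as [A B]. split; [lra|]. split; [apply HEc; lra|].
intros j. destruct (HU s Hs) as (_ & Ss & _). apply (Hcount (U s) (W s) (sol_du Ss)).
intros x Hx. destruct (Hcl x Hx). split; lra.
Qed.

(** Escaping would mean more than [k] sign changes, all of them before [r0], where their number is
    semicontinuous. *)
Lemma stay_of_one_sign t r0 eps : 0 <= t <= 1 -> 0 < r0 -> U t r0 <> 0 -> no_double_zero (U t) (W t) r0 ->
  cm < U t r0 < cp -> energy g (U t) (W t) r0 < h / 2 -> ~ alternates (U t) (S k) -> 0 < eps ->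
  (forall s, 0 <= s <= 1 -> Rabs (U s r0 - U t r0) < eps ->
     Rabs (energy g (U s) (W s) r0 - energy g (U t) (W t) r0) < eps ->
     forall r, r0 <= r -> U s r <> 0) ->
  exists d, 0 < d /\ forall s, 0 <= s <= 1 -> Rabs (s - t) < d -> ~ escapes cm cp rk k (U s).
Proof.
intros Ht Hr0 Hu Hnd HK HE Hk He Hnz.
destruct (below4 eps (h / 2 - energy g (U t) (W t) r0) (U t r0 - cm) (cp - U t r0)) as (e & He0 & P1 & P2 & P3 & P4); [lra|lra|lra|lra|].
destruct (nearby_state t r0 e Ht Hr0 Hu Hnd He0) as (d & Hd & Hnear).
exists d. split; [exact Hd|]. intros s Hs Hc Hesc.
destruct (Hnear s Hs Hc) as (A1 & A2 & A3).
assert (B := Hnz s Hs ltac:(lra) ltac:(lra)).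
apply Rabs_def2 in A1. apply Rabs_def2 in A2.
assert (Halt := escapes_alternates s r0 Hs ltac:(lra) ltac:(lra) Hesc).
destruct (HU s Hs) as (_ & Ss & _).
destruct (alt_end_truncate (U s) (S k) r0 Hr0) as (j & Hj & Hend); [|exact Halt|].
- intros x Hx. rewrite Rmult_comm. apply const_sign; [exact Hx| |].
  + intros; apply (sol_cu Ss).
  + intros y Hy. apply B. lra.
- apply Hk. apply (alternates_le _ _ j Hj). apply alternates_alt_end. exists r0. apply A3, Hend.
Qed.

(** At the end of an interval of escaping parameters every behaviour other than the one sought
    is stable under perturbation or, at a degenerate edge of the well, impossible. *)
Lemma no_escape_onset t : 0 < t <= 1 -> ~ escapes cm cp rk k (U t) ->
  (forall s, 0 <= s < t -> escapes cm cp rk k (U s)) ->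
  tends_to_0 (U t) /\ alternates (U t) k /\ ~ alternates (U t) (S k).
Proof.
intros Ht Hesc Hbef. assert (Hg := ct_cont C). assert (Hh := ct_h C).
assert (B1 := ct_cm C). assert (B2 := ct_bm C). assert (B3 := ct_bp C). assert (B4 := ct_cp C).
assert (Hk : ~ alternates (U t) (S k)) by (intros H; apply Hesc; left; exact H).
assert (HK : forall r, rk <= r -> cm <= U t r <= cp).
{ intros r Hr. apply NNPP. intros Hout. apply Hesc. right. eauto. }
assert (Ht1 : 0 <= t <= 1) by lra.
destruct (HU t Ht1) as (At & St & Rt).
assert (Hcontra : (exists d, 0 < d /\ forall s, 0 <= s <= 1 -> Rabs (s - t) < d -> ~ escapes cm cp rk k (U s)) -> False).
{ intros (d & Hd & Hno). max_of s 0 (t - d / 2) as M1 M2.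
  assert (M3 : s < t) by (apply Rmax_lub_lt; lra).
  apply (Hno s); [lra|apply Rabs_def1; lra|apply Hbef; lra]. }
destruct (trapped_or_settles n g cm bm bp cp h _ _ _ rk k Hn C At St Rt HR Hk HK)
  as [(r1 & Hr1 & HE1)|(l & Hl & HFl & Hgl & Hset)].
- exfalso. apply Hcontra.
  assert (Hu1 : U t r1 <> 0) by (apply (no_zero_negative_energy n g cm bm bp cp h C _ _ _ r1 St HE1); lra).
  assert (Hin : cm < U t r1 < cp).
  { apply (stays_inside n g cm bm bp cp h C _ _ _ r1 St (HK r1 ltac:(lra))); lra. }
  apply (stay_of_one_sign t r1 (- energy g (U t) (W t) r1) Ht1 ltac:(lra) Hu1
    (rests_no_double_zero _ _ _ Rt Hu1) Hin ltac:(lra) Hk ltac:(lra)).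
  intros s Hs _ HEs. destruct (HU s Hs) as (_ & Ss & _). apply Rabs_def2 in HEs.
  apply (no_zero_negative_energy n g cm bm bp cp h C _ _ _ r1 Ss). lra.
- destruct (Req_dec l 0) as [El|El].
  + subst l. assert (Hlim : tends_to_0 (U t)).
    { intros eps He. destruct (st_lim _ _ _ _ Hset eps He) as (r0 & H). exists r0.
      intros r Hr. specialize (H r Hr). rewrite Rminus_0_r in H. exact H. }
    split; [exact Hlim|]. split; [|exact Hk]. apply NNPP. intros Hnk. apply Hcontra.
    destruct (ct_F_near0 C) as (d0 & Hd0 & Hnear0).
    destruct (barrier_exists g cm bm bp cp h 0 d0 C) as (p & p' & q' & q & tq & Br & Hpq & Hp & Hq & Hpb & Hqb); [lra|exact Hd0|].
    assert (Tq := br_t _ _ _ _ _ _ Br). assert (Pp := br_p _ _ _ _ _ _ Br). assert (Qq := br_q _ _ _ _ _ _ Br).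
    destruct (below2 (tq * (p' - p)) (tq * (q - q'))) as (c & Hc & Hc1 & Hc2); [pos|pos|].
    destruct (below4 c (h / 2) (- p') q') as (e0 & He0 & Q1 & Q2 & Q3 & Q4); [lra|lra|lra|lra|].
    destruct (st_near _ _ _ _ Hset e0 0 He0) as (r0 & R0 & _ & R2 & R3 & R4 & R5 & R6).
    rewrite Rminus_0_r in R4. apply Rabs_def2 in R4.
    set (E0 := energy g (U t) (W t) r0) in *.
    destruct (below3 (e0 - E0) ((e0 - r0 * E0) / r0) (Rabs (U t r0))) as (e2 & He2 & S1 & S2 & S3);
      [lra|pos|apply Rabs_pos_lt, R2|].
    destruct (below3 e2 (U t r0 - p') (q' - U t r0)) as (e1 & He1 & S0 & S4 & S5); [lra|lra|lra|].
    destruct (nearby_state t r0 e1 Ht1 R0 R2 R3 He1) as (d & Hd & Hnear).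
    exists d. split; [exact Hd|]. intros s Hs Hdist Hes.
    destruct (Hnear s Hs Hdist) as (A1 & A2 & A3).
    assert (Hsne : U s r0 <> 0).
    { assert (A := close_same_sign _ _ _ A1 (Rle_trans _ _ _ S0 S3)). intros E. rewrite E in A. lra. }
    apply Rabs_def2 in A1. apply Rabs_def2 in A2. fold E0 in A2.
    assert (Halt := escapes_alternates s r0 Hs ltac:(lra) ltac:(lra) Hes).
    destruct (HU s Hs) as (_ & Ss & _).
    assert (HH : r0 * energy g (U s) (W s) r0 < c).
    { assert (D1 : r0 * energy g (U s) (W s) r0 < r0 * (E0 + e1)) by (apply Rmult_lt_compat_l; lra).
      assert (D2 : r0 * e1 <= r0 * ((e0 - r0 * E0) / r0)) by (apply Rmult_le_compat_l; lra).
      replace (r0 * ((e0 - r0 * E0) / r0)) with (e0 - r0 * E0) in D2 by (field; lra). lra. }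
    destruct (alt_end_one_more (U s) k r0 R0 Hsne) as (j & Hj & Hend); [|exact Halt|].
    * intros s1 s2 Hs12 Ho. apply (barrier_one_change n g _ (U s) (W s) p p' q' q tq r0 s1 s2 Hn Hg Ss Br); try lra.
      intros y Hy Hy0. apply Hnear0. split; [apply Rabs_pos_lt, Hy0|apply Rabs_def1; lra].
    * apply Hnk. apply (alternates_le _ _ j Hj). apply alternates_alt_end. exists r0. apply A3, Hend.
  + exfalso.
    destruct (Req_dec l bp) as [Ebp|Ebp]; [|destruct (Req_dec l bm) as [Ebm|Ebm]].
    1, 2: assert (Hd : exists d, 0 < d <= t /\ forall s, t - d <= s < t -> alternates (U s) (S k)).
    1, 3: destruct (below3 (h / 2) (cp - bp) (bm - cm)) as (e0 & He0 & N1 & N2 & N3); [lra|lra|lra|];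
      destruct (st_near _ _ _ _ Hset e0 0 He0) as (r0 & R0 & _ & R2 & R3 & R4 & R5 & _);
      apply Rabs_def2 in R4;
      set (E0 := energy g (U t) (W t) r0) in *;
      destruct (below3 (h / 2 - E0) (cp - U t r0) (U t r0 - cm)) as (e1 & He1 & N4 & N5 & N6); [lra|lra|lra|];
      destruct (nearby_state t r0 e1 Ht1 R0 R2 R3 He1) as (d & Hd & Hnear);
      destruct (below2 t (d / 2)) as (d' & Hd' & N7 & N8); [lra|lra|];
      exists d'; (split; [lra|]); intros s Hs;
      destruct (Hnear s ltac:(lra) ltac:(apply Rabs_def1; lra)) as (A1 & A2 & _);
      apply Rabs_def2 in A1; apply Rabs_def2 in A2; fold E0 in A2;
      apply (escapes_alternates s r0); [lra|lra|lra|apply Hbef; lra].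
    * destruct Hd as (d & Hd & Hdalt). subst l.
      apply (no_settling_at_edge n g M cm bm bp cp h k (x0 + t * dx) (- d * dx)
        (fun s => U (t - s * d)) (fun s => W (t - s * d)) Hn C HM).
      -- intros s Hs. assert (0 <= s * d <= d) by (split; [pos|nra]).
         destruct (HU (t - s * d)) as (A1 & A2 & A3); [lra|].
         replace (x0 + t * dx + s * (- d * dx)) with (x0 + (t - s * d) * dx) by ring. auto.
      -- replace (t - 0 * d) with t by ring. exact Hset.
      -- replace (t - 0 * d) with t by ring. exact Hk.
      -- intros s Hs. assert (0 < s * d <= d) by (split; [pos|nra]).
         apply Hdalt. lra.
    * destruct Hd as (d & Hd & Hdalt). subst l.
      apply (no_settling_at_edge n (mirror g) M (- cp) (- bp) (- bm) (- cm) h k (- (x0 + t * dx)) (- (- d * dx))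
        (fun s r => - U (t - s * d) r) (fun s r => - W (t - s * d) r) Hn).
      -- apply central_mirror, C.
      -- intros x. unfold mirror. rewrite Rabs_Ropp. apply HM.
      -- intros s Hs. assert (0 <= s * d <= d) by (split; [pos|nra]).
         destruct (HU (t - s * d)) as (A1 & A2 & A3); [lra|].
         replace (- (x0 + t * dx) + s * - (- d * dx)) with (- (x0 + (t - s * d) * dx)) by ring.
         split; [lra|]. split; [apply sol_mirror, A2|].
         intros y Y1 Y2 y' Hy. rewrite (A3 y); lra.
      -- replace (t - 0 * d) with t by ring. apply settles_to_mirror; assumption.
      -- replace (t - 0 * d) with t by ring. rewrite alternates_opp. exact Hk.
      -- intros s Hs. assert (0 < s * d <= d) by (split; [pos|nra]).
         apply alternates_opp. apply Hdalt. lra.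
    * apply Hcontra.
      destruct (barrier_exists g cm bm bp cp h l (Rabs l) C) as (p & p' & q' & q & tq & Br & Hpq & Hp & Hq & Hpb & Hqb);
        [lra|apply Rabs_pos_lt, El|].
      assert (H0pq : ~ p < 0 < q).
      { unfold Rabs in *. destruct (Rcase_abs l); lra. }
      assert (Tq := br_t _ _ _ _ _ _ Br). assert (Pp := br_p _ _ _ _ _ _ Br). assert (Qq := br_q _ _ _ _ _ _ Br).
      destruct (below2 (tq * (p' - p)) (tq * (q - q'))) as (c & Hc & Hc1 & Hc2); [pos|pos|].
      destruct (below4 c (h / 2) (l - p') (q' - l)) as (e0 & He0 & Q1 & Q2 & Q3 & Q4); [lra|lra|lra|lra|].
      destruct (st_near _ _ _ _ Hset e0 0 He0) as (r0 & R0 & _ & R2 & R3 & R4 & R5 & R6).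
      apply Rabs_def2 in R4.
      set (E0 := energy g (U t) (W t) r0) in *.
      destruct (below3 ((e0 - r0 * E0) / r0) (U t r0 - p') (q' - U t r0)) as (e1 & He1 & S2 & S4 & S5); [pos|lra|lra|].
      apply (stay_of_one_sign t r0 e1 Ht1 R0 R2 R3 ltac:(lra) ltac:(fold E0; lra) Hk He1).
      intros s Hs A1 A2 r Hr E. apply Rabs_def2 in A1. apply Rabs_def2 in A2. fold E0 in A2.
      destruct (HU s Hs) as (_ & Ss & _).
      assert (HH : r0 * energy g (U s) (W s) r0 < c).
      { assert (D1 : r0 * energy g (U s) (W s) r0 < r0 * (E0 + e1)) by (apply Rmult_lt_compat_l; lra).
        assert (D2 : r0 * e1 <= r0 * ((e0 - r0 * E0) / r0)) by (apply Rmult_le_compat_l; lra).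
        replace (r0 * ((e0 - r0 * E0) / r0)) with (e0 - r0 * E0) in D2 by (field; lra). lra. }
      apply H0pq. rewrite <- E.
      apply (barrier_stays n g _ (U s) (W s) p p' q' q tq r0 r Hn Hg Ss Br); try lra.
      assert (A := F_le_energy g (U s) (W s) r). rewrite E, Fint_0 in A. exact A.
Qed.

(** The first value that does not escape is the one sought: it is not an end point, because the
    solution there does not tend to [0]. *)
Theorem shooting : escapes cm cp rk k (U 0) -> ~ escapes cm cp rk k (U 1) -> ~ tends_to_0 (U 1) ->
  exists t, 0 < t < 1 /\ tends_to_0 (U t) /\ alternates (U t) k /\ ~ alternates (U t) (S k).
Proof.
intros H0 H1 Hno.
destruct (first_time (fun t => ~ escapes cm cp rk k (U t)) 0 1) as (t & Ht & Hesc & Hbef).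
- lra.
- exact H1.
- intros x Hx Hx2. destruct (escapes_open x Hx (NNPP _ Hx2)) as (d & Hd & Hop).
  exists d. split; [exact Hd|]. intros y Hy Hc Hn'. apply Hn', Hop; assumption.
- assert (Ht0 : 0 < t).
  { destruct (proj1 Ht) as [H|H]; [exact H|]. subst t. contradiction. }
  destruct (no_escape_onset t) as (A & B & D).
  + lra.
  + exact Hesc.
  + intros s Hs. apply NNPP, Hbef, Hs.
  + exists t. split; [|auto]. split; [exact Ht0|].
    destruct (proj2 Ht) as [H|H]; [exact H|]. subst t. contradiction.
Qed.

End shooting.

(** * Truncating the nonlinearity *)

(** The nonlinearity with constant values outside [[m, M]]: bounded and defined everywhere, with
    the same solutions as long as they stay in [[m, M]]. *)
Definition clamp (m M s : R) : R := Rmax m (Rmin M s).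
Definition clampf (m M : R) (f : R -> R) (s : R) : R := f (clamp m M s).

Lemma clamp_in m M s : m <= M -> m <= clamp m M s <= M.
Proof.
intros H. unfold clamp, Rmax, Rmin.
destruct (Rle_dec M s); destruct (Rle_dec m _); lra.
Qed.

Lemma clamp_id m M s : m <= s <= M -> clamp m M s = s.
Proof. intros H. unfold clamp. rewrite Rmin_right, Rmax_right; lra. Qed.

Lemma clamp_ge m M s : m <= M -> M <= s -> clamp m M s = M.
Proof. intros H H'. unfold clamp. rewrite Rmin_left, Rmax_right; lra. Qed.

Lemma clamp_lipschitz m M s t : Rabs (clamp m M s - clamp m M t) <= Rabs (s - t).
Proof.
unfold clamp, Rmax, Rmin.
destruct (Rle_dec M s); destruct (Rle_dec M t); destruct (Rle_dec m M);
  repeat match goal with |- context [Rle_dec ?a ?b] => destruct (Rle_dec a b) end;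
  unfold Rabs; repeat match goal with |- context [Rcase_abs ?a] => destruct (Rcase_abs a) end; lra.
Qed.

Section clamped.

Variables (f : R -> R) (gm gs : Rbar) (m M : R).
Hypothesis Hc : continuous_on (dom gm gs) f.
Hypothesis Hlip : locally_lipschitz_on (fun s => dom gm gs s /\ s <> 0) f.
Hypothesis Hf0 : f 0 = 0.
Hypothesis Hm : Rbar_lt gm m.
Hypothesis HM : Rbar_le M gs.
Hypothesis H0 : m < 0 < M.

Lemma clamp_dom s : dom gm gs (clamp m M s).
Proof.
destruct (clamp_in m M s) as [H1 H2]; [lra|]. split.
- apply Rbar_lt_le_trans with m; [exact Hm|exact H1].
- apply Rbar_le_trans with M; [exact H2|exact HM].
Qed.

Lemma clampf_cont x : continuous (clampf m M f) x.
Proof.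
apply eps_continuous. intros eps He.
destruct (proj1 (filterlim_locally _ _) (Hc _ (clamp_dom x)) (mkposreal eps He)) as [d Hd].
exists d. split; [apply cond_pos|]. intros y Hy.
apply Hd; [|apply clamp_dom].
apply Rle_lt_trans with (1 := clamp_lipschitz m M y x). exact Hy.
Qed.

Lemma clampf_lip : lip_off_0 (clampf m M f).
Proof.
intros x Hx.
assert (Hcx : clamp m M x <> 0).
{ unfold clamp, Rmax, Rmin. destruct (Rle_dec M x); destruct (Rle_dec m _); lra. }
destruct (Hlip (clamp m M x)) as (eps & L & He & H); [split; [apply clamp_dom|exact Hcx]|].
exists (Rmin eps (Rabs (clamp m M x))), (Rmax L 0).
split; [apply Rmin_pos; [exact He|apply Rabs_pos_lt, Hcx]|]. split; [apply Rmax_r|].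
assert (Hin : forall y, Rabs (y - x) < Rmin eps (Rabs (clamp m M x)) ->
  (dom gm gs (clamp m M y) /\ clamp m M y <> 0) /\ Rabs (clamp m M y - clamp m M x) < eps).
{ intros y Hy. assert (A := clamp_lipschitz m M y x).
  assert (B1 := Rmin_l eps (Rabs (clamp m M x))). assert (B2 := Rmin_r eps (Rabs (clamp m M x))).
  split; [split; [apply clamp_dom|]|lra]. intros E. rewrite E in A.
  rewrite Rminus_0_l, Rabs_Ropp in A. lra. }
intros y z Hy Hz. destruct (Hin y Hy) as [Y1 Y2]. destruct (Hin z Hz) as [Z1 Z2].
apply Rle_trans with (1 := H _ _ Y1 Z1 Y2 Z2).
assert (A := clamp_lipschitz m M y z). assert (P := Rabs_pos (clamp m M y - clamp m M z)).
apply Rle_trans with (Rmax L 0 * Rabs (clamp m M y - clamp m M z)).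
- apply Rmult_le_compat_r; [exact P|apply Rmax_l].
- apply Rmult_le_compat_l; [apply Rmax_r|exact A].
Qed.

Lemma clampf_0 : clampf m M f 0 = 0.
Proof. unfold clampf. rewrite clamp_id; [exact Hf0|lra]. Qed.

Lemma clampf_eq s : m <= s <= M -> clampf m M f s = f s.
Proof. intros H. unfold clampf. rewrite clamp_id; [reflexivity|exact H]. Qed.

Lemma clampf_bounded : exists B, forall x, Rabs (clampf m M f x) <= B.
Proof.
destruct (cont_max (fun s => Rabs (clampf m M f s)) m M) as (x & Hx & Hmax); [lra| |].
- intros y _. apply (continuous_comp (clampf m M f) Rabs); [apply clampf_cont|apply continuous_Rabs].
- exists (Rabs (clampf m M f x)). intros y.
  assert (E : clampf m M f y = clampf m M f (clamp m M y)).
  { unfold clampf. f_equal. symmetry. apply clamp_id, clamp_in. lra. }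
  rewrite E. apply Hmax. apply clamp_in. lra.
Qed.

Lemma Fint_clampf s : m <= s <= M -> Fint (clampf m M f) s = Fint f s.
Proof.
intros H. unfold Fint. apply RInt_ext. intros x Hx. apply clampf_eq.
unfold Rmin, Rmax in Hx. destruct (Rle_dec 0 s); lra.
Qed.

Lemma solution_family n : exists U W : R -> R -> R, forall a, a <> 0 ->
  sol n (clampf m M f) a (U a) (W a) /\ rests (U a) (W a).
Proof.
destruct clampf_bounded as [B HB].
assert (H : forall a, exists p : (R -> R) * (R -> R), a <> 0 ->
  sol n (clampf m M f) a (fst p) (snd p) /\ rests (fst p) (snd p)).
{ intros a. destruct (Req_dec a 0) as [E|E].
  - exists (fun _ => 0, fun _ => 0). contradiction.
  - destruct (sol_exists n (clampf m M f) B a clampf_cont HB) as (u & w & S).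
    destruct (sol_rests _ _ _ _ _ E clampf_0 S) as (u' & w' & S' & R').
    exists (u', w'). auto. }
destruct (choice _ H) as [P HP]. exists (fun a => fst (P a)), (fun a => snd (P a)). exact HP.
Qed.

End clamped.

Lemma between_below (gm : Rbar) (x : R) : Rbar_lt gm x -> exists y : R, Rbar_lt gm y /\ y < x.
Proof.
destruct gm as [g| |]; simpl; intros H.
- exists ((g + x) / 2). split; lra.
- contradiction.
- exists (x - 1). split; [exact I|lra].
Qed.

Lemma between_above (gs : Rbar) (x : R) : Rbar_lt x gs -> exists y : R, x < y /\ Rbar_lt y gs.
Proof.
destruct gs as [g| |]; simpl; intros H.
- exists ((g + x) / 2). split; lra.
- exists (x + 1). split; [lra|exact I].
- contradiction.
Qed.

Section interior.

Variables (f : R -> R) (gm gs : Rbar).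
Hypothesis Hc : continuous_on (dom gm gs) f.
Hypothesis Hgm : Rbar_lt gm 0.
Hypothesis Hgs : Rbar_lt 0 gs.

Lemma interior_agree (s : R) : Rbar_lt gm s -> Rbar_lt s gs ->
  exists m M : R, Rbar_lt gm m /\ Rbar_lt M gs /\ m < 0 < M /\ m < s < M.
Proof.
intros H1 H2.
destruct (between_below gm (Rmin s 0)) as (m & Hm & Hm').
{ unfold Rmin. destruct (Rle_dec s 0); assumption. }
destruct (between_above gs (Rmax s 0)) as (M & HM & HM').
{ unfold Rmax. destruct (Rle_dec s 0); assumption. }
assert (A1 := Rmin_l s 0). assert (A2 := Rmin_r s 0).
assert (A3 := Rmax_l s 0). assert (A4 := Rmax_r s 0).
exists m, M. repeat split; try assumption; lra.
Qed.

Lemma near_inside (m M s : R) : m < s < M -> locally s (fun x => m <= x <= M).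
Proof.
intros H. assert (Hd : 0 < Rmin (s - m) (M - s)) by pos.
exists (mkposreal _ Hd). intros y Hy.
assert (Hy' : Rabs (y - s) < Rmin (s - m) (M - s)) by exact Hy.
assert (B1 := Rmin_l (s - m) (M - s)). assert (B2 := Rmin_r (s - m) (M - s)).
apply Rabs_def2 in Hy'. lra.
Qed.

Lemma f_cont_inside (s : R) : Rbar_lt gm s -> Rbar_lt s gs -> continuous f s.
Proof.
intros H1 H2. destruct (interior_agree s H1 H2) as (m & M & Hm & HM & H0 & Hs).
apply (continuous_ext_loc _ (clampf m M f)).
- generalize (near_inside m M s Hs). apply filter_imp. intros x Hx. apply clampf_eq. exact Hx.
- apply (clampf_cont f gm gs); auto. apply Rbar_lt_le, HM.
Qed.

Lemma F_derive_inside (s : R) : Rbar_lt gm s -> Rbar_lt s gs -> is_derive (Fint f) s (f s).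
Proof.
intros H1 H2. destruct (interior_agree s H1 H2) as (m & M & Hm & HM & H0 & Hs).
apply (is_derive_ext_loc (Fint (clampf m M f))).
- generalize (near_inside m M s Hs). apply filter_imp. intros x Hx. apply Fint_clampf; assumption.
- rewrite <- (clampf_eq f m M s) by lra. apply Fint_derive.
  apply (clampf_cont f gm gs); auto. apply Rbar_lt_le, HM.
Qed.

Lemma F_cont_inside (s : R) : Rbar_lt gm s -> Rbar_lt s gs -> continuous (Fint f) s.
Proof. intros H1 H2. apply (is_derive_cont _ _ _ (F_derive_inside s H1 H2)). Qed.

End interior.

Lemma list_gap (l : list R) (x : R) : exists eta, 0 < eta /\
  forall y, In y l -> y <> x -> eta <= Rabs (y - x).
Proof.
induction l as [|z l (eta & He & IH)].
- exists 1. split; [lra|]. intros y [].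
- destruct (Req_dec z x) as [E|E].
  + exists eta. split; [exact He|]. intros y [<-|Hy] Hne; [contradiction|auto].
  + exists (Rmin eta (Rabs (z - x))). split.
    { apply Rmin_pos; [exact He|apply Rabs_pos_lt; lra]. }
    intros y [<-|Hy] Hne; [apply Rmin_r|]. apply Rle_trans with eta; [apply Rmin_l|auto].
Qed.

Lemma list_not_interval (l : list R) (p q : R) : p < q -> exists x, p < x < q /\ ~ In x l.
Proof.
intros Hpq. destruct (list_gap l p) as (eta & He & H).
destruct (below2 (eta / 2) ((q - p) / 2)) as (e & He0 & A1 & A2); [lra|lra|].
exists (p + e). split; [lra|]. intros Hin. specialize (H _ Hin ltac:(lra)).
replace (p + e - p) with e in H by ring. rewrite Rabs_pos_eq in H; lra.
Qed.

Lemma list_least (l : list R) (P : R -> Prop) : (forall x, P x -> In x l) -> (exists x, P x) ->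
  exists m, P m /\ forall x, P x -> m <= x.
Proof.
revert P. induction l as [|z l IH]; intros P Hl [x Hx]; [destruct (Hl x Hx)|].
destruct (classic (exists y, P y /\ y <> z)) as [(y & Hy & Hyz)|Hno].
- destruct (IH (fun y => P y /\ y <> z)) as (m & [Hm Hmz] & Hmin).
  + intros t [Ht Htz]. destruct (Hl t Ht) as [E|Ht']; [congruence|exact Ht'].
  + eauto.
  + destruct (classic (P z)) as [Hz|Hz].
    * destruct (Rle_dec m z) as [Hle|Hle].
      -- exists m. split; [exact Hm|]. intros t Ht. destruct (Req_dec t z) as [->|Hne]; [exact Hle|auto].
      -- exists z. split; [exact Hz|]. intros t Ht. destruct (Req_dec t z) as [->|Hne]; [lra|].
         specialize (Hmin t (conj Ht Hne)). lra.
    * exists m. split; [exact Hm|]. intros t Ht. apply Hmin. split; [exact Ht|].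
      intros ->. contradiction.
- exists x. split; [exact Hx|]. intros t Ht.
  assert (Et : t = z) by (apply NNPP; intros Hne; apply Hno; eauto).
  assert (Ex : x = z) by (apply NNPP; intros Hne; apply Hno; eauto). lra.
Qed.

(** * The graph of the primitive *)

(** Up to the first rise of [phi] above [0] there is nothing to show; just after it the
    derivative cannot vanish at more than finitely many points, hence is positive. *)
Lemma first_rise (phi psi : R -> R) (d s0 : R) (l : list R) :
  0 < d -> 0 < s0 -> (forall x, 0 <= x <= s0 -> continuous phi x) ->
  (forall x, 0 < x < s0 -> is_derive phi x (psi x)) ->
  (forall x, 0 < x < s0 -> continuous psi x) ->
  (forall x, d < x < s0 -> psi x = 0 -> In x l) ->
  phi 0 = 0 -> (forall x, 0 < x < d -> phi x < 0) -> 0 < phi s0 ->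
  exists b eta, d <= b /\ 0 < eta /\ b + eta < s0 /\ phi b = 0 /\
    (forall x, 0 <= x <= b -> phi x <= 0) /\ (forall x, b < x <= b + eta -> 0 < psi x).
Proof.
intros Hd Hs0 Hc Hder Hcpsi Hl H0 Hneg Hpos.
assert (Hds : d <= s0) by (apply Rnot_lt_le; intros H; specialize (Hneg s0); lra).
destruct (completeness (fun x => 0 <= x <= s0 /\ forall y, 0 <= y <= x -> phi y <= 0)) as [b [Hub Hlub]].
- exists s0. intros x [Hx _]; lra.
- exists 0. split; [lra|]. intros y Hy. replace y with 0 by lra. lra.
- assert (Hdb : d <= b).
  { apply Rnot_lt_le. intros Hlt.
    assert (Hb0 : 0 <= b) by (apply Hub; split; [lra|intros y Hy; replace y with 0 by lra; lra]).
    assert (A : (b + d) / 2 <= b).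
    { apply Hub. split; [lra|]. intros y Hy. destruct (Req_dec y 0) as [->|Hne]; [lra|].
      left. apply Hneg. lra. }
    lra. }
  assert (Hbs : b <= s0) by (apply Hlub; intros x [Hx _]; lra).
  assert (Hlt : forall y, 0 <= y < b -> phi y <= 0).
  { intros y Hy. apply Rnot_lt_le. intros Hp. enough (b <= y) by lra.
    apply Hlub. intros x [Hx Hx2]. apply Rnot_lt_le. intros Hyx. specialize (Hx2 y). lra. }
  assert (Hle : phi b <= 0).
  { apply Rnot_lt_le. intros Hp. destruct (continuous_gt phi b 0) as (e & He & He'); [apply Hc; lra|exact Hp|].
    max_of y 0 (b - e / 2) as Y1 Y2.
    assert (Y3 : y < b) by (apply Rmax_lub_lt; lra).
    specialize (He' y ltac:(apply Rabs_def1; lra)). specialize (Hlt y). lra. }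
  assert (Hall : forall y, 0 <= y <= b -> phi y <= 0).
  { intros y Hy. destruct (Req_dec y b) as [->|Hne]; [exact Hle|apply Hlt; lra]. }
  assert (Hbs' : b < s0) by (destruct Hbs as [H|H]; [exact H|subst b; lra]).
  assert (Hright : forall e, 0 < e -> exists y, b < y < b + e /\ y < s0 /\ 0 < phi y).
  { intros e He. apply NNPP. intros Hno.
    min_of x (b + e / 2) ((b + s0) / 2) as X1 X2.
    assert (X3 : b < x) by (apply Rmin_glb_lt; lra).
    enough (x <= b) by lra. apply Hub. split; [lra|]. intros y Hy.
    destruct (Rle_dec y b) as [Hyb|Hyb]; [apply Hall; lra|].
    apply Rnot_lt_le. intros Hp. apply Hno. exists y. split; [lra|]. split; [lra|exact Hp]. }
  assert (Hb0 : phi b = 0).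
  { apply Rle_antisym; [exact Hle|]. apply Rnot_lt_le. intros Hn.
    destruct (continuous_lt phi b 0) as (e & He & He'); [apply Hc; lra|exact Hn|].
    destruct (Hright e He) as (y & Hy1 & _ & Hy2). specialize (He' y ltac:(apply Rabs_def1; lra)). lra. }
  destruct (list_gap l b) as (e & He & Hgap).
  destruct (below2 (e / 2) ((s0 - b) / 2)) as (eta & Heta & E1 & E2); [lra|lra|].
  assert (Hnz : forall x, b < x <= b + eta -> psi x <> 0).
  { intros x Hx E. assert (A := Hgap x (Hl x ltac:(lra) E) ltac:(lra)).
    rewrite Rabs_pos_eq in A; lra. }
  exists b, eta. split; [exact Hdb|]. split; [exact Heta|]. split; [lra|]. split; [exact Hb0|].
  split; [exact Hall|].
  assert (Hp : 0 < psi (b + eta)).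
  { apply Rnot_le_lt. intros Hn.
    destruct (Hright eta Heta) as (y & Hy1 & _ & Hy2).
    assert (A : phi y <= phi b).
    { apply (derive_nonpos phi psi); [lra|intros; apply Hc; lra|intros; apply Hder; lra|].
      intros x Hx. assert (B : 0 < psi x * psi (b + eta)).
      { apply const_sign; [lra|intros; apply Hcpsi; lra|intros; apply Hnz; lra]. }
      nra. }
    lra. }
  intros x Hx. assert (B : 0 < psi x * psi (b + eta)).
  { apply const_sign; [lra|intros; apply Hcpsi; lra|intros; apply Hnz; lra]. }
  nra.
Qed.

Lemma local_max_zero (F f : R -> R) (x : R) : is_derive F x (f x) -> local_max F x -> f x = 0.
Proof.
intros Hd (e & He & Hm).
assert (A := interior_min (fun y => - F y) (fun y => - f y) (x - e / 2) (x + e / 2) x ltac:(lra)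
  (dR_opp _ _ _ Hd) ltac:(intros s Hs; assert (B := Hm s ltac:(apply Rabs_def1; lra)); lra)).
cbv beta in A. lra.
Qed.

Lemma interior_max (F : R -> R) (a b v x : R) :
  (forall y, a <= y <= b -> continuous F y) -> a <= x <= b -> F a < F x -> F b < F x ->
  exists z, a < z < b /\ local_max F z /\ F x <= F z.
Proof.
intros Hc Hx Ha Hb. destruct (cont_max F a b) as (z & Hz & Hmax); [lra|exact Hc|].
assert (Hzx := Hmax x Hx).
assert (z <> a) by (intros ->; lra). assert (z <> b) by (intros ->; lra).
exists z. split; [lra|]. split; [|exact Hzx].
exists (Rmin (z - a) (b - z)). split; [pos|]. intros y Hy. apply Hmax.
assert (M1 := Rmin_l (z - a) (b - z)). assert (M2 := Rmin_r (z - a) (b - z)).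
apply Rabs_def2 in Hy. lra.
Qed.

Section structure.

Variables (f : R -> R) (gm gs : Rbar) (delta : R).
Hypothesis A : common_assumptions f gm gs delta.
Hypothesis Htop : forall s : R, Rbar_lt gm s -> Rbar_lt s gs ->
  exists t0 : R, Rbar_lt t0 gs /\ forall t : R, t0 < t -> Rbar_lt t gs -> Fint f s < Fint f t.
Hypothesis Hbot : forall s : R, Rbar_lt gm s -> Rbar_lt s gs ->
  exists t0 : R, Rbar_lt gm t0 /\ forall t : R, Rbar_lt gm t -> t < t0 -> Fint f s < Fint f t.

Let F := Fint f.
Let Hc := f_cont _ _ _ _ A.
Let Hgm := gm_neg _ _ _ _ A.
Let Hgs := gs_pos _ _ _ _ A.

Lemma above_gm (x y : R) : Rbar_lt gm x -> x <= y -> Rbar_lt gm y.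
Proof. intros H1 H2. apply Rbar_lt_le_trans with x; [exact H1|exact H2]. Qed.

Lemma below_gs (x y : R) : Rbar_lt y gs -> x <= y -> Rbar_lt x gs.
Proof. intros H1 H2. apply Rbar_le_lt_trans with y; [exact H2|exact H1]. Qed.

Lemma above_gm0 (y : R) : 0 <= y -> Rbar_lt gm y.
Proof. intros H. apply (above_gm 0); [exact Hgm|exact H]. Qed.

Lemma F_cont_pos (x y : R) : Rbar_lt y gs -> 0 <= x <= y -> continuous F x.
Proof.
intros H1 H2. apply (F_cont_inside f gm gs Hc Hgm Hgs); [apply above_gm0; lra|].
apply (below_gs x y H1); lra.
Qed.

Lemma F_der_pos (x y : R) : Rbar_lt y gs -> 0 <= x <= y -> is_derive F x (f x).
Proof.
intros H1 H2. apply (F_derive_inside f gm gs Hc Hgm Hgs); [apply above_gm0; lra|].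
apply (below_gs x y H1); lra.
Qed.

Lemma F_0 : F 0 = 0.
Proof. apply Fint_0. Qed.

Lemma sign_change_negative (x : R) : delta < x -> Rbar_lt x gs -> f x = 0 ->
  forall eps, 0 < eps -> exists y, x - eps < y < x + eps /\ y <> x /\ f y < 0.
Proof.
intros Hx Hxs E eps He.
assert (Hd := delta_pos _ _ _ _ A).
destruct (f_zeros_sign _ _ _ _ A x) as (e & He' & Hs);
  [apply above_gm0; lra|exact Hxs|right; exact Hx|exact E|].
destruct (below2 (eps / 2) (e / 2)) as (d & Hd0 & D1 & D2); [lra|lra|].
specialize (Hs (x - d) (x + d) ltac:(lra) ltac:(lra)).
destruct (Rlt_dec (f (x - d)) 0) as [H|H].
- exists (x - d). split; [lra|]. split; [lra|exact H].
- exists (x + d). split; [lra|]. split; [lra|nra].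
Qed.

Variables (gamma1 gammaM beta1 betas : R).
Hypothesis Hgamma1 : is_gamma F gs 1 gamma1.
Hypothesis HgammaM : is_last_gamma F gs gammaM.
Hypothesis Hbeta1 : is_largest_level F 0 0 gamma1 beta1.
Hypothesis Hbetas : is_largest_level F (F gammaM) gammaM gs betas.

Lemma gamma1_next : next_right F gs 0 gamma1.
Proof. destruct Hgamma1 as (g0 & -> & H). exact H. Qed.

Lemma gamma1_pos : 0 < gamma1 /\ Rbar_lt gamma1 gs /\ 0 < F gamma1.
Proof.
destruct gamma1_next as (H1 & H2 & _ & H3 & _). rewrite F_0 in H3. auto.
Qed.

Lemma beta1_bounds : 0 < beta1 < gamma1 /\ F beta1 = 0.
Proof. destruct Hbeta1 as (H1 & H2 & H3 & _). simpl in H1, H2. auto. Qed.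

Lemma F_nonpos_upto_beta1 s : 0 <= s <= beta1 -> F s <= 0.
Proof.
intros Hs. destruct beta1_bounds as [Hb Hb0]. destruct gamma1_pos as (G1 & G2 & G3).
destruct gamma1_next as (_ & _ & _ & _ & Hno).
apply Rnot_lt_le. intros Hp.
destruct (interior_max F 0 beta1 0 s) as (z & Hz & Hmax & Hle).
- intros y Hy. apply (F_cont_pos y gamma1 G2). lra.
- exact Hs.
- rewrite F_0. exact Hp.
- rewrite Hb0. exact Hp.
- specialize (Hno z ltac:(lra) Hmax). rewrite F_0 in Hno. lra.
Qed.

Lemma F_pos_after_beta1 s : beta1 < s <= gamma1 -> 0 < F s.
Proof.
intros Hs. destruct beta1_bounds as [Hb Hb0]. destruct gamma1_pos as (G1 & G2 & G3).
destruct Hbeta1 as (_ & _ & _ & Hno).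
apply Rnot_le_lt. intros Hn.
destruct (ivt F s gamma1 0) as (t & Ht & E).
- lra.
- intros y Hy. apply (F_cont_pos y gamma1 G2). lra.
- lra.
- destruct (Req_dec t gamma1) as [->|Hne]; [lra|]. apply (Hno t); [lra|simpl; lra|exact E].
Qed.

(** By induction: a higher value before [gamma_(i+1)] would produce a local maximum that should
    have been chosen earlier. *)
Lemma gammas_dominate i g : is_gamma F gs (S i) g ->
  gamma1 <= g /\ Rbar_lt g gs /\ 0 < F g /\ forall t, 0 <= t <= g -> F t <= F g.
Proof.
revert g. induction i as [|i IH]; intros g (g0 & Hg0 & Hnext).
- simpl in Hg0. subst g0. destruct Hnext as (N1 & N2 & N3 & N4 & N5).
  rewrite F_0 in N4, N5.
  assert (Hle : gamma1 <= g).
  { apply Rnot_lt_le. intros Hlt. destruct gamma1_next as (_ & _ & _ & _ & Hno).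
    specialize (Hno g ltac:(lra) N3). rewrite F_0 in Hno. lra. }
  split; [exact Hle|]. split; [exact N2|]. split; [exact N4|].
  intros t Ht. apply Rnot_lt_le. intros Hlt.
  destruct (interior_max F 0 g 0 t) as (z & Hz & Hmax & Hzt).
  + intros y Hy. apply (F_cont_pos y g N2). lra.
  + lra.
  + rewrite F_0; lra.
  + lra.
  + specialize (N5 z Hz Hmax). lra.
- destruct (IH g0 Hg0) as (I1 & I2 & I3 & I4).
  destruct Hnext as (N1 & N2 & N3 & N4 & N5). destruct gamma1_pos as (G1 & G2 & G3).
  split; [lra|]. split; [exact N2|]. split; [lra|].
  intros t Ht. destruct (Rle_dec t g0) as [Hle|Hle]; [specialize (I4 t ltac:(lra)); lra|].
  apply Rnot_lt_le. intros Hlt.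
  destruct (interior_max F g0 g 0 t) as (z & Hz & Hmax & Hzt).
  + intros y Hy. apply (F_cont_pos y g N2). lra.
  + lra.
  + lra.
  + lra.
  + specialize (N5 z Hz Hmax). lra.
Qed.

Lemma gammaM_facts : gamma1 <= gammaM /\ Rbar_lt gammaM gs /\ 0 < F gammaM /\
  forall t, 0 <= t <= gammaM -> F t <= F gammaM.
Proof.
destruct HgammaM as ([|i] & Hi & Hlast).
- exfalso. simpl in Hi. subst gammaM. exact (Hlast gamma1 gamma1_next).
- exact (gammas_dominate i gammaM Hi).
Qed.

Lemma delta_le_gammaM : delta < gammaM.
Proof.
destruct gammaM_facts as (M1 & M2 & M3 & _). destruct gamma1_pos as (G1 & G2 & G3).
destruct beta1_bounds as [Hb Hb0]. assert (Hd := delta_pos _ _ _ _ A).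
enough (delta <= beta1) by lra.
apply Rnot_lt_le. intros Hlt.
assert (B := F_neg _ _ _ _ A beta1). fold F in B. rewrite Hb0 in B. enough (0 < 0) by lra.
apply B.
- split; [apply above_gm0; lra|]. apply Rbar_lt_le, (below_gs _ gamma1 G2). lra.
- rewrite Rabs_pos_eq; lra.
Qed.

Lemma no_higher_max (t : R) : gammaM < t -> Rbar_lt t gs -> local_max F t -> F t <= F gammaM.
Proof.
intros Ht Hts Hmax. apply Rnot_lt_le. intros Hlt.
destruct gammaM_facts as (M1 & M2 & M3 & _). destruct gamma1_pos as (G1 & _).
destruct (f_zeros_finite _ _ _ _ A) as [l Hl].
destruct (list_least l (fun x => gammaM < x /\ Rbar_lt x gs /\ local_max F x /\ F gammaM < F x))
  as (m & (Q1 & Q2 & Q3 & Q4) & Hmin).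
- intros x (X1 & X2 & X3 & X4). assert (D := delta_le_gammaM).
  apply Hl; [apply above_gm0; lra|exact X2|right; lra|].
  apply (local_max_zero F f x); [|exact X3]. apply (F_der_pos x x X2). lra.
- exists t. auto.
- destruct HgammaM as (M & _ & Hlast). apply (Hlast m).
  split; [exact Q1|]. split; [exact Q2|]. split; [exact Q3|]. split; [exact Q4|].
  intros y Hy Hym. apply Rnot_lt_le. intros Hyl.
  assert (m <= y); [|lra]. apply Hmin. split; [lra|]. split; [|auto].
  apply (below_gs y m Q2). lra.
Qed.

Lemma betas_bounds : gammaM < betas /\ Rbar_lt betas gs /\ F betas = F gammaM.
Proof. destruct Hbetas as (H1 & H2 & H3 & _). auto. Qed.

Lemma F_above_betas (s : R) : betas < s -> Rbar_lt s gs -> F gammaM < F s.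
Proof.
intros Hs Hss. destruct betas_bounds as (B1 & B2 & B3). destruct Hbetas as (_ & _ & _ & Hno).
destruct gammaM_facts as (M1 & M2 & M3 & _). destruct gamma1_pos as (G1 & _).
destruct (Htop gammaM) as (t0 & Ht0 & Ht); [apply above_gm0; lra|exact M2|].
apply Rnot_le_lt. intros Hle.
assert (Hmx : exists t : R, s < t /\ t0 < t /\ Rbar_lt t gs).
{ destruct (Rle_dec s t0) as [H|H].
  - destruct (between_above gs t0 Ht0) as (t & T1 & T2). exists t. split; [lra|auto].
  - destruct (between_above gs s Hss) as (t & T1 & T2). exists t. split; [lra|]. split; [lra|auto]. }
destruct Hmx as (t & T1 & T2 & T3). specialize (Ht t T2 T3). fold F in Ht.
destruct (ivt F s t (F gammaM)) as (x & Hx & E).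
- lra.
- intros y Hy. apply (F_cont_pos y t T3). lra.
- lra.
- apply (Hno x); [lra| |exact E]. apply (below_gs x t T3). lra.
Qed.

(** A zero of [f] beyond [betas] would be a sign change, hence produce a local maximum of [F]
    higher than the last one. *)
Lemma f_pos_above_betas (s : R) : betas < s -> Rbar_lt s gs -> 0 < f s.
Proof.
intros Hs Hss. destruct betas_bounds as (B1 & B2 & B3).
destruct gammaM_facts as (M1 & M2 & M3 & _). destruct gamma1_pos as (G1 & _).
assert (Hneg : forall x : R, betas < x -> Rbar_lt x gs -> ~ f x < 0).
{ intros x Hx Hxs Hf.
  destruct (derive_neg_local F x (f x)) as (d & Hd & _ & Hl); [apply (F_der_pos x x Hxs); lra|exact Hf|].
  max_of y (x - d / 2) ((betas + x) / 2) as Y1 Y2.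
  assert (Y3 : y < x) by (apply Rmax_lub_lt; lra).
  specialize (Hl y ltac:(lra)). assert (P := F_above_betas x Hx Hxs).
  destruct (interior_max F betas x 0 y) as (z & Hz & Hmax & Hzy); try lra.
  - intros t Ht. apply (F_cont_pos t x Hxs). lra.
  - assert (Q := no_higher_max z ltac:(lra) ltac:(apply (below_gs z x Hxs); lra) Hmax). lra. }
destruct (Rtotal_order (f s) 0) as [H|[H|H]]; [exfalso; exact (Hneg s Hs Hss H)| |exact H].
exfalso. assert (D := delta_le_gammaM).
destruct (between_above gs s Hss) as (s' & S1 & S2).
destruct (sign_change_negative s ltac:(lra) Hss H (Rmin (s - betas) (s' - s))) as (y & Hy & _ & Hfy).
{ pos. }
assert (N1 := Rmin_l (s - betas) (s' - s)). assert (N2 := Rmin_r (s - betas) (s' - s)).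
apply (Hneg y); [lra|apply (below_gs y s' S2); lra|exact Hfy].
Qed.

Lemma F_below_betas s : 0 <= s <= betas -> F s <= F gammaM.
Proof.
intros Hs. destruct betas_bounds as (B1 & B2 & B3).
destruct gammaM_facts as (M1 & M2 & M3 & M4). destruct gamma1_pos as (G1 & _).
destruct (Rle_dec s gammaM) as [H|H]; [apply M4; lra|].
apply Rnot_lt_le. intros Hlt.
destruct (interior_max F gammaM betas 0 s) as (z & Hz & Hmax & Hzs); try lra.
- intros y Hy. apply (F_cont_pos y betas B2). lra.
- assert (Q := no_higher_max z ltac:(lra) ltac:(apply (below_gs z betas B2); lra) Hmax). lra.
Qed.

(** [f] cannot vanish at [betas], since it would change sign there although [F] is below
    [F gammaM] on the left and above it on the right. *)
Lemma f_pos_betas : 0 < f betas.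
Proof.
destruct betas_bounds as (B1 & B2 & B3).
destruct gammaM_facts as (M1 & M2 & M3 & M4). destruct gamma1_pos as (G1 & _).
assert (D := delta_le_gammaM).
assert (Hneg : forall x, gammaM < x -> Rbar_lt x gs -> x <= betas -> f x < 0 -> x < betas -> F betas <= F x -> False).
{ intros x X1 X2 X3 X4 X5 X6.
  destruct (derive_neg_local F x (f x)) as (d & Hd & _ & Hl); [apply (F_der_pos x x X2); lra|exact X4|].
  max_of y (x - d / 2) ((gammaM + x) / 2) as Y1 Y2.
  assert (Y3 : y < x) by (apply Rmax_lub_lt; lra).
  specialize (Hl y ltac:(lra)). assert (P := F_below_betas y ltac:(lra)). lra. }
destruct (Rtotal_order (f betas) 0) as [H|[H|H]]; [exfalso|exfalso|exact H].
- destruct (derive_neg_local F betas (f betas)) as (d & Hd & _ & Hl); [apply (F_der_pos betas betas B2); lra|exact H|].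
  max_of y (betas - d / 2) ((gammaM + betas) / 2) as Y1 Y2.
  assert (Y3 : y < betas) by (apply Rmax_lub_lt; lra).
  specialize (Hl y ltac:(lra)). assert (P := F_below_betas y ltac:(lra)). lra.
- destruct (f_zeros_sign _ _ _ _ A betas) as (e & He & Hs);
    [apply above_gm0; lra|exact B2|right; lra|exact H|].
  destruct (between_above gs betas B2) as (s' & S1 & S2).
  min_of yr (betas + e / 2) s' as R1 R2.
  assert (R3 : betas < yr) by (apply Rmin_glb_lt; lra).
  assert (Pr := f_pos_above_betas yr R3 ltac:(apply (below_gs yr s' S2); lra)).
  max_of yl (betas - e / 2) ((gammaM + betas) / 2) as L1 L2.
  assert (L3 : yl < betas) by (apply Rmax_lub_lt; lra).
  assert (Hlt : F betas <= F yl).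
  { apply (derive_nonpos F f); [lra| | |].
    - intros x Hx. apply (F_cont_pos x betas B2). lra.
    - intros x Hx. apply (F_der_pos x betas B2). lra.
    - intros x Hx. specialize (Hs x yr ltac:(lra) ltac:(lra)). nra. }
  apply (Hneg yl); try lra.
  + apply (below_gs yl betas B2). lra.
  + specialize (Hs yl yr ltac:(lra) ltac:(lra)). nra.
Qed.

(** The well around [0] and its two edges; a finite zero set makes [F] strictly monotone just
    outside the well. *)
Lemma central_data : exists cm bm cp h : R,
  Rbar_lt gm cm /\ cp < gamma1 /\ h <= F gammaM /\
  forall m M : R, Rbar_lt gm m -> m <= cm -> cp <= M -> Rbar_le M gs ->
    central (clampf m M f) cm bm beta1 cp h.
Proof.
destruct beta1_bounds as [Hb Hb0]. destruct gamma1_pos as (G1 & G2 & G3).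
destruct gammaM_facts as (M1 & M2 & M3 & M4).
assert (Hd := delta_pos _ _ _ _ A).
destruct (f_zeros_finite _ _ _ _ A) as [l Hl].
destruct (first_rise F f delta gamma1 l) as (b & eta & Q1 & Q2 & Q3 & Q4 & Q5 & Q6); auto.
{ intros x Hx. apply (F_cont_pos x gamma1 G2 Hx). }
{ intros x Hx. apply (F_der_pos x gamma1 G2). lra. }
{ intros x Hx. apply (f_cont_inside f gm gs Hc Hgm Hgs); [apply above_gm0; lra|apply (below_gs x gamma1 G2); lra]. }
{ intros x Hx E. apply Hl; [apply above_gm0; lra|apply (below_gs x gamma1 G2); lra|right; lra|exact E]. }
{ apply F_0. }
{ intros x Hx. destruct (Rlt_dec x gamma1) as [H|H].
  - apply (F_neg _ _ _ _ A).
    + split; [apply above_gm0; lra|]. apply Rbar_lt_le, (below_gs x gamma1 G2). lra.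
    + rewrite Rabs_pos_eq; lra.
  - exfalso. assert (B := F_neg _ _ _ _ A gamma1). fold F in B. enough (F gamma1 < 0) by lra. apply B.
    + split; [apply above_gm0; lra|]. apply Rbar_lt_le, G2.
    + rewrite Rabs_pos_eq; lra. }
assert (Eb : b = beta1).
{ destruct (Rtotal_order b beta1) as [H|[H|H]]; [exfalso|exact H|exfalso].
  - min_of x (b + eta) beta1 as X1 X2.
    assert (X3 : b < x) by (apply Rmin_glb_lt; lra).
    destruct (mean_value F f ((b + x) / 2) x) as (c & Hc' & E); [lra|intros y Hy; apply (F_der_pos y gamma1 G2); lra|].
    assert (P := Q6 c ltac:(lra)).
    assert (0 < f c * (x - (b + x) / 2)) by pos.
    assert (Z : F b <= F ((b + x) / 2)).
    { apply (derive_nonneg F f); [lra| | |].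
      - intros y Hy. apply (F_cont_pos y gamma1 G2). lra.
      - intros y Hy. apply (F_der_pos y gamma1 G2). lra.
      - intros y Hy. left. apply Q6. lra. }
    assert (Z2 := F_nonpos_upto_beta1 x ltac:(lra)). lra.
  - assert (P := F_pos_after_beta1 b ltac:(lra)). lra. }
subst b.
(* The negative edge, found by reflecting the line. *)
destruct (Hbot gammaM) as (t0 & Ht0 & Ht0'); [apply above_gm0; lra|exact M2|].
destruct (between_below gm (Rmin t0 0)) as (sm & Sm1 & Sm2).
{ unfold Rmin. destruct (Rle_dec t0 0); assumption. }
assert (N1 := Rmin_l t0 0). assert (N2 := Rmin_r t0 0).
assert (Fsm : 0 < F sm) by (specialize (Ht0' sm Sm1 ltac:(lra)); fold F in Ht0'; lra).
assert (Hin : forall x, 0 <= x <= - sm -> Rbar_lt gm (- x) /\ Rbar_lt (- x) gs).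
{ intros x Hx. split; [apply (above_gm sm); [exact Sm1|lra]|apply (below_gs _ 0 Hgs); lra]. }
assert (Hm_neg : forall x, 0 < x < delta -> x <= - sm -> F (- x) < 0).
{ intros x Hx Hx2. destruct (Hin x ltac:(lra)) as [I1 I2]. apply (F_neg _ _ _ _ A).
  - split; [exact I1|apply Rbar_lt_le, I2].
  - rewrite Rabs_Ropp, Rabs_pos_eq; lra. }
destruct (first_rise (fun s => F (- s)) (fun s => - f (- s)) delta (- sm) (map Ropp l))
  as (b & etam & P1 & P2 & P3 & P4 & P5 & P6); auto.
{ lra. }
{ intros x Hx. destruct (Hin x Hx). apply (continuous_comp Ropp F);
    [apply continuous_Ropp, continuous_id|apply (F_cont_inside f gm gs); assumption]. }
{ intros x Hx. destruct (Hin x ltac:(lra)). eapply is_derive_eq.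
  - apply (dR_comp F Ropp); [apply (F_derive_inside f gm gs); assumption|apply (dR_opp (fun y => y)), dR_id].
  - ring. }
{ intros x Hx. destruct (Hin x ltac:(lra)). apply continuous_Ropp.
  apply (continuous_comp Ropp f); [apply continuous_Ropp, continuous_id|apply (f_cont_inside f gm gs); assumption]. }
{ intros x Hx E. destruct (Hin x ltac:(lra)). rewrite <- (Ropp_involutive x). apply in_map.
  apply Hl; [assumption|assumption|left; lra|lra]. }
{ rewrite Ropp_0. apply F_0. }
{ intros x Hx. destruct (Rle_dec x (- sm)) as [H|H]; [apply Hm_neg; [exact Hx|exact H]|].
  exfalso. assert (B := Hm_neg (- sm) ltac:(lra) ltac:(lra)). rewrite Ropp_involutive in B. lra. }
{ rewrite Ropp_involutive. exact Fsm. }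
set (bm := - b). set (c1 := beta1 + eta). set (c2 := - (b + etam)).
assert (Hinc : forall s t, beta1 <= s -> s < t -> t <= c1 -> F s < F t).
{ intros s t S1 S2 S3. set (x := (s + t) / 2).
  assert (Z : F s <= F x).
  { apply (derive_nonneg F f); [unfold x; lra| | |].
    - intros y Hy. apply (F_cont_pos y gamma1 G2). unfold x, c1 in *; lra.
    - intros y Hy. apply (F_der_pos y gamma1 G2). unfold x, c1 in *; lra.
    - intros y Hy. left. apply Q6. unfold x, c1 in *; lra. }
  destruct (mean_value F f x t) as (c & Hc' & E); [unfold x; lra|intros y Hy; apply (F_der_pos y gamma1 G2); unfold x, c1 in *; lra|].
  assert (Pc := Q6 c ltac:(unfold x, c1 in *; lra)).
  assert (0 < f c * (t - x)) by (apply Rmult_lt_0_compat; [exact Pc|unfold x; lra]). lra. }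
assert (Hinm : forall x, c2 <= x <= 0 -> Rbar_lt gm x /\ Rbar_lt x gs).
{ intros x Hx. rewrite <- (Ropp_involutive x). apply Hin. unfold c2 in Hx; lra. }
assert (Hneg : forall x, c2 <= x < bm -> f x < 0).
{ intros x Hx. assert (B := P6 (- x) ltac:(unfold c2, bm in Hx; lra)). rewrite Ropp_involutive in B. lra. }
assert (Hdec : forall s t, c2 <= s -> s < t -> t <= bm -> F t < F s).
{ intros s t S1 S2 S3. set (x := (s + t) / 2).
  assert (Z : F t <= F x).
  { apply (derive_nonpos F f); [unfold x; lra| | |].
    - intros y Hy. destruct (Hinm y ltac:(unfold x, bm in *; lra)). apply (F_cont_inside f gm gs); assumption.
    - intros y Hy. destruct (Hinm y ltac:(unfold x, bm in *; lra)). apply (F_derive_inside f gm gs); assumption.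
    - intros y Hy. left. apply Hneg. unfold x in *; lra. }
  destruct (mean_value F f s x) as (c & Hc' & E); [unfold x; lra| |].
  { intros y Hy. destruct (Hinm y ltac:(unfold x, bm in *; lra)). apply (F_derive_inside f gm gs); assumption. }
  assert (Pc := Hneg c ltac:(unfold x in *; lra)).
  assert (0 < (- f c) * (x - s)) by (apply Rmult_lt_0_compat; [lra|unfold x; lra]). lra. }
assert (Hbm0 : F bm = 0) by exact P4.
assert (Hc1 : 0 < F c1) by (rewrite <- Hb0; apply Hinc; unfold c1; lra).
assert (Hc2 : 0 < F c2) by (rewrite <- Hbm0; apply Hdec; unfold c2, bm; lra).
destruct (below2 (F c1) (F c2)) as (h & Hh & H1 & H2); [lra|lra|].
destruct (ivt F beta1 c1 h) as (cp & Hcp & Ecp).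
{ unfold c1; lra. } { intros y Hy. apply (F_cont_pos y gamma1 G2). unfold c1 in Hy; lra. } { lra. }
destruct (ivt F c2 bm h) as (cm & Hcm & Ecm).
{ unfold c2, bm; lra. }
{ intros y Hy. destruct (Hinm y ltac:(unfold bm in *; lra)). apply (F_cont_inside f gm gs); assumption. }
{ lra. }
assert (Hcp' : beta1 < cp) by (destruct (Req_dec cp beta1) as [->|]; lra).
assert (Hcm' : cm < bm) by (destruct (Req_dec cm bm) as [->|]; lra).
exists cm, bm, cp, h.
split; [apply Hinm; unfold bm in *; lra|]. split; [unfold c1 in Hcp; lra|].
split; [apply Rle_trans with (F c1); [exact H1|apply M4; unfold c1; lra]|].
intros m M Hm Hmc HcM HMs.
assert (Hbmn : bm < 0) by (unfold bm; lra).
assert (Hm0 : m < 0 < M) by lra.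
assert (Heq : forall s, m <= s <= M -> Fint (clampf m M f) s = F s) by (intros s Hs; apply Fint_clampf; assumption).
assert (Hfeq : forall s, m <= s <= M -> clampf m M f s = f s) by (intros s Hs; apply clampf_eq; assumption).
assert (HFle : forall s, bm <= s <= beta1 -> F s <= 0).
{ intros s Hs. destruct (Rle_dec 0 s); [apply F_nonpos_upto_beta1; lra|].
  assert (B := P5 (- s) ltac:(unfold bm in Hs; lra)). cbv beta in B. rewrite Ropp_involutive in B. exact B. }
assert (Hinw : forall x, bm <= x <= beta1 -> Rbar_lt gm x /\ Rbar_lt x gs).
{ intros x Hx. split; [apply (above_gm cm); [apply Hinm; unfold bm in *; lra|lra]|apply (below_gs _ gamma1 G2); lra]. }
split.
- intros x. apply (clampf_cont f gm gs); assumption.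
- apply (clampf_lip f gm gs); try assumption. exact (f_lip _ _ _ _ A).
- apply clampf_0; [exact (f_0 _ _ _ _ A)|exact Hm0].
- exact Hcm'.
- unfold bm; lra.
- lra.
- exact Hcp'.
- exact Hh.
- intros s Hs. rewrite Heq by lra. apply HFle, Hs.
- intros p q Hp Hpq Hq.
  assert (Hex : exists s, p < s < q /\ F s < 0).
  { apply NNPP. intros Hno.
    assert (Hz : forall s, p < s < q -> F s = 0).
    { intros s Hs. apply Rle_antisym; [apply HFle; lra|]. apply Rnot_lt_le. intros Hl'. apply Hno. eauto. }
    assert (Hfz : forall s, p < s < q -> f s = 0).
    { intros s Hs. destruct (Hinw s ltac:(lra)) as [I1 I2].
      rewrite <- (is_derive_unique _ _ _ (F_derive_inside f gm gs Hc Hgm Hgs s I1 I2)).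
      apply is_derive_unique. apply (is_derive_ext_loc (fun _ => 0)); [|apply dR_const].
      generalize (near_inside ((p + s) / 2) ((s + q) / 2) s ltac:(lra)). apply filter_imp.
      intros x Hx. symmetry. apply Hz. lra. }
    destruct (list_not_interval (0 :: delta :: - delta :: l) p q Hpq) as (x & Hx & Hnin).
    apply Hnin. destruct (Hinw x ltac:(lra)) as [I1 I2].
    destruct (Req_dec x 0) as [->|N0]; [left; reflexivity|].
    destruct (Req_dec x delta) as [->|N1']; [right; left; reflexivity|].
    destruct (Req_dec x (- delta)) as [->|N2']; [right; right; left; reflexivity|].
    right; right; right. apply Hl; [exact I1|exact I2| |apply Hfz, Hx].
    destruct (Rlt_dec (Rabs x) delta) as [Hlt|Hge].
    - exfalso. assert (B := F_neg _ _ _ _ A x (conj I1 (Rbar_lt_le _ _ I2)) (conj (Rabs_pos_lt _ N0) Hlt)).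
      fold F in B. rewrite (Hz x Hx) in B. lra.
    - unfold Rabs in Hge. destruct (Rcase_abs x); [left|right]; lra. }
  destruct Hex as (s & Hs & HFs). exists s. split; [exact Hs|]. rewrite Heq; lra.
- exists (Rmin delta (Rmin (- bm) beta1)). split; [repeat apply Rmin_pos; unfold bm; lra|].
  intros s [Hs1 Hs2].
  assert (B1 := Rmin_l delta (Rmin (- bm) beta1)). assert (B2 := Rmin_r delta (Rmin (- bm) beta1)).
  assert (B3 := Rmin_l (- bm) beta1). assert (B4 := Rmin_r (- bm) beta1).
  assert (Hs3 : - Rmin (- bm) beta1 < s < Rmin (- bm) beta1) by (apply Rabs_def2 in Hs2; lra).
  rewrite Heq by lra. destruct (Hinw s ltac:(lra)) as [I1 I2].
  apply (F_neg _ _ _ _ A); [split; [exact I1|apply Rbar_lt_le, I2]|lra].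
- intros s Hs. rewrite Hfeq by (unfold bm in *; lra). apply Q6. unfold c1 in Hcp. lra.
- intros s Hs. rewrite Hfeq by lra. apply Hneg. lra.
- rewrite Heq by (unfold bm in *; lra). exact Hb0.
- rewrite Heq by lra. exact Hbm0.
- rewrite Heq by (unfold bm in *; lra). exact Ecp.
- rewrite Heq by lra. exact Ecm.
Qed.

End structure.

(** * Descending into the well and staying there *)

Lemma stays_below n g a u w r : (forall x, continuous g x) -> sol n g a u w ->
  (forall s, a < s -> Fint g a < Fint g s) -> u r <= a.
Proof.
intros Hg S Ha. apply Rnot_lt_le. intros Hlt.
assert (A := energy_le_init Hg S r). assert (B := F_le_energy g u w r).
specialize (Ha _ Hlt). lra.
Qed.

(** Coming down to [c] would leave no energy for motion. *)
Lemma trapped_above n g a u w c : (1 <= n)%nat -> (forall x, continuous g x) -> sol n g a u w ->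
  c < a -> Fint g a <= Fint g c -> forall r, c < u r.
Proof.
intros Hn Hg S Hca HF r.
destruct (Rle_dec r 0) as [Hr|Hr]; [destruct (sol_init S r Hr) as [-> _]; exact Hca|].
apply Rnot_le_lt. intros Hle.
destruct (ivt u 0 r c) as (t & Ht & E).
- lra.
- intros; apply (sol_cu S).
- destruct (sol_init S 0 (Rle_refl 0)) as [-> _]. lra.
- destruct (sol_init S 0 (Rle_refl 0)) as [E0 _].
  assert (Ht0 : 0 < t) by (destruct (proj1 Ht) as [H|H]; [exact H|subst t; lra]).
  assert (B := F_le_energy g u w t). rewrite E in B.
  destruct (energy_const_rest Hg S 0 t Hn) as [Hu _]; [lra| |].
  + rewrite (energy_0 S 0) by lra. lra.
  + specialize (Hu t ltac:(lra)). lra.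
Qed.

(** Gronwall's inequality for [(u - p)^2 + w^2], on whose derivative the friction has a good
    sign. *)
Lemma near_top n g a u w p eta L R : sol n g a u w -> 0 <= L -> 0 < eta -> 0 <= R -> a <= p ->
  (forall r, u r <= a) -> (forall s, p - eta <= s <= a -> Rabs (g s) <= L * (p - s)) ->
  (p - a) ^ 2 * exp ((1 + L) * R) < eta * eta ->
  forall r, 0 <= r <= R -> p - eta < u r.
Proof.
intros S HL He HR Hap Hp Hg Hsmall r Hr. apply Rnot_le_lt. intros Hle.
destruct (sol_init S 0 (Rle_refl 0)) as [U0 W0].
assert (Hexp : forall x, 0 <= x <= R -> (p - a) ^ 2 * exp ((1 + L) * x) < eta * eta).
{ intros x Hx. apply Rle_lt_trans with (2 := Hsmall). apply Rmult_le_compat_l; [apply pow2_ge_0|].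
  assert (Hx2 : (1 + L) * x <= (1 + L) * R) by (apply Rmult_le_compat_l; lra).
  destruct Hx2 as [H|H]; [left; apply exp_increasing, H|rewrite H; lra]. }
assert (Ha : p - eta < u 0).
{ rewrite U0. specialize (Hexp 0 ltac:(lra)). rewrite Rmult_0_r, exp_0, Rmult_1_r in Hexp.
  specialize (Hp 0). rewrite U0 in Hp. apply Rnot_le_lt. intros H. nra. }
destruct (first_le u 0 r (p - eta)) as (t & Ht & Et & Hbef); [lra|intros; apply (sol_cu S)|exact Ha|exact Hle|].
assert (G := gronwall (fun r => (u r - p) ^ 2 + w r ^ 2)
  (fun r => 2 * (u r - p) * (w r - 0) + 2 * w r * (- (INR n / r) * w r - g (u r))) (1 + L) 0 t).
rewrite Rminus_0_r in G.
assert (Hfin : (u t - p) ^ 2 + w t ^ 2 <= ((u 0 - p) ^ 2 + w 0 ^ 2) * exp ((1 + L) * t)).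
{ apply G.
  - lra.
  - intros x _. apply cR_plus; [apply (cR_sqr (fun r => u r - p)), cR_minus; [apply (sol_cu S)|apply continuous_const]|].
    apply cR_sqr, (sol_cw S).
  - intros x Hx. apply dR_plus; [apply (dR_sqr (fun r => u r - p)), dR_minus; [apply (sol_du S)|apply dR_const]|].
    apply dR_sqr, (sol_dw S). lra.
  - intros x Hx. assert (B := Hbef x ltac:(lra)). assert (B2 := Hp x).
    assert (Hgx := Hg (u x) ltac:(lra)).
    assert (Hnx : 0 <= INR n / x) by pos.
    assert (0 <= INR n / x * w x ^ 2) by pos.
    set (y := p - u x) in *. assert (Hy : 0 <= y) by (unfold y; lra).
    replace (u x - p) with (- y) by (unfold y; ring).
    apply Rabs_le_between in Hgx.
    assert (Hwg : - w x * g (u x) <= Rabs (w x) * (L * y)).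
    { unfold Rabs. destruct (Rcase_abs (w x)); nra. }
    assert (Hyw : - y * w x <= y * Rabs (w x)) by (unfold Rabs; destruct (Rcase_abs (w x)); nra).
    assert (Sq : 2 * (y * Rabs (w x)) <= y ^ 2 + w x ^ 2).
    { assert (Q := pow2_ge_0 (y - Rabs (w x))). assert (Q2 := abs_sqr (w x)).
      replace (w x ^ 2) with (Rabs (w x) * Rabs (w x)) by (rewrite Q2; ring). lra. }
    assert (L * (2 * (y * Rabs (w x))) <= L * (y ^ 2 + w x ^ 2)) by (apply Rmult_le_compat_l; lra).
    lra. }
rewrite Et, U0, W0 in Hfin. specialize (Hexp t ltac:(lra)).
replace ((a - p) ^ 2 + 0 ^ 2) with ((p - a) ^ 2) in Hfin by ring.
assert (Q := pow2_ge_0 (w t)). replace ((p - eta - p) ^ 2) with (eta * eta) in Hfin by ring. lra.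
Qed.

(** From a late time at which [u = bb] with decreasing [u], the friction is too weak to stop the
    solution before [b1], and the time spent can be estimated: above [bs] the force is bounded
    below, below [bs] the velocity is. *)
Lemma descent n g a u w bb bs b1 mf GM Gm C :
  (1 <= n)%nat -> (forall x, continuous g x) -> sol n g a u w ->
  b1 < bs -> bs < bb -> 0 < mf -> (forall s, bs <= s <= bb -> mf <= g s) ->
  (forall s, b1 <= s <= bs -> Fint g s <= GM) -> (forall s, b1 <= s <= bb -> Gm <= Fint g s) ->
  GM < Fint g bb -> Gm <= GM ->
  C = 2 * INR n * ((bb - b1) / (Fint g bb - GM)) * sqrt (2 * (Fint g bb - Gm)) ->
  u C = bb -> w C < 0 ->
  exists T, C < T /\
    T <= C + ((bs - b1) / sqrt (Fint g bb - GM) + sqrt (2 * INR (S n) * (bb - bs) / mf)) /\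
    u T = b1 /\ (forall r, C <= r < T -> b1 < u r) /\ (forall r, C <= r <= T -> u r <= bb).
Proof.
intros Hn Hg S H1 H2 Hmf Hf HGM HGm HD HGmM HC HuC HwC.
assert (Hn0 : 0 < INR n) by pos.
set (D := Fint g bb - GM) in *. assert (HD0 : 0 < D) by (unfold D; lra).
set (sp := sqrt (2 * (Fint g bb - Gm))) in *.
assert (Hsp : 0 < sp) by pos.
assert (Hsp2 : sp * sp = 2 * (Fint g bb - Gm)) by (apply sqrt_sqrt; lra).
assert (HC0 : 0 < C).
{ rewrite HC. apply Rmult_lt_0_compat; [|exact Hsp]. apply Rmult_lt_0_compat; [lra|].
  apply Rdiv_lt_0_compat; lra. }
set (tau1 := sqrt (2 * INR (Datatypes.S n) * (bb - bs) / mf)).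
set (tau2 := (bs - b1) / sqrt D).
assert (HN : 0 < INR (Datatypes.S n)) by pos.
assert (Harg : 0 < 2 * INR (Datatypes.S n) * (bb - bs) / mf) by pos.
assert (Ht1 : 0 < tau1) by pos.
assert (Ht1s : tau1 * tau1 = 2 * INR (Datatypes.S n) * (bb - bs) / mf) by (apply sqrt_sqrt; lra).
assert (HsD : 0 < sqrt D) by pos.
assert (HsD2 : sqrt D * sqrt D = D) by (apply sqrt_sqrt; lra).
assert (Ht2 : 0 < tau2) by pos.
assert (Ht2s : sqrt D * tau2 = bs - b1) by (unfold tau2; field; lra).
set (X := C + (tau2 + tau1)).
assert (Hcu : forall r, continuous u r) by (intros; apply (sol_cu S)).
(* As long as the solution moves down within [b1, bb] it keeps half of the energy excess. *)
assert (Hener : forall r, C <= r -> (forall s, C < s < r -> w s <= 0) -> b1 <= u r ->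
  GM + D / 2 <= energy g u w r).
{ intros r Hr Hw Hur. apply Rnot_lt_le. intros Hlt.
  assert (Hmon : forall s, C <= s <= r -> u r <= u s <= bb).
  { intros s Hs. split.
    - apply (derive_nonpos u w); [lra|auto|intros; apply (sol_du S)|intros x Hx; apply Hw; lra].
    - rewrite <- HuC. apply (derive_nonpos u w); [lra|auto|intros; apply (sol_du S)|intros x Hx; apply Hw; lra]. }
  assert (EC : Fint g bb <= energy g u w C) by (rewrite <- HuC; apply F_le_energy).
  destruct (last_ge (energy g u w) C r (Fint g bb)) as (s & Hs & Es & Haft); [lra|intros; apply (energy_cont Hg S)|exact EC|unfold D in Hlt; lra|].
  assert (L := energy_loss n g a u w s r sp Hg S ltac:(lra)
    ltac:(right; intros x Hx; apply Hw; lra)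
    ltac:(intros x Hx; apply abs_le_sqr; [lra|];
          assert (A := Haft x ltac:(lra)); assert (B := HGm (u x) ltac:(destruct (Hmon x ltac:(lra)); lra));
          unfold energy in A; lra)).
  assert (K1 : INR n / s * sp * Rabs (u r - u s) <= INR n / C * sp * (bb - b1)).
  { destruct (Hmon s ltac:(lra)). rewrite Rabs_left1 by lra.
    apply Rmult_le_compat; [|lra| |lra].
    - apply Rmult_le_pos; [|lra]. apply Rmult_le_pos; [lra|left; pos].
    - apply Rmult_le_compat_r; [lra|]. apply Rmult_le_compat_l; [lra|]. apply Rinv_le_contravar; lra. }
  assert (K2 : INR n / C * sp * (bb - b1) = D / 2).
  { assert (HCD : C * D = 2 * INR n * (bb - b1) * sp) by (rewrite HC; clearbody sp D; field; lra).
    apply Rmult_eq_reg_r with C; [|lra]. transitivity (INR n * (bb - b1) * sp); [field; lra|]. lra. }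
  unfold D in *. lra. }
assert (Hdown : forall x, C <= x -> (forall r, C <= r <= x -> b1 < u r) -> forall r, C <= r <= x -> w r < 0).
{ intros x Hx Hab r Hr. apply Rnot_le_lt. intros Hle.
  destruct (first_ge w C r 0) as (t & Ht & Et & Hbef); [lra|intros; apply (sol_cw S)|exact HwC|exact Hle|].
  assert (Hwt : forall s, C < s < t -> w s <= 0) by (intros s Hs; left; apply Hbef; lra).
  assert (HE := Hener t ltac:(lra) Hwt ltac:(left; apply Hab; lra)).
  assert (Hut : u t <= bb).
  { rewrite <- HuC. apply (derive_nonpos u w); [lra|auto|intros; apply (sol_du S)|exact Hwt]. }
  assert (Hus : bs < u t).
  { apply Rnot_le_lt. intros Hl. assert (A := HGM (u t) ltac:(split; [left; apply Hab; lra|exact Hl])).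
    unfold energy in HE. rewrite Et in HE. lra. }
  assert (Hgt := Hf (u t) ltac:(lra)).
  destruct (derive_neg_local w t (- (INR n / t) * w t - g (u t))) as (d & Hd & _ & Hl).
  { apply (sol_dw S). lra. } { rewrite Et. lra. }
  max_of s C (t - d / 2) as S1 S2.
  assert (S3 : s < t) by (apply Rmax_lub_lt; lra).
  specialize (Hl s ltac:(lra)). specialize (Hbef s ltac:(lra)). lra. }
assert (Hreach : exists r, C <= r <= X /\ u r <= b1).
{ apply NNPP. intros Hno.
  assert (Hab : forall r, C <= r <= X -> b1 < u r).
  { intros r Hr. apply Rnot_le_lt. intros Hl. apply Hno. exists r; auto. }
  assert (Hw := Hdown X ltac:(unfold X; lra) Hab).
  assert (Hmon : forall s r, C <= s -> s <= r -> r <= X -> u r <= u s).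
  { intros s r Hs Hsr Hr. apply (derive_nonpos u w); [lra|auto|intros; apply (sol_du S)|].
    intros x Hx. left. apply Hw. lra. }
  set (t1 := C + tau1).
  assert (Ht1X : t1 <= X) by (unfold t1, X; lra).
  assert (Hut1 : u t1 <= bs).
  { apply Rnot_lt_le. intros Hlt.
    assert (Hin : forall s, C <= s <= t1 -> bs <= u s <= bb).
    { intros s Hs. split; [left; apply Rlt_le_trans with (1 := Hlt); apply Hmon; lra|].
      rewrite <- HuC. apply Hmon; lra. }
    assert (Hws : forall s, C <= s <= t1 -> w s <= - mf * (s - C) / INR (Datatypes.S n)).
    { intros s Hs.
      assert (A : s ^ n * w s + mf * s ^ (Datatypes.S n) / INR (Datatypes.S n) <=
                  C ^ n * w C + mf * C ^ (Datatypes.S n) / INR (Datatypes.S n)).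
      { apply (derive_nonpos (fun r => r ^ n * w r + mf * r ^ (Datatypes.S n) / INR (Datatypes.S n))
          (fun r => - (r ^ n * g (u r)) + mf * r ^ n)).
        - lra.
        - intros x _. apply cR_plus; [apply cR_mult; [apply cR_pow|apply (sol_cw S)]|].
          apply cR_mult; [apply cR_scal, cR_pow|apply continuous_const].
        - intros x Hx. apply dR_plus; [apply (sol_flux S); lra|].
          eapply is_derive_eq.
          + apply dR_mult; [apply dR_scal, dR_pow|apply dR_const].
          + change (pred (Datatypes.S n)) with n. cbv beta. field. lra.
        - intros x Hx. destruct (Hin x ltac:(lra)). assert (B := Hf (u x) ltac:(lra)).
          assert (P : 0 < x ^ n) by pos. nra. }
      assert (Ps : 0 < s ^ n) by pos.
      assert (PC : 0 < C ^ n) by pos.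
      assert (PCs : C ^ n <= s ^ n) by (apply pow_incr; lra).
      rewrite <- !tech_pow_Rmult in A.
      assert (Q : C * C ^ n <= C * s ^ n) by (apply Rmult_le_compat_l; lra).
      assert (HwC' : C ^ n * w C <= 0) by nra.
      assert (HmN : 0 < mf / INR (Datatypes.S n)) by pos.
      apply Rmult_le_reg_l with (s ^ n); [exact Ps|].
      replace (s ^ n * (- mf * (s - C) / INR (Datatypes.S n)))
        with (mf / INR (Datatypes.S n) * (C * s ^ n) - mf / INR (Datatypes.S n) * (s * s ^ n)) by (field; lra).
      replace (mf * (s * s ^ n) / INR (Datatypes.S n)) with (mf / INR (Datatypes.S n) * (s * s ^ n)) in A by (field; lra).
      replace (mf * (C * C ^ n) / INR (Datatypes.S n)) with (mf / INR (Datatypes.S n) * (C * C ^ n)) in A by (field; lra).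
      assert (mf / INR (Datatypes.S n) * (C * C ^ n) <= mf / INR (Datatypes.S n) * (C * s ^ n)) by (apply Rmult_le_compat_l; lra).
      lra. }
    assert (B : u t1 + mf * (t1 - C) ^ 2 / (2 * INR (Datatypes.S n)) <= u C + mf * (C - C) ^ 2 / (2 * INR (Datatypes.S n))).
    { apply (derive_nonpos (fun r => u r + mf * (r - C) ^ 2 / (2 * INR (Datatypes.S n)))
        (fun r => w r + mf * (r - C) / INR (Datatypes.S n))).
      - unfold t1; lra.
      - intros x _. apply cR_plus; [auto|]. apply cR_mult; [|apply continuous_const].
        apply cR_scal. apply (cR_sqr (fun r => r - C)), cR_minus; [apply continuous_id|apply continuous_const].
      - intros x Hx. apply dR_plus; [apply (sol_du S)|]. eapply is_derive_eq.
        + apply dR_mult; [apply dR_scal, (dR_sqr (fun r => r - C)), dR_minus; [apply dR_id|apply dR_const]|apply dR_const].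
        + cbv beta. field. lra.
      - intros x Hx. specialize (Hws x ltac:(lra)).
        replace (- mf * (x - C) / INR (Datatypes.S n)) with (- (mf * (x - C) / INR (Datatypes.S n))) in Hws by (field; lra).
        lra. }
    replace (t1 - C) with tau1 in B by (unfold t1; ring).
    replace (tau1 ^ 2) with (tau1 * tau1) in B by ring. rewrite Ht1s, HuC in B.
    replace (mf * (2 * INR (Datatypes.S n) * (bb - bs) / mf) / (2 * INR (Datatypes.S n))) with (bb - bs) in B by (field; lra).
    replace (mf * (C - C) ^ 2 / (2 * INR (Datatypes.S n))) with 0 in B by (field; lra). lra. }
  assert (Hslow : forall r, t1 <= r <= X -> w r <= - sqrt D).
  { intros r Hr. assert (t1 = C + tau1) by reflexivity.
    assert (HE := Hener r ltac:(lra) ltac:(intros s Hs; left; apply Hw; lra) ltac:(left; apply Hab; lra)).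
    assert (A := HGM (u r) ltac:(split; [left; apply Hab; lra|apply Rle_trans with (2 := Hut1); apply Hmon; lra])).
    unfold energy in HE. assert (Hwr := Hw r ltac:(lra)). apply Rnot_lt_le. intros Hl. nra. }
  assert (B : u X + sqrt D * X <= u t1 + sqrt D * t1).
  { apply (derive_nonpos (fun r => u r + sqrt D * r) (fun r => w r + sqrt D * 1)).
    - exact Ht1X.
    - intros x _. apply cR_plus; [auto|apply cR_scal, continuous_id].
    - intros x Hx. apply dR_plus; [apply (sol_du S)|apply dR_scal, dR_id].
    - intros x Hx. specialize (Hslow x ltac:(lra)). lra. }
  assert (HX : b1 < u X) by (apply Hab; unfold X; lra).
  assert (sqrt D * (X - t1) = bs - b1) by (unfold X, t1; rewrite <- Ht2s; ring). lra. }
destruct Hreach as (r & Hr & Hur).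
destruct (first_le u C r b1) as (T & HT & ET & Hbef); [lra|auto|lra|exact Hur|].
exists T. split; [lra|]. split; [exact (Rle_trans _ _ _ (proj2 HT) (proj2 Hr))|]. split; [exact ET|].
split; [exact Hbef|]. intros s Hs. rewrite <- HuC.
apply (derive_nonpos u w); [lra|auto|intros; apply (sol_du S)|].
intros x Hx. left. apply (Hdown x); [lra| |lra]. intros y Hy. apply Hbef. lra.
Qed.

Section well.

Variables (n : nat) (g : R -> R) (a : R) (u w : R -> R) (b1 T Tb I Fb : R).
Hypothesis Hn : (1 <= n)%nat.
Hypothesis Hg : forall x, continuous g x.
Hypothesis HS : sol n g a u w.
Hypothesis Hb1 : 0 < b1.
Hypothesis HF : forall s, 0 <= s <= b1 -> - Fb <= Fint g s <= 0.
Hypothesis HFb1 : Fint g b1 = 0.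
Hypothesis HT : 0 < T <= Tb.
Hypothesis HuT : u T = b1.
Hypothesis HwT : w T <= 0.
Hypothesis HET : energy g u w T <= I.
Hypothesis HI : 0 < I.
Hypothesis Hcross : Tb * I < sqrt 2 * INR n / sqrt (I + Fb) * RInt (fun s => Rabs (Fint g s)) 0 b1.

Let J := Fint (fun s => Rabs (Fint g s)).
Let kap := sqrt 2 * INR n / sqrt (I + Fb).

Lemma absF_cont s : continuous (fun s => Rabs (Fint g s)) s.
Proof. apply (continuous_comp (Fint g) Rabs); [apply Fint_cont, Hg|apply continuous_Rabs]. Qed.

(** The derivative of [r * energy] is at most [- 2 n |F|] while the energy is nonnegative, and
    [|w|] is at most [sqrt (2 (I + Fb))]; so the loss dominates [kap] times the loss of [J u]. *)
Lemma well_mono r : T <= r -> (forall s, T <= s <= r -> w s <= 0 /\ 0 <= u s <= b1) ->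
  0 <= energy g u w r ->
  r * energy g u w r - kap * J (u r) <= T * energy g u w T - kap * J b1.
Proof.
intros Hr Hin HE.
assert (Fb0 : 0 <= Fb) by (assert (A := HF b1 ltac:(lra)); lra).
assert (Hs2 : sqrt 2 * sqrt 2 = 2) by (apply sqrt_sqrt; lra).
assert (P2 : 0 < sqrt 2) by pos.
assert (PI : 0 < sqrt (I + Fb)) by pos.
assert (HsI : sqrt (I + Fb) * sqrt (I + Fb) = I + Fb) by (apply sqrt_sqrt; lra).
rewrite <- HuT.
apply (derive_nonpos (fun r => r * energy g u w r - kap * J (u r))
    (fun r => (Fint g (u r) - (INR n - / 2) * w r ^ 2) - kap * (w r * Rabs (Fint g (u r))))).
  - exact Hr.
  - intros x _. apply cR_minus; [apply (rE_cont n g a u w Hg HS)|]. apply cR_scal.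
    apply (continuous_comp u J); [apply (sol_cu HS)|apply Fint_cont; intros; apply absF_cont].
  - intros x Hx. apply dR_minus; [apply (rE_derive n g a u w Hg HS); lra|]. apply dR_scal.
    apply (dR_comp J u); [|apply (sol_du HS)].
    apply (Fint_derive (fun s => Rabs (Fint g s))). intros; apply absF_cont.
  - intros x Hx. destruct (Hin x ltac:(lra)) as [Hw Hu]. destruct (HF (u x) Hu) as [F1 F2].
    assert (E0 : 0 <= energy g u w x).
    { apply Rle_trans with (1 := HE). apply (energy_noninc Hg HS). lra. }
    assert (E1 : energy g u w x <= I).
    { apply Rle_trans with (2 := HET). apply (energy_noninc Hg HS). lra. }
    unfold energy in E0, E1. rewrite (Rabs_left1 (Fint g (u x))) by exact F2.
    set (G := - Fint g (u x)) in *. set (y := - w x).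
    replace (w x) with (- y) in * by (unfold y; ring). assert (Hy : 0 <= y) by lra.
    assert (Hn1 : 1 <= INR n) by (apply (le_INR 1); lia).
    assert (G0 : 0 <= G) by (unfold G; lra).
    assert (Hyb : y <= sqrt 2 * sqrt (I + Fb)).
    { apply Rnot_lt_le. intros Hl.
      assert (sqrt 2 * sqrt (I + Fb) * (sqrt 2 * sqrt (I + Fb)) < y * y).
      { apply Rmult_le_0_lt_compat; try (pos); exact Hl. }
      replace (sqrt 2 * sqrt (I + Fb) * (sqrt 2 * sqrt (I + Fb)))
        with (sqrt 2 * sqrt 2 * (sqrt (I + Fb) * sqrt (I + Fb))) in H by ring.
      rewrite Hs2, HsI in H. replace ((- y) ^ 2) with (y * y) in E1 by ring. lra. }
    assert (Hky : kap * y <= 2 * INR n).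
    { apply Rle_trans with (kap * (sqrt 2 * sqrt (I + Fb))).
      - apply Rmult_le_compat_l; [|exact Hyb]. unfold kap. left.
        apply Rdiv_lt_0_compat; [pos|exact PI].
      - unfold kap. right. transitivity (sqrt 2 * sqrt 2 * INR n); [field; lra|rewrite Hs2; ring]. }
    assert (Hk2 : kap * y * G <= 2 * INR n * G) by (apply Rmult_le_compat_r; lra).
    assert (Hy2 : 2 * G <= y ^ 2) by (replace ((- y) ^ 2) with (y ^ 2) in E0 by ring; unfold G; lra).
    assert ((INR n - / 2) * (2 * G) <= (INR n - / 2) * y ^ 2) by (apply Rmult_le_compat_l; lra).
    replace ((- y) ^ 2) with (y ^ 2) by ring.
    replace (kap * (- y * G)) with (- (kap * y * G)) by ring.
    replace (Fint g (u x)) with (- G) by (unfold G; ring). lra.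
Qed.

Lemma kap_pos : 0 < kap.
Proof.
assert (Fb0 : 0 <= Fb) by (assert (A := HF b1 ltac:(lra)); lra).
apply Rdiv_lt_0_compat; [|pos].
apply Rmult_lt_0_compat; [pos|apply lt_0_INR; lia].
Qed.

Lemma well_excess : 0 <= energy g u w T -> T * energy g u w T < kap * J b1.
Proof.
intros E0. assert (T * energy g u w T <= Tb * I) by (apply Rmult_le_compat; lra).
apply Rle_lt_trans with (1 := H). exact Hcross.
Qed.

Lemma well_cost r : T <= r -> (forall s, T <= s <= r -> w s <= 0 /\ 0 <= u s <= b1) ->
  0 <= energy g u w r ->
  r * energy g u w r - kap * J (u r) < 0.
Proof.
intros Hr Hin HE. assert (A := well_mono r Hr Hin HE).
assert (E0 : 0 <= energy g u w T).
{ apply Rle_trans with (1 := HE). apply (energy_noninc Hg HS). lra. }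
assert (B := well_excess E0). lra.
Qed.

(** While the energy is positive the solution can only move down in the well. *)
Lemma well_descends r : w T < 0 -> T <= r ->
  (forall s, T <= s <= r -> 0 < energy g u w s) -> (forall s, T <= s < r -> 0 < u s) ->
  forall s, T <= s <= r -> (s < r -> w s < 0) /\ w s <= 0 /\ 0 <= u s <= b1.
Proof.
intros Hw0 Hr HE Hu.
assert (Hcu : forall r, continuous u r) by (intros; apply (sol_cu HS)).
assert (Hneg : forall s, T <= s < r -> w s < 0).
{ intros s Hs. apply Rnot_le_lt. intros Hle.
  destruct (first_ge w T s 0) as (t & Ht & Et & Hbef); [lra|intros; apply (sol_cw HS)|exact Hw0|exact Hle|].
  assert (Hut : u t <= b1).
  { rewrite <- HuT. apply (derive_nonpos u w); [lra|auto|intros; apply (sol_du HS)|].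
    intros x Hx. left. apply Hbef. lra. }
  assert (A := HE t ltac:(lra)). unfold energy in A. rewrite Et in A.
  assert (B := HF (u t) ltac:(split; [left; apply Hu; lra|exact Hut])). lra. }
intros s Hs.
assert (Hus : u s <= b1).
{ rewrite <- HuT. apply (derive_nonpos u w); [lra|auto|intros; apply (sol_du HS)|].
  intros x Hx. left. apply Hneg. lra. }
assert (Hus0 : 0 <= u s).
{ destruct (Req_dec s r) as [->|Hne]; [|left; apply Hu; lra].
  apply Rnot_lt_le. intros Hl. destruct (continuous_lt u r 0 (Hcu r) Hl) as (d & Hd & Hd').
  destruct (Req_dec T r) as [E|E]; [subst r; lra|].
  max_of x T (r - d / 2) as X1 X2.
  assert (X3 : x < r) by (apply Rmax_lub_lt; lra).
  specialize (Hd' x ltac:(apply Rabs_def1; lra)). specialize (Hu x ltac:(lra)). lra. }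
split; [intros; apply Hneg; lra|]. split; [|lra].
destruct (Req_dec s r) as [->|Hne]; [|left; apply Hneg; lra].
destruct (Req_dec T r) as [E|E]; [rewrite <- E; lra|].
apply Rnot_lt_le. intros Hl. destruct (continuous_gt w r 0 (sol_cw HS r) Hl) as (d & Hd & Hd').
max_of x T (r - d / 2) as X1 X2.
assert (X3 : x < r) by (apply Rmax_lub_lt; lra).
specialize (Hd' x ltac:(apply Rabs_def1; lra)). specialize (Hneg x ltac:(lra)). lra.
Qed.

Lemma rest_in_well r0 r : T <= r0 -> energy g u w r0 <= 0 -> r0 < r -> 0 <= energy g u w r ->
  u r = u r0.
Proof.
intros H1 H2 H3 H4.
apply (energy_const_rest Hg HS r0 r Hn); lra.
Qed.

(** Reaching [0] would cost more than the available [r * energy]. *)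
Lemma well_positive r : T <= r -> 0 < u r.
Proof.
intros Hr. apply Rnot_le_lt. intros Hle.
destruct (first_le u T r 0) as (z & Hz & Ez & Hbef); [exact Hr|intros; apply (sol_cu HS)|lra|exact Hle|].
assert (HEz : 0 <= energy g u w z).
{ assert (A := F_le_energy g u w z). rewrite Ez, Fint_0 in A. exact A. }
assert (HE : forall s, T <= s < z -> 0 < energy g u w s).
{ intros s Hs. apply Rnot_le_lt. intros Hl.
  assert (A := rest_in_well s z ltac:(lra) Hl ltac:(lra) HEz).
  assert (B := Hbef s Hs). lra. }
assert (Hw0 : w T < 0).
{ destruct HwT as [H|H]; [exact H|]. assert (A := HE T ltac:(lra)). unfold energy in A.
  rewrite H, HuT, HFb1 in A. lra. }
destruct HEz as [HEz|HEz].
- assert (Hd := well_descends z Hw0 ltac:(lra)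
    ltac:(intros s Hs; destruct (Req_dec s z) as [->|]; [exact HEz|apply HE; lra]) Hbef).
  assert (C := well_cost z ltac:(lra) ltac:(intros s Hs; destruct (Hd s Hs) as (_ & A & B); auto) ltac:(lra)).
  rewrite Ez in C. unfold J in C. rewrite Fint_0 in C.
  assert (0 < z * energy g u w z) by pos. lra.
- assert (Hlim : forall s, T <= s < z -> s * energy g u w s - kap * J (u s) < 0 /\ 0 <= u s <= b1 /\ w s <= 0).
  { intros s Hs.
    assert (Hd := well_descends s Hw0 ltac:(lra) ltac:(intros x Hx; apply HE; lra) ltac:(intros x Hx; apply Hbef; lra)).
    split; [|destruct (Hd s ltac:(lra)) as (_ & A & B); auto].
    apply well_cost; [lra| |left; apply HE, Hs]. intros x Hx. destruct (Hd x Hx) as (_ & A & B); auto. }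
  assert (Hin : forall s, T <= s <= z -> w s <= 0 /\ 0 <= u s <= b1).
  { intros s Hs. destruct (Req_dec s z) as [->|Hne]; [|destruct (Hlim s ltac:(lra)) as (_ & A & B); auto].
    split; [|lra]. apply Rnot_lt_le. intros Hl.
    destruct (continuous_gt w z 0 (sol_cw HS z) Hl) as (d & Hd & Hd').
    max_of x T (z - d / 2) as X1 X2.
    assert (X3 : x < z) by (apply Rmax_lub_lt; lra).
    specialize (Hd' x ltac:(apply Rabs_def1; lra)). destruct (Hlim x ltac:(lra)) as (_ & _ & B). lra. }
  assert (C := well_cost z ltac:(lra) Hin ltac:(lra)).
  rewrite Ez, <- HEz in C. unfold J in C. rewrite Fint_0 in C. lra.
Qed.

(** If the energy becomes negative, [u] cannot approach [0], where [F] vanishes.  Otherwise the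
    excess of [kap * J b1] over the initial [r * energy] persists, which keeps [u] away
    from [0]. *)
Lemma well_not_to_0 : ~ tends_to_0 u.
Proof.
intros Hlim.
assert (Hpos := well_positive).
destruct (classic (exists r0, T <= r0 /\ energy g u w r0 <= 0)) as [(r0 & Hr0 & HE0)|Hno].
- destruct (Rle_lt_or_eq_dec _ _ HE0) as [HEn|HEz].
  + destruct (continuous_eps (Fint g) 0 (Fint_cont g 0 Hg) (- energy g u w r0)) as (d & Hd & Hd'); [lra|].
    destruct (Hlim d Hd) as (r1 & H1). max_of r r0 r1 as R1 R2.
    specialize (Hd' (u r) ltac:(rewrite Rminus_0_r; apply H1, R2)). rewrite Fint_0, Rminus_0_r in Hd'.
    apply Rabs_def2 in Hd'. assert (A := energy_noninc Hg HS r0 r R1).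
    assert (B := F_le_energy g u w r). lra.
  + destruct (classic (exists r, r0 < r /\ energy g u w r < 0)) as [(r2 & H2 & HE2)|Hno2].
    * destruct (continuous_eps (Fint g) 0 (Fint_cont g 0 Hg) (- energy g u w r2)) as (d & Hd & Hd'); [lra|].
      destruct (Hlim d Hd) as (r1 & H1). max_of r r2 r1 as R1 R2.
      specialize (Hd' (u r) ltac:(rewrite Rminus_0_r; apply H1, R2)). rewrite Fint_0, Rminus_0_r in Hd'.
      apply Rabs_def2 in Hd'. assert (A := energy_noninc Hg HS r2 r R1).
      assert (B := F_le_energy g u w r). lra.
    * destruct (Hlim (u r0)) as (r1 & H1); [apply Hpos, Hr0|]. max_of r (r0 + 1) r1 as R1 R2.
      assert (A := rest_in_well r0 r Hr0 HE0 ltac:(lra) ltac:(apply Rnot_lt_le; intros Hl; apply Hno2; exists r; split; lra)).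
      specialize (H1 r R2). rewrite A, Rabs_pos_eq in H1; [lra|]. left; apply Hpos, Hr0.
- assert (HE : forall s, T <= s -> 0 < energy g u w s).
  { intros s Hs. apply Rnot_le_lt. intros Hl. apply Hno. eauto. }
  assert (Hw0 : w T < 0).
  { destruct HwT as [H|H]; [exact H|]. assert (A := HE T ltac:(lra)). unfold energy in A.
    rewrite H, HuT, HFb1 in A. lra. }
  assert (Hin : forall s, T <= s -> w s < 0 /\ 0 <= u s <= b1).
  { intros s Hs.
    assert (Hd := well_descends (s + 1) Hw0 ltac:(lra) ltac:(intros x Hx; apply HE; lra) ltac:(intros x Hx; apply Hpos; lra)).
    destruct (Hd s ltac:(lra)) as (A & _ & B). split; [apply A; lra|exact B]. }
  assert (Hex := well_excess ltac:(left; apply HE; lra)).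
  set (e := kap * J b1 - T * energy g u w T) in *. assert (He : 0 < e) by (unfold e; lra).
  assert (Hk := kap_pos).
  destruct (continuous_eps J 0 ltac:(apply Fint_cont; intros; apply absF_cont) (e / kap)) as (d & Hd & Hd').
  { pos. }
  destruct (Hlim d Hd) as (r1 & H1). max_of r T r1 as R1 R2.
  specialize (Hd' (u r) ltac:(rewrite Rminus_0_r; apply H1, R2)).
  unfold J at 2 in Hd'. rewrite Fint_0, Rminus_0_r in Hd'. apply Rabs_def2 in Hd'.
  assert (A := well_mono r R1 ltac:(intros s Hs; destruct (Hin s ltac:(lra)); split; lra) ltac:(left; apply HE, R1)).
  assert (0 < r * energy g u w r) by (apply Rmult_lt_0_compat; [lra|apply HE, R1]).
  assert (kap * J (u r) < kap * (e / kap)) by (apply Rmult_lt_compat_l; lra).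
  replace (kap * (e / kap)) with e in H0 by (field; lra). unfold e in H0. lra.
Qed.

Variable cp : R.
Hypothesis Hcp : b1 < cp.
Hypothesis HFcp : forall s, b1 < s <= cp -> 0 < Fint g s.

Lemma well_below r : T <= r -> u r <= b1.
Proof.
intros Hr. apply Rnot_lt_le. intros Hl.
set (b' := Rmin (u r) cp). assert (B1 : b1 < b') by (apply Rmin_glb_lt; lra).
assert (B2 : b' <= u r) by apply Rmin_l. assert (B3 : b' <= cp) by apply Rmin_r.
destruct (first_ge u T r b') as (t & Ht & Et & Hbef); [exact Hr|intros; apply (sol_cu HS)|lra|exact B2|].
assert (A := F_le_energy g u w t). rewrite Et in A.
assert (B := HFcp b' ltac:(lra)).
assert (HE : forall s, T <= s <= t -> 0 < energy g u w s).
{ intros s Hs. assert (M := energy_noninc Hg HS s t ltac:(lra)). lra. }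
assert (Hw0 : w T < 0).
{ destruct HwT as [H|H]; [exact H|]. assert (D := HE T ltac:(lra)). unfold energy in D.
  rewrite H, HuT, HFb1 in D. lra. }
assert (Hd := well_descends t Hw0 ltac:(lra) HE ltac:(intros; apply well_positive; lra)).
destruct (Hd t ltac:(lra)) as (_ & _ & D). lra.
Qed.

(** A lower bound on the energy would be a lower bound on the speed. *)
Lemma well_small_energy eps r0 : 0 < eps -> exists r, r0 <= r /\ energy g u w r < eps /\ 0 < u r <= b1.
Proof.
intros He. max_of r1 T r0 as R1 R2.
assert (Hpos := well_positive). assert (Hbel := well_below).
apply NNPP. intros Hno.
assert (HE : forall r, T <= r -> eps <= energy g u w r).
{ intros r Hr. apply Rnot_lt_le. intros Hl. apply Hno. exists (Rmax r1 r).
  assert (r1 <= Rmax r1 r) by apply Rmax_l. assert (r <= Rmax r1 r) by apply Rmax_r.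
  split; [lra|]. split; [|split; [apply Hpos; lra|apply Hbel; lra]].
  apply Rle_lt_trans with (2 := Hl). apply (energy_noninc Hg HS). lra. }
assert (Hw0 : w T < 0).
{ destruct HwT as [H|H]; [exact H|]. assert (D := HE T ltac:(lra)). unfold energy in D.
  rewrite H, HuT, HFb1 in D. lra. }
assert (Hs : 0 < sqrt (2 * eps)) by pos.
assert (Hs2 : sqrt (2 * eps) * sqrt (2 * eps) = 2 * eps) by (apply sqrt_sqrt; lra).
apply (growth_unbounded (fun r => - u r) (fun r => - w r) T (sqrt (2 * eps)) 0 Hs).
- intros r Hr. apply dR_opp, (sol_du HS).
- intros r Hr.
  assert (Hd := well_descends (r + 1) Hw0 ltac:(lra) ltac:(intros s Hs'; specialize (HE s ltac:(lra)); lra) ltac:(intros; apply Hpos; lra)).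
  destruct (Hd r ltac:(lra)) as (W & _ & D). specialize (W ltac:(lra)).
  assert (E := HE r ltac:(lra)). unfold energy in E. assert (F0 := HF (u r) D).
  apply Rnot_lt_le. intros Hl. nra.
- intros r Hr. specialize (Hpos r ltac:(lra)). lra.
Qed.

End well.

(** * Back to classical solutions *)

Section regularity.

Variables (n : nat) (g : R -> R) (a : R) (u w : R -> R).
Hypothesis Hg : forall x, continuous g x.
Hypothesis HS : sol n g a u w.

Lemma flux_bounds c e d : (forall r, 0 <= r <= d -> c - e <= g (u r) <= c + e) ->
  forall r, 0 < r <= d -> - (c + e) / INR (S n) <= w r / r <= - (c - e) / INR (S n).
Proof.
intros H r Hr.
assert (HN : 0 < INR (S n)) by (apply lt_0_INR; lia).
assert (Hder : forall q x, 0 < x -> is_derive (fun r => r ^ n * w r + q * r ^ S n / INR (S n)) x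
  (- (x ^ n * g (u x)) + q * x ^ n)).
{ intros q x Hx. apply dR_plus; [apply (sol_flux HS); lra|]. eapply is_derive_eq.
  - apply dR_mult; [apply dR_scal, dR_pow|apply dR_const].
  - change (pred (S n)) with n. cbv beta. field. lra. }
assert (Hcont : forall q x, continuous (fun r => r ^ n * w r + q * r ^ S n / INR (S n)) x).
{ intros q x. apply cR_plus; [apply cR_mult; [apply cR_pow|apply (sol_cw HS)]|].
  apply cR_mult; [apply cR_scal, cR_pow|apply continuous_const]. }
assert (E0 : forall q, 0 ^ n * w 0 + q * 0 ^ S n / INR (S n) = 0).
{ intros q. destruct (sol_init HS 0 (Rle_refl 0)) as [_ ->]. rewrite (pow_i (S n)) by lia. unfold Rdiv. ring. }
assert (Pr : 0 < r ^ n) by (apply pow_lt; lra).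
assert (A1 : r ^ n * w r + (c - e) * r ^ S n / INR (S n) <= 0).
{ rewrite <- (E0 (c - e)). apply (derive_nonpos (fun r => r ^ n * w r + (c - e) * r ^ S n / INR (S n)) (fun x => - (x ^ n * g (u x)) + (c - e) * x ^ n)); [lra|auto| |].
  - intros x Hx. apply Hder. lra.
  - intros x Hx. assert (P : 0 < x ^ n) by (apply pow_lt; lra).
    specialize (H x ltac:(lra)).
    assert ((c - e) * x ^ n <= g (u x) * x ^ n) by (apply Rmult_le_compat_r; lra). cbv beta. lra. }
assert (A2 : 0 <= r ^ n * w r + (c + e) * r ^ S n / INR (S n)).
{ rewrite <- (E0 (c + e)). apply (derive_nonneg (fun r => r ^ n * w r + (c + e) * r ^ S n / INR (S n)) (fun x => - (x ^ n * g (u x)) + (c + e) * x ^ n)); [lra|auto| |].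
  - intros x Hx. apply Hder. lra.
  - intros x Hx. assert (P : 0 < x ^ n) by (apply pow_lt; lra).
    specialize (H x ltac:(lra)).
    assert (g (u x) * x ^ n <= (c + e) * x ^ n) by (apply Rmult_le_compat_r; lra). cbv beta. lra. }
assert (Hrw : r ^ n * w r = r ^ S n * (w r / r)) by (simpl; field; lra).
assert (Prs : 0 < r ^ S n) by (apply pow_lt; lra).
rewrite Hrw in A1, A2. split; apply Rmult_le_reg_l with (r ^ S n); try exact Prs; unfold Rdiv in *; lra.
Qed.

(** At the centre the equation degenerates to [(n + 1) u'' + g(a) = 0]. *)
Lemma speed_at_centre e : 0 < e -> exists d, 0 < d /\ forall r, 0 < r < d ->
  Rabs (w r / r + g a / INR (S n)) < e.
Proof.
intros He. assert (HN : 1 <= INR (S n)) by (apply (le_INR 1); lia).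
destruct (continuous_eps (fun r => g (u r)) 0) with (eps := e / 2) as (d & Hd & Hd').
- apply (continuous_comp u g); [apply (sol_cu HS)|apply Hg].
- lra.
- exists d. split; [exact Hd|]. intros r Hr.
  destruct (sol_init HS 0 (Rle_refl 0)) as [U0 _]. rewrite U0 in Hd'.
  destruct (flux_bounds (g a) (e / 2) r) with (r := r) as [B1 B2]; [|lra|].
  { intros x Hx. specialize (Hd' x ltac:(rewrite Rminus_0_r, Rabs_pos_eq; lra)).
    apply Rabs_def2 in Hd'. lra. }
  assert (Hq : e / 2 / INR (S n) <= e / 2).
  { apply Rmult_le_reg_r with (INR (S n)); [lra|]. unfold Rdiv at 1. rewrite Rmult_assoc, Rinv_l by lra.
    assert (e / 2 * 1 <= e / 2 * INR (S n)) by (apply Rmult_le_compat_l; lra). lra. }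
  replace (- (g a + e / 2) / INR (S n)) with (- (g a / INR (S n)) - e / 2 / INR (S n)) in B1 by (field; lra).
  replace (- (g a - e / 2) / INR (S n)) with (- (g a / INR (S n)) + e / 2 / INR (S n)) in B2 by (field; lra).
  apply Rabs_def1; lra.
Qed.

Lemma continuous_halfline (v : R -> R) (x : R) : continuous v x ->
  filterlim v (within (fun t => 0 <= t) (locally x)) (locally (v x)).
Proof.
intros H P HP. assert (Q : locally x (fun y => P (v y))) by exact (H P HP).
change (locally x (fun y => 0 <= y -> P (v y))). revert Q. apply filter_imp. intros y Hy _. exact Hy.
Qed.

Lemma derive_halfline (v dv : R -> R) (x : R) : is_derive v x (dv x) -> D_in v dv (fun t => 0 <= t) x.
Proof.
intros H. apply is_derive_Reals in H. intros eps He.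
destruct (H eps He) as [d Hd]. exists d. split; [apply cond_pos|].
intros y [[Hy Hne] Hdist]. simpl in Hdist |- *. unfold Rdist in *.
specialize (Hd (y - x) ltac:(lra) Hdist).
rewrite (Rplus_minus x y) in Hd. exact Hd.
Qed.

Lemma sol_is_solution (f : R -> R) (gm gs : Rbar) :
  (forall r, 0 <= r -> dom gm gs (u r)) -> (forall r, 0 <= r -> g (u r) = f (u r)) ->
  tends_to_0 u -> is_solution (S n) f gm gs u.
Proof.
intros Hdom Hgf Hlim.
assert (HN : 0 < INR (S n)) by (apply lt_0_INR; lia).
destruct (sol_init HS 0 (Rle_refl 0)) as [U0 W0].
set (ddu := fun r => if Rle_dec r 0 then - (g a / INR (S n)) else - (INR n / r) * w r - g (u r)).
assert (Hpos : forall r, 0 < r -> ddu r = - (INR n / r) * w r - g (u r)).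
{ intros r Hr. unfold ddu. destruct (Rle_dec r 0); [lra|reflexivity]. }
assert (Hdd0 : ddu 0 = - (g a / INR (S n))).
{ unfold ddu. destruct (Rle_dec 0 0); [reflexivity|lra]. }
exists w, ddu. split; [|split; [|split; [|split; [|split]]]].
- split.
  + intros r Hr. apply derive_halfline, (sol_du HS).
  + intros r Hr. apply continuous_halfline, (sol_cw HS).
- split.
  + intros r [Hr|<-].
    * apply derive_halfline. rewrite (Hpos r Hr). apply (sol_dw HS), Hr.
    * intros eps He. destruct (speed_at_centre eps He) as (d & Hd & Hd').
      exists d. split; [exact Hd|]. intros y [[Hy Hne] Hdist].
      simpl in Hdist |- *. unfold Rdist in *.
      rewrite Rminus_0_r in Hdist. rewrite Hdd0, W0, !Rminus_0_r.
      rewrite Rabs_pos_eq in Hdist by exact Hy.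
      specialize (Hd' y ltac:(lra)).
      replace (w y / y - - (g a / INR (S n))) with (w y / y + g a / INR (S n)) by ring. exact Hd'.
  + intros r [Hr|<-].
    * apply continuous_halfline.
      apply (continuous_ext_loc _ (fun r => - (INR n / r) * w r - g (u r))).
      { exists (mkposreal r Hr). intros y Hy. symmetry. apply Hpos.
        assert (Hy' : Rabs (y - r) < r) by exact Hy. apply Rabs_def2 in Hy'. lra. }
      apply cR_minus; [apply cR_mult; [|apply (sol_cw HS)]|].
      { apply continuous_Ropp, cR_mult; [apply continuous_const|]. apply continuous_Rinv. lra. }
      apply (continuous_comp u g); [apply (sol_cu HS)|apply Hg].
    * apply filterlim_locally. intros eps.
      assert (He' : 0 < eps / (2 * (INR n + 1))).
      { apply Rdiv_lt_0_compat; [apply cond_pos|]. assert (A := pos_INR n). lra. }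
      destruct (speed_at_centre _ He') as (d & Hd & Hd').
      destruct (continuous_eps (fun r => g (u r)) 0) with (eps := eps / 2) as (d2 & Hd2 & Hd2').
      { apply (continuous_comp u g); [apply (sol_cu HS)|apply Hg]. }
      { assert (A := cond_pos eps). lra. }
      assert (Hmin : 0 < Rmin d d2) by pos.
      exists (mkposreal _ Hmin). intros y Hy Hy0.
      assert (Hy' : Rabs (y - 0) < Rmin d d2) by exact Hy.
      assert (M1 := Rmin_l d d2). assert (M2 := Rmin_r d d2).
      change (Rabs (ddu y - ddu 0) < eps).
      destruct Hy0 as [Hy0|<-]; [|rewrite Rminus_diag, Rabs_R0; apply cond_pos].
      specialize (Hd2' y ltac:(lra)). rewrite Rminus_0_r, Rabs_pos_eq in Hy' by lra.
      specialize (Hd' y ltac:(lra)). rewrite (Hpos y Hy0), Hdd0. rewrite U0 in Hd2'.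
      replace (- (INR n / y) * w y - g (u y) - - (g a / INR (S n))) with
        (- (INR n * (w y / y + g a / INR (S n))) - (g (u y) - g a))
        by (rewrite S_INR; field; rewrite S_INR in HN; lra).
      apply Rle_lt_trans with (1 := Rabs_triang _ _). rewrite !Rabs_Ropp, Rabs_mult.
      rewrite (Rabs_pos_eq (INR n)) by apply pos_INR.
      assert (A := pos_INR n).
      assert (INR n * Rabs (w y / y + g a / INR (S n)) <= INR n * (eps / (2 * (INR n + 1)))).
      { apply Rmult_le_compat_l; lra. }
      assert (INR n * (eps / (2 * (INR n + 1))) <= eps / 2).
      { apply Rle_trans with ((INR n + 1) * (eps / (2 * (INR n + 1)))).
        - apply Rmult_le_compat_r; lra.
        - right. field. lra. }
      lra.
- exact Hdom.
- intros r Hr. rewrite (Hpos r Hr), <- Hgf by lra. rewrite S_INR. field. lra.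
- exact W0.
- apply is_lim_spec. intros eps. destruct (Hlim eps (cond_pos eps)) as (r0 & H0).
  exists r0. intros x Hx. rewrite Rminus_0_r. apply H0. lra.
Qed.

End regularity.

(** * Two solutions from one trapped solution *)

(** What the dynamics uses of [f]: the central well, the barrier of height [F gammaM] that ends
    at [betas], a positive force beyond, and a higher barrier on the negative side. *)
Record landscape (f : R -> R) (gm gs : Rbar) (gammaM beta1 betas cm bm cp h : R) : Prop := {
  ls_cont : continuous_on (dom gm gs) f;
  ls_lip : locally_lipschitz_on (fun s => dom gm gs s /\ s <> 0) f;
  ls_f0 : f 0 = 0;
  ls_gm0 : Rbar_lt gm 0;
  ls_gs0 : Rbar_lt 0 gs;
  ls_cm : Rbar_lt gm cm;
  ls_cp : cp <= gammaM;
  ls_h : h <= Fint f gammaM;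
  ls_b1 : 0 < beta1;
  ls_M : gammaM < betas;
  ls_bs : Rbar_lt betas gs;
  ls_well : forall s, 0 <= s <= beta1 -> Fint f s <= 0;
  ls_Fbs : Fint f betas = Fint f gammaM;
  ls_below : forall s, 0 <= s <= betas -> Fint f s <= Fint f gammaM;
  ls_f : forall s : R, betas <= s -> Rbar_lt s gs -> 0 < f s;
  ls_bot : forall s : R, Rbar_lt gm s -> Rbar_lt s gs -> exists t0 : R, Rbar_lt gm t0 /\
    forall t : R, Rbar_lt gm t -> t < t0 -> Fint f s < Fint f t;
  ls_central : forall m M : R, Rbar_lt gm m -> m <= cm -> cp <= M -> Rbar_le M gs ->
    central (clampf m M f) cm bm beta1 cp h
}.

Arguments ls_cont {f gm gs gammaM beta1 betas cm bm cp h} _.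
Arguments ls_lip {f gm gs gammaM beta1 betas cm bm cp h} _.
Arguments ls_f0 {f gm gs gammaM beta1 betas cm bm cp h} _.
Arguments ls_gm0 {f gm gs gammaM beta1 betas cm bm cp h} _.
Arguments ls_gs0 {f gm gs gammaM beta1 betas cm bm cp h} _.
Arguments ls_cm {f gm gs gammaM beta1 betas cm bm cp h} _.
Arguments ls_cp {f gm gs gammaM beta1 betas cm bm cp h} _.
Arguments ls_h {f gm gs gammaM beta1 betas cm bm cp h} _.
Arguments ls_b1 {f gm gs gammaM beta1 betas cm bm cp h} _.
Arguments ls_M {f gm gs gammaM beta1 betas cm bm cp h} _.
Arguments ls_bs {f gm gs gammaM beta1 betas cm bm cp h} _.
Arguments ls_well {f gm gs gammaM beta1 betas cm bm cp h} _.
Arguments ls_Fbs {f gm gs gammaM beta1 betas cm bm cp h} _.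
Arguments ls_below {f gm gs gammaM beta1 betas cm bm cp h} _.
Arguments ls_f {f gm gs gammaM beta1 betas cm bm cp h} _.
Arguments ls_bot {f gm gs gammaM beta1 betas cm bm cp h} _.
Arguments ls_central {f gm gs gammaM beta1 betas cm bm cp h} _.

Lemma landscape_exists (f : R -> R) (gm gs : Rbar) (delta gamma1 gammaM beta1 betas : R) :
  common_assumptions f gm gs delta ->
  (forall s : R, Rbar_lt gm s -> Rbar_lt s gs -> exists t0 : R, Rbar_lt t0 gs /\
     forall t : R, t0 < t -> Rbar_lt t gs -> Fint f s < Fint f t) ->
  (forall s : R, Rbar_lt gm s -> Rbar_lt s gs -> exists t0 : R, Rbar_lt gm t0 /\
     forall t : R, Rbar_lt gm t -> t < t0 -> Fint f s < Fint f t) ->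
  is_gamma (Fint f) gs 1 gamma1 -> is_last_gamma (Fint f) gs gammaM ->
  is_largest_level (Fint f) 0 0 gamma1 beta1 ->
  is_largest_level (Fint f) (Fint f gammaM) gammaM gs betas ->
  exists cm bm cp h, landscape f gm gs gammaM beta1 betas cm bm cp h.
Proof.
intros A Htop Hbot H1 HM Hb1 Hbs.
destruct (central_data f gm gs delta A Hbot gamma1 gammaM beta1 betas H1 HM Hb1 Hbs) as (cm & bm & cp & h & C1 & C2 & C3 & C4).
destruct (gammaM_facts f gm gs delta A gamma1 gammaM betas H1 HM Hbs) as (G1 & G2 & G3 & G4).
destruct (betas_bounds f gs gammaM betas Hbs) as (B1 & B2 & B3).
destruct (beta1_bounds f gamma1 beta1 Hb1) as [B4 B5].
exists cm, bm, cp, h. constructor; try assumption; try apply A; try lra.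
- apply (F_nonpos_upto_beta1 f gm gs delta A gamma1 beta1 H1 Hb1).
- apply (F_below_betas f gm gs delta A gamma1 gammaM beta1 betas H1 HM Hb1 Hbs).
- intros s [Hs| <-] Hs2.
  + apply (f_pos_above_betas f gm gs delta A Htop gamma1 gammaM beta1 betas H1 HM Hb1 Hbs s Hs Hs2).
  + apply (f_pos_betas f gm gs delta A Htop gamma1 gammaM beta1 betas H1 HM Hb1 Hbs).
Qed.

Section reduction.

Variables (n : nat) (f : R -> R) (gm gs : Rbar) (gammaM beta1 betas cm bm cp h : R).
Hypothesis Hn : (1 <= n)%nat.
Hypothesis L : landscape f gm gs gammaM beta1 betas cm bm cp h.

Variables (m amax : R).
Hypothesis Hm : Rbar_lt gm m.
Hypothesis Hmcm : m <= cm.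
Hypothesis Hamax : betas < amax.
Hypothesis Hamax2 : Rbar_lt amax gs.
Hypothesis HFm : Fint f amax < Fint f m.

Notation g := (clampf m amax f).
Notation F := (Fint f).

Lemma cut_central : central g cm bm beta1 cp h.
Proof.
apply (ls_central L); auto.
- assert (A := ls_cp L). assert (B := ls_M L). lra.
- apply Rbar_lt_le, Hamax2.
Qed.

Lemma cut_signs : m < 0 < amax.
Proof.
assert (C := cut_central). assert (A := ct_cm C). assert (B := ct_bm C). assert (D := ct_bp C).
assert (E := ct_cp C). assert (A' := ls_cp L). assert (B' := ls_M L). lra.
Qed.

Lemma cut_cont x : continuous g x.
Proof. apply (ct_cont cut_central). Qed.

Lemma cut_F s : m <= s <= amax -> Fint g s = F s.
Proof. apply Fint_clampf, cut_signs. Qed.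

Lemma betas_pos : 0 < betas.
Proof.
assert (C := cut_central). assert (D := ct_bp C). assert (E := ct_cp C).
assert (A' := ls_cp L). assert (B' := ls_M L). lra.
Qed.

Lemma cut_force s : betas <= s -> 0 < g s.
Proof.
intros Hs. assert (S := cut_signs). assert (P := betas_pos).
destruct (Rle_dec s amax) as [H|H].
- rewrite clampf_eq by lra. apply (ls_f L s Hs). apply (below_gs gs s amax Hamax2 H).
- unfold clampf. rewrite clamp_ge by lra. apply (ls_f L amax); [lra|exact Hamax2].
Qed.

Lemma cut_F_increasing s t : betas <= s -> s < t -> Fint g s < Fint g t.
Proof.
intros Hs Hst.
destruct (mean_value (Fint g) g s t) as (x & Hx & E); [exact Hst|intros; apply Fint_derive; intros; apply cut_cont|].
assert (A := cut_force x ltac:(lra)).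
assert (0 < g x * (t - s)) by pos. lra.
Qed.

(** The energy does not suffice to reach [m], and above the initial value [F] is larger than
    initially. *)
Lemma confined a u w r : sol n g a u w -> betas <= a <= amax -> m < u r <= a.
Proof.
intros S Ha. assert (P := betas_pos). assert (Q := cut_signs). split.
- destruct (Rle_dec r 0) as [Hr|Hr]; [destruct (sol_init S r Hr) as [-> _]; lra|].
  apply Rnot_le_lt. intros Hl.
  destruct (ivt u 0 r m) as (t & Ht & E); [lra|intros; apply (sol_cu S)| |].
  + destruct (sol_init S 0 (Rle_refl 0)) as [-> _]. lra.
  + assert (A := F_le_energy g u w t). assert (B := energy_le_init cut_cont S t).
    rewrite E in A. rewrite cut_F in A, B by lra.
    assert (D : Fint g a <= Fint g amax).
    { destruct (proj2 Ha) as [H| ->]; [left; apply cut_F_increasing; lra|lra]. }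
    rewrite !cut_F in D by lra. lra.
- apply (stays_below n g a u w r cut_cont S). intros s Hs. apply cut_F_increasing; lra.
Qed.

Lemma betas_escapes u w rk k : sol n g betas u w -> escapes cm cp rk k u.
Proof.
intros S. right. exists rk. split; [lra|]. intros [_ H].
assert (P := betas_pos). assert (Q := cut_signs). assert (A' := ls_cp L). assert (B' := ls_M L).
assert (C := cut_central). assert (D := ct_bp C). assert (E := ct_cp C).
assert (A := trapped_above n g betas u w gammaM Hn cut_cont S B').
rewrite !cut_F in A by lra. specialize (A ltac:(rewrite (ls_Fbs L); lra) rk). lra.
Qed.

Variables (U W : R -> R -> R).
Hypothesis HU : forall a, a <> 0 -> sol n g a (U a) (W a) /\ rests (U a) (W a).

Lemma one_solution sp rk k x y : 0 < sp -> (forall s, cm <= s <= cp -> 2 * (h - Fint g s) <= sp * sp) ->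
  0 < rk -> INR (S k) * (2 * (INR n / rk * sp * (cp - cm))) <= h / 4 ->
  betas <= x <= amax -> betas <= y <= amax ->
  escapes cm cp rk k (U x) -> ~ escapes cm cp rk k (U y) -> ~ tends_to_0 (U y) ->
  exists t, 0 < t < 1 /\ is_solution (S n) f gm gs (U (x + t * (y - x))) /\ U (x + t * (y - x)) 0 = x + t * (y - x) /\
    exactly_sign_changes (U (x + t * (y - x))) k.
Proof.
intros Hsp Hspb Hrk Hrkb Hx Hy Ex Ey Ny.
assert (P := betas_pos). assert (Q := cut_signs).
assert (Hin : forall t, 0 <= t <= 1 -> betas <= x + t * (y - x) <= amax).
{ intros t Ht. assert (0 <= t * (y - betas)) by pos.
  assert (0 <= (1 - t) * (x - betas)) by pos.
  assert (0 <= t * (amax - y)) by pos.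
  assert (0 <= (1 - t) * (amax - x)) by pos. split; lra. }
assert (C := cut_central).
destruct (clampf_bounded f gm gs m amax) as [B HB]; [apply L|exact Hm|apply Rbar_lt_le, Hamax2|exact Q|].
assert (Fam : forall t, 0 <= t <= 1 -> x + t * (y - x) <> 0 /\
  sol n g (x + t * (y - x)) (U (x + t * (y - x))) (W (x + t * (y - x))) /\
  rests (U (x + t * (y - x))) (W (x + t * (y - x)))).
{ intros t Ht. specialize (Hin t Ht). split; [lra|]. apply HU. lra. }
destruct (shooting n g B cm bm beta1 cp h sp rk k x (y - x) (fun t => U (x + t * (y - x)))
  (fun t => W (x + t * (y - x))) Hn C HB Fam Hsp Hspb Hrk Hrkb) as (t & Ht & T1 & T2 & T3).
- replace (x + 0 * (y - x)) with x by ring. exact Ex.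
- replace (x + 1 * (y - x)) with y by ring. exact Ey.
- replace (x + 1 * (y - x)) with y by ring. exact Ny.
- exists t. split; [exact Ht|].
  set (a := x + t * (y - x)) in *. assert (Ha := Hin t ltac:(lra)). fold a in Ha.
  destruct (HU a ltac:(lra)) as [Sa _].
  split; [|split; [apply (sol_init Sa), Rle_refl|split; assumption]].
  assert (Hconf := fun r => confined a _ _ r Sa Ha).
  apply (sol_is_solution n g a (U a) (W a) cut_cont Sa f gm gs); [| |exact T1].
  + intros r _. destruct (Hconf r). split.
    * apply (above_gm gm m (U a r) Hm). lra.
    * apply Rbar_lt_le, (below_gs gs (U a r) amax Hamax2). lra.
  + intros r _. destruct (Hconf r). apply clampf_eq. lra.
Qed.

(** The solution starting at [y] separates the two others. *)
Theorem two_solutions sp rk k y : 0 < sp -> (forall s, cm <= s <= cp -> 2 * (h - Fint g s) <= sp * sp) ->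
  0 < rk -> INR (S k) * (2 * (INR n / rk * sp * (cp - cm))) <= h / 4 ->
  betas <= y <= amax -> ~ escapes cm cp rk k (U y) -> ~ tends_to_0 (U y) ->
  escapes cm cp rk k (U amax) ->
  exists u v : R -> R,
    (is_solution (S n) f gm gs u /\ betas < u 0 /\ Rbar_lt (u 0) gs /\ exactly_sign_changes u k) /\
    (is_solution (S n) f gm gs v /\ betas < v 0 /\ Rbar_lt (v 0) gs /\ exactly_sign_changes v k) /\
    exists r, 0 <= r /\ u r <> v r.
Proof.
intros Hsp Hspb Hrk Hrkb Hy Ey Ny Em. assert (P := betas_pos).
destruct (HU betas ltac:(lra)) as [Sb _].
assert (Eb := betas_escapes _ _ rk k Sb).
assert (Hyb : betas < y) by (destruct (proj1 Hy) as [H| <-]; [exact H|contradiction]).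
assert (Hym : y < amax) by (destruct (proj2 Hy) as [H|H]; [exact H|subst y; contradiction]).
destruct (one_solution sp rk k betas y) as (t & Ht & T1 & T2 & T3); try assumption; try lra.
destruct (one_solution sp rk k amax y) as (s & Hs & S1 & S2 & S3); try assumption; try lra.
assert (Hv1 : 0 < t * (y - betas)) by pos.
assert (Hv2 : 0 < (1 - t) * (y - betas)) by pos.
assert (Hv3 : 0 < s * (amax - y)) by pos.
assert (Hv4 : 0 < (1 - s) * (amax - y)) by pos.
exists (U (betas + t * (y - betas))), (U (amax + s * (y - amax))). split; [|split].
- split; [exact T1|]. rewrite T2. split; [lra|]. split; [|exact T3].
  apply (below_gs gs _ amax Hamax2). lra.
- split; [exact S1|]. rewrite S2. split; [lra|]. split; [|exact S3].
  apply (below_gs gs _ amax Hamax2). lra.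
- exists 0. split; [lra|]. rewrite T2, S2. lra.
Qed.

(** The solution stays positive in the well, and its energy becomes small there, so by
    [late_energy] it cannot have left the central interval late. *)
Lemma bottom sp rk k a T Tb I Fb : 0 < sp -> (forall s, cm <= s <= cp -> 2 * (h - Fint g s) <= sp * sp) ->
  0 < rk -> INR (S k) * (2 * (INR n / rk * sp * (cp - cm))) <= h / 4 ->
  betas <= a <= amax -> 0 < T <= Tb -> (forall r, 0 <= r <= T -> beta1 <= U a r) -> U a T = beta1 ->
  energy g (U a) (W a) T <= I -> 0 < I -> (forall s, 0 <= s <= beta1 -> - Fb <= F s) ->
  Tb * I < sqrt 2 * INR n / sqrt (I + Fb) * RInt (fun s => Rabs (F s)) 0 beta1 ->
  ~ escapes cm cp rk k (U a) /\ ~ tends_to_0 (U a).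
Proof.
intros Hsp Hspb Hrk Hrkb Ha HT Habove HuT HET HI HFb Hcross.
assert (P := betas_pos). assert (Q := cut_signs). assert (C := cut_central).
assert (B0 := ct_bp C). assert (B1 := ct_cp C).
assert (A' := ls_cp L). assert (B' := ls_M L).
destruct (HU a ltac:(lra)) as [Sa _].
assert (HF : forall s, 0 <= s <= beta1 -> - Fb <= Fint g s <= 0).
{ intros s Hs. rewrite cut_F by lra. split; [apply HFb, Hs|apply (ls_well L s Hs)]. }
assert (HwT : W a T <= 0).
{ apply Rnot_lt_le. intros Hl.
  destruct (derive_neg_local (fun r => - U a r) T (- W a T)) as (d & Hd & _ & Hd').
  { apply dR_opp, (sol_du Sa). } { lra. }
  max_of s 0 (T - d / 2) as S1 S2.
  assert (S3 : s < T) by (apply Rmax_lub_lt; lra).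
  specialize (Hd' s ltac:(lra)). specialize (Habove s ltac:(lra)). lra. }
assert (Hcross' : Tb * I < sqrt 2 * INR n / sqrt (I + Fb) * RInt (fun s => Rabs (Fint g s)) 0 beta1).
{ rewrite (RInt_ext (fun s => Rabs (Fint g s)) (fun s => Rabs (F s))); [exact Hcross|].
  intros x Hx. rewrite Rmin_left, Rmax_right in Hx by lra. rewrite cut_F by lra. reflexivity. }
assert (HFcp : forall s, beta1 < s <= cp -> 0 < Fint g s) by (apply (F_pos_right g cm bm beta1 cp h C)).
assert (Hpos := well_positive n g a (U a) (W a) beta1 T Tb I Fb Hn cut_cont Sa B0 HF (ct_Fbp C) HT HuT HwT HET HI Hcross').
assert (Hpos' : forall r, 0 < r -> 0 < U a r).
{ intros r Hr. destruct (Rle_dec r T) as [H|H]; [specialize (Habove r ltac:(lra)); lra|apply Hpos; lra]. }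
assert (Halt : ~ alternates (U a) (S k)).
{ intros (t & Ht0 & Ht). assert (A : forall i, (i <= S k)%nat -> 0 < t i).
  { intros i. induction i as [|i IH]; intros Hi; [exact Ht0|].
    destruct (Ht i ltac:(lia)) as [H _]. specialize (IH ltac:(lia)). lra. }
  destruct (Ht O ltac:(lia)) as [_ H].
  assert (X := Hpos' _ (A O ltac:(lia))). assert (Y := Hpos' _ (A 1%nat ltac:(lia))).
  assert (0 < U a (t O) * U a (t 1%nat)) by pos. lra. }
split.
- intros [H|(r & Hr & Hout)]; [exact (Halt H)|]. apply Halt.
  assert (Hh := ct_h C). assert (Hbm := ct_bm C). assert (Hcm := ct_cm C).
  destruct (well_small_energy n g a (U a) (W a) beta1 T Tb I Fb Hn cut_cont Sa B0 HF (ct_Fbp C) HT HuT HwT HET HI Hcross'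
    cp B1 HFcp (h / 2) 0) as (r0 & _ & HE & Hu); [lra|].
  apply (late_energy n g cm bm beta1 cp h a (U a) (W a) sp rk k r r0); auto. lra.
- apply (well_not_to_0 n g a (U a) (W a) beta1 T Tb I Fb Hn cut_cont Sa B0 HF (ct_Fbp C) HT HuT HwT HET HI Hcross').
Qed.

End reduction.
Arguments two_solutions {n f gm gs gammaM beta1 betas cm bm cp h}.
Arguments bottom {n f gm gs gammaM beta1 betas cm bm cp h}.
Arguments confined n {f gm gs gammaM beta1 betas cm bm cp h}.
Arguments cut_F_increasing {f gm gs gammaM beta1 betas cm bm cp h}.
Arguments cut_force {f gm gs gammaM beta1 betas cm bm cp h}.
Arguments cut_F {f gm gs gammaM beta1 betas cm bm cp h}.
Arguments cut_central {f gm gs gammaM beta1 betas cm bm cp h}.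
Arguments cut_cont {f gm gs gammaM beta1 betas cm bm cp h}.
Arguments cut_signs {f gm gs gammaM beta1 betas cm bm cp h}.

(** * Tuning the time of descent *)

Section upper.

Variables (n : nat) (g : R -> R) (a : R) (u w : R -> R) (bs bb c : R).
Hypothesis Hg : forall x, continuous g x.
Hypothesis HS : sol n g a u w.
Hypothesis Hbs : bs < bb.
Hypothesis Hforce : forall x, bs <= x -> 0 < g x.
Hypothesis Hbelow : forall s, 0 <= s <= bs -> Fint g s <= c.
Hypothesis Hc : c < Fint g bb.

Lemma flux_falls r s : 0 <= r < s -> (forall x, r <= x <= s -> bs <= u x) ->
  s ^ n * w s < r ^ n * w r.
Proof.
intros Hr Hu.
set (q := (r + s) / 2). assert (Hq : r < q < s) by (unfold q; lra).
apply Rlt_le_trans with (q ^ n * w q).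
- destruct (mean_value (fun r => r ^ n * w r) (fun r => - (r ^ n * g (u r))) q s) as (x & Hx & E).
  + lra.
  + intros x Hx. apply (sol_flux HS). lra.
  + assert (A := Hforce (u x) ltac:(apply Hu; lra)).
    assert (B : 0 < x ^ n * g (u x)) by pos.
    assert (0 < x ^ n * g (u x) * (s - q)) by pos. lra.
- apply (derive_nonpos (fun r => r ^ n * w r) (fun r => - (r ^ n * g (u r)))).
  + lra.
  + intros x _. apply cR_mult; [apply cR_pow|apply (sol_cw HS)].
  + intros x Hx. apply (sol_flux HS). lra.
  + intros x Hx. assert (A := Hforce (u x) ltac:(apply Hu; lra)).
    assert (B : 0 < x ^ n * g (u x)) by pos. lra.
Qed.

(** Where the force is positive the flux [r^n w] decreases. *)
Lemma falls_from r s : 0 <= r < s -> w r <= 0 -> (forall x, r <= x <= s -> bs <= u x) -> w s < 0.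
Proof.
intros Hr Hw Hu. assert (A := flux_falls r s Hr Hu).
assert (0 <= r ^ n) by pos. assert (P : 0 < s ^ n) by pos.
assert (0 <= r ^ n * (- w r)) by pos.
apply Rnot_le_lt. intros Hl. assert (0 <= s ^ n * w s) by pos. lra.
Qed.

(** To come back up to [bb] the solution would have to turn: above [bs] the force forbids it, and
    below [bs] the energy at the turning point is at most [c]. *)
Lemma no_return r s : 0 <= r <= s -> (forall x, 0 <= x <= s -> 0 <= u x) -> u r <= bb -> u s <= bb.
Proof.
intros Hr Hpos Hur. apply Rnot_lt_le. intros Hl.
assert (Hcu : forall r, continuous u r) by (intros; apply (sol_cu HS)).
destruct (last_le u r s bb) as (r1 & Hr1 & E1 & Haft); [lra|auto|exact Hur|exact Hl|].
destruct (sol_init HS 0 (Rle_refl 0)) as [_ W0].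
destruct (last_time (fun x => w x <= 0) 0 r1) as (t & Ht & Pt & Hat).
{ lra. } { rewrite W0. lra. }
{ intros x Hx Hn. destruct (continuous_gt w x 0 (sol_cw HS x)) as (d & Hd & Hd'); [lra|].
  exists d. split; [exact Hd|]. intros y _ Hy. specialize (Hd' y Hy). lra. }
destruct (Req_dec t r1) as [->|Hne].
- assert (A : u s <= u r1).
  { apply (derive_nonpos u w); [lra|auto|intros; apply (sol_du HS)|].
    intros x Hx. left. apply (falls_from r1 x ltac:(lra) Pt).
    intros y Hy. destruct (Req_dec y r1) as [->|Hy1]; [lra|]. specialize (Haft y ltac:(lra)). lra. }
  lra.
- assert (Hwpos : forall x, t < x <= r1 -> 0 < w x).
  { intros x Hx. specialize (Hat x Hx). lra. }
  assert (Hw0 : w t = 0).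
  { apply Rle_antisym; [exact Pt|]. apply Rnot_lt_le. intros Hn.
    destruct (continuous_lt w t 0 (sol_cw HS t) Hn) as (d & Hd & Hd').
    min_of x (t + d / 2) r1 as X1 X2.
    assert (X3 : t < x) by (apply Rmin_glb_lt; lra).
    specialize (Hd' x ltac:(apply Rabs_def1; lra)). specialize (Hwpos x ltac:(lra)). lra. }
  destruct (Rle_dec bs (u t)) as [Hb|Hb].
  + assert (A := falls_from t r1 ltac:(lra) Pt).
    assert (B : w r1 < 0); [apply A|specialize (Hwpos r1 ltac:(lra)); lra].
    intros x Hx. apply Rle_trans with (1 := Hb).
    apply (derive_nonneg u w); [lra|auto|intros; apply (sol_du HS)|].
    intros y Hy. left. apply Hwpos. lra.
  + assert (A := Hbelow (u t) ltac:(split; [apply Hpos; lra|lra])).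
    assert (B := energy_noninc Hg HS t r1 ltac:(lra)).
    assert (D := F_le_energy g u w r1). rewrite E1 in D.
    unfold energy at 2 in B. rewrite Hw0 in B. lra.
Qed.

(** If the descent from [bb] to [b1] takes at least a unit of time then the speed is at most
    [bb - b1] somewhere on the way. *)
Lemma slow_passage b1 C T : 0 <= b1 -> b1 <= bs -> 0 <= C -> C + 1 <= T ->
  (forall r, 0 <= r <= C + 1 -> b1 <= u r) -> u C <= bb ->
  energy g u w T <= Fint g bb + (bb - b1) ^ 2 / 2.
Proof.
intros Hb1 Hb1s HC HT Hab HuC.
assert (Hret : forall s, C <= s <= C + 1 -> u s <= bb).
{ intros s Hs. apply (no_return C s); [lra| |exact HuC]. intros x Hx. specialize (Hab x ltac:(lra)). lra. }
destruct (mean_value u w C (C + 1)) as (x & Hx & E); [lra|intros; apply (sol_du HS)|].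
apply Rle_trans with (energy g u w x).
{ apply (energy_noninc Hg HS). lra. }
assert (A1 := Hab C ltac:(lra)). assert (A2 := Hab (C + 1) ltac:(lra)). assert (A3 := Hret (C + 1) ltac:(lra)).
assert (A4 := Hab x ltac:(lra)). assert (A5 := Hret x ltac:(lra)).
assert (Hw : w x ^ 2 <= (bb - b1) * (bb - b1)).
{ apply sqr_le. lra. }
assert (HF : Fint g (u x) <= Fint g bb).
{ destruct (Rle_dec (u x) bs) as [H|H].
  - specialize (Hbelow (u x) ltac:(lra)). lra.
  - apply (derive_nonneg (Fint g) g); [lra|intros; apply Fint_cont, Hg|intros; apply Fint_derive, Hg|].
    intros y Hy. left. apply Hforce. lra. }
unfold energy. replace ((bb - b1) ^ 2) with ((bb - b1) * (bb - b1)) by ring. lra.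
Qed.

End upper.

Section family.

Variables (n : nat) (g : R -> R) (B a0 a1 bs bb b1 c C : R) (U W : R -> R -> R).
Hypothesis Hg : forall x, continuous g x.
Hypothesis Hlip : lip_off_0 g.
Hypothesis HB : forall x, Rabs (g x) <= B.
Hypothesis Hb1 : 0 < b1.
Hypothesis Hb1s : b1 < bs.
Hypothesis Hbs : bs < bb.
Hypothesis Ha0 : bs <= a0.
Hypothesis HU : forall a, a0 <= a <= a1 -> sol n g a (U a) (W a).
Hypothesis Hforce : forall x, bs <= x -> 0 < g x.
Hypothesis HC : 0 < C.

Lemma first_hit_unstable T c0 a : a0 <= a <= a1 -> 0 <= T -> 0 < c0 <= a ->
  (exists r, 0 <= r <= T /\ U a r < c0) ->
  exists d, 0 < d /\ forall y, a0 <= y <= a1 -> Rabs (y - a) < d -> exists r, 0 <= r <= T /\ U y r < c0.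
Proof.
intros Ha HT Hc0 (r & Hr & Hur). assert (S := HU a Ha).
assert (Hcu : forall r, continuous (U a) r) by (intros; apply (sol_cu S)).
destruct (sol_init S 0 (Rle_refl 0)) as [U0 _].
max_of e ((U a r + c0) / 2) (c0 / 2) as E1 E2.
assert (E3 : e < c0) by (apply Rmax_lub_lt; lra).
destruct (first_le (U a) 0 r e) as (t & Ht & Et & Hbef); [lra|auto|lra|lra|].
destruct (continuous_dependence n g B Hg HB a (U a) (W a) t Hlip S ltac:(lra)) with (eps := c0 - e) as (d & Hd & Hd'); [|lra|].
{ intros x Hx [X _]. destruct (Req_dec x t) as [->|Hne]; [lra|]. specialize (Hbef x ltac:(lra)). lra. }
exists d. split; [exact Hd|]. intros y Hy Hya. exists t. split; [lra|].
destruct (Hd' y (U y) (W y) (HU y Hy) Hya t ltac:(lra)) as [A _]. apply Rabs_def2 in A. lra.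
Qed.

Lemma stays_above_stable T c0 a : a0 <= a <= a1 -> 0 <= T -> 0 < c0 ->
  (forall r, 0 <= r <= T -> c0 < U a r) ->
  exists d, 0 < d /\ forall y, a0 <= y <= a1 -> Rabs (y - a) < d -> forall r, 0 <= r <= T -> c0 < U y r.
Proof.
intros Ha HT Hc0 Hab. assert (S := HU a Ha).
destruct (cont_min (U a) 0 T HT) as (x & Hx & Hmin); [intros; apply (sol_cu S)|].
assert (Hux := Hab x Hx).
destruct (continuous_dependence n g B Hg HB a (U a) (W a) T Hlip S HT) with (eps := U a x - c0) as (d & Hd & Hd'); [|lra|].
{ intros r Hr [X _]. specialize (Hab r Hr). lra. }
exists d. split; [exact Hd|]. intros y Hy Hya r Hr.
destruct (Hd' y (U y) (W y) (HU y Hy) Hya r Hr) as [A _]. apply Rabs_def2 in A.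
specialize (Hmin r Hr). lra.
Qed.

(** The first initial value whose solution stays above [bb] until [C] has a solution meeting
    [bb], and only at the time [C], because it is falling. *)
Lemma crossing_at : a0 <= bb <= a1 -> (forall r, 0 <= r <= C -> bb <= U a1 r) ->
  exists a, bb < a <= a1 /\ U a C = bb /\ (forall r, 0 <= r <= C -> bb <= U a r) /\ W a C < 0 /\
    forall y, a0 <= y < a -> exists r, 0 <= r <= C /\ U y r < bb.
Proof.
intros Hbb Htop.
destruct (first_time (fun a => forall r, 0 <= r <= C -> bb <= U a r) bb a1) as (a & Ha & Qa & Hbef); [lra|exact Htop| |].
- intros x Hx Hno. 
  assert (Hex : exists r, 0 <= r <= C /\ U x r < bb).
  { apply NNPP. intros Hno2. apply Hno. intros r Hr. apply Rnot_lt_le. intros Hl. apply Hno2. eauto. }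
  assert (Hcx := first_hit_unstable C bb x ltac:(lra) ltac:(lra) ltac:(lra) Hex).
  destruct Hcx as (d & Hd & Hd'). exists d. split; [exact Hd|]. intros y Hy Hya Q.
  destruct (Hd' y ltac:(lra) Hya) as (r & Hr & Hur). specialize (Q r Hr). lra.
- assert (S := HU a ltac:(lra)).
  destruct (sol_init S 0 (Rle_refl 0)) as [U0 W0].
  assert (Hw : forall s, 0 < s <= C -> W a s < 0).
  { intros s Hs. apply (falls_from n g a (U a) (W a) bs S Hforce 0 s); [lra|lra|].
    intros x Hx. specialize (Qa x ltac:(lra)). lra. }
  assert (Hdec : forall r, 0 <= r < C -> bb < U a r).
  { intros r Hr. set (q := (r + C) / 2). assert (Hq : r < q < C) by (unfold q; lra).
    assert (A0 : U a q <= U a r).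
    { apply (derive_nonpos (U a) (W a)); [lra|intros; apply (sol_cu S)|intros; apply (sol_du S)|].
      intros x Hx. left. apply Hw. lra. }
    destruct (mean_value (U a) (W a) q C) as (x & Hx & E); [lra|intros; apply (sol_du S)|].
    assert (A := Hw x ltac:(lra)). assert (0 < - W a x * (C - q)) by pos.
    specialize (Qa C ltac:(lra)). lra. }
  assert (Hab : bb < a) by (rewrite <- U0; apply Hdec; lra).
  assert (EC : U a C = bb).
  { apply Rle_antisym; [|apply Qa; lra]. apply Rnot_lt_le. intros Hl.
    destruct (stays_above_stable C bb a) as (d & Hd & Hd'); [lra|lra|lra| |].
    { intros r Hr. destruct (Req_dec r C) as [->|Hne]; [exact Hl|apply Hdec; lra]. }
    max_of y bb (a - d / 2) as Y1 Y2.
    assert (Y3 : y < a) by (apply Rmax_lub_lt; lra).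
    apply (Hbef y ltac:(lra)). intros r Hr. left. apply (Hd' y); [lra|apply Rabs_def1; lra|exact Hr]. }
  exists a. split; [lra|]. split; [exact EC|]. split; [exact Qa|]. split; [apply Hw; lra|].
  intros y Hy. destruct (Rlt_dec y bb) as [Hyb|Hyb].
  { exists 0. split; [lra|]. destruct (sol_init (HU y ltac:(lra)) 0 (Rle_refl 0)) as [-> _]. exact Hyb. }
  apply NNPP. intros Hno. apply (Hbef y ltac:(lra)). intros r Hr. apply Rnot_lt_le. intros Hl. apply Hno. eauto.
Qed.

(** At the first initial value whose solution meets [b1] it cannot pass below [b1], since this
    would persist for smaller initial values. *)
Lemma touching_at T : 0 < T -> a0 <= a1 -> (forall r, 0 <= r <= T -> b1 < U a0 r) ->
  (exists r, 0 <= r <= T /\ U a1 r <= b1) ->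
  exists a r, a0 <= a <= a1 /\ 0 < r <= T /\ U a r = b1 /\ (forall x, 0 <= x <= T -> b1 <= U a x).
Proof.
intros HT Ha01 Hlow (r1 & Hr1 & Hur1).
destruct (first_time (fun a => exists r, 0 <= r <= T /\ U a r <= b1) a0 a1) as (a & Ha & (r & Hr & Hur) & Hbef); [lra|eauto| |].
- intros x Hx Hno.
  destruct (stays_above_stable T b1 x) as (d & Hd & Hd'); [lra|lra|exact Hb1| |].
  { intros r Hr. apply Rnot_le_lt. intros Hl. apply Hno. eauto. }
  exists d. split; [exact Hd|]. intros y Hy Hya (r & Hr & Hl). specialize (Hd' y Hy Hya r Hr). lra.
- assert (Haa : a0 < a).
  { destruct (proj1 Ha) as [H|H]; [exact H|]. subst a. specialize (Hlow r Hr). lra. }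
  assert (Hge : forall x, 0 <= x <= T -> b1 <= U a x).
  { intros x Hx. apply Rnot_lt_le. intros Hl.
    destruct (first_hit_unstable T b1 a) as (d & Hd & Hd'); [lra|lra|lra|eauto|].
    max_of y a0 (a - d / 2) as Y1 Y2.
    assert (Y3 : y < a) by (apply Rmax_lub_lt; lra).
    destruct (Hd' y ltac:(lra) ltac:(apply Rabs_def1; lra)) as (z & Hz & Huz).
    apply (Hbef y ltac:(lra)). exists z. split; [exact Hz|lra]. }
  exists a, r. split; [lra|].
  assert (E : U a r = b1) by (apply Rle_antisym; [exact Hur|apply Hge, Hr]).
  split; [|split; [exact E|exact Hge]].
  split; [|lra]. destruct (proj1 Hr) as [H|H]; [exact H|]. subst r.
  destruct (sol_init (HU a ltac:(lra)) 0 (Rle_refl 0)) as [U0 _]. lra.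
Qed.

End family.

(** * Solutions that reach the well early *)

Section well_reached.

Variables (n : nat) (f : R -> R) (gm gs : Rbar) (gammaM beta1 betas cm bm cp h : R).
Hypothesis Hn : (1 <= n)%nat.
Hypothesis L : landscape f gm gs gammaM beta1 betas cm bm cp h.
Variables (m amax bbar : R).
Hypothesis Hm : Rbar_lt gm m.
Hypothesis Hmcm : m <= cm.
Hypothesis Hbbar : betas < bbar.
Hypothesis Hamax : bbar <= amax.
Hypothesis Hamax2 : Rbar_lt amax gs.
Hypothesis HFm : Fint f amax < Fint f m.

Notation g := (clampf m amax f).
Notation F := (Fint f).

Variables (U W : R -> R -> R).
Hypothesis HU : forall a, a <> 0 -> sol n g a (U a) (W a) /\ rests (U a) (W a).
Variables (mf Gm C : R).
Hypothesis Hmf : 0 < mf.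
Hypothesis Hmf2 : forall s, betas <= s <= bbar -> mf <= f s.
Hypothesis HGm : forall s, beta1 <= s <= betas -> Gm <= F s.
Hypothesis HC : C = 2 * INR n * ((bbar - beta1) / (F bbar - F gammaM)) * sqrt (2 * (F bbar - Gm)).

Let Af := (betas - beta1) / sqrt (F bbar - F gammaM) + sqrt (2 * INR (S n) * (bbar - betas) / mf).

Let Hamax1 : betas < amax.
Proof. lra. Qed.

Let Hsigns := cut_signs L m amax Hm Hmcm Hamax1 Hamax2.
Let Hcont := cut_cont L m amax Hm Hmcm Hamax1 Hamax2.
Let Hcen := cut_central L m amax Hm Hmcm Hamax1 Hamax2.
Let HF := cut_F L m amax Hm Hmcm Hamax1 Hamax2.
Let Hforce := cut_force L m amax Hm Hmcm Hamax1 Hamax2.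
Let Hincr := cut_F_increasing L m amax Hm Hmcm Hamax1 Hamax2.
Let Hb1 := ls_b1 L.

Lemma points : 0 < beta1 /\ beta1 < gammaM /\ gammaM < betas.
Proof.
assert (A := ct_cp Hcen). assert (B := ls_cp L). assert (D := ls_M L). lra.
Qed.

Let Hpts := points.

Lemma cut_below s : 0 <= s <= betas -> Fint g s <= F gammaM.
Proof. intros Hs. rewrite HF by lra. apply (ls_below L s Hs). Qed.

Lemma F_bbar : F gammaM < F bbar.
Proof.
assert (A := Hincr betas bbar ltac:(lra) Hbbar). rewrite !HF in A by lra.
rewrite (ls_Fbs L) in A. exact A.
Qed.

Lemma C_pos : 0 < C.
Proof.
assert (A := F_bbar). assert (B := HGm gammaM ltac:(lra)). rewrite HC.
apply Rmult_lt_0_compat; [|pos].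
apply Rmult_lt_0_compat; [assert (0 < INR n) by pos; lra|].
apply Rdiv_lt_0_compat; lra.
Qed.

Lemma descends a : betas <= a <= amax -> U a C = bbar -> W a C < 0 ->
  exists T, C < T <= C + Af /\ U a T = beta1 /\ (forall r, C <= r < T -> beta1 < U a r).
Proof.
intros Ha EC WC. destruct (HU a ltac:(lra)) as [S _].
destruct (descent n g a (U a) (W a) bbar betas beta1 mf (F gammaM) Gm C Hn Hcont S) as (T & T1 & T2 & T3 & T4 & _); try lra; try assumption.
- intros s Hs. rewrite clampf_eq by lra. apply Hmf2, Hs.
- intros s Hs. apply cut_below. lra.
- intros s Hs. rewrite HF by lra. destruct (Rle_dec s betas) as [H|H]; [apply HGm; lra|].
  assert (A := Hincr betas s ltac:(lra) ltac:(lra)). rewrite !HF in A by lra.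
  specialize (HGm betas ltac:(lra)). lra.
- rewrite HF by lra. apply F_bbar.
- apply HGm. lra.
- rewrite HF by lra. exact HC.
- rewrite HF in T2 by lra. exists T. unfold Af. split; [split; [exact T1|exact T2]|]. split; assumption.
Qed.

Lemma crossing a' : bbar <= a' <= amax -> (forall r, 0 <= r <= C -> bbar <= U a' r) ->
  exists a, bbar < a <= a' /\ U a C = bbar /\ (forall r, 0 <= r <= C -> bbar <= U a r) /\ W a C < 0 /\
    forall y, betas <= y < a -> exists r, 0 <= r <= C /\ U y r < bbar.
Proof.
intros Ha' HQ.
destruct (clampf_bounded f gm gs m amax) as [B HB]; [apply L|exact Hm|apply Rbar_lt_le, Hamax2|exact Hsigns|].
apply (crossing_at n g B betas a' betas bbar beta1 C U W Hcont (ct_lip Hcen) HB); try lra; try assumption.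
- intros a Ha. apply HU. lra.
- apply C_pos.
Qed.

Theorem reaches_well : (forall r, 0 <= r <= C -> bbar <= U amax r) ->
  exists a T, betas <= a <= amax /\ 0 < T <= C + Af /\ (forall r, 0 <= r <= T -> beta1 <= U a r) /\
    U a T = beta1.
Proof.
intros HQ. destruct (crossing amax) as (a & Ha & EC & Hge & WC & _); [lra|exact HQ|].
destruct (descends a ltac:(lra) EC WC) as (T & HT & ET & Hbef). assert (C0 := C_pos).
exists a, T. split; [lra|]. split; [lra|]. split; [|exact ET].
intros r Hr. destruct (Rle_dec r C) as [H|H]; [specialize (Hge r ltac:(lra)); lra|].
destruct (Req_dec r T) as [->|Hne]; [lra|]. left. apply Hbef. lra.
Qed.

Lemma slow_descent_energy a T : betas <= a <= amax -> C + 1 <= T -> (forall r, 0 <= r <= C + 1 -> beta1 <= U a r) ->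
  (exists r, 0 <= r <= C /\ U a r <= bbar) -> energy g (U a) (W a) T <= F bbar + (bbar - beta1) ^ 2 / 2.
Proof.
intros Ha HT Hab (r & Hr & Hur). destruct (HU a ltac:(lra)) as [S _]. assert (C0 := C_pos).
assert (A := F_bbar). rewrite <- (HF bbar) in A |- * by lra.
apply (slow_passage n g a (U a) (W a) betas bbar (F gammaM) Hcont S Hbbar Hforce cut_below A beta1 C); try lra; try assumption.
apply (no_return n g a (U a) (W a) betas bbar (F gammaM) Hcont S Hbbar Hforce cut_below A r C); [lra| |exact Hur].
intros x Hx. specialize (Hab x ltac:(lra)). lra.
Qed.

(** Lowering the initial value until [beta1] is just reached makes the passage slow: either it
    takes until [C + 1], or the solution turns at [beta1] with zero energy. *)
Lemma reaches_later a' : betas <= a' <= amax ->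
  (forall a, betas <= a <= a' -> exists r, 0 <= r <= C /\ U a r <= bbar) ->
  (exists r, 0 <= r <= C + 1 /\ U a' r <= beta1) ->
  exists a T, betas <= a <= amax /\ 0 < T <= C + 1 /\ (forall r, 0 <= r <= T -> beta1 <= U a r) /\
    U a T = beta1 /\ energy g (U a) (W a) T <= F bbar + (bbar - beta1) ^ 2 / 2.
Proof.
intros Ha' Hcr Hr. assert (C0 := C_pos).
destruct (clampf_bounded f gm gs m amax) as [B HB]; [apply L|exact Hm|apply Rbar_lt_le, Hamax2|exact Hsigns|].
destruct (touching_at n g B betas a' betas beta1 U W Hcont (ct_lip Hcen) HB) with (T := C + 1) as (a & T & Ha & HT & ET & Hab); try lra; try assumption.
- intros a Ha. apply HU. lra.
- intros r _. destruct (HU betas ltac:(lra)) as [S _].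
  assert (A := trapped_above n g betas (U betas) (W betas) gammaM Hn Hcont S ltac:(lra)).
  rewrite !HF in A by lra. specialize (A ltac:(rewrite (ls_Fbs L); lra) r). lra.
- exists a, T. split; [lra|]. split; [exact HT|].
  split; [intros r Hr'; apply Hab; lra|]. split; [exact ET|].
  destruct (Req_dec T (C + 1)) as [->|Hne].
  + apply slow_descent_energy; [lra|lra|exact Hab|apply Hcr, Ha].
  + (* an interior minimum of the solution: its speed vanishes there *)
    destruct (HU a ltac:(lra)) as [S _].
    assert (WT : W a T = 0).
    { apply (interior_min (U a) (W a) 0 (C + 1) T); [lra|apply (sol_du S)|].
      intros x Hx. rewrite ET. apply Hab. lra. }
    unfold energy. rewrite WT, ET, (ct_Fbp Hcen).
    assert (A := F_bbar). assert (D := ls_below L beta1 ltac:(lra)).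
    assert (E := ct_Fbp Hcen). rewrite HF in E by lra. assert (P := pow2_ge_0 (bbar - beta1)). lra.
Qed.

(** Take the value whose solution comes down to [bbar] exactly at the time [C].  If it needs less
    than a unit of time from there to [beta1], lower the initial value. *)
Theorem reaches_well_slowly :
  (forall r, 0 <= r <= C -> bbar <= U amax r) \/ (exists r, 0 <= r <= C + 1 /\ U amax r <= beta1) ->
  exists a T, betas <= a <= amax /\ 0 < T <= C + Rmax 1 Af /\ (forall r, 0 <= r <= T -> beta1 <= U a r) /\
    U a T = beta1 /\ energy g (U a) (W a) T <= F bbar + (bbar - beta1) ^ 2 / 2.
Proof.
intros Htop. assert (M1 := Rmax_l 1 Af). assert (M2 := Rmax_r 1 Af). assert (C0 := C_pos).
destruct (classic (exists a, bbar <= a <= amax /\ forall r, 0 <= r <= C -> bbar <= U a r)) as [(a' & Ha' & HQ)|Hno].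
- destruct (crossing a' Ha' HQ) as (a & Ha & EC & Hge & WC & Hbef).
  destruct (descends a ltac:(lra) EC WC) as (T & HT & ET & Hab).
  destruct (Rle_dec (C + 1) T) as [HT1|HT1].
  + assert (Hall : forall r, 0 <= r <= T -> beta1 <= U a r).
    { intros r Hr. destruct (Rle_dec r C) as [H|H]; [specialize (Hge r ltac:(lra)); lra|].
      destruct (Req_dec r T) as [->|Hne]; [lra|]. left. apply Hab. lra. }
    exists a, T. split; [lra|]. split; [lra|]. split; [exact Hall|]. split; [exact ET|].
    apply slow_descent_energy; [lra|exact HT1|intros r Hr; apply Hall; lra|]. exists C. split; lra.
  + destruct (reaches_later a) as (y & T' & Y1 & Y2 & Y3 & Y4 & Y5); [lra| | |].
    * intros y Hy. destruct (Req_dec y a) as [->|Hne]; [exists C; split; lra|].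
      destruct (Hbef y ltac:(lra)) as (r & Hr & Hur). exists r. split; [exact Hr|lra].
    * exists T. split; [lra|]. lra.
    * exists y, T'. split; [exact Y1|]. split; [lra|]. auto.
- destruct (reaches_later amax) as (y & T' & Y1 & Y2 & Y3 & Y4 & Y5); [lra| | |].
  + intros y Hy. apply NNPP. intros Hn2. destruct (HU y ltac:(lra)) as [S _].
    destruct (sol_init S 0 (Rle_refl 0)) as [U0 _].
    destruct (Rle_dec y bbar) as [H|H].
    { apply Hn2. exists 0. rewrite U0. split; lra. }
    apply Hno. exists y. split; [lra|]. intros r Hr. apply Rnot_lt_le. intros Hl.
    apply Hn2. exists r. split; [exact Hr|lra].
  + destruct Htop as [H|H]; [|exact H]. exfalso. apply Hno. exists amax. split; [lra|exact H].
  + exists y, T'. split; [exact Y1|]. split; [lra|]. auto.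
Qed.

End well_reached.
Arguments slow_descent_energy {n f gm gs gammaM beta1 betas cm bm cp h}.
Arguments reaches_well_slowly {n f gm gs gammaM beta1 betas cm bm cp h}.
Arguments reaches_well {n f gm gs gammaM beta1 betas cm bm cp h}.

(** * The finite case *)

Lemma inf_on_attained (g : R -> R) (a b : R) : a <= b -> (forall x, a <= x <= b -> continuous g x) ->
  exists x, a <= x <= b /\ inf_on g a b = g x /\ forall s, a <= s <= b -> g x <= g s.
Proof.
intros Hab Hg. destruct (cont_min g a b Hab Hg) as (x & Hx & Hmin).
exists x. split; [exact Hx|]. split; [|exact Hmin]. unfold inf_on.
rewrite (is_glb_Rbar_unique _ (Finite (g x))); [reflexivity|]. split.
- intros y (s & Hs & ->). simpl. apply Hmin, Hs.
- intros l Hl. apply Hl. eauto.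
Qed.

Lemma sup_on_attained (g : R -> R) (a b : R) : a <= b -> (forall x, a <= x <= b -> continuous g x) ->
  exists x, a <= x <= b /\ sup_on g a b = g x /\ forall s, a <= s <= b -> g s <= g x.
Proof.
intros Hab Hg. destruct (cont_max g a b Hab Hg) as (x & Hx & Hmax).
exists x. split; [exact Hx|]. split; [|exact Hmax]. unfold sup_on.
rewrite (is_lub_Rbar_unique _ (Finite (g x))); [reflexivity|]. split.
- intros y (s & Hs & ->). simpl. apply Hmax, Hs.
- intros l Hl. apply Hl. eauto.
Qed.

Lemma from_above_eventually (gm : Rbar) (P : R -> Prop) : Rbar_lt gm 0 -> from_above gm P ->
  exists t0 : R, Rbar_lt gm t0 /\ forall t : R, Rbar_lt gm t -> t < t0 -> P t.
Proof.
intros Hgm H. destruct gm as [x| |].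
- destruct H as [d Hd]. exists (x + d). split; [simpl; assert (A := cond_pos d); lra|].
  intros t Ht Ht2. apply Hd; [|exact Ht]. simpl in Ht. change (Rabs (t - x) < d). apply Rabs_def1; lra.
- destruct Hgm.
- destruct H as [B HB]. exists B. split; [exact I|]. intros t Ht Ht2. apply HB; [exact Ht2|exact Ht].
Qed.

Section late.

Variables (n : nat) (f : R -> R) (gm gs : Rbar) (gammaM beta1 betas cm bm cp h : R).
Hypothesis Hn : (1 <= n)%nat.
Hypothesis L : landscape f gm gs gammaM beta1 betas cm bm cp h.

Lemma F_cont_landscape (s : R) : Rbar_lt gm s -> Rbar_lt s gs -> continuous (Fint f) s.
Proof. apply F_cont_inside; apply L. Qed.

Lemma f_cont_landscape (s : R) : Rbar_lt gm s -> Rbar_lt s gs -> continuous f s.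
Proof. apply f_cont_inside; apply L. Qed.

Lemma cutoff_exists (amax : R) : 0 < amax -> Rbar_lt amax gs ->
  exists m : R, Rbar_lt gm m /\ m <= cm /\ Fint f amax < Fint f m.
Proof.
intros H0 Ha.
destruct (ls_bot L amax) as (t0 & Ht0 & Ht); [|exact Ha|].
{ apply (above_gm gm 0); [apply L|lra]. }
destruct (between_below gm (Rmin t0 cm)) as (m & Hm & Hm').
{ unfold Rmin. destruct (Rle_dec t0 cm); [exact Ht0|apply L]. }
assert (M1 := Rmin_l t0 cm). assert (M2 := Rmin_r t0 cm).
exists m. split; [exact Hm|]. split; [lra|]. apply Ht; [exact Hm|lra].
Qed.

Lemma late_exists k : exists sp rk, 0 < sp /\ 0 < rk /\
  (forall s, cm <= s <= cp -> 2 * (h - Fint f s) <= sp * sp) /\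
  INR (S k) * (2 * (INR n / rk * sp * (cp - cm))) <= h / 4.
Proof.
assert (Hgb : Rbar_lt gammaM gs).
{ apply (below_gs gs gammaM betas); [apply L|]. left. apply L. }
assert (Hcp := ls_cp L).
assert (C := ls_central L cm gammaM (ls_cm L) (Rle_refl _) Hcp
  (Rbar_lt_le _ _ Hgb)).
assert (C1 := ct_cm C). assert (C2 := ct_bm C). assert (C3 := ct_bp C). assert (C4 := ct_cp C). assert (Hh := ct_h C).
destruct (cont_min (Fint f) cm cp) as (x & Hx & Hmin); [lra| |].
{ intros s Hs. apply F_cont_landscape; [apply (above_gm gm cm); [apply L|lra]|apply (below_gs gs s gammaM Hgb); lra]. }
assert (P2 := Rmax_l 1 (2 * (h - Fint f x))). assert (P3 := Rmax_r 1 (2 * (h - Fint f x))).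
set (v := Rmax 1 (2 * (h - Fint f x))) in *.
assert (Hsp : 0 < sqrt v) by (apply sqrt_lt_R0; lra).
assert (Hsp2 : sqrt v * sqrt v = v) by (apply sqrt_sqrt; lra).
set (X := INR (S k) * (2 * (INR n * sqrt v * (cp - cm)))).
assert (HX : 0 < X).
{ apply Rmult_lt_0_compat; [apply lt_0_INR; lia|]. apply Rmult_lt_0_compat; [lra|].
  apply Rmult_lt_0_compat; [|lra]. apply Rmult_lt_0_compat; [apply lt_0_INR; lia|exact Hsp]. }
exists (sqrt v), (4 * X / h). split; [exact Hsp|]. split; [|split].
- apply Rdiv_lt_0_compat; lra.
- intros s Hs. specialize (Hmin s Hs). lra.
- right. transitivity (X / (4 * X / h)).
  + unfold X. field. repeat split; try lra; try (apply not_0_INR; lia).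
  + field. lra.
Qed.

End late.
Arguments cutoff_exists {f gm gs gammaM beta1 betas cm bm cp h}.
Arguments late_exists {n f gm gs gammaM beta1 betas cm bm cp h}.
Arguments f_cont_landscape {f gm gs gammaM beta1 betas cm bm cp h}.
Arguments F_cont_landscape {f gm gs gammaM beta1 betas cm bm cp h}.

Section finite_case.

Variables (n : nat) (f : R -> R) (gm : Rbar) (gs delta : R) (gammaM beta1 betas cm bm cp h : R).
Hypothesis Hn : (1 <= n)%nat.
Hypothesis H1 : assumptions_A1 f gm gs delta.

Lemma top_A1 (s : R) : Rbar_lt gm s -> Rbar_lt s gs ->
  exists t0 : R, Rbar_lt t0 gs /\ forall t : R, t0 < t -> Rbar_lt t gs -> Fint f s < Fint f t.
Proof.
intros Hs Hs2.
assert (A := A1_common _ _ _ _ H1). assert (Hgs := gs_pos _ _ _ _ A).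
destruct (between_below gm 0 (gm_neg _ _ _ _ A)) as (m & Hm & Hm0). simpl in Hgs.
assert (Hsig : m < 0 < gs) by lra.
assert (Hc : continuous (Fint (clampf m gs f)) gs).
{ apply Fint_cont. apply (clampf_cont f gm gs); [apply A|exact Hm|apply Rle_refl|exact Hsig]. }
destruct (continuous_gt _ _ (Fint f s) Hc) as (d & Hd & Hd').
{ rewrite Fint_clampf by lra. apply (A1_F_lt _ _ _ _ H1 s Hs Hs2). }
exists (Rmax 0 (gs - d)). assert (M1 := Rmax_l 0 (gs - d)). assert (M2 := Rmax_r 0 (gs - d)).
split; [apply Rmax_lub_lt; lra|]. intros t Ht Ht2. simpl in Ht2.
specialize (Hd' t ltac:(apply Rabs_def1; lra)). rewrite Fint_clampf in Hd' by lra. exact Hd'.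
Qed.

Lemma bottom_A1 (s : R) : Rbar_lt gm s -> Rbar_lt s gs ->
  exists t0 : R, Rbar_lt gm t0 /\ forall t : R, Rbar_lt gm t -> t < t0 -> Fint f s < Fint f t.
Proof.
intros Hs Hs2. apply from_above_eventually; [apply (A1_common _ _ _ _ H1)|].
apply (A1_F_gm _ _ _ _ H1 (fun y => Fint f s < y)).
assert (Hlt := A1_F_lt _ _ _ _ H1 s Hs Hs2).
assert (Hd : 0 < Fint f gs - Fint f s) by lra. exists (mkposreal _ Hd). intros y Hy.
assert (Hy' : Rabs (y - Fint f gs) < Fint f gs - Fint f s) by exact Hy. apply Rabs_def2 in Hy'. lra.
Qed.

Hypothesis L : landscape f gm gs gammaM beta1 betas cm bm cp h.

(** Close to the rest point [gs] the solutions start as slowly as desired. *)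
Lemma slow_start (bbar R0 : R) : betas < bbar -> bbar < gs -> 0 <= R0 ->
  exists amax, bbar < amax /\ amax < gs /\ forall (m : R) u w, Rbar_lt gm m -> m <= cm -> Fint f amax < Fint f m ->
    sol n (clampf m amax f) amax u w -> forall r, 0 <= r <= R0 -> bbar < u r.
Proof.
intros Hb Hb2 HR.
assert (A := A1_common _ _ _ _ H1).
assert (P0 : 0 < betas).
{ assert (P := ls_b1 L). assert (Q := ls_M L). assert (T := ls_cp L).
  assert (C := ls_central L cm gammaM (ls_cm L) (Rle_refl _) T).
  specialize (C ltac:(simpl; lra)). assert (X := ct_cp C). lra. }
assert (Hdomgs : dom gm gs gs) by (split; [apply (above_gm gm 0); [apply A|lra]|apply Rbar_le_refl]).
destruct (f_lip _ _ _ _ A gs) as (eps & Lc & He & HL); [split; [exact Hdomgs|lra]|].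
destruct (below2 (eps / 2) ((gs - bbar) / 2)) as (eta & Heta & E1 & E2); [lra|lra|].
set (X := (1 + Rmax Lc 0) * R0). assert (HX : 0 <= X).
{ apply Rmult_le_pos; [assert (M := Rmax_r Lc 0); lra|exact HR]. }
set (t := eta / 2 * exp (- X)).
assert (Hex : 0 < exp (- X) <= 1).
{ split; [apply exp_pos|]. rewrite <- exp_0. destruct (Req_dec X 0) as [->|Hne]; [rewrite Ropp_0; lra|].
  left. apply exp_increasing. lra. }
assert (Ht : 0 < t) by pos.
assert (Ht2 : t <= eta / 2).
{ unfold t. assert (eta / 2 * exp (- X) <= eta / 2 * 1) by (apply Rmult_le_compat_l; lra). lra. }
exists (gs - t). split; [lra|]. split; [lra|].
intros m u w Hm Hmcm HFm S r Hr.
assert (Hconf := fun x => confined n L m (gs - t)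
  Hm Hmcm ltac:(lra) ltac:(simpl; lra) HFm (gs - t) u w x S ltac:(lra)).
assert (Hsig := cut_signs L m (gs - t) Hm Hmcm ltac:(lra) ltac:(simpl; lra)).
apply Rlt_trans with (gs - eta); [lra|].
apply (near_top n (clampf m (gs - t) f) (gs - t) u w gs eta (Rmax Lc 0) R0 S); try lra.
- apply Rmax_r.
- intros x. apply Hconf.
- intros s Hs. rewrite clampf_eq by lra.
  assert (Hds : dom gm gs s) by (split; [apply (above_gm gm m); [exact Hm|lra]|simpl; lra]).
  assert (B := HL s gs ltac:(split; [exact Hds|lra]) ltac:(split; [exact Hdomgs|lra])
    ltac:(rewrite Rabs_left1; lra) ltac:(rewrite Rminus_diag, Rabs_R0; exact He)).
  rewrite (A1_f_gs _ _ _ _ H1), Rminus_0_r, (Rabs_left1 (s - gs)) in B by lra.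
  apply Rle_trans with (1 := B). replace (- (s - gs)) with (gs - s) by ring.
  apply Rmult_le_compat_r; [lra|apply Rmax_l].
- replace (gs - (gs - t)) with t by ring. fold X. unfold t.
  assert (EX : exp (- X) * exp X = 1) by (rewrite <- exp_plus, Rplus_opp_l; apply exp_0).
  replace ((eta / 2 * exp (- X)) ^ 2 * exp X) with (eta * eta / 4 * exp (- X) * (exp (- X) * exp X)) by field.
  rewrite EX, Rmult_1_r.
  assert (0 < eta * eta) by pos.
  assert (eta * eta / 4 * exp (- X) <= eta * eta / 4 * 1) by (apply Rmult_le_compat_l; lra). lra.
Qed.

End finite_case.

(** * High energy in the infinite case *)

Section pohozaev.

Variables (n : nat) (g : R -> R) (a : R) (u w : R -> R).
Hypothesis Hg : forall x, continuous g x.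
Hypothesis HS : sol n g a u w.

(** Pohozaev's function; its derivative no longer contains the speed. *)
Definition poho (r : R) : R :=
  r ^ S n * (2 * energy g u w r) + (INR (S n) - 2) * (u r * (r ^ n * w r)).

Lemma poho_derive r : 0 < r -> is_derive poho r (r ^ n * Qfun (S n) g (u r)).
Proof.
intros Hr. eapply is_derive_eq.
- apply dR_plus.
  + apply dR_mult; [apply dR_pow|]. apply dR_scal. apply (energy_derive Hg HS). exact Hr.
  + apply dR_scal, dR_mult; [apply (sol_du HS)|]. apply (sol_flux HS), Hr.
- cbv beta. unfold energy, Qfun. change (pred (S n)) with n. rewrite <- (tech_pow_Rmult r n), S_INR. field. lra.
Qed.

Lemma poho_cont r : continuous poho r.
Proof.
apply cR_plus.
- apply cR_mult; [apply cR_pow|]. apply cR_scal. apply (energy_cont Hg HS).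
- apply cR_scal, cR_mult; [apply (sol_cu HS)|]. apply cR_mult; [apply cR_pow|apply (sol_cw HS)].
Qed.

Lemma poho_0 : poho 0 = 0.
Proof.
unfold poho. destruct (sol_init HS 0 (Rle_refl 0)) as [_ ->]. rewrite (pow_i (S n)) by lia. ring.
Qed.

Lemma poho_lower q r s : 0 <= r <= s -> (forall x, r < x < s -> q <= Qfun (S n) g (u x)) ->
  poho r + q / INR (S n) * (s ^ S n - r ^ S n) <= poho s.
Proof.
intros Hr Hq. assert (HN : 0 < INR (S n)) by (apply lt_0_INR; lia).
assert (A : poho r - q / INR (S n) * r ^ S n <= poho s - q / INR (S n) * s ^ S n).
{ apply (derive_nonneg (fun x => poho x - q / INR (S n) * x ^ S n)
    (fun x => x ^ n * Qfun (S n) g (u x) - q / INR (S n) * (INR (S n) * x ^ n))).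
  - lra.
  - intros x _. apply cR_minus; [apply poho_cont|apply cR_scal, cR_pow].
  - intros x Hx. apply dR_minus; [apply poho_derive; lra|]. apply dR_scal, (dR_pow (S n)).
  - intros x Hx. assert (P : 0 < x ^ n) by (apply pow_lt; lra). specialize (Hq x Hx).
    replace (q / INR (S n) * (INR (S n) * x ^ n)) with (x ^ n * q) by (field; lra).
    assert (x ^ n * q <= x ^ n * Qfun (S n) g (u x)) by (apply Rmult_le_compat_l; lra). lra. }
lra.
Qed.

(** The flux is at most the integral of the force, so [|w| <= fm r / (n + 1)]. *)
Lemma falling_time fm T : 0 <= T -> (forall r, 0 <= r <= T -> 0 <= g (u r) <= fm) ->
  a - u T <= fm / (2 * INR (S n)) * T ^ 2.
Proof.
intros HT Hf. assert (HN : 0 < INR (S n)) by (apply lt_0_INR; lia).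
destruct (sol_init HS 0 (Rle_refl 0)) as [U0 _].
assert (A : u 0 + fm / (2 * INR (S n)) * 0 ^ 2 <= u T + fm / (2 * INR (S n)) * T ^ 2).
{ apply (derive_nonneg (fun r => u r + fm / (2 * INR (S n)) * r ^ 2)
    (fun r => w r + fm / (2 * INR (S n)) * (2 * r * 1))).
  - exact HT.
  - intros x _. apply cR_plus; [apply (sol_cu HS)|apply cR_scal, cR_pow].
  - intros x _. apply dR_plus; [apply (sol_du HS)|apply dR_scal]. apply (dR_sqr (fun r => r)), dR_id.
  - intros x Hx.
    destruct (flux_bounds n g a u w HS (fm / 2) (fm / 2) x) with (r := x) as [B _]; [|lra|].
    { intros y Hy. specialize (Hf y ltac:(lra)). lra. }
    replace (- (fm / 2 + fm / 2)) with (- fm) in B by field.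
    assert (C : - fm / INR (S n) * x <= w x / x * x) by (apply Rmult_le_compat_r; lra).
    replace (w x / x * x) with (w x) in C by (field; lra).
    replace (fm / (2 * INR (S n)) * (2 * x * 1)) with (- (- fm / INR (S n) * x)) by (field; lra). lra. }
rewrite U0 in A. replace (0 ^ 2) with 0 in A by ring. lra.
Qed.

End pohozaev.

Lemma pow_Rpower (x : R) (k : nat) : 0 < x -> x ^ k = Rpower (x ^ 2) (INR k / 2).
Proof.
intros Hx. rewrite <- (Rpower_pow 2 x Hx), Rpower_mult, <- (Rpower_pow k x Hx). f_equal.
simpl INR. field.
Qed.

Section infinite_case.

Variables (n : nat) (f : R -> R) (gm : Rbar) (delta s0 : R) (gammaM beta1 betas cm bm cp h bbar : R).
Hypothesis Hn : (1 <= n)%nat.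
Hypothesis H2 : assumptions_A2 (S n) f gm delta s0.
Hypothesis HQ : forall s : R, dom gm p_infty s -> Fint f bbar < Fint f s -> 0 < Qfun (S n) f s.

(** An infinite infimum is represented by [0], which is excluded by the limit. *)
Lemma Q_force_ratio : exists theta, 0 < theta < 1 /\ forall X, 0 < X -> exists a0, 0 < a0 /\
  forall a, a0 <= a -> forall s1 s2, theta * a <= s1 <= a -> theta * a <= s2 <= a ->
    X < Qfun (S n) f s2 * Rpower (a / f s1) (INR (S n) / 2).
Proof.
destruct (A2_Q_lim _ _ _ _ _ H2) as (theta & Hth & Hlim). exists theta. split; [exact Hth|].
intros X HX. apply is_lim_spec in Hlim. destruct (Hlim X) as (A & HA).
exists (Rmax 1 (A + 1)). assert (M1 := Rmax_l 1 (A + 1)). assert (M2 := Rmax_r 1 (A + 1)).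
split; [lra|]. intros a Ha s1 s2 Hs1 Hs2. specialize (HA a ltac:(lra)).
match type of HA with _ < real (Glb_Rbar ?E) => destruct (Glb_Rbar_correct E) as [Hlb _]; destruct (Glb_Rbar E) as [y| |] end.
- apply Rlt_le_trans with (1 := HA). apply (Hlb (Qfun (S n) f s2 * Rpower (a / f s1) (INR (S n) / 2))).
  exists s1, s2. auto.
- simpl in HA. lra.
- simpl in HA. lra.
Qed.

Variable Lim : Rbar.
Hypothesis HLp : filterlim (Fint f) (Rbar_locally p_infty) (Rbar_locally Lim).
Hypothesis HLm : filterlim (Fint f) (from_above gm) (Rbar_locally Lim).
Hypothesis HLt : forall s : R, dom gm p_infty s -> Rbar_lt (Fint f s) Lim.

Lemma exceeds_right (M : R) : Rbar_lt M Lim -> exists t0 : R, forall t, t0 < t -> M < Fint f t.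
Proof.
intros HM. destruct (HLp (fun y => M < y)) as (t0 & H).
- apply (open_Rbar_gt' Lim M HM).
- exists t0. exact H.
Qed.

Lemma exceeds_left (M : R) : Rbar_lt M Lim -> exists t0 : R, Rbar_lt gm t0 /\
  forall t : R, Rbar_lt gm t -> t < t0 -> M < Fint f t.
Proof.
intros HM. apply from_above_eventually; [apply (A2_common _ _ _ _ _ H2)|].
apply (HLm (fun y => M < y)), (open_Rbar_gt' Lim M HM).
Qed.

Lemma top_A2 (s : R) : Rbar_lt gm s -> Rbar_lt s p_infty ->
  exists t0 : R, Rbar_lt t0 p_infty /\ forall t : R, t0 < t -> Rbar_lt t p_infty -> Fint f s < Fint f t.
Proof.
intros Hs _. destruct (exceeds_right (Fint f s)) as (t0 & Ht).
- apply HLt. split; [exact Hs|exact I].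
- exists t0. split; [exact I|]. intros t H _. apply Ht, H.
Qed.

Lemma bottom_A2 (s : R) : Rbar_lt gm s -> Rbar_lt s p_infty ->
  exists t0 : R, Rbar_lt gm t0 /\ forall t : R, Rbar_lt gm t -> t < t0 -> Fint f s < Fint f t.
Proof. intros Hs _. apply exceeds_left, HLt. split; [exact Hs|exact I]. Qed.

Hypothesis L : landscape f gm p_infty gammaM beta1 betas cm bm cp h.
Hypothesis Hbb : betas < bbar.

Lemma pos_points : 0 < beta1 /\ beta1 < gammaM /\ gammaM < betas.
Proof.
assert (P := ls_b1 L). assert (Q := ls_M L). assert (T := ls_cp L).
assert (C := ls_central L cm gammaM (ls_cm L) (Rle_refl _) T Logic.I).
assert (X := ct_cp C). lra.
Qed.

Lemma F_increasing_above (s t : R) : betas <= s -> s < t -> Fint f s < Fint f t.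
Proof.
intros Hs Hst. assert (P := pos_points).
assert (Hg : forall x, 0 <= x -> Rbar_lt gm x) by (intros x Hx; apply (above_gm gm 0); [apply L|exact Hx]).
destruct (mean_value (Fint f) f s t Hst) as (x & Hx & E).
- intros x Hx. apply (F_derive_inside f gm p_infty); [apply L|apply L|exact I|apply Hg; lra|exact I].
- assert (A := ls_f L x ltac:(lra) Logic.I).
  assert (0 < f x * (t - s)) by (apply Rmult_lt_0_compat; lra). lra.
Qed.

Lemma Q_cont (s : R) : Rbar_lt gm s -> continuous (Qfun (S n) f) s.
Proof.
intros Hs. apply cR_minus.
- apply cR_scal. apply (F_cont_landscape L); [exact Hs|exact I].
- apply cR_mult; [apply cR_scal, continuous_id|].
  apply (f_cont_landscape L); [exact Hs|exact I].
Qed.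

Lemma Q_bounded_below : exists B, 0 <= B /\ forall s : R, Rbar_lt gm s -> - B <= Qfun (S n) f s.
Proof.
destruct (A2_s0 _ _ _ _ _ H2) as [Hs0 Hs0']. assert (P := pos_points).
destruct (cont_min (Qfun (S n) f) s0 bbar) as (x & Hx & Hmin); [lra| |].
- intros s Hs. apply Q_cont. apply (above_gm gm s0); [exact Hs0|lra].
- exists (Rmax 0 (- Qfun (S n) f x)).
  assert (M1 := Rmax_l 0 (- Qfun (S n) f x)). assert (M2 := Rmax_r 0 (- Qfun (S n) f x)).
  split; [exact M1|]. intros s Hs.
  destruct (Rlt_dec s s0) as [H|H].
  + assert (A := A2_Q_pos _ _ _ _ _ H2 s Hs H). lra.
  + destruct (Rle_dec s bbar) as [H'|H']; [specialize (Hmin s ltac:(lra)); lra|].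
    assert (A := HQ s ltac:(split; [exact Hs|exact Logic.I]) (F_increasing_above bbar s ltac:(lra) ltac:(lra))). lra.
Qed.

(** Down to [theta * amax] the energy is large because [F] is.  The time needed for this part of
    the descent is at least of the order of [sqrt (amax / max f)], so Pohozaev's function is
    huge at its end; later it decreases by a bounded amount, because [Q] is bounded below.  At
    low energy both [u] and [w] would be bounded, and with them this function. *)
Lemma high_energy (M R0 : R) : Rbar_lt M Lim -> 0 < M -> 0 < R0 ->
  exists a0, bbar < a0 /\ forall amax (m : R) u w, a0 <= amax ->
    Rbar_lt gm m -> m <= cm -> Fint f amax < Fint f m ->
    sol n (clampf m amax f) amax u w -> M <= energy (clampf m amax f) u w R0.
Proof.
intros HM HM0 HR.
assert (HN : 2 <= INR (S n)) by (apply (le_INR 2); lia).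
destruct Q_force_ratio as (theta & Hth & Hratio).
destruct Q_bounded_below as (B & HB0 & HB).
assert (P := pos_points).
destruct (exceeds_right M HM) as (K2 & HK2).
destruct (exceeds_left M HM) as (K1 & HK1 & HK1').
set (k1 := Rmin K1 0). set (k2 := Rmax K2 0).
assert (A1 : k1 <= K1) by apply Rmin_l. assert (A2 : k1 <= 0) by apply Rmin_r.
assert (A3 : K2 <= k2) by apply Rmax_l. assert (A4 : 0 <= k2) by apply Rmax_r.
assert (Hk1 : Rbar_lt gm k1).
{ unfold k1, Rmin. destruct (Rle_dec K1 0); [exact HK1|apply L]. }
destruct (cont_min (Fint f) k1 k2) as (x0 & Hx0 & Hmin); [lra| |].
{ intros s Hs. apply (F_cont_landscape L);
    [apply (above_gm gm k1); [exact Hk1|lra]|exact I]. }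
set (D := Rmax 0 (- Fint f x0)).
assert (D1 : 0 <= D) by apply Rmax_l. assert (D2 : - Fint f x0 <= D) by apply Rmax_r.
set (V := sqrt (2 * (M + D))).
assert (HV : 0 <= V) by apply sqrt_pos.
assert (HV2 : V * V = 2 * (M + D)) by (apply sqrt_sqrt; lra).
set (K := k2 - k1). assert (HK : 0 <= K) by (unfold K; lra).
set (Lam := R0 ^ S n * (2 * M) + (INR (S n) - 2) * (K * (R0 ^ n * V)) + B / INR (S n) * R0 ^ S n).
assert (PR : 0 < R0 ^ S n) by (apply pow_lt, HR). assert (PRn : 0 < R0 ^ n) by (apply pow_lt, HR).
assert (HBN : 0 <= B / INR (S n)) by (apply Rmult_le_pos; [exact HB0|left; apply Rinv_0_lt_compat; lra]).
assert (HLam : 0 < Lam).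
{ unfold Lam. assert (0 < R0 ^ S n * (2 * M)) by (apply Rmult_lt_0_compat; lra).
  assert (0 <= (INR (S n) - 2) * (K * (R0 ^ n * V))).
  { apply Rmult_le_pos; [lra|]. apply Rmult_le_pos; [exact HK|]. apply Rmult_le_pos; lra. }
  assert (0 <= B / INR (S n) * R0 ^ S n) by (apply Rmult_le_pos; lra). lra. }
set (c := 2 * INR (S n) * (1 - theta)).
assert (Hc : 0 < c) by (apply Rmult_lt_0_compat; lra).
assert (Hcp : 0 < Rpower c (INR (S n) / 2)) by apply exp_pos.
set (X := Lam * INR (S n) / Rpower c (INR (S n) / 2)).
assert (HX : 0 < X) by pos.
destruct (Hratio X HX) as (a1 & Ha1 & Hrat).
max_of bt (bbar + 1) (k2 + 1) as B1 B2. clearbody bt.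
max_of a0 a1 (bt / theta) as B3 B4. clearbody a0.
assert (B5 : bt <= bt / theta).
{ apply Rmult_le_reg_r with theta; [lra|]. replace (bt / theta * theta) with bt by (field; lra).
  assert (bt * theta <= bt * 1) by (apply Rmult_le_compat_l; lra). lra. }
exists a0. split; [lra|].
intros amax m u w Ham Hm Hmcm HFm S.
assert (Hbt : bt <= theta * amax).
{ apply Rle_trans with (theta * (bt / theta)); [right; field; lra|]. apply Rmult_le_compat_l; lra. }
assert (Hthm : theta * amax < amax).
{ assert (theta * amax < 1 * amax) by (apply Rmult_lt_compat_r; lra). lra. }
assert (Hba : betas < amax) by lra.
assert (Hconf := fun x => confined n L m amax
  Hm Hmcm Hba Logic.I HFm amax u w x S ltac:(lra)).
assert (Hsig := cut_signs L m amax Hm Hmcm Hba Logic.I).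
assert (Hcont := cut_cont L m amax Hm Hmcm Hba Logic.I).
assert (HF := cut_F L m amax Hm Hmcm Hba Logic.I).
set (g := clampf m amax f) in *.
assert (HgQ : forall x, Qfun (Datatypes.S n) g (u x) = Qfun (Datatypes.S n) f (u x)).
{ intros x. destruct (Hconf x). unfold Qfun. rewrite HF by lra. unfold g. rewrite clampf_eq by lra. reflexivity. }
apply Rnot_lt_le. intros HE.
assert (HFu := F_le_energy g u w R0). rewrite HF in HFu by (destruct (Hconf R0); lra).
assert (Hgmu : Rbar_lt gm (u R0)) by (apply (above_gm gm m); [exact Hm|destruct (Hconf R0); lra]).
assert (Huk : k1 <= u R0 <= k2).
{ split.
  - apply Rnot_lt_le. intros Hl. specialize (HK1' (u R0) Hgmu ltac:(lra)). lra.
  - apply Rnot_lt_le. intros Hl. specialize (HK2 (u R0) ltac:(lra)). lra. }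
destruct (sol_init S 0 (Rle_refl 0)) as [U0 _].
destruct (first_le u 0 R0 (theta * amax)) as (rt & Hrt & Ert & Hbef); [lra|intros; apply (sol_cu S)|lra|lra|].
assert (Hin : forall r, 0 <= r <= rt -> theta * amax <= u r <= amax).
{ intros r Hr. split; [|apply Hconf]. destruct (Req_dec r rt) as [->|Hne]; [lra|]. left. apply Hbef. lra. }
destruct (cont_max f (theta * amax) amax) as (s1 & Hs1 & Hmax); [lra| |].
{ intros s Hs. apply (f_cont_landscape L);
    [apply (above_gm gm 0); [apply L|lra]|exact I]. }
destruct (cont_min (Qfun (Datatypes.S n) f) (theta * amax) amax) as (s2 & Hs2 & Hqmin); [lra| |].
{ intros s Hs. apply Q_cont. apply (above_gm gm 0); [apply L|lra]. }
assert (Hr := Hrat amax ltac:(lra) s1 s2 Hs1 Hs2).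
assert (Hf1 : 0 < f s1) by (apply (ls_f L); [lra|exact I]).
assert (Hft := falling_time n g amax u w S (f s1) rt ltac:(lra)
  ltac:(intros r Hr'; specialize (Hin r Hr'); unfold g; rewrite clampf_eq by lra;
        split; [left; apply (ls_f L); [lra|exact Logic.I]|apply Hmax, Hin])).
rewrite Ert in Hft.
assert (Hsq : c * (amax / f s1) <= rt ^ 2).
{ apply Rmult_le_reg_l with (f s1 / (2 * INR (Datatypes.S n))); [pos|].
  apply Rle_trans with (2 := Hft). right. unfold c. field. lra. }
assert (Hy : 0 < amax / f s1) by pos.
assert (Hpow : Rpower c (INR (Datatypes.S n) / 2) * Rpower (amax / f s1) (INR (Datatypes.S n) / 2) <= rt ^ Datatypes.S n).
{ rewrite Rpower_mult_distr by assumption. rewrite (pow_Rpower rt) by lra.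
  apply Rle_Rpower_l; [|split; [apply Rmult_lt_0_compat; assumption|exact Hsq]]. lra. }
assert (Hq : 0 < Qfun (Datatypes.S n) f s2).
{ apply Rnot_le_lt. intros Hl.
  assert (0 < Rpower (amax / f s1) (INR (Datatypes.S n) / 2)) by apply exp_pos.
  assert (0 <= - Qfun (Datatypes.S n) f s2 * Rpower (amax / f s1) (INR (Datatypes.S n) / 2)) by pos. lra. }
assert (HP1 : Lam < poho n g u w rt).
{ assert (A := poho_lower n g amax u w Hcont S (Qfun (Datatypes.S n) f s2) 0 rt ltac:(lra)
    ltac:(intros x Hx; rewrite HgQ; apply Hqmin, Hin; lra)).
  rewrite (poho_0 n g amax u w S), pow_i, Rminus_0_r, Rplus_0_l in A by lia.
  apply Rlt_le_trans with (2 := A).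
  set (q := Qfun (Datatypes.S n) f s2) in *. set (rp := Rpower (amax / f s1) (INR (Datatypes.S n) / 2)) in *.
  set (pc := Rpower c (INR (Datatypes.S n) / 2)) in *.
  assert (Hqn : 0 < q / INR (Datatypes.S n)) by pos.
  apply Rlt_le_trans with (q / INR (Datatypes.S n) * (pc * rp)).
  - apply Rmult_lt_reg_l with (INR (Datatypes.S n) / pc); [pos|].
    replace (INR (Datatypes.S n) / pc * Lam) with X by (unfold X; field; lra).
    replace (INR (Datatypes.S n) / pc * (q / INR (Datatypes.S n) * (pc * rp))) with (q * rp) by (field; lra). exact Hr.
  - apply Rmult_le_compat_l; lra. }
assert (HP2 := poho_lower n g amax u w Hcont S (- B) rt R0 ltac:(lra)
  ltac:(intros x Hx; rewrite HgQ; apply HB, (above_gm gm m); [exact Hm|destruct (Hconf x); lra])).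
assert (HP3 : - B / INR (Datatypes.S n) * (R0 ^ Datatypes.S n - rt ^ Datatypes.S n) >= - (B / INR (Datatypes.S n) * R0 ^ Datatypes.S n)).
{ assert (0 <= B / INR (Datatypes.S n) * rt ^ Datatypes.S n) by pos.
  replace (- B / INR (Datatypes.S n)) with (- (B / INR (Datatypes.S n))) by (field; lra). lra. }
assert (Hw : Rabs (w R0) <= V).
{ apply abs_le_sqr; [exact HV|]. rewrite HV2. unfold energy in HE.
  rewrite HF in HE by (destruct (Hconf R0); lra). specialize (Hmin (u R0) Huk). lra. }
assert (Hu : Rabs (u R0) <= K) by (unfold K; apply Rabs_le; lra).
assert (HP4 : poho n g u w R0 <= R0 ^ Datatypes.S n * (2 * M) + (INR (Datatypes.S n) - 2) * (K * (R0 ^ n * V))).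
{ unfold poho. apply Rplus_le_compat.
  - apply Rmult_le_compat_l; lra.
  - apply Rmult_le_compat_l; [lra|]. apply Rle_trans with (1 := Rle_abs _). rewrite Rabs_mult.
    apply Rmult_le_compat; try apply Rabs_pos; [exact Hu|].
    rewrite Rabs_mult, (Rabs_pos_eq (R0 ^ n)) by lra. apply Rmult_le_compat_l; lra. }
unfold Lam in HP1. lra.
Qed.

End infinite_case.

(** * The theorem *)

Lemma leaves_with_energy n g a u w cm bm bp cp h M rk R0 : central g cm bm bp cp h -> sol n g a u w ->
  h < M -> rk + (cp - cm) / sqrt (2 * (M - h)) < R0 -> M <= energy g u w R0 ->
  exists r, rk <= r /\ ~ cm <= u r <= cp.
Proof.
intros C S HM HR HE. apply NNPP. intros Hno.
assert (Hin : forall r, rk <= r -> cm <= u r <= cp).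
{ intros r Hr. apply NNPP. intros H. apply Hno. eauto. }
assert (C1 := ct_cm C). assert (C2 := ct_bm C). assert (C3 := ct_bp C). assert (C4 := ct_cp C).
set (v := sqrt (2 * (M - h))) in *.
assert (Hv : 0 < v) by pos.
assert (Hv2 : v * v = 2 * (M - h)) by (apply sqrt_sqrt; lra).
assert (Hq : 0 < (cp - cm) / v) by pos.
destruct (mean_value u w rk R0) as (x & Hx & E); [lra|intros; apply (sol_du S)|].
assert (Hux := Hin x ltac:(lra)).
assert (HFx : Fint g (u x) <= h).
{ destruct (Req_dec (u x) cm) as [->|H1]; [rewrite (ct_Fcm C); lra|].
  destruct (Req_dec (u x) cp) as [->|H2]; [rewrite (ct_Fcp C); lra|].
  left. apply (F_lt_h g cm bm bp cp h (u x) C). lra. }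
assert (HEx := energy_noninc (ct_cont C) S x R0 ltac:(lra)).
assert (Hw : v <= Rabs (w x)).
{ apply Rnot_lt_le. intros Hl. unfold energy at 2 in HEx.
  assert (A := abs_sqr (w x)). assert (B := Rabs_pos (w x)).
  assert (Rabs (w x) * Rabs (w x) < v * v) by (apply Rmult_le_0_lt_compat; lra).
  replace (w x ^ 2) with (w x * w x) in HEx by ring. lra. }
assert (A1 := Hin rk ltac:(lra)). assert (A2 := Hin R0 ltac:(lra)).
assert (A3 : Rabs (u R0 - u rk) <= cp - cm) by (apply Rabs_le; lra).
rewrite E, Rabs_mult, (Rabs_pos_eq (R0 - rk)) in A3 by lra.
assert (v * ((cp - cm) / v) = cp - cm) by (field; lra).
assert (v * ((cp - cm) / v) < v * (R0 - rk)) by (apply Rmult_lt_compat_l; lra).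
assert (v * (R0 - rk) <= Rabs (w x) * (R0 - rk)) by (apply Rmult_le_compat_r; lra). lra.
Qed.

(** A bounded speed needs a long time to cross a long interval. *)
Lemma far_away n g a u w bb E0 C : (forall x, continuous g x) -> sol n g a u w -> 0 <= C -> 0 <= E0 ->
  Fint g a <= E0 -> bb + sqrt (2 * E0) * C < a -> (forall s, bb <= s <= a -> 0 <= Fint g s) ->
  (forall r, u r <= a) -> forall r, 0 <= r <= C -> bb <= u r.
Proof.
intros Hg S HC HE0 HFa Ha HF Hu r Hr. apply Rnot_lt_le. intros Hl.
assert (Hs := sqrt_pos (2 * E0)).
assert (Hs2 : sqrt (2 * E0) * sqrt (2 * E0) = 2 * E0) by (apply sqrt_sqrt; lra).
assert (Hsc : 0 <= sqrt (2 * E0) * C) by pos.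
destruct (sol_init S 0 (Rle_refl 0)) as [U0 _].
destruct (first_le u 0 r bb) as (t & Ht & Et & Hbef); [lra|intros; apply (sol_cu S)|lra|lra|].
destruct (mean_value u w 0 t) as (x & Hx & E); [lra|intros; apply (sol_du S)|].
assert (Hux : bb <= u x).
{ destruct (Req_dec x t) as [->|Hne]; [lra|]. left. apply Hbef. lra. }
assert (A := energy_le_init Hg S x). unfold energy in A.
assert (B := HF (u x) ltac:(split; [exact Hux|apply Hu])).
assert (Hw : Rabs (w x) <= sqrt (2 * E0)) by (apply abs_le_sqr; [exact Hs|lra]).
apply Rabs_le_between in Hw.
assert (- w x * t <= sqrt (2 * E0) * t) by (apply Rmult_le_compat_r; lra).
assert (sqrt (2 * E0) * t <= sqrt (2 * E0) * C) by (apply Rmult_le_compat_l; lra).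
rewrite Rminus_0_r, U0, Et in E. lra.
Qed.

Section assembly.

Variables (n : nat) (f : R -> R) (gm gs : Rbar) (gammaM beta1 betas cm bm cp h bbar : R).
Hypothesis Hn : (1 <= n)%nat.
Hypothesis L : landscape f gm gs gammaM beta1 betas cm bm cp h.
Hypothesis Hbb : betas < bbar.
Hypothesis Hbb2 : Rbar_lt bbar gs.

Notation F := (Fint f).

Lemma order_points : 0 < beta1 /\ beta1 < cp /\ cp <= gammaM /\ gammaM < betas /\ cm < cp.
Proof.
assert (P := ls_b1 L). assert (Q := ls_M L). assert (T := ls_cp L).
assert (C := ls_central L cm gammaM (ls_cm L) (Rle_refl _) T
  (Rbar_lt_le _ _ (below_gs gs gammaM betas (ls_bs L) (Rlt_le _ _ Q)))).
assert (X := ct_cp C). assert (Y := ct_bm C). assert (Z := ct_cm C). lra.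
Qed.

Lemma nonneg_dom (x : R) : 0 <= x -> Rbar_lt gm x.
Proof. intros Hx. apply (above_gm gm 0); [apply L|exact Hx]. Qed.

Lemma min_f : 0 < inf_on f betas bbar /\ forall s, betas <= s <= bbar -> inf_on f betas bbar <= f s.
Proof.
assert (P := order_points).
destruct (inf_on_attained f betas bbar) as (x & Hx & -> & Hmin); [lra| |].
- intros s Hs. apply (f_cont_landscape L);
    [apply nonneg_dom; lra|apply (below_gs gs s bbar Hbb2); lra].
- split; [|exact Hmin]. apply (ls_f L); [lra|apply (below_gs gs x bbar Hbb2); lra].
Qed.

Lemma min_F a b : 0 <= a <= b -> b <= betas -> forall s, a <= s <= b -> inf_on F a b <= F s.
Proof.
intros Ha Hb. destruct (inf_on_attained F a b) as (x & Hx & -> & Hmin); [lra| |exact Hmin].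
intros s Hs. apply (F_cont_landscape L);
  [apply nonneg_dom; lra|apply (below_gs gs s bbar Hbb2); lra].
Qed.

Lemma Cbar_eq : Cbar (S n) f gammaM beta1 betas bbar =
  2 * INR n * ((bbar - beta1) / (F bbar - F gammaM)) * sqrt (2 * (F bbar - inf_on F beta1 betas)).
Proof. unfold Cbar. rewrite S_INR. replace (INR n + 1 - 1) with (INR n) by ring. reflexivity. Qed.

Lemma F_pos_level : 0 < F gammaM.
Proof.
assert (P := order_points). assert (Q := ls_h L).
assert (C := ls_central L cm gammaM (ls_cm L) (Rle_refl _) ltac:(lra)
  (Rbar_lt_le _ _ (below_gs gs gammaM betas (ls_bs L) ltac:(lra)))).
assert (X := ct_h C). lra.
Qed.

Variables (A I : R).
Notation Cb := (Cbar (S n) f gammaM beta1 betas bbar).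
Hypothesis HI : 0 < I.
Hypothesis Hcross : (Cb + A) * I < sqrt 2 * (INR (S n) - 1) / sqrt (I + Fbar f beta1) *
    RInt (fun s => Rabs (F s)) 0 beta1.

Definition two_sol (k : nat) : Prop := exists u v : R -> R,
    (is_solution (S n) f gm gs u /\ betas < u 0 /\ Rbar_lt (u 0) gs /\ exactly_sign_changes u k) /\
    (is_solution (S n) f gm gs v /\ betas < v 0 /\ Rbar_lt (v 0) gs /\ exactly_sign_changes v k) /\
    exists r, 0 <= r /\ u r <> v r.

Lemma two_solutions_from_well (k : nat) (m amax sp rk : R) (U W : R -> R -> R) :
  Rbar_lt gm m -> m <= cm -> bbar <= amax -> Rbar_lt amax gs -> F amax < F m ->
  (forall a, a <> 0 -> sol n (clampf m amax f) a (U a) (W a) /\ rests (U a) (W a)) ->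
  0 < sp -> (forall s, cm <= s <= cp -> 2 * (h - F s) <= sp * sp) ->
  0 < rk -> INR (S k) * (2 * (INR n / rk * sp * (cp - cm))) <= h / 4 ->
  (exists r, rk <= r /\ ~ cm <= U amax r <= cp) ->
  (exists a T, betas <= a <= amax /\ 0 < T <= Cb + A /\ (forall r, 0 <= r <= T -> beta1 <= U a r) /\
    U a T = beta1 /\ energy (clampf m amax f) (U a) (W a) T <= I) ->
  two_sol k.
Proof.
intros Hm Hmcm Ham Ham2 HFm HU Hsp Hspb Hrk Hrkb Hesc (a & T & Ha & HT & Hab & ET & HE).
assert (P := order_points).
assert (Hba : betas < amax) by lra.
assert (Hspb' : forall s, cm <= s <= cp -> 2 * (h - Fint (clampf m amax f) s) <= sp * sp).
{ intros s Hs.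
  rewrite (cut_F L m amax Hm Hmcm Hba Ham2) by lra. apply Hspb, Hs. }
destruct (bottom Hn L m amax Hm Hmcm Hba Ham2 U W HU sp rk k a T (Cb + A) I (Fbar f beta1)
  Hsp Hspb' Hrk Hrkb Ha HT Hab ET HE HI) as [N1 N2].
- intros s Hs. unfold Fbar. rewrite Ropp_involutive. apply min_F; lra.
- replace (INR n) with (INR (S n) - 1) by (rewrite S_INR; ring). exact Hcross.
- apply (two_solutions Hn L m amax Hm Hmcm Hba Ham2 HFm U W HU sp rk k a); auto.
  right. exact Hesc.
Qed.

End assembly.
Arguments two_solutions_from_well {n f gm gs gammaM beta1 betas cm bm cp h bbar}.
Arguments min_F {f gm gs gammaM beta1 betas cm bm cp h bbar}.
Arguments min_f {f gm gs gammaM beta1 betas cm bm cp h bbar}.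
Arguments nonneg_dom {f gm gs gammaM beta1 betas cm bm cp h}.
Arguments F_pos_level {f gm gs gammaM beta1 betas cm bm cp h}.
Arguments order_points {f gm gs gammaM beta1 betas cm bm cp h}.

Lemma two_solutions_finite n f gm gs delta gammaM beta1 betas cm bm cp h bbar :
  (1 <= n)%nat -> assumptions_A1 f gm gs delta -> landscape f gm gs gammaM beta1 betas cm bm cp h ->
  betas < bbar -> bbar < gs ->
  (Cbar (S n) f gammaM beta1 betas bbar + A_fin (S n) f gammaM beta1 betas bbar) * Fint f gs <
    sqrt 2 * (INR (S n) - 1) / sqrt (Fint f gs + Fbar f beta1) * RInt (fun s => Rabs (Fint f s)) 0 beta1 ->
  forall k, two_sol n f gm gs betas k.
Proof.
intros Hn H1 L Hbb Hbb2 Hcross k.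
assert (P := order_points L).
assert (HF0 := F_pos_level L).
assert (Hdom := nonneg_dom L).
assert (HI : 0 < Fint f gs).
{ assert (A := A1_F_lt _ _ _ _ H1 gammaM (Hdom gammaM ltac:(lra)) ltac:(lra)). lra. }
destruct (late_exists Hn L k) as (sp & rk & Hsp & Hrk & Hspb & Hrkb).
destruct (min_f L Hbb Hbb2) as [Hmf Hmf2].
assert (HGm := min_F L Hbb Hbb2 beta1 betas ltac:(lra) (Rle_refl _)).
assert (HC := Cbar_eq n f gammaM beta1 betas bbar).
set (C := Cbar (S n) f gammaM beta1 betas bbar) in *.
max_of R0 C rk as M1 M2. clearbody R0.
destruct (slow_start n f gm gs delta gammaM beta1 betas cm bm cp h H1 L bbar R0 Hbb Hbb2 ltac:(lra)) as (amax & Ham & Ham2 & Hslow).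
destruct (cutoff_exists L amax ltac:(lra) Ham2) as (m & Hm & Hmcm & HFm).
assert (Hsig := cut_signs L m amax Hm Hmcm ltac:(lra) Ham2).
destruct (solution_family f gm gs m amax) with (n := n) as (U & W & HU); [apply L|apply L|exact Hm|apply Rbar_lt_le, Ham2|exact Hsig|].
assert (Hstart := Hslow m _ _ Hm Hmcm HFm (proj1 (HU amax ltac:(lra)))).
destruct (reaches_well Hn L m amax bbar Hm Hmcm Hbb ltac:(lra) Ham2 U W HU
  (inf_on f betas bbar) (inf_on (Fint f) beta1 betas) C Hmf Hmf2 HGm HC) as (a & T & Ha & HT & Hab & ET).
{ intros r Hr. left. apply Hstart. lra. }
apply (two_solutions_from_well Hn L Hbb Hbb2
  (A_fin (S n) f gammaM beta1 betas bbar) (Fint f gs) HI Hcross k m amax sp rk U W); auto; try lra.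
- exists rk. split; [lra|]. specialize (Hstart rk ltac:(lra)). lra.
- exists a, T. repeat (split; [assumption|]).
  destruct (HU a ltac:(lra)) as [S _].
  assert (Hcont := cut_cont L m amax Hm Hmcm ltac:(lra) Ham2).
  apply Rle_trans with (1 := energy_le_init Hcont S T).
  rewrite Fint_clampf by lra. left. apply (A1_F_lt _ _ _ _ H1); [apply Hdom; lra|lra].
Qed.

(** All other terms of the constant are nonnegative, as the supremum of [Q] is taken over an
    interval that meets the one of the infimum. *)
Lemma Ibar_large n f gm delta s0 gammaM beta1 betas cm bm cp h bbar C :
  (1 <= n)%nat -> assumptions_A2 (S n) f gm delta s0 -> landscape f gm p_infty gammaM beta1 betas cm bm cp h ->
  betas < bbar -> 0 < C -> 0 <= Fint f bbar ->
  Fint f bbar + (bbar - beta1) ^ 2 / 2 <= Ibar_inf (S n) f beta1 bbar C s0.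
Proof.
intros Hn H2 L Hbb HC HF0. assert (P := order_points L).
assert (HQc := Q_cont n f gm gammaM beta1 betas cm bm cp h L).
destruct (A2_s0 _ _ _ _ _ H2) as [Hs0 Hs0'].
assert (HQ : 0 <= sup_on (Qfun (S n) f) beta1 bbar - inf_on (Qfun (S n) f) s0 bbar).
{ destruct (inf_on_attained (Qfun (S n) f) s0 bbar) as (x & Hx & -> & Hmin); [lra| |].
  { intros s Hs. apply HQc, (above_gm gm s0); [exact Hs0|lra]. }
  destruct (sup_on_attained (Qfun (S n) f) beta1 bbar) as (y & Hy & -> & Hmax); [lra| |].
  { intros s Hs. apply HQc, (above_gm gm s0); [exact Hs0|lra]. }
  specialize (Hmin beta1 ltac:(lra)). specialize (Hmax beta1 ltac:(lra)). lra. }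
unfold Ibar_inf. assert (HN : 0 < INR (S n)) by pos.
assert (HQ' : 0 <= 1 / INR (S n) * (sup_on (Qfun (S n) f) beta1 bbar - inf_on (Qfun (S n) f) s0 bbar)) by pos.
set (Qt := 1 / INR (S n) * (sup_on (Qfun (S n) f) beta1 bbar - inf_on (Qfun (S n) f) s0 bbar)) in *.
assert (Hp : 1 <= ((C + 1) / C) ^ S n).
{ apply pow_R1_Rle. replace ((C + 1) / C) with (1 + / C) by (field; lra).
  assert (0 < / C) by pos. lra. }
assert (Hsq := pow2_ge_0 (bbar - beta1)).
assert (Hlast : 0 <= (INR (S n) - 2) ^ 2 * bbar ^ 2 / (2 * C ^ 2)) by pos.
assert (1 * (2 * Fint f bbar + (bbar - beta1) ^ 2 + Qt) <= ((C + 1) / C) ^ S n * (2 * Fint f bbar + (bbar - beta1) ^ 2 + Qt)).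
{ apply Rmult_le_compat_r; [lra|exact Hp]. }
lra.
Qed.

Lemma two_solutions_infinite n f gm delta s0 gammaM beta1 betas cm bm cp h bbar Lim :
  (1 <= n)%nat -> assumptions_A2 (S n) f gm delta s0 ->
  filterlim (Fint f) (Rbar_locally p_infty) (Rbar_locally Lim) ->
  filterlim (Fint f) (from_above gm) (Rbar_locally Lim) ->
  (forall s : R, dom gm p_infty s -> Rbar_lt (Fint f s) Lim) ->
  landscape f gm p_infty gammaM beta1 betas cm bm cp h ->
  betas < bbar ->
  (forall s : R, dom gm p_infty s -> Fint f bbar < Fint f s -> 0 < Qfun (S n) f s) ->
  (Cbar (S n) f gammaM beta1 betas bbar + Rmax 1 (A_fin (S n) f gammaM beta1 betas bbar)) *
    Ibar_inf (S n) f beta1 bbar (Cbar (S n) f gammaM beta1 betas bbar) s0 <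
    sqrt 2 * (INR (S n) - 1) / sqrt (Ibar_inf (S n) f beta1 bbar (Cbar (S n) f gammaM beta1 betas bbar) s0 + Fbar f beta1) *
    RInt (fun s => Rabs (Fint f s)) 0 beta1 ->
  forall k, two_sol n f gm p_infty betas k.
Proof.
intros Hn H2 HLp HLm HLt L Hbb HQ Hcross k.
assert (P := order_points L).
assert (HF0 := F_pos_level L).
assert (Hdom := nonneg_dom L).
assert (Hinc := F_increasing_above f gm gammaM beta1 betas cm bm cp h L).
assert (Hbb2 : Rbar_lt bbar p_infty) by exact Logic.I.
assert (HFb : Fint f gammaM < Fint f bbar).
{ rewrite <- (ls_Fbs L). apply Hinc; lra. }
assert (Hh := ls_h L).
destruct (late_exists Hn L k) as (sp & rk & Hsp & Hrk & Hspb & Hrkb).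
destruct (min_f L Hbb Hbb2) as [Hmf Hmf2].
assert (HGm := min_F L Hbb Hbb2 beta1 betas ltac:(lra) (Rle_refl _)).
assert (HC := Cbar_eq n f gammaM beta1 betas bbar).
set (C := Cbar (S n) f gammaM beta1 betas bbar) in *.
assert (C0 : 0 < C).
{ rewrite HC. specialize (HGm gammaM ltac:(lra)). apply Rmult_lt_0_compat; [|pos].
  apply Rmult_lt_0_compat; [assert (0 < INR n) by pos; lra|]. apply Rdiv_lt_0_compat; lra. }
assert (HIb := Ibar_large n f gm delta s0 gammaM beta1 betas cm bm cp h bbar C Hn H2 L Hbb C0 ltac:(lra)).
assert (Hsq := pow2_ge_0 (bbar - beta1)).
(* If F tends to infinity, an energy level too high for a slow passage; otherwise the speed is
   bounded, and u stays above bbar up to the time C if it starts high enough. *)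
assert (HM : exists M R1 : R, Rbar_lt M Lim /\ Fint f bbar <= M /\ forall amax m : R, R1 <= amax -> bbar <= amax ->
  Rbar_lt gm m -> m <= cm -> Fint f amax < Fint f m ->
  Fint f bbar + (bbar - beta1) ^ 2 / 2 < M \/
  (forall u w, sol n (clampf m amax f) amax u w -> forall r, 0 <= r <= C -> bbar <= u r)).
{ assert (HLb : Rbar_lt (Fint f bbar) Lim) by (apply HLt; split; [apply Hdom; lra|exact Logic.I]).
  destruct Lim as [l| |].
  - exists (Fint f bbar), (bbar + sqrt (2 * l) * C + 1). split; [exact HLb|]. split; [lra|].
    intros amax m Ham Ham2 Hm Hmcm HFm. right. intros u w S.
    assert (Hba : betas < amax) by lra.
    assert (Hsig := cut_signs L m amax Hm Hmcm Hba Logic.I).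
    assert (Hl := HLt amax ltac:(split; [apply Hdom; lra|exact Logic.I])). simpl in Hl, HLb.
    apply (far_away n (clampf m amax f) amax u w bbar l C); try lra.
    + apply (cut_cont L m amax Hm Hmcm Hba Logic.I).
    + exact S.
    + rewrite Fint_clampf by lra. lra.
    + intros s Hs. rewrite Fint_clampf by lra. destruct (Req_dec s bbar) as [->|Hne]; [lra|].
      assert (X := Hinc bbar s ltac:(lra) ltac:(lra)). lra.
    + intros r. apply (confined n L m amax Hm Hmcm Hba Logic.I HFm amax u w r S). lra.
  - exists (Fint f bbar + (bbar - beta1) ^ 2 / 2 + 1), 0. split; [exact Logic.I|]. split; [lra|]. intros. left. lra.
  - destruct HLb. }
destruct HM as (M & R1 & HML & HMb & HMalt).
set (q := (cp - cm) / sqrt (2 * (M - h))).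
assert (Hq : 0 < q) by pos.
set (R0 := rk + q + C + 1).
destruct (high_energy n f gm delta s0 gammaM beta1 betas cm bm cp h bbar Hn H2 HQ Lim HLp HLm L Hbb M R0 HML ltac:(lra) ltac:(unfold R0; lra))
  as (a0 & Ha0 & Hhigh).
max_of amax a0 R1 as M1 M2. clearbody amax.
destruct (cutoff_exists L amax ltac:(lra) Logic.I) as (m & Hm & Hmcm & HFm).
assert (Hba : betas < amax) by lra.
assert (Hsig := cut_signs L m amax Hm Hmcm Hba Logic.I).
destruct (solution_family f gm p_infty m amax) with (n := n) as (U & W & HU); [apply L|apply L|exact Hm|exact Logic.I|exact Hsig|].
destruct (HU amax ltac:(lra)) as [Sa _].
assert (HE := Hhigh amax m _ _ M1 Hm Hmcm HFm Sa).
assert (Hcen := cut_central L m amax Hm Hmcm Hba Logic.I).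
destruct (reaches_well_slowly Hn L m amax bbar Hm Hmcm Hbb ltac:(lra) Logic.I U W HU
  (inf_on f betas bbar) (inf_on (Fint f) beta1 betas) C Hmf Hmf2 HGm HC) as (a & T & Ha & HT & Hab & ET & HET).
{ destruct (classic (forall r, 0 <= r <= C -> bbar <= U amax r)) as [H|H]; [left; exact H|right].
  destruct (HMalt amax m M2 ltac:(lra) Hm Hmcm HFm) as [Hlt|Hall]; [|destruct H; apply (Hall _ _ Sa)].
  assert (Hex : exists r, 0 <= r <= C /\ U amax r <= bbar).
  { apply NNPP. intros Hno. apply H. intros r Hr. apply Rnot_lt_le. intros Hl. apply Hno. exists r. split; [exact Hr|lra]. }
  apply NNPP. intros Hno.
  assert (Hs := slow_descent_energy Hn L m amax bbar Hm Hmcm Hbb ltac:(lra) Logic.I U W HU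
    (inf_on (Fint f) beta1 betas) C HGm HC amax (C + 1) ltac:(lra) (Rle_refl _)
    ltac:(intros r Hr; left; apply Rnot_le_lt; intros Hl; apply Hno; exists r; split; assumption) Hex).
  assert (X := energy_noninc (ct_cont Hcen) Sa (C + 1) R0 ltac:(unfold R0; lra)). lra. }
apply (two_solutions_from_well Hn L Hbb Hbb2
  (Rmax 1 (A_fin (S n) f gammaM beta1 betas bbar)) (Ibar_inf (S n) f beta1 bbar C s0) ltac:(lra) Hcross k m amax sp rk U W); auto; try lra.
- apply (leaves_with_energy n (clampf m amax f) amax (U amax) (W amax) cm bm beta1 cp h M rk R0 Hcen Sa); [lra| |exact HE].
  fold q. unfold R0. lra.
- exists a, T. repeat (split; [assumption|]). lra.
Qed.

Theorem theorem1p3 :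
  forall (N : nat) (f : R -> R) (gm gs : Rbar) (delta : R)
    (gamma1 gammaM gammaMbar beta1 betas betasm bbar C A I : R),
  (2 <= N)%nat ->
  is_gamma (Fint f) gs 1 gamma1 ->
  is_last_gamma (Fint f) gs gammaM ->
  is_last_gamma_neg (Fint f) gm gammaMbar ->
  is_largest_level (Fint f) 0 0 gamma1 beta1 ->
  is_largest_level (Fint f) (Fint f gammaM) gammaM gs betas ->
  is_smallest_level (Fint f) (Fint f gammaMbar) gm gammaMbar betasm ->
  betas < bbar -> Rbar_lt bbar gs ->
  Fint f betasm < Fint f bbar ->
  C = Cbar N f gammaM beta1 betas bbar ->
  ((exists g : R, gs = Finite g /\ assumptions_A1 f gm g delta /\
      A = A_fin N f gammaM beta1 betas bbar /\
      I = Fint f g)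
   \/
   (exists s0 : R, gs = p_infty /\ assumptions_A2 N f gm delta s0 /\
      (forall s : R, dom gm gs s -> Fint f bbar < Fint f s -> 0 < Qfun N f s) /\
      A = Rmax 1 (A_fin N f gammaM beta1 betas bbar) /\
      I = Ibar_inf N f beta1 bbar C s0)) ->
  (C + A) * I <
    sqrt 2 * (INR N - 1) / sqrt (I + Fbar f beta1) *
    RInt (fun s => Rabs (Fint f s)) 0 beta1 ->
  forall k : nat, exists u v : R -> R,
    (is_solution N f gm gs u /\ betas < u 0 /\ Rbar_lt (u 0) gs /\
     exactly_sign_changes u k) /\
    (is_solution N f gm gs v /\ betas < v 0 /\ Rbar_lt (v 0) gs /\
     exactly_sign_changes v k) /\
    exists r, 0 <= r /\ u r <> v r.
Proof.
intros N f gm gs delta gamma1 gammaM gammaMbar beta1 betas betasm bbar C A I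
  HN Hg1 HgM _ Hb1 Hbs _ Hbb Hbb2 _ -> Hcases Hcross k.
destruct N as [|n]; [lia|]. assert (Hn : (1 <= n)%nat) by lia.
destruct Hcases as [(g & -> & H1 & -> & ->)|(s0 & -> & H2 & HQ & -> & ->)].
- destruct (landscape_exists f gm g delta gamma1 gammaM beta1 betas (A1_common _ _ _ _ H1)
    (top_A1 f gm g delta H1) (bottom_A1 f gm g delta H1) Hg1 HgM Hb1 Hbs) as (cm & bm & cp & h & L).
  exact (two_solutions_finite n f gm g delta gammaM beta1 betas cm bm cp h bbar Hn H1 L Hbb Hbb2 Hcross k).
- destruct (A2_F_lim _ _ _ _ _ H2) as (Lim & HLp & HLm & HLt).
  destruct (landscape_exists f gm p_infty delta gamma1 gammaM beta1 betas (A2_common _ _ _ _ _ H2)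
    (top_A2 f gm Lim HLp HLt) (bottom_A2 n f gm delta s0 H2 Lim HLm HLt) Hg1 HgM Hb1 Hbs)
    as (cm & bm & cp & h & L).
  exact (two_solutions_infinite n f gm delta s0 gammaM beta1 betas cm bm cp h bbar Lim
    Hn H2 HLp HLm HLt L Hbb HQ Hcross k).
Qed.
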